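(* Let $0<p<\infty$, and let $s>1/4$ if $p\le4$ and $s>1/2-1/p$ if $p>4$. Let $R_s(x)=\sum_{n=1}^\infty n^{-2s}e^{2\pi i n^2x}$ and $S_{s,p}(\ell)=\int_{\mathbb T}|R_s(x+\ell)-R_s(x)|^p\,dx$. Then for all sufficiently small $\ell>0$ (implicit constants depending on $s,p$ but not $\ell$): \begin{itemize} \item if $s<5/4$: $S_{s,p}(\ell)^{1/p}\simeq\ell^{s-1/4}$ for $p<4$; $S_{s,4}(\ell)^{1/4}\simeq\ell^{s-1/4}\log(\ell^{-1})^{1/4}$; $S_{s,p}(\ell)^{1/p}\simeq\ell^{s+1/p-1/2}$ for $p>4$; \item if $s=5/4$: $S_{5/4,p}(\ell)^{1/p}\simeq\ell\log(\ell^{-1})^{1/2}$ for $p<4$; $S_{5/4,p}(\ell)^{1/p}\simeq\ell^{3/4+1/p}$ for $p>4$; and $\ell\log(\ell^{-1})^{1/2}\lesssim S_{5/4,4}(\ell)^{1/4}\lesssim\ell\log(\ell^{-1})^{3/4}$; \item if $5/4<s<3/2$: $S_{s,p}(\ell)^{1/p}\simeq\ell$ for $p<2/(3-2s)$; $S_{s,p}(\ell)^{1/p}\simeq\ell^{s+1/p-1/2}$ for $p>2/(3-2s)$; for $p=2/(3-2s)$, $\ell\lesssim S_{s,p}(\ell)^{1/p}\lesssim\ell\log(\ell^{-1})^{1/2}$, and moreover if $p=2/(3-2s)$ is an even integer then $\ell\log(\ell^{-1})^{1/p}\lesssim S_{s,p}(\ell)^{1/p}\lesssim\ell\log(\ell^{-1})^{1/2}$;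 \item if $s\ge3/2$: $S_{s,p}(\ell)^{1/p}\simeq\ell$ for all $p>0$. \end{itemize}
   Context: $\mathbb T=\mathbb R/\mathbb Z$. For $s\le1/2$, $R_s$ is understood as the limit in $L^p(\mathbb T)$ of its partial sums. *)

(* Defs.v *)
(* over an abstract R : realType.
   Complex-valued functions T -> C are represented by their real and
   imaginary parts (two real functions); |z| = sqrt (Re z ^2 + Im z ^2). *)
From HB Require Import structures.
From mathcomp Require Import all_boot all_order all_algebra.
From mathcomp Require Import all_classical all_reals all_analysis.
Set Implicit Arguments. Unset Strict Implicit. Unset Printing Implicit Defensive.
Import Order.TTheory GRing.Theory Num.Theory.
Import numFieldNormedType.Exports.
Local Open Scope classical_set_scope.
Local Open Scope ring_scope.

Section Defs.
Variable R : realType.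

Definition cmod (a b : R) : R := Num.sqrt (a ^+ 2 + b ^+ 2).

Definition RsN_re (s : R) (N : nat) (x : R) : R :=
  \sum_(1 <= n < N.+1) (n%:R `^ (- (2 * s)) * cos (2 * pi * (n ^ 2)%N%:R * x)).
Definition RsN_im (s : R) (N : nat) (x : R) : R :=
  \sum_(1 <= n < N.+1) (n%:R `^ (- (2 * s)) * sin (2 * pi * (n ^ 2)%N%:R * x)).

(* Integral over the torus T = R/Z of a 1-periodic function, as the
   Lebesgue integral over [0,1] (extended-real valued). *)
Definition intT (f : R -> R) : \bar R :=
  (\int[@lebesgue_measure R]_(x in `[0%R, 1%R]) (f x)%:E)%E.

(* (F_re + i F_im) : T -> C is R_s, i.e. the limit in L^p(T) of the partial
   sums: F is 1-periodic, measurable, and int_T |F - S_N|^p -> 0. *)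
Definition is_Rs (s p : R) (F_re F_im : R -> R) : Prop :=
  (forall x, F_re (x + 1) = F_re x) /\ (forall x, F_im (x + 1) = F_im x) /\
  measurable_fun (`[0%R, 1%R] : set R) F_re /\ measurable_fun (`[0%R, 1%R] : set R) F_im /\
  ((fun N => intT (fun x => cmod (F_re x - RsN_re s N x)
                                (F_im x - RsN_im s N x) `^ p))
     @ \oo --> 0%E).

Definition Ssp (p : R) (F_re F_im : R -> R) (l : R) : \bar R :=
  intT (fun x => cmod (F_re (x + l) - F_re x) (F_im (x + l) - F_im x) `^ p).

Definition Ssp_root (p : R) (F_re F_im : R -> R) (l : R) : \bar R :=
  poweR (Ssp p F_re F_im l) p^-1.

Definition small_le (f : R -> \bar R) (g : R -> R) : Prop :=
  exists C delta : R, 0 < C /\ 0 < delta /\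
    forall l, 0 < l < delta -> (f l <= (C * g l)%:E)%E.
Definition small_ge (f : R -> \bar R) (g : R -> R) : Prop :=
  exists C delta : R, 0 < C /\ 0 < delta /\
    forall l, 0 < l < delta -> ((g l)%:E <= (C%:E * f l))%E.
Definition small_sim (f : R -> \bar R) (g : R -> R) : Prop :=
  small_le f g /\ small_ge f g.

Definition logi (l : R) : R := ln l^-1.

End Defs.

(* Main.v *)
(* The increment of a partial sum of [R_s] has, up to a translation, the modulus of an exponential
   sum over the squares with real coefficients [a_n] of size [n^(-2s) min(1, n^2 l)], so the scale is
   [n ~ l^(-1/2)].

   Upper bounds. Weyl differencing of smooth weights of width [H], with a Dirichlet approximation of
   [2x], gives the weak type estimate [|{|S|^2 > L}| <= C H^2 / L^2]; it yields the [L^p] norms of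
   sums over intervals, of order [H^(1/2)], [H^(1/2) log(H)^(1/4)], [H^(1-2/p)] for [p < 4],
   [p = 4], [p > 4].  Summing over dyadic blocks is enough, except when all blocks have the same
   size (s = 5/4, or p = 2/(3-2s)).  There the energy [int (1 + |F_j|^2)^(p/2)] of the partial sums
   is followed from one block to the next; integrating the first order term by parts shows that
   blocks at different scales are almost orthogonal, so only the square root of the number of blocks
   is lost.

   Lower bounds. Parseval gives [p = 2], hence all [p >= 2], and all [p < 2] by interpolation with the
   upper bounds.  Testing against a Fejer kernel of degree about [1/l] gives the concentration at 0,
   which dominates for large [p].  For [p = 2k], testing against [G^(k-1) \bar G^k] bounds the norm
   from below by the [L^2] norm of [G^k]: for [p = 4] this counts the solutions of
   [n1^2 + n2^2 = n3^2 + n4^2], through a sum of gcd's, and at the critical exponent the coefficients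
   of [G^k] split into disjoint dyadic windows of equal mass. *)
Require Import Defs.
From HB Require Import structures.
From mathcomp Require Import all_boot all_order all_algebra.
From mathcomp Require Import all_classical all_reals all_analysis.
From mathcomp Require Import measurable_realfun ring lra zify.
From mathcomp Require cyclic.
Set Implicit Arguments. Unset Strict Implicit. Unset Printing Implicit Defensive.
Import Order.TTheory GRing.Theory Num.Theory.
Import numFieldNormedType.Exports.
Local Open Scope classical_set_scope.
Local Open Scope ring_scope.

(** * Integration over the torus *)

(** The weights in Weyl differencing are smooth because a sharp cut-off only gives correlations of
    size [1 / d], with [d] the distance of [2 h x] to the integers, and summing over [h] would cost
    a logarithm; piecewise linear weights of width [H] give [1 / (H d^2)], which is summable.
    Intervals are wanted because the coefficients are removed by partial summation: on a dyadic
    block below the scale, [n^(-2s)] and [sin(pi n^2 l)] are both monotone. Above the scale the sine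
    oscillates, and the increment is bounded by two translates of the tail.

    The threshold [p = 4] comes from the weak type estimate: the level [L = 2^i H] contributes
    [2^(i (p/2 - 2))] to the normalised [p]-th moment.

    In the lower bounds by duality, the sines of high frequencies have no sign; the test polynomials
    have a degree of order [1 / l], small enough to meet nonnegative sines only.

    All bounds are proved for partial sums, uniformly in their length; the limit enters at the end.
    For [p < 1], where Minkowski's inequality fails, they are deduced from larger exponents. *)

Section integral_on_the_torus.
Variable R : realType.
Implicit Types (f g : R -> R) (x y : R).
Local Notation mu := (@lebesgue_measure R).
Local Notation U := (`[0%R, 1%R]%classic : set R).

(** Bounded measurable functions are closed under all the operations applied to trigonometric sums,
    and [I] is linear and real valued on them. The limit function need not be bounded; it is treated
    with [intT] at the end. *)
Definition bm f := measurable_fun [set: R] f /\ exists M : R, forall x, `|f x| <= M.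

Definition I f : R := (\int[mu]_(x in U) f x)%R.

Lemma measurable_U : measurable U. Proof. exact: measurable_itv. Qed.
Hint Resolve measurable_U : core.

Lemma mu_U : mu U = 1%E.
Proof. by rewrite lebesgue_measure_itv /= lte_fin ltr01 oppr0 adde0. Qed.

Lemma bm_intg f : bm f -> mu.-integrable U (EFin \o f).
Proof.
move=> [mf [M fM]]; apply: measurable_bounded_integrable => //.
- by rewrite [X in (X < _)%E]mu_U ltry.
- exact: measurable_funS mf.
- exists M; split; rewrite ?num_real // => y My x _ /=.
  exact: le_trans (fM x) (ltW My).
Qed.

Lemma bm_cst (c : R) : bm (fun=> c).
Proof. by split=> //; exists `|c| => x. Qed.

Lemma bmD f g : bm f -> bm g -> bm (fun x => f x + g x).
Proof.
move=> [mf [M fM]] [mg [N gN]]; split; first exact: measurable_funD.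
by exists (M + N) => x; rewrite (le_trans (ler_normD _ _))// lerD.
Qed.

Lemma bmM f g : bm f -> bm g -> bm (fun x => f x * g x).
Proof.
move=> [mf [M fM]] [mg [N gN]]; split; first exact: measurable_funM.
by exists (M * N) => x; rewrite normrM ler_pM.
Qed.

Lemma bmZ (c : R) f : bm f -> bm (fun x => c * f x).
Proof. exact: bmM (bm_cst c). Qed.

Lemma bmN f : bm f -> bm (fun x => - f x).
Proof. by move=> /(bmZ (-1)); under eq_fun do rewrite mulN1r. Qed.

Lemma bmB f g : bm f -> bm g -> bm (fun x => f x - g x).
Proof. by move=> bf bg; exact: bmD bf (bmN bg). Qed.

Lemma bmX f n : bm f -> bm (fun x => f x ^+ n).
Proof.
move=> bf; elim: n => [|n IHn]; first by under eq_fun do rewrite expr0; exact: bm_cst.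
by under eq_fun do rewrite exprS; exact: bmM.
Qed.

Lemma bm_sum (T : Type) (r : seq T) (P : pred T) (F : T -> R -> R) :
  (forall i, P i -> bm (F i)) -> bm (fun x => \sum_(i <- r | P i) F i x).
Proof.
move=> bF; elim: r => [|i r IHr].
  by under eq_fun do rewrite big_nil; exact: bm_cst.
under eq_fun do rewrite big_cons; case: (boolP (P i)) => Pi //.
by apply: bmD => //; exact: bF.
Qed.

Lemma bm_powR f (p : R) : 0 <= p -> (forall x, 0 <= f x) -> bm f ->
  bm (fun x => f x `^ p).
Proof.
move=> p0 f0 [mf [M fM]]; split.
  exact: (measurableT_comp (measurable_powR _)).
exists (M `^ p) => x; rewrite ger0_norm ?powR_ge0//.
have fxM : f x <= M by rewrite (le_trans (ler_norm _)).
by apply: ge0_ler_powR; rewrite ?nnegrE//; exact: le_trans (f0 x) fxM.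
Qed.

Lemma bm_sqrt f : bm f -> bm (fun x => Num.sqrt (f x)).
Proof.
move=> [mf [M fM]]; split.
  apply: (measurableT_comp _ mf); apply: continuous_measurable_fun.
  exact: sqrt_continuous.
exists (Num.sqrt M) => x; rewrite ger0_norm ?sqrtr_ge0// ler_wsqrtr//.
by rewrite (le_trans (ler_norm _)).
Qed.

Lemma bm_indic (a b : R) : bm (\1_(`[a, b]%classic) : R -> R).
Proof.
split; first exact: measurable_indic.
by exists 1 => x; rewrite indicE; case: (_ \in _); rewrite ?normr1 ?normr0.
Qed.

Lemma bm_continuous f (M : R) : continuous f -> (forall x, `|f x| <= M) -> bm f.
Proof. by move=> cf fM; split; [exact: continuous_measurable_fun | exists M]. Qed.

Lemma I_cst (c : R) : I (fun=> c) = c.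
Proof. by rewrite /I Rintegral_cst// -[X in fine X]/(mu U) mu_U mulr1. Qed.

Lemma ID f g : bm f -> bm g -> I (fun x => f x + g x) = I f + I g.
Proof. by move=> bf bg; rewrite /I RintegralD//; exact: bm_intg. Qed.

Lemma IZ (c : R) f : bm f -> I (fun x => c * f x) = c * I f.
Proof. by move=> bf; rewrite /I RintegralZl//; exact: bm_intg. Qed.

Lemma I_ext f g : (forall x, f x = g x) -> I f = I g.
Proof. by move=> fg; congr I; apply/funext. Qed.

Lemma I_sum (T : Type) (r : seq T) (P : pred T) (F : T -> R -> R) :
  (forall i, P i -> bm (F i)) ->
  I (fun x => \sum_(i <- r | P i) F i x) = \sum_(i <- r | P i) I (F i).
Proof.
move=> bF; elim: r => [|i r IHr].
  by rewrite big_nil -[RHS](I_cst 0); apply: I_ext => x; rewrite big_nil.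
rewrite big_cons; under [X in I X]eq_fun do rewrite big_cons.
case: (boolP (P i)) => Pi //.
by rewrite ID ?IHr//; [exact: bF | exact: bm_sum].
Qed.

Lemma I_le f g : bm f -> bm g -> (forall x, 0 <= x <= 1 -> f x <= g x) -> I f <= I g.
Proof.
move=> bf bg fg; by apply: le_Rintegral => //; exact: bm_intg.
Qed.

Lemma I_ge0 f : (forall x, 0 <= f x) -> 0 <= I f.
Proof. by move=> f0; apply: Rintegral_ge0. Qed.

Lemma I_indic (a b : R) : a <= b -> I (\1_(`[a, b]%classic)) <= b - a.
Proof.
move=> ab; rewrite /I /Rintegral integral_indic//= -[X in _ <= X]/(fine (b - a)%:E).
have muab : mu `[a, b]%classic = (b - a)%:E.
  rewrite lebesgue_measure_itv /= lte_fin; by case: ltgtP ab => // ->; rewrite subrr.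
have le_ab : (mu (`[a, b]%classic `&` U) <= (b - a)%:E)%E.
  by rewrite -muab; apply: le_measure; rewrite ?inE//; exact: measurableI.
by apply: fine_le => //; rewrite ge0_fin_numE// (le_lt_trans le_ab)// ltry.
Qed.

Lemma intT_bm f : bm f -> intT f = (I f)%:E.
Proof.
move=> bf; rewrite /intT /I /Rintegral fineK//.
by apply: integrable_fin_num => //; exact: bm_intg.
Qed.

Lemma I_derive (H H' : R -> R) : (forall x, is_derive x 1 H (H' x)) ->
  continuous H' -> H 1 = H 0 -> I H' = 0.
Proof.
move=> dH cH' H10; rewrite /I /Rintegral (@continuous_FTC2 _ H' H)//.
- by rewrite H10 subee.
- exact: continuous_subspaceT.
- have cH : continuous H.
    by move=> x; apply: differentiable_continuous; apply/derivable1_diffP; case: (dH x).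
  split.
  + by move=> x _; case: (dH x).
  + by apply: cvg_at_right_filter; exact: cH.
  + by apply: cvg_at_left_filter; exact: cH.
- by move=> x _; rewrite derive1E; apply: derive_val.
Qed.

End integral_on_the_torus.
#[global] Hint Resolve measurable_U : core.

(** * Translation invariance for periodic functions *)

Section translation.
Variable R : realType.
Implicit Types (f g : R -> R) (x y : R).
Local Notation mu := (@lebesgue_measure R).
Local Notation U := (`[0%R, 1%R]%classic : set R).

Definition shiftr (l : R) (x : measurableTypeR R) : measurableTypeR R := x + l.

Lemma measurable_shiftr l : measurable_fun setT (shiftr l).
Proof. exact: measurable_funD. Qed.

HB.instance Definition _ l :=
  isMeasurableFun.Build _ _ _ _ (shiftr l) (measurable_shiftr l).

Lemma lebesgue_measure_shift (l : R) (A : set (measurableTypeR R)) : measurable A ->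
  mu A = pushforward mu (shiftr l) A.
Proof.
apply: (@lebesgue_measure_unique R (pushforward mu (shiftr l))).
move=> X [[a b] _ <-] /=; rewrite /pushforward.
have -> : shiftr l @^-1` `]a, b]%classic = `]a - l, b - l]%classic.
  by apply/seteqP; split => x /=; rewrite /shiftr !in_itv /= ltrBlDr lerBrDr.
rewrite !lebesgue_measure_itv /= !lte_fin ltrD2r.
by case: ifP => // _; rewrite -!EFinB; congr EFin; ring.
Qed.

Lemma integral_shift (f : R -> \bar R) (l : R) (D : set R) : measurable D ->
  measurable_fun setT f -> (forall x, 0 <= f x)%E ->
  (\int[mu]_(x in D) f x = \int[mu]_(x in [set x | D (x + l)%R]) f (x + l)%R)%E.
Proof.
move=> mD mf f0.
rewrite -(@ge0_integral_pushforward _ _ _ _ R (shiftr l) _ mu D f)//.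
- apply: eq_measure_integral => A mA _; exact: lebesgue_measure_shift.
- exact: measurable_funS mf.
Qed.

Lemma periodic_integer (T : Type) (f : R -> T) : (forall x, f (x + 1) = f x) ->
  forall x (k : int), f (x + k%:~R) = f x.
Proof.
move=> f1; have fn x (n : nat) : f (x + n%:R) = f x.
  by elim: n => [|n IHn]; rewrite ?addr0// -natr1 addrA f1.
move=> x [] n; first by rewrite -pmulrn fn.
by rewrite NegzE mulrNz -[LHS](fn _ n.+1) subrK.
Qed.

(* The values on [0,1] determine a periodic function through its fractional part. *)
Lemma periodic_measurable d (T : measurableType d) (f : R -> T) :
  (forall x, f (x + 1) = f x) -> measurable_fun U f -> measurable_fun setT f.
Proof.
move=> f1 mf.
have -> : f = f \o (fun x => x - (Num.floor x)%:~R).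
  by apply/funext => x /=; rewrite -mulrNz periodic_integer.
apply: (@measurable_comp _ _ _ _ _ _ U) => //.
- move=> _ [x _ <-]; rewrite /= in_itv /=.
  have := floor_le x; have := floorD1_gt x; rewrite intrD; lra.
- apply: measurable_funB => //; apply: nondecreasing_measurable => // x y xy.
  by rewrite ler_int; apply: le_floor.
Qed.

(** The interval is cut at [1 - l] before the shift and at [l] after it; the two pieces are
    exchanged, one of them after moving back by a period. *)
Lemma integral_periodic (f : R -> \bar R) (l : R) : 0 <= l <= 1 ->
  measurable_fun setT f -> (forall x, 0 <= f x)%E -> (forall x, f (x + 1)%R = f x) ->
  (\int[mu]_(x in U) f (x + l)%R = \int[mu]_(x in U) f x)%E.
Proof.
move=> /andP[l0 l1] mf f0 f1.
have split (g : R -> \bar R) (c : R) : 0 <= c <= 1 -> measurable_fun setT g ->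
    (forall x, 0 <= g x)%E ->
    (\int[mu]_(x in U) g x = \int[mu]_(x in (`[0%R, c]%classic : set R)) g x +
       \int[mu]_(x in (`[c, 1%R]%classic : set R)) g x)%E.
  move=> /andP[c0 c1] mg g0.
  have -> : U = `[0, c[%classic `|` `[c, 1]%classic.
    by rewrite -itv_bndbnd_setU// bnd_simp.
  rewrite ge0_integral_setU//=; last 2 first.
  - exact: measurable_funS mg.
  - apply/disj_setPS => x /= []; rewrite !in_itv /= => /andP[_ xc] /andP[cx _]; lra.
  congr (_ + _)%E; apply: integral_itv_bndo_bndc.
  exact: measurable_funS mg.
have mfl (m : R) : measurable_fun setT (fun x => f (x + m)%R).
  by apply: (measurableT_comp mf); exact: (measurable_shiftr m).
rewrite (split (fun x => f (x + l)%R) (1 - l)) ?(split f l) ?l0//; last by lra.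
rewrite addeC; congr (_ + _)%E.
  rewrite (@integral_shift f (l - 1) `[0, l]%classic)//.
  have -> : [set x | `[0, l]%classic (x + (l - 1))] = `[1 - l, 1]%classic.
    by apply/seteqP; split => x /=; rewrite !in_itv /=; lra.
  apply: eq_integral => x _; rewrite -(f1 (x + (l - 1))); congr f; ring.
rewrite (@integral_shift f l `[l, 1]%classic)//.
have -> : [set x | `[l, 1]%classic (x + l)] = `[0, 1 - l]%classic.
  by apply/seteqP; split => x /=; rewrite !in_itv /=; lra.
by [].
Qed.

Lemma I_shift f (l : R) : 0 <= l <= 1 -> bm f -> (forall x, 0 <= f x) ->
  (forall x, f (x + 1) = f x) -> I (fun x => f (x + l)) = I f.
Proof.
move=> l01 [mf _] f0 f1; rewrite /I /Rintegral; congr fine.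
apply: (integral_periodic (f := fun x => (f x)%:E)) => //.
- exact/measurable_EFinP.
- by move=> x; rewrite f1.
Qed.

Lemma bm_shift f (l : R) : bm f -> bm (fun x => f (x + l)).
Proof.
move=> [mf [M fM]]; split; last by exists M.
by apply: (measurableT_comp mf); exact: (measurable_shiftr l).
Qed.

End translation.

(** * Inequalities for real powers *)

Section powR_inequalities.
Variable R : realType.
Implicit Types (p q r a b t x y z : R).

Lemma powR2 x : 0 <= x -> x `^ 2 = x ^+ 2.
Proof. by move=> x0; rewrite powR_mulrn. Qed.

Lemma powRDp x r t : 0 < x -> x `^ (r + t) = x `^ r * x `^ t.
Proof. by move=> x0; rewrite powRD// (lt0r_neq0 x0) implybT. Qed.

Lemma powRS x r : 0 < x -> x `^ (r + 1) = x `^ r * x.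
Proof. by move=> x0; rewrite powRDp// powRr1// ltW. Qed.

Lemma powR_div x y p : 0 <= x -> 0 < y -> (x / y) `^ p = x `^ p / y `^ p.
Proof.
by move=> x0 y0; rewrite powRM// ?invr_ge0 ?ltW// -powR_inv1 ?ltW// powRAC powR_inv1 ?powR_ge0.
Qed.

Lemma ler_pow x y p : 0 <= p -> 0 <= x -> x <= y -> x `^ p <= y `^ p.
Proof.
by move=> p0 x0 xy; apply: ge0_ler_powR; rewrite ?nnegrE// (le_trans x0).
Qed.

Lemma ltr_pow x y p : 0 < p -> 0 <= x -> x < y -> x `^ p < y `^ p.
Proof.
move=> p0 x0 xy; apply: gt0_ltr_powR; rewrite ?nnegrE//.
exact: le_trans x0 (ltW xy).
Qed.

Lemma powRK x p : 0 < p -> 0 <= x -> (x `^ p) `^ p^-1 = x.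
Proof. by move=> p0 x0; rewrite -powRrM divff ?gt_eqF// powRr1. Qed.

Lemma powRVK x p : 0 < p -> 0 <= x -> (x `^ p^-1) `^ p = x.
Proof. by move=> p0 x0; rewrite -powRrM mulVf ?gt_eqF// powRr1. Qed.

(** Bernoulli's inequality, read off Young's inequality for the product [y * 1]. *)
Lemma powR_tangent1 p y : 1 <= p -> 0 <= y -> 1 + p * (y - 1) <= y `^ p.
Proof.
rewrite le_eqVlt => /predU1P[<-|p1] y0; first by rewrite powRr1//; lra.
have p0 : 0 < p by lra.
have q0 : 0 < p / (p - 1) by rewrite divr_gt0//; lra.
have := @conjugate_powR R y 1 p (p / (p - 1)) y0 ler01 p0 q0.
rewrite mulr1 powR1 => /(_ _); have pq : p^-1 + (p / (p - 1))^-1 = 1.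
  by field; apply/andP; split; lra.
move=> /(_ pq); rewrite -(ler_pM2l p0) mulrDr.
have -> : p * (y `^ p / p) = y `^ p by field; lra.
have -> : p * (1 / (p / (p - 1))) = p - 1 by field; apply/andP; split; lra.
by lra.
Qed.

Lemma powR_tangent p t y : 1 <= p -> 0 < t -> 0 <= y ->
  t `^ p * (1 + p * (y / t - 1)) <= y `^ p.
Proof.
move=> p1 t0 y0; rewrite -{2}[y](divfK (lt0r_neq0 t0)).
have yt0 : 0 <= y / t by rewrite divr_ge0// ltW.
rewrite powRM//; last exact: ltW.
by rewrite mulrC ler_wpM2r ?powR_ge0// powR_tangent1.
Qed.

Lemma powR_concave1 a y : 0 < a <= 1 -> 0 <= y -> y `^ a <= 1 + a * (y - 1).
Proof.
move=> /andP[a0 a1] y0.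
have a1' : 1 <= a^-1 by rewrite invf_ge1.
have := powR_tangent1 a1' (powR_ge0 y a); rewrite powRK//.
rewrite -(ler_pM2l a0) mulrDr mulrA divff ?gt_eqF// mul1r; lra.
Qed.

(** Taylor's formula at [1] with a quadratic remainder, on the range met in [energy_pointwise]. For
    [1 < r <= 2] the power [r - 1] is concave; larger [r] are reduced by one on multiplying the
    bound for [r - 1] by [y], and the cubic term so created is absorbed because [y <= 4]. *)
Lemma powR_quadratic r : 1 <= r -> exists2 C : R, 0 < C &
  forall y, 0 <= y <= 4 -> y `^ r <= 1 + r * (y - 1) + C * (y - 1) ^+ 2.
Proof.
move=> r1; have [n] : exists n : nat, r <= n.+1%:R.
  exists (Num.truncn r); have := truncnS_gt r; exact: ltW.
elim: n r r1 => [|n IHn] r r1 rn.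
  have -> : r = 1 by apply/eqP; rewrite eq_le r1 rn.
  exists 1 => // y /andP[y0 _]; rewrite powRr1//; have := sqr_ge0 (y - 1); lra.
have yr y : 0 <= y -> y `^ r = y * y `^ (r - 1).
  by move=> y0; rewrite mulr_powRB1//; lra.
have [r2|r2] := leP r 2.
  have [r1'|r1'] := eqVneq r 1.
    rewrite r1'; exists 1 => // y /andP[y0 _]; rewrite powRr1//.
    have := sqr_ge0 (y - 1); lra.
  have r1_gt : 1 < r by rewrite lt_neqAle eq_sym r1'.
  exists 1 => // y /andP[y0 y4]; rewrite yr//.
  have h : y `^ (r - 1) <= 1 + (r - 1) * (y - 1) by rewrite powR_concave1//; lra.
  apply: le_trans (ler_wpM2l y0 h) _.
  have : 0 <= (2 - r) * (y - 1) ^+ 2 by rewrite mulr_ge0 ?sqr_ge0//; lra.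
  lra.
have [||C C0 HC] := IHn (r - 1); first by lra.
  by move: rn; rewrite -(natr1 n.+1); lra.
exists (r - 1 + 4 * C) => [|y /andP[y0 y4]]; first by lra.
have h := HC y; rewrite yr//; apply: le_trans (ler_wpM2l y0 (h _)) _; first by lra.
have : 0 <= C * (y - 1) ^+ 2 * (4 - y).
  apply: mulr_ge0; last by lra.
  by apply: mulr_ge0; [exact: ltW | exact: sqr_ge0].
lra.
Qed.

Lemma powR_le1D p q y : 0 <= p <= q -> 0 <= y -> y `^ p <= 1 + y `^ q.
Proof.
move=> /andP[p0 pq] y0; have [y1|y1] := leP y 1.
  have : y `^ p <= 1 by have := ler_pow p0 y0 y1; rewrite powR1.
  have := powR_ge0 y q; lra.
have : y `^ p <= y `^ q by rewrite ler_powR// ltW.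
by lra.
Qed.

(** Below the threshold [t = eps^(1/p)] the constant suffices; above it,
    [y^(p - q) <= t^(p - q)]. *)
Lemma powR_le_epsD p q (eps : R) : 0 < p <= q -> 0 < eps ->
  exists2 C : R, 0 < C & forall y, 0 <= y -> y `^ p <= eps + C * y `^ q.
Proof.
move=> /andP[p0 pq] e0; pose t := eps `^ p^-1.
have t0 : 0 < t by rewrite powR_gt0.
exists (t `^ (p - q)) => [|y y0]; first by rewrite powR_gt0.
have [yt|yt] := leP y t.
  have : y `^ p <= t `^ p by rewrite ler_pow// ltW.
  rewrite powRVK//; last exact: ltW.
  move=> h.
  by rewrite (le_trans h)// lerDl mulr_ge0 ?powR_ge0.
have y0' : 0 < y by exact: lt_trans yt.
have -> : y `^ p = y `^ (p - q) * y `^ q.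
  by rewrite -powRDp// subrK.
apply: ler_wpDl; first exact: ltW.
rewrite ler_wpM2r ?powR_ge0// -[p - q]opprB !powRN lef_pV2 ?posrE ?powR_gt0//.
by apply: ler_pow; [lra | exact: ltW | exact: ltW].
Qed.

(** Split at the [t] with [eps * t^r = t^q]: above it the higher power wins, below it the lower
    one. *)
Lemma powR_interpolate p q r (eps : R) : 0 < p -> p <= q -> q < r -> 0 < eps ->
  exists2 C : R, 0 < C & forall y, 0 <= y -> y `^ q <= eps * y `^ r + C * y `^ p.
Proof.
move=> p0 pq qr e0; pose t := eps `^ (- (r - q)^-1).
have t0 : 0 < t by rewrite powR_gt0.
exists (t `^ (q - p)) => [|y y0]; first by rewrite powR_gt0.
have [->|yN0] := eqVneq y 0; first by rewrite !powR0 ?gt_eqF//; lra.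
have y0' : 0 < y by rewrite lt_neqAle eq_sym yN0.
have [yt|yt] := leP y t.
  apply: ler_wpDl; first by rewrite mulr_ge0 ?powR_ge0//; exact: ltW.
  have -> : y `^ q = y `^ (q - p) * y `^ p by rewrite -powRDp// subrK.
  by rewrite ler_wpM2r ?powR_ge0// ler_pow//; lra.
apply: ler_wpDr; first by rewrite mulr_ge0 ?powR_ge0.
have -> : y `^ r = y `^ (r - q) * y `^ q by rewrite -powRDp// subrK.
rewrite mulrA -{1}[y `^ q]mul1r ler_wpM2r ?powR_ge0//.
have : t `^ (r - q) <= y `^ (r - q) by apply: ler_pow; [lra | exact: ltW | exact: ltW].
rewrite /t -powRrM mulNr mulVf; last by lra.
rewrite powRN powRr1; last exact: ltW.
move=> h.
by rewrite -(divff (lt0r_neq0 e0)) ler_pM2l.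
Qed.

Lemma powR_addl x y p : 0 <= p -> 0 <= x -> 0 <= y ->
  (x + y) `^ p <= 2 `^ p * (x `^ p + y `^ p).
Proof.
move=> p0; wlog xy : x y / x <= y => [hw x0 y0|x0 y0].
  have [xy|/ltW xy] := leP x y; first exact: hw.
  by rewrite addrC [X in _ * X]addrC; exact: hw.
apply: (@le_trans _ _ ((2 * y) `^ p)); first by rewrite ler_pow ?addr_ge0//; lra.
by rewrite powRM// ler_wpM2l ?powR_ge0// lerDr powR_ge0.
Qed.

Lemma sum_pos_eq0 (T : Type) (s : seq T) (P : pred T) (A f : T -> R) :
  (forall i, P i -> 0 < A i) -> \sum_(i <- s | P i) A i = 0 ->
  \sum_(i <- s | P i) f i = 0.
Proof.
move=> A0; elim: s => [|i s IHs]; rewrite ?big_nil// !big_cons.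
case: ifP => // Pi; have : 0 <= \sum_(j <- s | P j) A j.
  by apply: sumr_ge0 => j /A0/ltW.
by have := A0 _ Pi; lra.
Qed.

(** The tangent inequality at the weighted mean [t = m / S], summed with the weights [A i / S]: the
    linear terms cancel. *)
Lemma powR_jensen (T : Type) (s : seq T) (P : pred T) (A f : T -> R) p : 1 <= p ->
  (forall i, P i -> 0 < A i) -> (forall i, P i -> 0 <= f i) ->
  (\sum_(i <- s | P i) f i) `^ p <= (\sum_(i <- s | P i) A i) `^ p *
    \sum_(i <- s | P i) (A i / \sum_(i <- s | P i) A i) * (f i / A i) `^ p.
Proof.
move=> p1 A0 f0; set S := \sum_(i <- s | P i) A i; set m := \sum_(i <- s | P i) f i.
have p0 : 0 < p by lra.
have m0 : 0 <= m by apply: sumr_ge0.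
have S0 : 0 <= S by apply: sumr_ge0 => i /A0/ltW.
have rhs0 : 0 <= S `^ p * \sum_(i <- s | P i) A i / S * (f i / A i) `^ p.
  rewrite mulr_ge0 ?powR_ge0// sumr_ge0// => i Pi.
  by rewrite mulr_ge0 ?powR_ge0// divr_ge0// ltW// A0.
have [->|mN0] := eqVneq m 0; first by rewrite powR0 ?gt_eqF.
have mgt0 : 0 < m by rewrite lt_neqAle eq_sym mN0.
have Sgt0 : 0 < S.
  rewrite lt_neqAle eq_sym S0 andbT; apply: contraNneq mN0 => SE.
  by apply/eqP; exact: sum_pos_eq0 SE.
have -> : m = S * (m / S) by field; lra.
have mS0 : 0 <= m / S by rewrite divr_ge0.
rewrite powRM// ler_wpM2l ?powR_ge0//.
set t := m / S.
have t0 : 0 < t by rewrite divr_gt0.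
apply: (@le_trans _ _ (\sum_(i <- s | P i) A i / S * (t `^ p * (1 + p * (f i / A i / t - 1))))).
  have -> : \sum_(i <- s | P i) A i / S * (t `^ p * (1 + p * (f i / A i / t - 1))) =
    \sum_(i <- s | P i) (t `^ p / S * (1 - p) * A i + t `^ p / S * p / t * f i).
    apply: eq_bigr => i Pi; have := A0 _ Pi; move: Sgt0 t0 => + + Ai0.
    move=> Sgt0 t0; field; by apply/and3P; split; lra.
  rewrite big_split/= -!mulr_sumr -/S -/m le_eqVlt; apply/orP; left; apply/eqP.
  have -> : m = t * S by rewrite /t; field; lra.
  field; apply/andP; split; lra.
rewrite ler_sum// => i Pi; rewrite ler_wpM2l//; first by rewrite divr_ge0// ltW// A0.
by rewrite powR_tangent// divr_ge0 ?f0// ltW// A0.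
Qed.

(* Minkowski's inequality, by convexity with the weights [A i / \sum_i A i]. *)
Lemma I_powR_sum (T : Type) (s : seq T) (P : pred T) (A : T -> R) (f : T -> R -> R) p :
  1 <= p -> (forall i, P i -> 0 < A i) -> (forall i x, P i -> 0 <= f i x) ->
  (forall i, P i -> bm (f i)) -> (forall i, P i -> I (fun x => f i x `^ p) <= A i `^ p) ->
  I (fun x => (\sum_(i <- s | P i) f i x) `^ p) <= (\sum_(i <- s | P i) A i) `^ p.
Proof.
move=> p1 A0 f0 bf fA; set S := \sum_(i <- s | P i) A i.
have p0 : 0 <= p by lra.
have S0 : 0 <= S by apply: sumr_ge0 => i /A0/ltW.
have b1 i : P i -> bm (fun x => (f i x / A i) `^ p).
  move=> Pi; apply: bm_powR => // [x|].
    by rewrite divr_ge0 ?f0// ltW ?A0.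
  by under eq_fun do rewrite mulrC; exact: bmZ (bf _ Pi).
have b2 : bm (fun x => \sum_(i <- s | P i) (A i / S) * (f i x / A i) `^ p).
  by apply: bm_sum => i Pi; apply: bmZ; exact: b1.
apply: (@le_trans _ _ (I (fun x => S `^ p *
    \sum_(i <- s | P i) (A i / S) * (f i x / A i) `^ p))).
  apply: I_le => //.
  - by apply: bm_powR => // [x|]; [apply: sumr_ge0 => i Pi; exact: f0 | exact: bm_sum].
  - exact: bmZ.
  - by move=> x _; apply: powR_jensen => // i Pi; exact: f0.
rewrite IZ// -[X in _ <= X]mulr1 ler_wpM2l ?powR_ge0//.
rewrite I_sum; last by move=> i Pi; apply: bmZ; exact: b1.
apply: (@le_trans _ _ (\sum_(i <- s | P i) A i / S)).
  apply: ler_sum => i Pi; rewrite IZ; last exact: b1.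
  rewrite -[X in _ <= X]mulr1 ler_wpM2l//; first by rewrite divr_ge0// ltW// A0.
  have Ap : 0 < A i `^ p by apply: powR_gt0; exact: A0.
  rewrite (_ : I _ = (A i `^ p)^-1 * I (fun x => f i x `^ p)); last first.
    rewrite -IZ; last by apply: bm_powR => // [x|]; [exact: f0 | exact: bf].
    by apply: I_ext => x; rewrite powR_div; [rewrite mulrC | exact: f0 | exact: A0].
  by rewrite mulrC ler_pdivrMr// mul1r fA.
rewrite -mulr_suml -/S; have [->|SN0] := eqVneq S 0; first by rewrite mul0r.
by rewrite divff.
Qed.

End powR_inequalities.

(** * Weyl differencing *)

Section trigonometry.
Variable R : realType.
Implicit Types (x y u th : R).

Lemma cos_2pi_int x (k : int) : cos (x + 2 * pi * k%:~R) = cos x.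
Proof.
have cn y (n : nat) : cos (y + 2 * pi * n%:R) = cos y.
  elim: n => [|n IHn]; first by rewrite mulr0 addr0.
  have -> : y + 2 * pi * n.+1%:R = y + 2 * pi * n%:R + pi *+ 2.
    by rewrite -[n.+1%:R]natr1; ring.
  by rewrite cosD2pi.
case: k => n; first exact: cn.
by rewrite NegzE mulrNz -[LHS](cn _ n.+1) mulrN subrK.
Qed.

Lemma sin_2pi_int x (k : int) : sin (x + 2 * pi * k%:~R) = sin x.
Proof.
have cn y (n : nat) : sin (y + 2 * pi * n%:R) = sin y.
  elim: n => [|n IHn]; first by rewrite mulr0 addr0.
  have -> : y + 2 * pi * n.+1%:R = y + 2 * pi * n%:R + pi *+ 2.
    by rewrite -[n.+1%:R]natr1; ring.
  by rewrite sinD2pi.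
case: k => n; first exact: cn.
by rewrite NegzE mulrNz -[LHS](cn _ n.+1) mulrN subrK.
Qed.

Lemma sin_MVT u : 0 < u -> exists2 c, 0 < c < u & sin u = u * cos c.
Proof.
move=> u0; have [|c] := @MVT R sin cos 0 u u0 (fun x _ => is_derive_sin x).
  by apply: continuous_subspaceT; exact: continuous_sin.
by rewrite in_itv /= sin0 !subr0 mulrC => cu ->; exists c.
Qed.

Lemma sin_le_id u : 0 <= u -> sin u <= u.
Proof.
rewrite le_eqVlt => /predU1P[<-|u0]; first by rewrite sin0.
have [c _ ->] := sin_MVT u0; by rewrite -[X in _ <= X]mulr1 ler_pM2l// cos_le1.
Qed.

Lemma cos_half u : 1 - cos u = 2 * sin (u / 2) ^+ 2.
Proof.
have -> : cos u = cos (u / 2 + u / 2) by congr cos; field.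
by rewrite cosD sin2cos2; have := sin2cos2 (u / 2); lra.
Qed.

Lemma sin_ge_half u : 0 <= u <= 1 -> u / 2 <= sin u.
Proof.
move=> /andP[]; rewrite le_eqVlt => /predU1P[<- _|u0 u1]; first by rewrite sin0; lra.
have [c /andP[c0 cu] ->] := sin_MVT u0; rewrite ler_pM2l//.
have p2 := @pi_ge2 R.
have s0 : 0 <= sin (c / 2) by apply: sin_ge0_pi; lra.
have s1 : sin (c / 2) <= c / 2 by apply: sin_le_id; lra.
have := cos_half c; nra.
Qed.

Lemma sin_ge_quarter u : 0 <= u <= pi / 2 -> u / 4 <= sin u.
Proof.
move=> /andP[u0 u2]; have [u1|u1] := leP u 1.
  by have := @sin_ge_half u; lra.
have pi4 := @pihalf_lt2 R; have p2 := @pi_ge2 R.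
(* Past [1] the sine exceeds [sin 1 >= 1/2], while [u / 4 < 1/2] because [pi / 2 < 2]. *)
have h1 : sin 1 < sin u by rewrite ltr_sin ?in_itv//=; lra.
have := @sin_ge_half 1; lra.
Qed.

(** The right-hand side is [|e(y) - 1|^2 = 4 sin(pi y)^2]; it controls the distance of [y] to the
    nearest integer [k]. *)
Lemma chord_ge y (k : int) : `|y - k%:~R| <= 2^-1 ->
  (y - k%:~R) ^+ 2 <= 2 - 2 * cos (2 * pi * y).
Proof.
have p2 := @pi_ge2 R.
move=> yk; have -> : cos (2 * pi * y) = cos (2 * pi * `|y - k%:~R|).
  rewrite -[RHS]cos_norm normrM normr_id ger0_norm ?mulr_ge0 ?pi_ge0//.
  rewrite -[in RHS](@ger0_norm _ (2 * pi)) ?mulr_ge0 ?pi_ge0// -normrM cos_norm.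
  by rewrite -(cos_2pi_int (2 * pi * (y - k%:~R)) k); congr cos; ring.
rewrite -real_normK ?num_real//; set u := `|_| in yk *.
have u0 : 0 <= u by exact: normr_ge0.
have h : pi * u / 4 <= sin (pi * u).
  by apply: sin_ge_quarter; apply/andP; split; nra.
have -> : 2 - 2 * cos (2 * pi * u) = (2 * sin (pi * u)) ^+ 2.
  have := cos_half (2 * pi * u).
  have -> : 2 * pi * u / 2 = pi * u by field.
  lra.
have h2 : u / 2 <= sin (pi * u) by nra.
rewrite ler_pXn2r ?nnegrE//; lra.
Qed.

Lemma second_difference_sum (b c : nat -> R) B : b 0 = 0 -> b 1 = 0 -> b B = 0 -> b B.+1 = 0 ->
  \sum_(0 <= n < B) b n * (c n - 2 * c n.+1 + c n.+2) =
  \sum_(0 <= n < B) (b n.+2 - 2 * b n.+1 + b n) * c n.+2.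
Proof.
(* For the induction on the upper end the identity carries its boundary terms, which the four
   conditions on [b] then cancel. *)
move=> b0 b1 bB bB1; suff : forall N, \sum_(0 <= n < N) b n * (c n - 2 * c n.+1 + c n.+2) =
  \sum_(0 <= n < N) (b n.+2 - 2 * b n.+1 + b n) * c n.+2
  + b 0 * c 0 + b 1 * c 1 - b N * c N - b N.+1 * c N.+1 - 2 * (b 0 * c 1 - b N * c N.+1).
  by move=> ->; rewrite b0 b1 bB bB1; ring.
elim=> [|N IHN]; first by rewrite !big_geq//; ring.
by rewrite !big_nat_recr//= IHN; ring.
Qed.

(** Multiplication by [2 - 2 cos th] turns the cosine at [n] into minus its centred second
    difference, and two summations by parts move this difference to the weights. *)
Lemma cos_sum_second_difference (b : nat -> R) B th phi :
  b 0 = 0 -> b 1 = 0 -> (forall n, (B <= n)%N -> b n = 0) ->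
  `|\sum_(0 <= n < B) b n * cos (n%:R * th + phi)| * (2 - 2 * cos th) <=
  \sum_(0 <= n < B) `|b n.+2 - 2 * b n.+1 + b n|.
Proof.
move=> b0 b1 bB; pose c n := cos ((n%:R - 1) * th + phi).
have c0 : 0 <= 2 - 2 * cos th by have := cos_le1 th; lra.
rewrite -[X in _ * X]ger0_norm// -normrM mulr_suml.
rewrite (_ : \sum_(_ <= _ < _) _ = - \sum_(0 <= n < B) b n * (c n - 2 * c n.+1 + c n.+2)); last first.
  rewrite -sumrN; apply: eq_bigr => n _; rewrite /c -[n.+2%:R]natr1 -[n.+1%:R]natr1.
  have -> : (n%:R - 1) * th + phi = (n%:R * th + phi) - th by ring.
  have -> : (n%:R + 1 - 1) * th + phi = n%:R * th + phi by ring.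
  have -> : (n%:R + 1 + 1 - 1) * th + phi = (n%:R * th + phi) + th by ring.
  set al := n%:R * th + phi; rewrite (cosB al) (cosD al); ring.
rewrite normrN second_difference_sum//; [|exact: bB|by apply: bB; exact: leqnSn].
apply: le_trans (ler_norm_sum _ _ _) _.
apply: ler_sum => n _; rewrite normrM -[X in _ <= X]mulr1 ler_wpM2l//.
exact: cos_max.
Qed.

End trigonometry.

(** * The squared modulus as a sum of correlations *)

Section weyl_differencing.
Variable R : realType.
Implicit Types (a : nat -> R) (x : R).

(** This is [|\sum_n a n * exp(i ph n)|^2]. *)
Definition TS a (ph : nat -> R) B : R :=
  (\sum_(0 <= n < B) a n * cos (ph n)) ^+ 2 + (\sum_(0 <= n < B) a n * sin (ph n)) ^+ 2.

Lemma TS_ge0 a ph B : 0 <= TS a ph B.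
Proof. by rewrite addr_ge0 ?sqr_ge0. Qed.

Lemma sum_square (F : nat -> nat -> R) B : (forall n m, F n m = F m n) ->
  \sum_(0 <= n < B) \sum_(0 <= m < B) F n m =
  \sum_(0 <= n < B) F n n + 2 * \sum_(0 <= m < B) \sum_(0 <= n < m) F n m.
Proof.
move=> Fsym; elim: B => [|B IHB]; first by rewrite !big_geq//; ring.
rewrite !big_nat_recr//=.
under eq_bigr do rewrite big_nat_recr//=.
rewrite big_split/= IHB.
have -> : \sum_(0 <= m < B) F B m = \sum_(0 <= n < B) F n B by apply: eq_bigr.
ring.
Qed.

Lemma sum_triangle (F : nat -> nat -> R) B : (forall n m, (B <= m)%N -> F n m = 0) ->
  \sum_(0 <= m < B) \sum_(0 <= n < m) F n m =
  \sum_(1 <= h < B) \sum_(0 <= n < B) F n (n + h)%N.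
Proof.
move=> F0; transitivity (\sum_(0 <= m < B) \sum_(0 <= n < B | (n < m)%N) F n m).
  apply: eq_big_nat => m /andP[_ mB].
  by rewrite (big_nat_widen _ _ B)//; exact: ltnW.
rewrite (exchange_big_dep xpredT)//= exchange_big/=.
apply: eq_big_nat => n /andP[_ nB].
transitivity (\sum_(n.+1 <= m < n + B) F n m); last first.
  rewrite -{1}[n.+1]addn1 [(n + 1)%N]addnC big_addn addKn.
  by apply: eq_bigr => h _; rewrite addnC.
rewrite [RHS](@big_cat_nat _ _ _ B)//=; last lia.
rewrite [X in _ + X]big1_seq ?addr0; last first.
  by move=> m /andP[_]; rewrite mem_index_iota => /andP[Bm _]; exact: F0.
by rewrite [RHS](big_nat_widenl _ 0).
Qed.

(** The pairs [(n, n + h)] and [(n + h, n)] contribute conjugate terms, so positive lags and cosines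
    suffice. For a quadratic phase the difference [ph (n + h) - ph n] is linear in [n], which is
    what makes the inner sums tractable. *)
Lemma TS_expand a ph B : (forall n, (B <= n)%N -> a n = 0) ->
  TS a ph B = \sum_(0 <= n < B) a n ^+ 2 +
    2 * \sum_(1 <= h < B) \sum_(0 <= n < B) a n * a (n + h)%N * cos (ph (n + h)%N - ph n).
Proof.
move=> aB; pose F n m := a n * a m * cos (ph m - ph n).
transitivity (\sum_(0 <= n < B) \sum_(0 <= m < B) F n m).
  rewrite /TS !expr2 !mulr_suml -big_split/=; apply: eq_bigr => n _.
  rewrite !mulr_sumr -big_split/=; apply: eq_bigr => m _.
  by rewrite /F cosB; ring.
rewrite sum_square; last first.
  by move=> n m; rewrite /F -[in RHS]cosN opprB; ring.
congr (_ + 2 * _).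
  by apply: eq_bigr => n _; rewrite /F subrr cos0; ring.
by rewrite sum_triangle// => n m mB; rewrite /F (aB m mB) mulr0 mul0r.
Qed.

(* Weights of the width [H]: both the tents and the trapezoids of the
   decomposition of an interval below are of this form. *)
Definition bump (H : nat) a : Prop :=
  [/\ a 0 = 0, a 1 = 0, forall n, (2 * H + 2 <= n)%N -> a n = 0, forall n, `|a n| <= 1 &
    (forall n, `|a n.+1 - a n| <= H%:R^-1) /\
    \sum_(0 <= n < 2 * H + 2) `|a n.+2 - 2 * a n.+1 + a n| <= 4 / H%:R].

(** A discrete product rule: the second difference of [a n * a (n + h)] consists of two second
    differences of [a], of total [4 / H] each, and of two products of first differences, at most
    [H^-2] at each of the [2 H + 2] indices. *)
Lemma bump_correlation H a h : (0 < H)%N -> bump H a ->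
  \sum_(0 <= n < 2 * H + 2) `|a n.+2 * a (n.+2 + h)%N - 2 * (a n.+1 * a (n.+1 + h)%N)
     + a n * a (n + h)%N| <= 16 / H%:R.
Proof.
move=> H0 [a0 a1 aB a_le [da d2a]]; set B := (2 * H + 2)%N in aB d2a *.
pose D n := a n.+2 - 2 * a n.+1 + a n.
have HR : 1 <= H%:R :> R by rewrite (ler_nat _ 1).
apply: (@le_trans _ _ (\sum_(0 <= n < B) (`|D n| + `|D (n + h)%N| + 2 * H%:R^-1 ^+ 2))).
  apply: ler_sum => n _; rewrite !addSn.
  set u := a n.+1; set v := a (n + h).+1; set s := a n; set t := a (n + h)%N.
  set p := a n.+2; set q := a (n + h).+2.
  have -> : p * q - 2 * (u * v) + s * t =
    D n * v + u * D (n + h)%N + (p - u) * (q - v) + (u - s) * (v - t).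
    by rewrite /D -/u -/v -/s -/t -/p -/q; ring.
  have le1 (y z : R) : `|z| <= 1 -> `|y * z| <= `|y|.
    by move=> z1; rewrite normrM -[X in _ <= X]mulr1 ler_wpM2l.
  have leH (y z : R) : `|y| <= H%:R^-1 -> `|z| <= H%:R^-1 -> `|y * z| <= H%:R^-1 ^+ 2.
    by move=> y1 z1; rewrite normrM expr2 ler_pM.
  apply: le_trans (ler_normD _ _) _; apply: le_trans (lerD (ler_normD _ _) (lexx _)) _.
  apply: le_trans (lerD (lerD (ler_normD _ _) (lexx _)) (lexx _)) _.
  have e1 := le1 (D n) v (a_le _); have e2 := le1 (D (n + h)%N) u (a_le _).
  rewrite mulrC in e2.
  have e3 := leH _ _ (da n.+1) (da (n + h).+1); have e4 := leH _ _ (da n) (da (n + h)%N).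
  lra.
rewrite !big_split/=.
have shift : \sum_(0 <= n < B) `|D (n + h)%N| <= \sum_(0 <= n < B) `|D n|.
  have -> : \sum_(0 <= n < B) `|D (n + h)%N| = \sum_(h <= n < B + h) `|D n|.
    by rewrite -{2}[h]add0n big_addn addnK.
  have D0 m n : \sum_(B + m <= i < n) `|D i| = 0.
    apply: big1_seq => i /andP[_]; rewrite mem_index_iota => /andP[Bi _].
    by rewrite /D !aB ?mulr0 ?subr0 ?addr0 ?normr0//; lia.
  have [hB|Bh] := leqP h B.
    rewrite (@big_cat_nat _ _ _ B h)//=; last by rewrite leq_addr.
    have := D0 0%N (B + h)%N; rewrite addn0 => ->; rewrite addr0 [X in _ <= X](@big_cat_nat _ _ _ h 0)//=.
    by rewrite lerDr sumr_ge0.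
  have -> : \sum_(h <= n < B + h) `|D n| = 0.
    by rewrite -(subnKC (ltnW Bh)) D0.
  by rewrite sumr_ge0.
have -> : \sum_(0 <= n < B) 2 * H%:R^-1 ^+ 2 = B%:R * (2 * H%:R^-1 ^+ 2) :> R.
  by rewrite sumr_const_nat subn0 [RHS]mulr_natl.
have hB : B%:R * (2 * H%:R^-1 ^+ 2) <= 8 / H%:R :> R.
  have -> : B%:R = 2 * H%:R + 2 :> R by rewrite /B natrD natrM.
  have -> : (2 * H%:R + 2) * (2 * H%:R^-1 ^+ 2) = (4 + 4 / H%:R) / H%:R :> R.
    by field; lra.
  rewrite ler_pM2r ?invr_gt0; last by lra.
  suff : 4 / H%:R <= 4 :> R by lra.
  by rewrite ler_pdivrMr; lra.
have -> : 16 / H%:R = 4 / H%:R + 4 / H%:R + 8 / H%:R :> R by ring.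
apply: lerD; last exact: hB.
by apply: lerD; [exact: d2a | exact: le_trans shift d2a].
Qed.

(** The lower order terms come from moving a block to the origin: [(m + j - 2)^2 x] is a quadratic
    polynomial in [j]. Differencing removes [gamma] and turns [beta] into a phase independent of
    [n], so neither affects the bounds. *)
Definition quad_phase x (beta gamma : R) (n : nat) : R :=
  2 * pi * (n%:R ^+ 2 * x) + beta * n%:R + gamma.

Definition weylT H a x beta h : R := \sum_(0 <= n < 2 * H + 2) a n * a (n + h)%N *
  cos (n%:R * (2 * pi * (h%:R * (2 * x))) + (2 * pi * (h%:R ^+ 2 * x) + beta * h%:R)).

Lemma weyl_bound H a x beta gamma : bump H a ->
  TS a (quad_phase x beta gamma) (2 * H + 2) <=
    (2 * H + 2)%:R + 2 * \sum_(1 <= h < 2 * H + 2) `|weylT H a x beta h|.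
Proof.
move=> [_ _ aB a_le _]; rewrite TS_expand//; apply: lerD.
  apply: (@le_trans _ _ (\sum_(0 <= n < 2 * H + 2) 1)); last first.
    by rewrite sumr_const_nat subn0.
  by apply: ler_sum => n _; rewrite -real_normK ?num_real// expr_le1.
rewrite ler_pM2l//; apply: ler_sum => h _; apply: le_trans (ler_norm _).
rewrite le_eqVlt; apply/orP; left; apply/eqP; apply: eq_bigr => n _.
by congr (_ * cos _); rewrite /quad_phase natrD; ring.
Qed.

Lemma weylT_trivial H a x beta h : bump H a -> `|weylT H a x beta h| <= (2 * H + 2)%:R.
Proof.
move=> [_ _ _ a_le _]; apply: le_trans (ler_norm_sum _ _ _) _.
apply: (@le_trans _ _ (\sum_(0 <= n < 2 * H + 2) 1)); last by rewrite sumr_const_nat subn0.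
apply: ler_sum => n _; rewrite !normrM mulr_ile1 ?mulr_ge0 ?cos_max//.
by rewrite mulr_ile1.
Qed.

Lemma weylT_decay H a x beta h (k : int) (d : R) : (0 < H)%N -> bump H a ->
  0 < d -> d <= `|h%:R * (2 * x) - k%:~R| <= 2^-1 ->
  `|weylT H a x beta h| <= 16 / H%:R / d ^+ 2.
Proof.
move=> H0 bmp d0 /andP[dk k2]; have [a0 a1 aB _ _] := bmp.
rewrite ler_pdivlMr ?exprn_gt0//.
apply: le_trans (bump_correlation h H0 bmp).
set th := 2 * pi * (h%:R * (2 * x)).
set phi := 2 * pi * (h%:R ^+ 2 * x) + beta * h%:R.
have := @cos_sum_second_difference _ (fun n => a n * a (n + h)%N) (2 * H + 2) th phi.
rewrite /= a0 a1 !mul0r => /(_ erefl erefl).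
have a_eq0 n : (2 * H + 2 <= n)%N -> a n * a (n + h)%N = 0 by move=> nB; rewrite aB ?mul0r.
move=> /(_ a_eq0); apply: le_trans; rewrite ler_wpM2l//; apply: le_trans (chord_ge k2).
by rewrite -[X in _ <= X]real_normK ?num_real// ler_pXn2r ?nnegrE//; exact: ltW.
Qed.

End weyl_differencing.

(** * Rational approximation and sums over residues *)

Section diophantine.
Variable R : realType.
Implicit Types (x y : R).

(** Pigeonhole: the fractional parts of [j y], for [0 <= j <= N], fall into [N] bins. *)
Lemma dirichlet_approximation y (N : nat) : 0 <= y -> (0 < N)%N ->
  exists q a : nat, [/\ (0 < q <= N)%N, coprime a q & `|q%:R * y - a%:R| <= N%:R^-1].
Proof.
move=> y0 N0; have NR : 0 < N%:R :> R by rewrite ltr0n.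
pose fl j := Num.truncn (j%:R * y); pose fr j : R := j%:R * y - (fl j)%:R.
have flP j : (fl j)%:R <= j%:R * y < (fl j).+1%:R.
  by apply: truncn_itv; rewrite mulr_ge0.
have fr01 j : 0 <= fr j < 1.
  have /andP[] := flP j; rewrite /fr -[(fl j).+1%:R]natr1; lra.
pose bin j := Num.truncn (N%:R * fr j).
have binP j : (bin j)%:R <= N%:R * fr j < (bin j).+1%:R.
  by apply: truncn_itv; have /andP[? _] := fr01 j; rewrite mulr_ge0.
have bin_lt j : (bin j < N)%N.
  have /andP[h _] := binP j; have /andP[_ fr1] := fr01 j.
  by rewrite -(ltr_nat R) (le_lt_trans h)// -[X in _ < X]mulr1 ltr_pM2l.
pose f (j : 'I_N.+1) : 'I_N := Ordinal (bin_lt j).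
have /injectivePn[i [j ij fij]] : ~~ injectiveb f.
  apply/negP => /injectiveP inj_f.
  by have := leq_card f inj_f; rewrite !card_ord ltnn.
wlog lt_ij : i j ij fij / (i < j)%N.
  move=> hw; have := ij; rewrite -(inj_eq val_inj) /= neq_ltn => /orP[h|h].
    exact: hw ij fij h.
  by apply: (hw j i) => //; rewrite eq_sym.
have ij_bin : bin i = bin j by have := congr1 val fij.
have close : `|fr j - fr i| <= N%:R^-1.
  have /andP[h1 h2] := binP i; have /andP[h3 h4] := binP j.
  move: h2 h4; rewrite -![(bin _).+1%:R]natr1 ij_bin in h1 *; move=> h2 h4.
  rewrite -(ler_pM2l NR) divff ?gt_eqF// -{1}[N%:R](@ger0_norm R)// -normrM.
  by rewrite ler_norml mulrBr; lra.
pose q := (j - i)%N; pose a := (fl j - fl i)%N.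
have fl_ij : (fl i <= fl j)%N.
  by apply: le_truncn; rewrite ler_wpM2r// ler_nat ltnW.
have qy : q%:R * y - a%:R = fr j - fr i.
  by rewrite /q /a !natrB ?(ltnW lt_ij)// /fr; ring.
have q0 : (0 < q)%N by rewrite subn_gt0.
have qN : (q <= N)%N by rewrite leq_subLR -ltnS (leq_trans (ltn_ord j))// ltnS leq_addl.
(* Reducing the fraction also divides the error by [d], so the coprimality used to permute residues
   costs nothing. *)
pose d := gcdn a q; have d0 : (0 < d)%N by rewrite gcdn_gt0 q0 orbT.
exists (q %/ d)%N, (a %/ d)%N; split.
- rewrite divn_gt0// dvdn_leq ?dvdn_gcdr//=; exact: leq_trans (leq_div _ _) qN.
- rewrite /coprime -(eqn_pmul2r d0) mul1n muln_gcdl !divnK ?dvdn_gcdl ?dvdn_gcdr//.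
- have dR : 1 <= d%:R :> R by rewrite (ler_nat _ 1).
  apply: le_trans close; rewrite -qy.
  have -> : q%:R * y - a%:R = d%:R * ((q %/ d)%:R * y - (a %/ d)%:R) :> R.
    rewrite mulrBr mulrA -!natrM ![(d * _)%N]mulnC !divnK//; [exact: dvdn_gcdl | exact: dvdn_gcdr].
  by rewrite normrM ger0_norm// ler_peMl.
Qed.

Lemma sum_inv_square (N : nat) : \sum_(1 <= n < N) (n%:R ^+ 2)^-1 <= 2 :> R.
Proof.
suff h n : \sum_(1 <= k < n.+2) (k%:R ^+ 2)^-1 <= 2 - n.+1%:R^-1 :> R.
  case: N => [|[|n]]; [by rewrite big_geq | by rewrite big_geq |].
  by apply: le_trans (h n) _; rewrite gerBl invr_ge0.
elim: n => [|n IHn]; first by rewrite big_nat1; lra.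
rewrite big_nat_recr//=; apply: le_trans (lerD IHn (lexx _)) _.
rewrite -[n.+2%:R]natr1; have : 1 <= n.+1%:R :> R by rewrite (ler_nat _ 1).
move: (n.+1%:R) => t t1; rewrite -subr_ge0.
have -> : 2 - (t + 1)^-1 - (2 - t^-1 + ((t + 1) ^+ 2)^-1) = (t * (t + 1) ^+ 2)^-1.
  by field; apply/andP; split; lra.
by rewrite invr_ge0 mulr_ge0 ?sqr_ge0//; lra.
Qed.

(** The term of index [k] is compared with [4 A w^2 / ((k - 1 + w) (k + w))], which telescopes;
    which of the two bounds on [g k] is used depends on whether [k <= w]. *)
Lemma sum_min_inv_square (g : nat -> R) (A w : R) (N : nat) : 0 <= A -> 0 < w ->
  (forall k, (0 < k < N)%N -> g k <= A /\ g k <= A * w ^+ 2 / k%:R ^+ 2) ->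
  \sum_(1 <= k < N) g k <= 4 * A * w.
Proof.
move=> A0 w0 gA; have Aw : 0 <= 4 * A * w by rewrite !mulr_ge0// ltW.
case: N gA => [|N] gA; first by rewrite big_geq.
suff : \sum_(1 <= k < N.+1) g k <= 4 * A * w ^+ 2 * (w^-1 - (N%:R + w)^-1).
  move=> /le_trans; apply; apply: (@le_trans _ _ (4 * A * w ^+ 2 * w^-1)).
    rewrite ler_wpM2l ?gerBl ?invr_ge0 ?addr_ge0// ?mulr_ge0 ?sqr_ge0//; exact: ltW.
  by rewrite le_eqVlt; apply/orP; left; apply/eqP; field; lra.
elim: N gA => [|N IHN] gA; first by rewrite big_geq// add0r subrr mulr0.
rewrite big_nat_recr//=; apply: le_trans (lerD (IHN _) (lexx _)) _.
  by move=> k /andP[k0 kN]; apply: gA; rewrite k0 ltnS ltnW.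
rewrite -lerBrDl -mulrBr.
have [] := gA N.+1; first by rewrite ltnS leqnn.
rewrite -[N.+1%:R]natr1; have := ler0n R N; move: (N%:R) => t t0.
move: (g N.+1) => gN h1 h2.
have -> : w^-1 - (t + 1 + w)^-1 - (w^-1 - (t + w)^-1) = ((t + w) * (t + 1 + w))^-1.
  by field; apply/and3P; split; lra.
have tw : 0 < (t + w) * (t + 1 + w) by rewrite mulr_gt0//; lra.
rewrite ler_pdivlMr//.
have [tw1|tw1] := leP (t + 1) w.
  have h3 : (t + w) * (t + 1 + w) <= 4 * w ^+ 2 by nra.
  apply: le_trans (ler_wpM2r (ltW tw) h1) _; apply: le_trans (ler_wpM2l A0 h3) _.
  by rewrite le_eqVlt; apply/orP; left; apply/eqP; ring.
have h3 : (t + w) * (t + 1 + w) <= 4 * (t + 1) ^+ 2 by nra.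
apply: le_trans (ler_wpM2r (ltW tw) h2) _.
have P : 0 <= A * w ^+ 2 / (t + 1) ^+ 2 
  by apply: mulr_ge0; [apply: mulr_ge0 => //; exact: sqr_ge0 | rewrite invr_ge0 sqr_ge0].
apply: le_trans (ler_wpM2l P h3) _.
by rewrite le_eqVlt; apply/orP; left; apply/eqP; field; lra.
Qed.

Lemma sum_blocks (g : nat -> R) K q :
  \sum_(0 <= h < K * q) g h = \sum_(0 <= k < K) \sum_(0 <= r < q) g (k * q + r)%N.
Proof.
elim: K => [|K IHK]; first by rewrite mul0n !big_geq.
rewrite big_nat_recr//= -IHK (@big_cat_nat _ _ _ (K * q))//=; last by rewrite mulSn leq_addl.
congr (_ + _); rewrite -{1}[(K * q)%N]add0n big_addn mulSn addnK.
by apply: eq_bigr => r _; rewrite addnC.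
Qed.

(** Multiplication by [a] permutes the residues modulo [q] and fixes [0]. *)
Lemma sum_coprime_residues (F : nat -> R) (a q : nat) : (0 < q)%N -> coprime a q ->
  \sum_(1 <= r < q) F ((r * a) %% q)%N = \sum_(1 <= r < q) F r.
Proof.
move=> q0 caq.
have toI (G : nat -> R) : \sum_(1 <= r < q) G r = \sum_(i < q | (i != 0 :> nat)%N) G i.
  rewrite -(big_mkord (fun i => i != 0)%N) [in RHS]big_nat_cond (big_nat_widenl _ 0)//.
  rewrite [in LHS]big_nat_cond; apply: eq_bigl => i; rewrite -lt0n; lia.
rewrite !toI.
have lt_q r : ((r * a) %% q < q)%N by rewrite ltn_mod.
pose s (i : 'I_q) : 'I_q := Ordinal (lt_q i).
have s_inj : injective s.
  move=> i j /(congr1 val) /= /eqP; wlog ij : i j / (i <= j)%N.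
    move=> hw h; have [ij|/ltnW ij] := leqP i j; first exact: hw.
    by apply/esym; apply: hw => //; rewrite eq_sym.
  rewrite eq_sym eqn_mod_dvd ?leq_mul2r ?ij ?orbT// -mulnBl Gauss_dvdl 1?coprime_sym// => dv.
  apply/val_inj/eqP; rewrite eqn_leq ij /= -subn_eq0.
  by rewrite -leqn0 leqNgt; apply/negP => /dvdn_leq/(_ dv); have := ltn_ord j; lia.
rewrite [RHS](reindex_inj s_inj) /=; apply: eq_bigl => i.
congr (~~ _); apply/eqP/eqP => [->|si]; first by rewrite mul0n mod0n.
have s0 : s i = s (Ordinal q0) by apply/val_inj; rewrite /= si mul0n mod0n.
by have := congr1 val (s_inj _ _ s0).
Qed.

End diophantine.

(** * Pointwise bounds near a rational *)

Section weyl_sums.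
Variable R : realType.
Implicit Types (a : nat -> R) (x : R).

Lemma weylT_eq0 H a x beta h : bump H a -> (2 * H + 2 <= h)%N -> weylT H a x beta h = 0.
Proof.
move=> [_ _ aB _ _] Bh; apply: big1 => n _.
by rewrite (aB (n + h)%N) ?mulr0 ?mul0r// (leq_trans Bh)// leq_addl.
Qed.

(** Write [q (2 x) = b + t] and [rho] for the residue of [h b]. Then [h (2 x)] is an integer plus
    [(rho + h t) / q], where [|h t| <= 1/2] for the lags [h <= 4 H], so its distance to the integers
    is at least [rho / (2 q)] or [(q - rho) / (2 q)]; the sum of the two bounds covers both
    cases. *)
Lemma weylT_residue H a x beta (q b : nat) h : (0 < H)%N -> bump H a ->
  (0 < q)%N ->
  `|q%:R * (2 * x) - b%:R| <= (8 * H)%:R^-1 -> (0 < (h * b) %% q)%N ->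
  `|weylT H a x beta h| <= 64 * q%:R ^+ 2 / H%:R *
     ((((h * b) %% q)%:R ^+ 2)^-1 + ((q - (h * b) %% q)%:R ^+ 2)^-1).
Proof.
move=> H0 bmp q0; set t := q%:R * _ - _ => tle; set rho := ((h * b) %% q)%N => rho0.
have rho_lt : (rho < q)%N by rewrite ltn_mod.
have qR : 1 <= q%:R :> R by rewrite (ler_nat _ 1).
have HR : 1 <= H%:R :> R by rewrite (ler_nat _ 1).
pose m := ((h * b) %/ q)%N.
have hbE : h%:R * b%:R = m%:R * q%:R + rho%:R :> R.
  by rewrite -!natrM -natrD -divn_eq.
have [Bh|hB] := leqP (2 * H + 2) h.
  rewrite weylT_eq0// normr0; apply: mulr_ge0; last by rewrite addr_ge0// invr_ge0 sqr_ge0.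
  by apply: mulr_ge0; [apply: mulr_ge0 => //; exact: sqr_ge0 | rewrite invr_ge0].
have hH : (h <= 4 * H)%N by lia.
have rhoR : 1 <= rho%:R :> R by rewrite (ler_nat _ 1).
have rhoq : rho%:R + 1 <= q%:R :> R by rewrite natr1 ler_nat.
pose z : R := (rho%:R + h%:R * t) / q%:R.
have hyE : h%:R * (2 * x) = m%:R + z.
  rewrite /z /t mulrDr mulrN hbE; field; lra.
have ht : `|h%:R * t| <= 2^-1.
  rewrite normrM ger0_norm//; apply: le_trans (ler_wpM2l (ler0n _ _) tle) _.
  rewrite natrM ler_pdivrMr; last by lra.
  have : h%:R <= 4 * H%:R :> R by rewrite -natrM ler_nat.
  lra.
have [zl zr] : rho%:R / (2 * q%:R) <= z /\ (q%:R - rho%:R) / (2 * q%:R) <= 1 - z.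
  move: ht; rewrite ler_norml /z => /andP[h1 h2]; split.
    rewrite ler_pdivrMr; last by lra.
    have -> : (rho%:R + h%:R * t) / q%:R * (2 * q%:R) = 2 * (rho%:R + h%:R * t).
      by field; lra.
    lra.
  rewrite ler_pdivrMr; last by lra.
  have -> : (1 - (rho%:R + h%:R * t) / q%:R) * (2 * q%:R) = 2 * (q%:R - (rho%:R + h%:R * t)).
    by field; lra.
  lra.
have sq (u : R) : 0 < u -> 16 / H%:R / (u / (2 * q%:R)) ^+ 2 = 64 * q%:R ^+ 2 / H%:R * (u ^+ 2)^-1.
  by move=> u0; field; apply/and3P; split; lra.
have i0 (u : R) : 0 <= (u ^+ 2)^-1 by rewrite invr_ge0 sqr_ge0.
have c0 : 0 <= 64 * q%:R ^+ 2 / H%:R :> R.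
  by apply: mulr_ge0; [apply: mulr_ge0 => //; exact: sqr_ge0 | rewrite invr_ge0].
have d1 : 0 < rho%:R / (2 * q%:R) :> R by rewrite divr_gt0//; lra.
have d2 : 0 < (q%:R - rho%:R) / (2 * q%:R) :> R by rewrite divr_gt0//; lra.
have [z2|z2] := leP z 2^-1.
  apply: (@le_trans _ _ (64 * q%:R ^+ 2 / H%:R * (rho%:R ^+ 2)^-1)); last first.
    by rewrite ler_wpM2l// lerDl.
  rewrite -sq; last by lra.
  apply: (@weylT_decay _ _ _ _ _ _ m%:Z) => //.
  rewrite hyE -[m%:Z%:~R]/(m%:R) addrC addKr ger0_norm ?zl ?z2//; lra.
apply: (@le_trans _ _ (64 * q%:R ^+ 2 / H%:R * ((q - rho)%:R ^+ 2)^-1)); last first.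
  by rewrite ler_wpM2l// lerDr.
rewrite natrB ?(ltnW rho_lt)// -sq; last by lra.
apply: (@weylT_decay _ _ _ _ _ _ (m.+1)%:Z) => //.
rewrite hyE -[m.+1%:Z%:~R]/(m.+1%:R) -[m.+1%:R]natr1.
have -> : m%:R + z - (m%:R + 1) = - (1 - z) by ring.
rewrite normrN ger0_norm; lra.
Qed.

(** Among [q] consecutive lags each nonzero residue occurs once, and the inverse squares of the
    residues have a bounded sum. *)
Lemma sum_weylT_residues H a x beta (q b k : nat) : (0 < H)%N -> bump H a ->
  (0 < q)%N -> coprime b q ->
  `|q%:R * (2 * x) - b%:R| <= (8 * H)%:R^-1 ->
  \sum_(1 <= r < q) `|weylT H a x beta (k * q + r)| <= 256 * q%:R ^+ 2 / H%:R.
Proof.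
move=> H0 bmp q0 cbq tle.
pose F (rho : nat) : R := 64 * q%:R ^+ 2 / H%:R * ((rho%:R ^+ 2)^-1 + ((q - rho)%:R ^+ 2)^-1).
apply: (@le_trans _ _ (\sum_(1 <= r < q) F ((r * b) %% q)%N)).
  apply: ler_sum_nat => r /andP[r1 rq].
  have e : (((k * q + r) * b) %% q = (r * b) %% q)%N.
    by rewrite mulnDl mulnAC modnMDl.
  rewrite -e; apply: weylT_residue => //.
  rewrite e lt0n -/(dvdn _ _) Gauss_dvdl 1?coprime_sym//.
  by apply/negP => /(dvdn_leq r1); rewrite leqNgt rq.
rewrite sum_coprime_residues// /F -mulr_sumr big_split/=.
have -> : \sum_(1 <= r < q) ((q - r)%:R ^+ 2)^-1 = \sum_(1 <= r < q) (r%:R ^+ 2)^-1 :> R.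
  by rewrite [RHS]big_nat_rev/=; apply: eq_bigr => i _; rewrite add1n subSS.
have s2 := @sum_inv_square R q.
have c0 : 0 <= 64 * q%:R ^+ 2 / H%:R :> R.
  by apply: mulr_ge0; [apply: mulr_ge0 => //; exact: sqr_ge0 | rewrite invr_ge0].
apply: (@le_trans _ _ (64 * q%:R ^+ 2 / H%:R * (2 + 2))).
  by rewrite ler_wpM2l// lerD.
by rewrite le_eqVlt; apply/orP; left; apply/eqP; ring.
Qed.

(** For a lag [k q] only the error [t = q (2 x) - b] keeps [k q (2 x)] away from the integer [k b],
    at distance [k |t|]. The first bound is the trivial one; the second uses the decay once [k]
    exceeds [1 / (H |t|)]. *)
Lemma sum_weylT_multiples H a x beta (q b N : nat) : (0 < H)%N -> bump H a ->
  (0 < q)%N -> (N * q <= 4 * H)%N ->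
  `|q%:R * (2 * x) - b%:R| <= (8 * H)%:R^-1 ->
  (\sum_(1 <= k < N.+1) `|weylT H a x beta (k * q)|) * q%:R <= 16 * H%:R ^+ 2 /\
  (\sum_(1 <= k < N.+1) `|weylT H a x beta (k * q)|) * `|q%:R * (2 * x) - b%:R| <= 64.
Proof.
move=> H0 bmp q0 NH tle; set t := `|_| in tle *.
have qR : 1 <= q%:R :> R by rewrite (ler_nat _ 1).
have HR : 1 <= H%:R :> R by rewrite (ler_nat _ 1).
have NR : N%:R * q%:R <= 4 * H%:R :> R by rewrite -!natrM ler_nat.
have triv k : `|weylT H a x beta k| <= 4 * H%:R.
  apply: le_trans (weylT_trivial _ _ _ bmp) _.
  by rewrite natrD natrM; lra.
split.
  apply: (@le_trans _ _ ((N%:R * (4 * H%:R)) * q%:R)).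
    rewrite ler_wpM2r//; apply: (@le_trans _ _ (\sum_(1 <= k < N.+1) (4 * H%:R))).
      by apply: ler_sum => k _; exact: triv.
    by rewrite sumr_const_nat subn1 [X in _ <= X]mulr_natl.
  rewrite mulrAC; apply: le_trans (ler_wpM2r _ NR) _; first by lra.
  by rewrite le_eqVlt; apply/orP; left; apply/eqP; ring.
have t0 : 0 <= t by exact: normr_ge0.
move: t0; rewrite le_eqVlt => /predU1P[<-|t0]; first by rewrite mulr0.
have Ht : H%:R * t <= 8^-1.
  by move: tle; rewrite natrM invfM ler_pdivlMr 1?mulrC//; lra.
apply: (@le_trans _ _ (4 * (16 * H%:R) * (H%:R * t)^-1 * t)); last first.
  by rewrite le_eqVlt; apply/orP; left; apply/eqP; field; apply/andP; split; lra.
rewrite ler_wpM2r ?(ltW t0)//; apply: sum_min_inv_square => [||k /andP[k0 kN]].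
- by rewrite mulr_ge0.
- by rewrite invr_gt0 mulr_gt0//; lra.
have kR : 1 <= k%:R :> R by rewrite (ler_nat _ 1).
split; first by apply: le_trans (triv _) _; lra.
have -> : 16 * H%:R * (H%:R * t)^-1 ^+ 2 / k%:R ^+ 2 = 16 / H%:R / (k%:R * t) ^+ 2.
  by field; apply/and3P; split; lra.
apply: (@weylT_decay _ _ _ _ _ _ (k * b)%N%:Z) => //; first by rewrite mulr_gt0//; lra.
rewrite -[(k * b)%N%:Z%:~R]/((k * b)%:R) !natrM.
have -> : k%:R * q%:R * (2 * x) - k%:R * b%:R = k%:R * (q%:R * (2 * x) - b%:R) by ring.
rewrite normrM -/t ger0_norm// lexx /=.
have kH : k%:R <= 4 * H%:R :> R.
  rewrite -natrM ler_nat (leq_trans _ NH)// (leq_trans (_ : k <= N)%N)//.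
  by rewrite leq_pmulr.
apply: le_trans (ler_wpM2r (ltW t0) kH) _; lra.
Qed.

(* The constant is the one produced by the proof; only its existence matters. *)
Definition cW : R := 4 * 12 * 256 * 64.

(** That is, [|S|^2 <= C min(H^2 / q, 1 / |2 q x - b|)], without a logarithm. There are [O(H / q)]
    blocks of [q] lags, and the nonzero residues of each cost [O(q^2 / H)], hence [O(q)] in all;
    this and the diagonal term [O(H)] are below both bounds since [q <= 8 H] and
    [|2 q x - b| <= 1 / (8 H)]. *)
Lemma weyl_pointwise H a x beta gamma : (0 < H)%N -> bump H a -> 0 <= x ->
  exists q b : nat, [/\ (0 < q)%N,
    `|q%:R * (2 * x) - b%:R| <= (8 * H)%:R^-1,
    TS a (quad_phase x beta gamma) (2 * H + 2) * q%:R <= cW * H%:R ^+ 2 &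
    TS a (quad_phase x beta gamma) (2 * H + 2) * `|q%:R * (2 * x) - b%:R| <= cW].
Proof.
move=> H0 bmp x0; have y0 : 0 <= 2 * x by lra.
have B4 : ((2 * H + 2).-1 <= 4 * H)%N by lia.
(* With the height [8 H], the error moves [h (2 x)] by at most [1 / (2 q)] for every lag
   [h <= 4 H]. *)
have [|q [b [/andP[q0 qN] cbq tle]]] := dirichlet_approximation (N := 8 * H) y0.
  by rewrite muln_gt0.
set B := (2 * H + 2)%N; set t := `|_| in tle *.
have qR : 1 <= q%:R :> R by rewrite (ler_nat _ 1).
have HR : 1 <= H%:R :> R by rewrite (ler_nat _ 1).
have qH : q%:R <= 8 * H%:R :> R by rewrite -natrM ler_nat.
have BR : B%:R <= 4 * H%:R :> R by rewrite /B natrD natrM; lra.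
pose N := (B.-1 %/ q)%N.
have B0 : (0 < B)%N by rewrite /B addnS.
have NqB : (N * q <= B.-1)%N by exact: leq_trunc_div.
have BNq : (B <= N.+1 * q)%N by rewrite -(prednK B0) ltn_ceil.
(* The lag [0] does not occur in the sum; setting it to zero lets the blocks of [q] lags start at
   [0]. *)
pose g h : R := if h == 0%N then 0 else `|weylT H a x beta h|.
have g0 h : 0 <= g h by rewrite /g; case: ifP.
pose M := \sum_(1 <= k < N.+1) `|weylT H a x beta (k * q)|.
have Nq : N.+1%:R * q%:R <= 12 * H%:R :> R.
  rewrite -!natrM ler_nat mulSn (leq_trans (leq_add qN NqB))//.
  by rewrite (leq_trans (leq_add (leqnn _) B4))// -mulnDl.
have sumT : \sum_(1 <= h < B) `|weylT H a x beta h| <= M + 12 * 256 * q%:R.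
  apply: (@le_trans _ _ (\sum_(0 <= h < N.+1 * q) g h)).
    rewrite [X in _ <= X](@big_cat_nat _ _ _ B)//= -[X in X <= _]addr0 lerD ?sumr_ge0//.
    rewrite [X in _ <= X]big_ltn// {1}/g eqxx add0r.
    by apply: ler_sum_nat => h /andP[h1 _]; rewrite /g -leqn0 leqNgt h1.
  rewrite sum_blocks.
  apply: (@le_trans _ _ (\sum_(0 <= k < N.+1) (g (k * q)%N + 256 * q%:R ^+ 2 / H%:R))).
    apply: ler_sum => k _; rewrite big_ltn// addn0 lerD2l.
    apply: le_trans (@sum_weylT_residues H a x beta q b k H0 bmp q0 cbq tle).
    apply: ler_sum_nat => r /andP[r1 _]; rewrite /g.
    by case: eqP => // /eqP; rewrite addn_eq0 => /andP[_ /eqP r0]; rewrite r0 in r1.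
  rewrite big_split/= lerD//.
    rewrite big_ltn// {1}/g mul0n eqxx add0r.
    by apply: ler_sum => k _; rewrite /g; case: ifP => // _; exact: normr_ge0.
  rewrite sumr_const_nat subn0 -[X in X <= _]mulr_natl.
  have -> : N.+1%:R * (256 * q%:R ^+ 2 / H%:R) = N.+1%:R * q%:R * (256 * q%:R / H%:R) :> R.
    by ring.
  have c0 : 0 <= 256 * q%:R / H%:R :> R.
    by apply: divr_ge0; [apply: mulr_ge0; exact: ler0n | exact: ler0n].
  apply: le_trans (ler_wpM2r c0 Nq) _.
  by rewrite le_eqVlt; apply/orP; left; apply/eqP; field; lra.
have bnd : TS a (quad_phase x beta gamma) B <= 4 * H%:R + 2 * (M + 12 * 256 * q%:R).
  apply: le_trans (weyl_bound x beta gamma bmp) _; rewrite -/B; lra.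
have [|Mq Mt] := @sum_weylT_multiples H a x beta q b N H0 bmp q0 _ tle.
  exact: leq_trans NqB B4.
rewrite -/M in Mq; rewrite -/M -/t in Mt.
have t0 : 0 <= t by exact: normr_ge0.
have Ht : H%:R * t <= 8^-1.
  by move: tle; rewrite natrM invfM ler_pdivlMr 1?mulrC//; lra.
have qt : q%:R * t <= 1 by apply: le_trans (ler_wpM2r t0 qH) _; lra.
exists q, b; split => //; rewrite -/t.
  apply: le_trans (ler_wpM2r (ler0n R q) bnd) _; rewrite /cW.
  have h1 : H%:R * q%:R <= 8 * H%:R ^+ 2 :> R by nra.
  have h2 : q%:R ^+ 2 <= 64 * H%:R ^+ 2 :> R by nra.
  have h3 : H%:R ^+ 2 >= 0 :> R by exact: sqr_ge0.
  move: M Mq h1 h2 h3 {sumT bnd Mt} => M Mq h1 h2 h3.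
  lra.
apply: le_trans (ler_wpM2r t0 bnd) _; rewrite /cW; lra.
Qed.

End weyl_sums.

(** * Level sets and moments of smoothly weighted sums *)

Section bump_moments.
Variable R : realType.
Implicit Types (a : nat -> R) (x : R).
Local Notation cW := (cW R).

Definition arc (q b : nat) (d : R) : set R :=
  `[b%:R / (2 * q%:R) - d / (2 * q%:R), b%:R / (2 * q%:R) + d / (2 * q%:R)]%classic.

(** A sum of indicators instead of the indicator of a union: only an upper bound of the measure is
    wanted, and overlaps may be counted several times. The numerators go up to [2 q] because [2 x]
    runs over [[0, 2]]. *)
Definition arcs (Q : nat) (d : R) x : R :=
  \sum_(1 <= q < Q.+1) \sum_(0 <= b < (2 * q).+1) \1_(arc q b d) x.

Lemma bm_arcs Q d : bm (arcs Q d).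
Proof. by apply: bm_sum => q _; apply: bm_sum => b _; exact: bm_indic. Qed.

Lemma arcs_ge0 Q d x : 0 <= arcs Q d x.
Proof. by rewrite sumr_ge0// => q _; rewrite sumr_ge0. Qed.

Lemma I_arcs Q d : 0 <= d -> I (arcs Q d) <= 3 * Q%:R * d.
Proof.
move=> d0; rewrite I_sum; last by move=> q _; apply: bm_sum => b _; exact: bm_indic.
apply: (@le_trans _ _ (\sum_(1 <= q < Q.+1) (3 * d))); last first.
  by rewrite sumr_const_nat subn1/= -[X in X <= _]mulr_natl; lra.
apply: ler_sum_nat => q /andP[q1 _]; have qR : 1 <= q%:R :> R by rewrite (ler_nat _ 1).
rewrite I_sum; last by move=> b _; exact: bm_indic.
apply: (@le_trans _ _ (\sum_(0 <= b < (2 * q).+1) (d / q%:R))).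
  apply: ler_sum => b _; have dq : 0 <= d / (2 * q%:R) by rewrite divr_ge0// mulr_ge0.
  apply: le_trans (I_indic _) _; first by lra.
  by rewrite le_eqVlt; apply/orP; left; apply/eqP; field; lra.
rewrite sumr_const_nat subn0 -[X in X <= _]mulr_natl mulrCA mulrC.
rewrite ler_wpM2r// ler_pdivrMr; last by lra.
by rewrite -[(2 * q).+1%:R]natr1 natrM; lra.
Qed.

(** On the level set [q <= C H^2 / L] and [|2 q x - b| <= C / L]. By [I_arcs] its measure is then
    [O(H^2 / L^2)], the weak type estimate. *)
Lemma weyl_level_set H a x beta gamma (L : R) : (0 < H)%N -> bump H a -> 0 < L -> 0 <= x <= 1 ->
  L < TS a (quad_phase x beta gamma) (2 * H + 2) ->
  1 <= arcs (Num.truncn (cW * H%:R ^+ 2 / L)) (cW / L) x.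
Proof.
move=> H0 bmp L0 /andP[x0 x1]; set X := TS _ _ _ => LX.
have [q [b [q0 tle Xq Xt]]] := weyl_pointwise beta gamma H0 bmp x0.
rewrite -/X in Xq Xt.
have qR : 1 <= q%:R :> R by rewrite (ler_nat _ 1).
have HR : 1 <= H%:R :> R by rewrite (ler_nat _ 1).
have cW0 : 0 <= cW by rewrite /cW; lra.
have qQ : (q <= Num.truncn (cW * H%:R ^+ 2 / L))%N.
  rewrite truncn_ge_nat; last by rewrite divr_ge0 ?(ltW L0)// mulr_ge0// sqr_ge0.
  rewrite ler_pdivlMr// mulrC; apply: le_trans Xq; rewrite ler_wpM2r//; exact: ltW.
have b2q : (b <= 2 * q)%N.
  rewrite -ltnS -(ltr_nat R).
  apply: (@le_lt_trans _ _ (q%:R * (2 * x) + 8^-1)).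
    have : (8 * H)%:R^-1 <= 8^-1 :> R.
      by rewrite lef_pV2 ?posrE ?ltr0n ?muln_gt0// ler_nat leq_pmulr.
    by move: tle; rewrite ler_norml => /andP[]; lra.
  rewrite -[(2 * q).+1%:R]natr1 natrM.
  have : q%:R * (2 * x) <= q%:R * 2 by rewrite ler_wpM2l//; lra.
  lra.
have tL : `|q%:R * (2 * x) - b%:R| <= cW / L.
  rewrite ler_pdivlMr// mulrC; apply: le_trans Xt; rewrite ler_wpM2r//; exact: ltW.
have xarc : x \in arc q b (cW / L).
  rewrite inE /arc /= in_itv /=; move: tL; rewrite ler_norml => /andP[h1 h2].
  rewrite -mulrBl -mulrDl ler_pdivrMr; last by lra.
  rewrite ler_pdivlMr; last by lra.
  by apply/andP; split; lra.
rewrite /arcs (@big_cat_nat _ _ _ q)//=; last by rewrite ltnW.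
rewrite -[X in X <= _]add0r lerD//.
  by rewrite sumr_ge0// => i _; rewrite sumr_ge0.
rewrite big_ltn// -[X in X <= _]addr0 lerD//; last first.
  by rewrite sumr_ge0// => i _; rewrite sumr_ge0.
rewrite (@big_cat_nat _ _ _ b)//=; last by rewrite ltnW.
rewrite -[X in X <= _]add0r lerD//; first by rewrite sumr_ge0.
rewrite big_ltn// indicE xarc -[X in X <= _]addr0 lerD//.
by rewrite sumr_ge0.
Qed.

(** [G i] is a majorant of the indicator of [2^i * H < X], so that [arcs] can be used directly; the
    levels are dyadic and [L] is where the trivial bound of [X] takes over. *)
Lemma layer_cake (X H r : R) (G : nat -> R) (L : nat) : 0 < r -> 0 <= X -> 0 < H ->
  (forall i, 0 <= G i) -> (forall i, 2 ^+ i * H < X -> 1 <= G i) -> X <= 2 ^+ L * H ->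
  X `^ r <= H `^ r + \sum_(0 <= i < L) (2 ^+ i.+1 * H) `^ r * G i.
Proof.
move=> r0 X0 H0 G0 G1; elim: L => [|L IHL] XL.
  by rewrite big_geq// addr0 ler_pow ?(ltW r0)//; move: XL; rewrite expr0 mul1r.
rewrite big_nat_recr//= addrA; have [h|h] := leP X (2 ^+ L * H).
  by rewrite ler_wpDr ?IHL// mulr_ge0 ?powR_ge0.
rewrite ler_wpDl//.
  rewrite addr_ge0 ?powR_ge0// sumr_ge0// => i _.
  by rewrite mulr_ge0 ?powR_ge0.
rewrite -[X in X <= _]mulr1 ler_pM ?powR_ge0 ?G1//.
by rewrite ler_pow// ltW.
Qed.

Lemma TS_le_bump H a ph : (0 < H)%N -> bump H a -> TS a ph (2 * H + 2) <= 32 * H%:R * H%:R.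
Proof.
move=> H0 [_ _ _ a_le _].
have HR : 1 <= H%:R :> R by rewrite (ler_nat _ 1).
have B : (2 * H + 2)%:R <= 4 * H%:R :> R by rewrite natrD natrM; lra.
have bd (f : R -> R) : (forall y, `|f y| <= 1) ->
    (\sum_(0 <= n < 2 * H + 2) a n * f (ph n)) ^+ 2 <= (4 * H%:R) ^+ 2.
  move=> f1; rewrite -real_normK ?num_real// ler_pXn2r ?nnegrE ?mulr_ge0//.
  apply: le_trans (ler_norm_sum _ _ _) _; apply: le_trans B.
  apply: (@le_trans _ _ (\sum_(0 <= n < 2 * H + 2) 1)); last first.
    by rewrite sumr_const_nat subn0.
  by apply: ler_sum => n _; rewrite normrM mulr_ile1.
have := lerD (bd cos (@cos_max R)) (bd sin (@sin_max R)); rewrite -/(TS a ph _).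
by move=> /le_trans; apply; rewrite le_eqVlt; apply/orP; left; apply/eqP; ring.
Qed.

Definition cM r : R := 3 * cW ^+ 2 * 2 `^ r.

(** The level [2^i * H] has measure [O(4^-i)], hence a contribution [H^r 2^(i (r - 2))]; the series
    is critical at [r = 2], that is [p = 4]. After [k + 5] levels the trivial bound [32 H^2] is
    reached. The lower coefficients [be] and [ga] depend on [x], as they do for a translated
    block. *)
Lemma bump_moment (k : nat) a (be ga : R -> R) (r : R) : 0 < r -> bump (2 ^ k) a ->
  bm (fun x => TS a (quad_phase x (be x) (ga x)) (2 * 2 ^ k + 2)) ->
  I (fun x => TS a (quad_phase x (be x) (ga x)) (2 * 2 ^ k + 2) `^ r) <= (2 ^+ k) `^ r * (1 + cM r * \sum_(0 <= i < k + 5) (2 `^ (r - 2)) ^+ i).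
Proof.
move=> r0 bmp bX; pose X x := TS a (quad_phase x (be x) (ga x)) (2 * 2 ^ k + 2).
rewrite -[fun x => _ `^ r]/(fun x => X x `^ r); rewrite -/X in bX.
set H := (2 ^ k)%N in bmp X bX *.
have H0 : (0 < H)%N by rewrite expn_gt0.
have HE : H%:R = 2 ^+ k :> R by rewrite natrX.
have HR : 1 <= H%:R :> R by rewrite (ler_nat _ 1).
have cW0 : 0 <= cW by rewrite /cW; lra.
pose L i : R := 2 ^+ i * H%:R.
have L0 i : 0 < L i by rewrite mulr_gt0 ?exprn_gt0//; lra.
pose Q i := Num.truncn (cW * H%:R ^+ 2 / L i).
pose G i := arcs (Q i) (cW / L i).
have X0 x : 0 <= X x by exact: TS_ge0.
apply: (@le_trans _ _ (I (fun x => H%:R `^ r + \sum_(0 <= i < k + 5) (2 ^+ i.+1 * H%:R) `^ r * G i x))).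
  apply: I_le.
  - by apply: bm_powR => //; exact: ltW.
  - apply: bmD; first exact: bm_cst.
    by apply: bm_sum => i _; apply: bmZ; exact: bm_arcs.
  - move=> x x01; apply: layer_cake => //.
    + by lra.
    + by move=> i; exact: arcs_ge0.
    + by move=> i hi; exact: (weyl_level_set H0 bmp (L0 i) x01 hi).
    + apply: le_trans (TS_le_bump _ H0 bmp) _.
      rewrite exprD -HE le_eqVlt; apply/orP; left; apply/eqP; ring.
rewrite ID; [|exact: bm_cst|by apply: bm_sum => i _; apply: bmZ; exact: bm_arcs].
rewrite I_cst I_sum; last by move=> i _; apply: bmZ; exact: bm_arcs.
rewrite -HE mulrDr mulr1 lerD2l mulr_sumr mulr_sumr.
apply: ler_sum => i _; rewrite IZ; last exact: bm_arcs.
have GI : I (G i) <= 3 * cW ^+ 2 * (2 ^+ i) ^- 2.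
  apply: le_trans (I_arcs _ _) _; first by rewrite divr_ge0// ltW.
  have QL : (Q i)%:R <= cW * H%:R ^+ 2 / L i.
    by rewrite -truncn_ge_nat// divr_ge0 ?(ltW (L0 i))// mulr_ge0// sqr_ge0.
  have d0 : 0 <= 3 * (cW / L i) by rewrite mulr_ge0// divr_ge0// ltW.
  rewrite [X in X <= _](_ : _ = (Q i)%:R * (3 * (cW / L i))); last by ring.
  apply: le_trans (ler_wpM2r d0 QL) _.
  rewrite le_eqVlt; apply/orP; left; apply/eqP; rewrite /L; field.
  have HN : H%:R != 0 :> R by rewrite lt0r_neq0//; lra.
  have iN : 2 ^+ i != 0 :> R by rewrite expf_neq0// pnatr_eq0.
  by rewrite HN iN.
apply: le_trans (ler_wpM2l (powR_ge0 _ _) GI) _.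
have i0 : 0 < 2 ^+ i :> R by rewrite exprn_gt0.
rewrite le_eqVlt; apply/orP; left; apply/eqP.
rewrite powRM//.
rewrite exprS powRM// /cM.
have -> : (2 `^ (r - 2)) ^+ i = (2 ^+ i) `^ r / (2 ^+ i) ^+ 2 :> R.
  rewrite -powR_mulrn ?powR_ge0// powRAC powR_mulrn// powRB ?(gt_eqF i0) ?implybT//.
  by rewrite powR2// ltW.
ring.
Qed.

End bump_moments.

(** * The modulus of a complex number given by its two parts *)

Section modulus.
Variable R : realType.
Implicit Types (a b c d x : R).

Lemma cmod_ge0 a b : 0 <= cmod a b. Proof. exact: sqrtr_ge0. Qed.

Lemma sqr_cmod a b : cmod a b ^+ 2 = a ^+ 2 + b ^+ 2.
Proof. by rewrite sqr_sqrtr// addr_ge0 ?sqr_ge0. Qed.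

Lemma cmodD a b c d : cmod (a + c) (b + d) <= cmod a b + cmod c d.
Proof.
rewrite -(@ler_pXn2r _ 2)// ?nnegrE ?addr_ge0 ?cmod_ge0//.
rewrite sqrrD !sqr_cmod; have cs : a * c + b * d <= cmod a b * cmod c d.
  have [h|h] := leP (a * c + b * d) 0; first by rewrite (le_trans h)// mulr_ge0 ?cmod_ge0.
  rewrite -(@ler_pXn2r _ 2)// ?nnegrE ?mulr_ge0 ?cmod_ge0//; last exact: ltW.
  by rewrite exprMn !sqr_cmod; have := sqr_ge0 (a * d - b * c); lra.
lra.
Qed.

Lemma cmod0 : cmod (0 : R) 0 = 0.
Proof. by rewrite /cmod expr0n addr0 sqrtr0. Qed.

Lemma cmodN a b : cmod (- a) (- b) = cmod a b.
Proof. by rewrite /cmod !sqrrN. Qed.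

Lemma cmodZ c a b : cmod (c * a) (c * b) = `|c| * cmod a b.
Proof. by rewrite /cmod !exprMn -mulrDr sqrtrM ?sqr_ge0// sqrtr_sqr. Qed.

Lemma cmod_sum (T : Type) (s : seq T) (P : pred T) (f g : T -> R) :
  cmod (\sum_(i <- s | P i) f i) (\sum_(i <- s | P i) g i) <= \sum_(i <- s | P i) cmod (f i) (g i).
Proof.
elim: s => [|i s IHs]; first by rewrite !big_nil cmod0.
rewrite !big_cons; case: ifP => // _; apply: le_trans (cmodD _ _ _ _) _.
by rewrite lerD2l.
Qed.

Lemma bm_cmod (f g : R -> R) : bm f -> bm g -> bm (fun x => cmod (f x) (g x)).
Proof. by move=> bf bg; apply: bm_sqrt; apply: bmD; exact: bmX. Qed.

Lemma continuous_affine (c d : R) : continuous (fun x => c * x + d).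
Proof. by move=> x; apply: cvgD; [apply: cvgM; [exact: cvg_cst | exact: cvg_id] | exact: cvg_cst]. Qed.

Lemma bm_cos_affine (c d : R) : bm (fun x => cos (c * x + d)).
Proof.
apply: (@bm_continuous _ _ 1) => [x|x]; last exact: cos_max.
by apply: continuous_comp; [exact: continuous_affine | exact: continuous_cos].
Qed.

Lemma bm_sin_affine (c d : R) : bm (fun x => sin (c * x + d)).
Proof.
apply: (@bm_continuous _ _ 1) => [x|x]; last exact: sin_max.
by apply: continuous_comp; [exact: continuous_affine | exact: continuous_sin].
Qed.

Lemma bm_cosZ (c : R) : bm (fun x => cos (c * x)).
Proof. by under eq_fun do rewrite -[_ * _]addr0; exact: bm_cos_affine. Qed.

Lemma bm_sinZ (c : R) : bm (fun x => sin (c * x)).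
Proof. by under eq_fun do rewrite -[_ * _]addr0; exact: bm_sin_affine. Qed.

Lemma I_powR_add (f g : R -> R) (A B p : R) : 1 <= p -> 0 < A -> 0 < B ->
  (forall x, 0 <= f x) -> (forall x, 0 <= g x) -> bm f -> bm g ->
  I (fun x => f x `^ p) <= A `^ p -> I (fun x => g x `^ p) <= B `^ p ->
  I (fun x => (f x + g x) `^ p) <= (A + B) `^ p.
Proof.
move=> p1 A0 B0 f0 g0 bf bg fA gB.
have := @I_powR_sum R bool [:: true; false] xpredT (fun i : bool => if i then A else B)
  (fun i : bool => if i then f else g) p p1.
rewrite !big_cons big_nil addr0.
under [X in I X]eq_fun do rewrite !big_cons big_nil addr0.
by apply => -[].
Qed.

Lemma I_powR_le (f g : R -> R) (p : R) : 0 <= p -> (forall x, 0 <= f x) -> (forall x, f x <= g x) ->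
  bm f -> bm g -> I (fun x => f x `^ p) <= I (fun x => g x `^ p).
Proof.
move=> p0 f0 fg bf bg; have g0 x : 0 <= g x by exact: le_trans (fg x).
by apply: I_le => [||x _]; [exact: bm_powR | exact: bm_powR | rewrite ler_pow].
Qed.

End modulus.

(** * Exponential sums over intervals *)

Section ramps.
Variable R : realType.

(** The predecessor makes the ramp vanish at both [0] and [1], as the double summation by parts
    requires of the weights. *)
Definition ramp (H j : nat) : R := (minn j.-1 H)%:R / H%:R.

Lemma ramp01 H j : (0 < H)%N -> 0 <= ramp H j <= 1.
Proof.
move=> H0; have HR : 0 < H%:R :> R by rewrite ltr0n.
by rewrite /ramp divr_ge0//= ler_pdivrMr// mul1r ler_nat geq_minr.
Qed.

Lemma ramp_slope H j : (0 < H)%N -> 0 <= ramp H j.+1 - ramp H j <= H%:R^-1.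
Proof.
move=> H0; have HR : 0 < H%:R :> R by rewrite ltr0n.
rewrite /ramp -mulrBl /=.
have h1 : (minn j.-1 H <= minn j H)%N by lia.
have h2 : (minn j H <= minn j.-1 H + 1)%N by lia.
rewrite -natrB//; apply/andP; split; first by rewrite divr_ge0.
by rewrite -[X in _ <= X]mul1r ler_wpM2r ?invr_ge0// (ler_nat _ _ 1) leq_subLR.
Qed.

Lemma ramp_eq1 H j : (0 < H)%N -> (H < j)%N -> ramp H j = 1.
Proof.
move=> H0 Hj; rewrite /ramp (minn_idPr _) ?divff ?pnatr_eq0 -?lt0n//.
by rewrite -ltnS prednK// (leq_ltn_trans _ Hj).
Qed.

Lemma ramp_eq0 H j : (j <= 1)%N -> ramp H j = 0.
Proof. by case: j => [|[|j]]// _; rewrite /ramp min0n mul0r. Qed.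

(** Width [1] is the sharp cut-off at index [2]: hence the shifts by [2] in the decomposition of
    intervals. *)
Lemma ramp1 j : ramp 1 j = if (2 <= j)%N then 1 else 0.
Proof.
by case: ifPn => j2; [rewrite ramp_eq1 | rewrite ramp_eq0// leqNgt].
Qed.

(** The ramp is linear except at its two kinks, [j = 0] and [j = H], where the second difference is
    [1 / H] in modulus. *)
Lemma ramp_second_difference H N : (0 < H)%N ->
  \sum_(0 <= j < N) `|ramp H j.+2 - 2 * ramp H j.+1 + ramp H j| <= 2 / H%:R.
Proof.
move=> H0; have HR : 0 < H%:R :> R by rewrite ltr0n.
apply: (@le_trans _ _ (\sum_(0 <= j < N) ((j == 0%N)%:R + (j == H)%:R) / H%:R)).
  apply: ler_sum => j _; rewrite /ramp /=.
  have -> : (minn j.+1 H)%:R / H%:R - 2 * ((minn j H)%:R / H%:R) + (minn j.-1 H)%:R / H%:R =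
    ((minn j.+1 H)%:R - 2 * (minn j H)%:R + (minn j.-1 H)%:R) / H%:R :> R by ring.
  rewrite normrM [X in _ * X]ger0_norm ?invr_ge0// ler_wpM2r ?invr_ge0//.
  have [->|j0] := posnP j.
    by rewrite (minn_idPl H0) !min0n mulr0 subr0 addr0 normr1 lerDl.
  case: (ltngtP j H) => [jH|jH|->].
  - have -> : minn j.+1 H = j.+1 by lia.
    have -> : minn j.-1 H = j.-1 by lia.
    rewrite -[j.+1%:R]natr1 -{2}(prednK j0) -[in X in 2 * X]natr1.
    rewrite -{1}(prednK j0) -[j.-1.+1%:R]natr1.
    by rewrite [X in `|X|](_ : _ = 0) ?normr0//; ring.
  - have -> : minn j.+1 H = H by lia.
    have -> : minn j.-1 H = H by lia.
    by rewrite [X in `|X|](_ : _ = 0) ?normr0//; ring.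
  - rewrite (minn_idPr (leqnSn _)) (minn_idPl (leq_pred _)).
    have -> : H%:R - 2 * H%:R + H.-1%:R = - 1 :> R.
      by rewrite -{1 2}(prednK H0) -natr1; ring.
    by rewrite normrN1 lerDr.
rewrite -mulr_suml ler_wpM2r ?invr_ge0// big_split/=.
have one k : \sum_(0 <= j < N) (j == k)%:R <= 1 :> R.
  suff -> : \sum_(0 <= j < N) (j == k)%:R = (k < N)%N%:R :> R by case: (k < N)%N.
  elim: N => [|N IHN]; first by rewrite big_geq.
  rewrite big_nat_recr//= IHN -natrD; congr _%:R.
  by rewrite ltnS; case: (ltngtP k N).
by have := lerD (one 0%N) (one H).
Qed.

Lemma ramp_shift_second_difference H L N : (0 < H)%N ->
  \sum_(0 <= j < N) `|ramp H (j.+2 - L) - 2 * ramp H (j.+1 - L) + ramp H (j - L)| <= 2 / H%:R.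
Proof.
move=> H0; have z j : (j < L)%N ->
    `|ramp H (j.+2 - L) - 2 * ramp H (j.+1 - L) + ramp H (j - L)| = 0.
  by move=> jL; rewrite !ramp_eq0 ?mulr0 ?subr0 ?addr0 ?normr0//; lia.
have [NL|LN] := leqP N L.
  rewrite big_nat big1 ?divr_ge0// => j /andP[_ jN]; apply: z; exact: leq_trans jN NL.
rewrite (@big_cat_nat _ _ _ L)//=; last exact: ltnW.
rewrite big_nat big1 ?add0r => [|j /andP[_ jL]]; last exact: z.
rewrite -{1}[L]add0n big_addn; apply: le_trans (ramp_second_difference (N - L) H0).
apply: ler_sum => j _.
have -> : ((j + L).+2 - L = j.+2)%N by lia.
have -> : ((j + L).+1 - L = j.+1)%N by lia.
by rewrite addnK.
Qed.

Definition tent (H j : nat) : R := ramp H j - ramp (2 * H) j.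

Definition trapezoid (H L j : nat) : R := ramp H j - ramp H (j - L).

Lemma bump_tent H : (0 < H)%N -> bump H (tent H).
Proof.
move=> H0; have H20 : (0 < 2 * H)%N by rewrite muln_gt0.
have HR : 0 < H%:R :> R by rewrite ltr0n.
split; [| | | |split].
- by rewrite /tent !ramp_eq0 ?subrr.
- by rewrite /tent !ramp_eq0 ?subrr.
- by move=> n Hn; rewrite /tent !ramp_eq1 ?subrr//; lia.
- move=> n; have := ramp01 n H0; have := ramp01 n H20.
  by rewrite ler_norml /tent; lra.
- move=> n; have := ramp_slope n H0; have := ramp_slope n H20.
  have : (2 * H)%:R^-1 <= H%:R^-1 :> R.
    by rewrite lef_pV2 ?posrE ?ltr0n// ler_nat leq_pmull.
  by rewrite ler_norml /tent; lra.
- apply: (@le_trans _ _ (\sum_(0 <= n < 2 * H + 2) (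
     `|ramp H n.+2 - 2 * ramp H n.+1 + ramp H n| +
     `|ramp (2 * H) n.+2 - 2 * ramp (2 * H) n.+1 + ramp (2 * H) n|))).
    apply: ler_sum => n _; apply: le_trans (ler_normB _ _).
    by rewrite le_eqVlt; apply/orP; left; apply/eqP; congr `|_|; rewrite /tent; ring.
  rewrite big_split/=; apply: le_trans (lerD (ramp_second_difference _ H0) (ramp_second_difference _ H20)) _.
  have -> : 4 / H%:R = 2 / H%:R + 2 / H%:R :> R by ring.
  by rewrite lerD2l ler_wpM2l// lef_pV2 ?posrE ?ltr0n// ler_nat leq_pmull.
Qed.

Lemma bump_trapezoid H L : (0 < H)%N -> (L <= H)%N -> bump H (trapezoid H L).
Proof.
move=> H0 LH; have HR : 0 < H%:R :> R by rewrite ltr0n.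
split; [| | | |split].
- by rewrite /trapezoid !ramp_eq0 ?subrr.
- by rewrite /trapezoid !ramp_eq0 ?subrr//; lia.
- by move=> n Hn; rewrite /trapezoid !ramp_eq1 ?subrr//; lia.
- move=> n; have := ramp01 n H0; have := ramp01 (n - L) H0.
  by rewrite ler_norml /trapezoid; lra.
- move=> n; have := ramp_slope n H0; have : 0 <= ramp H (n.+1 - L) - ramp H (n - L) <= H%:R^-1.
    have [nL|Ln] := ltnP n L.
      by rewrite (ramp_eq0 H (j := n.+1 - L)) ?ramp_eq0 ?subrr ?lexx ?invr_ge0 ?ler0n//; lia.
    by rewrite subSn//; exact: ramp_slope.
  by rewrite ler_norml /trapezoid; lra.
- apply: (@le_trans _ _ (\sum_(0 <= n < 2 * H + 2) (
     `|ramp H n.+2 - 2 * ramp H n.+1 + ramp H n| +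
     `|ramp H (n.+2 - L) - 2 * ramp H (n.+1 - L) + ramp H (n - L)|))).
    apply: ler_sum => n _; apply: le_trans (ler_normB _ _).
    by rewrite le_eqVlt; apply/orP; left; apply/eqP; congr `|_|; rewrite /trapezoid; ring.
  rewrite big_split/=; apply: le_trans (lerD (ramp_second_difference _ H0)
    (ramp_shift_second_difference L _ H0)) _.
  by rewrite le_eqVlt; apply/orP; left; apply/eqP; ring.
Qed.

Lemma ramp_telescope K j : ramp 1 j = ramp (2 ^ K) j + \sum_(0 <= k < K) tent (2 ^ k) j.
Proof.
elim: K => [|K IHK]; first by rewrite big_geq// addr0.
by rewrite big_nat_recr//= IHK /tent expnS; ring.
Qed.

Definition bsum (H : nat) (a G : nat -> R) (m : nat) : R :=
  \sum_(0 <= j < 2 * H + 2) a j * G (m + j)%N.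

(* An interval is a trapezoid plus dyadic tents accumulating at its two ends. *)
Lemma interval_decomposition (G : nat -> R) (m L K : nat) : (L <= 2 ^ K)%N ->
  \sum_(m <= n < m + L) G n.+2 = bsum (2 ^ K) (trapezoid (2 ^ K) L) G m +
    \sum_(0 <= k < K) (bsum (2 ^ k) (tent (2 ^ k)) G m - bsum (2 ^ k) (tent (2 ^ k)) G (m + L)).
Proof.
move=> LK; pose N := (2 * 2 ^ K + 2)%N.
have widen k a M m' : bump (2 ^ k) a -> (2 * 2 ^ k + 2 <= M)%N ->
    bsum (2 ^ k) a G m' = \sum_(0 <= j < M) a j * G (m' + j)%N.
  move=> [_ _ aB _ _] kM; rewrite [RHS](@big_cat_nat _ _ _ (2 * 2 ^ k + 2))//=.
  rewrite [X in _ + X]big_nat [X in _ + X]big1 ?addr0// => j /andP[kj _].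
  by rewrite aB ?mul0r.
have pow0 k : (0 < 2 ^ k)%N by rewrite expn_gt0.
rewrite (widen _ _ (N + L)%N _ (bump_trapezoid (pow0 K) LK)); last by rewrite leq_addr.
under [X in _ = _ + X]eq_big_nat => k /andP[_ kK].
  have kN : (2 * 2 ^ k + 2 <= N)%N by rewrite leq_add2r leq_mul2l leq_exp2l// ltnW// orbT.
  rewrite (widen k (tent (2 ^ k)) (N + L)%N m (bump_tent (pow0 k))); last first.
    exact: leq_trans kN (leq_addr _ _).
  rewrite (widen k (tent (2 ^ k)) N (m + L)%N (bump_tent (pow0 k)))//.
  over.
rewrite sumrB (exchange_big_nat _ _ _ _ _ _)//= [X in _ - X]exchange_big_nat//=.
have shiftE (a : nat -> R) : a 0 = 0 -> \sum_(0 <= j < N) a j * G (m + L + j)%N =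
    \sum_(0 <= j < N + L) a (j - L)%N * G (m + j)%N.
  move=> a0; rewrite [RHS](@big_cat_nat _ _ _ L)//=; last exact: leq_addl.
  rewrite [X in _ = X + _]big_nat [X in _ = X + _]big1 ?add0r; last first.
    move=> j /andP[_ jL]; have -> : (j - L = 0)%N by lia.
    by rewrite a0 mul0r.
  rewrite -[X in index_iota X (N + L)]add0n big_addn addnK.
  by apply: eq_bigr => j _; rewrite addnK addnAC addnA.
have -> : \sum_(0 <= j < N) \sum_(0 <= i < K) tent (2 ^ i) j * G (m + L + j)%N =
    \sum_(0 <= j < N + L) \sum_(0 <= i < K) tent (2 ^ i) (j - L) * G (m + j)%N.
  under eq_bigr do rewrite -mulr_suml.
  rewrite (shiftE (fun j => \sum_(0 <= i < K) tent (2 ^ i) j)).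
    by apply: eq_bigr => j _; rewrite mulr_suml.
  by apply: big1 => i _; rewrite /tent !ramp_eq0 ?subrr.
rewrite -sumrB -big_split/=.
(* By [ramp_telescope] the total weight of [G (m + j)] is [ramp 1 j - ramp 1 (j - L)], the indicator
   of [2 <= j < L + 2]. *)
transitivity (\sum_(0 <= j < N + L) (ramp 1 j - ramp 1 (j - L)) * G (m + j)%N); last first.
  apply: eq_bigr => j _; rewrite (ramp_telescope K j) (ramp_telescope K (j - L)).
  by rewrite -!mulr_suml /trapezoid; ring.
rewrite (@big_cat_nat _ _ _ 2 0)//=; last by rewrite /N; lia.
rewrite [X in _ = X + _]big_nat [X in _ = X + _]big1 ?add0r; last first.
  by move=> j /andP[_ j2]; rewrite !ramp_eq0 ?subrr ?mul0r//; lia.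
rewrite (@big_cat_nat _ _ _ (L + 2) 2)//=; [|by rewrite leq_addl|by rewrite /N; lia].
rewrite [X in _ = _ + X]big_nat [X in _ = _ + X]big1 ?addr0; last first.
  move=> j /andP[Lj _]; rewrite !ramp1.
  have -> : (2 <= j)%N by lia.
  have -> : (2 <= j - L)%N by lia.
  by rewrite subrr mul0r.
rewrite -{1}[m]add0n [(m + L)%N]addnC big_addn addnK.
rewrite -[X in index_iota X (L + 2)]add0n big_addn addnK.
apply: eq_big_nat => j /andP[_ jL]; rewrite !ramp1.
have -> : (2 <= j + 2)%N by lia.
have -> : (2 <= j + 2 - L)%N = false by lia.
by rewrite subr0 mul1r addn2 addnS addnS addnC.
Qed.

End ramps.

(** * Partial summation against monotone coefficients *)

Section square_sums.
Variable R : realType.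
Implicit Types (c b : nat -> R) (x p A : R) (m n : nat).

(* Exponential sums over the squares: [Emod c m n x] is the modulus of
   [\sum_(m <= j < n) c j * e(j ^ 2 * x)] with [e(t) = exp(2 i pi t)]. *)
Definition Ere c m n x : R := \sum_(m <= j < n) c j * cos (2 * pi * (j ^ 2)%N%:R * x).
Definition Eim c m n x : R := \sum_(m <= j < n) c j * sin (2 * pi * (j ^ 2)%N%:R * x).
Definition Emod c m n x : R := cmod (Ere c m n x) (Eim c m n x).

Lemma bm_Ere c m n : bm (Ere c m n).
Proof. by apply: bm_sum => j _; apply: bmZ; exact: bm_cosZ. Qed.

Lemma bm_Eim c m n : bm (Eim c m n).
Proof. by apply: bm_sum => j _; apply: bmZ; exact: bm_sinZ. Qed.

Lemma bm_Emod c m n : bm (Emod c m n).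
Proof. by apply: bm_cmod; [exact: bm_Ere | exact: bm_Eim]. Qed.

Lemma Emod_ge0 c m n x : 0 <= Emod c m n x. Proof. exact: cmod_ge0. Qed.
Hint Resolve Emod_ge0 bm_Emod : core.

Lemma Emod_cat c m n k x : (m <= k <= n)%N -> Emod c m n x <= Emod c m k x + Emod c k n x.
Proof.
move=> /andP[mk kn]; rewrite /Emod /Ere /Eim (@big_cat_nat _ _ _ k)//=.
by rewrite (@big_cat_nat _ _ _ k m n xpredT (fun j => c j * sin _))//=; exact: cmodD.
Qed.

Lemma I_powR_wsum (T : Type) (s : seq T) (w : T -> R) (f : T -> R -> R) A p :
  1 <= p -> 0 < A -> (forall i, 0 <= w i) -> (forall i x, 0 <= f i x) ->
  (forall i, bm (f i)) -> (forall i, 0 < w i -> I (fun x => f i x `^ p) <= A `^ p) ->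
  I (fun x => (\sum_(i <- s) w i * f i x) `^ p) <= ((\sum_(i <- s) w i) * A) `^ p.
Proof.
move=> p1 A0 w0 f0 bf fA.
(* Terms of weight zero are dropped first: [I_powR_sum] divides by the weights. *)
have nz (g : T -> R) : \sum_(i <- s) w i * g i = \sum_(i <- s | 0 < w i) w i * g i.
  rewrite [RHS]big_mkcond/=; apply: eq_bigr => i _; case: ltP => // wi.
  have -> : w i = 0 by apply/eqP; rewrite eq_le wi w0.
  by rewrite mul0r.
under [X in I X]eq_fun do rewrite nz.
rewrite mulr_suml (nz (fun=> A)).
apply: I_powR_sum => // [i wi|i x _|i _|i wi].
- exact: mulr_gt0.
- exact: mulr_ge0.
- exact: bmZ.
under [X in I X]eq_fun do rewrite powRM//.
rewrite powRM ?(ltW A0)// IZ; last by apply: bm_powR => //; lra.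
by rewrite ler_wpM2l ?powR_ge0// fA.
Qed.

(** Two forms of summation by parts are used. For nonnegative nonincreasing [c] the coefficients
    here are nonnegative with total [c m]; for nondecreasing [c] those of [abel_inc] are nonnegative
    with total [c n]. *)
Lemma abel_dec (c g : nat -> R) m n : (m <= n)%N ->
  \sum_(m <= j < n.+1) c j * g j = c n * \sum_(m <= j < n.+1) g j +
    \sum_(m <= k < n) (c k - c k.+1) * \sum_(m <= j < k.+1) g j.
Proof.
move=> mn; rewrite -(subnKC mn); elim: (n - m)%N => [|d IHd].
  by rewrite addn0 !big_nat1 big_geq// addr0.
rewrite addnS big_nat_recr ?leqW ?leq_addr//= IHd.
rewrite [in RHS]big_nat_recr ?leqW ?leq_addr//=.
rewrite [X in _ = _ + X]big_nat_recr ?leq_addr//=; ring.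
Qed.

Lemma abel_inc (c g : nat -> R) m n : (m <= n)%N ->
  \sum_(m <= j < n.+1) c j * g j = c m * \sum_(m <= j < n.+1) g j +
    \sum_(m <= k < n) (c k.+1 - c k) * \sum_(k.+1 <= j < n.+1) g j.
Proof.
move=> mn; rewrite -(subnKC mn); elim: (n - m)%N => [|d IHd].
  by rewrite addn0 !big_nat1 big_geq// addr0.
rewrite addnS big_nat_recr ?leqW ?leq_addr//= IHd.
rewrite [\sum_(m <= j < (m + d).+2) g j]big_nat_recr ?leqW ?leq_addr//=.
have -> : \sum_(m <= k < (m + d).+1) (c k.+1 - c k) * \sum_(k.+1 <= j < (m + d).+2) g j =
  \sum_(m <= k < (m + d).+1) (c k.+1 - c k) * \sum_(k.+1 <= j < (m + d).+1) g j +
  \sum_(m <= k < (m + d).+1) (c k.+1 - c k) * g (m + d).+1.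
  rewrite -big_split/=; apply: eq_big_nat => k /andP[_ kd].
  by rewrite big_nat_recr//= mulrDr.
rewrite -[in X in _ + (_ + X)]mulr_suml telescope_sumr ?leqW ?leq_addr//.
by rewrite [X in _ = _ + (X + _)]big_nat_recr ?leq_addr//= (@big_geq _ _ _ (m + d).+1 (m + d).+1)//; ring.
Qed.

(** Uniformity over all subintervals is what partial summation consumes, and also what it yields, so
    monotone factors can be inserted one after the other. *)
Definition blockb p A (M N : nat) b : Prop :=
  forall m n, (M <= m)%N -> (m <= n)%N -> (n <= N)%N -> I (fun x => Emod b m n x `^ p) <= A `^ p.

(** Partial summation expresses the new sum as a combination of sums over subintervals, with
    nonnegative weights of total at most [C]; Minkowski's inequality then loses nothing more. *)
Lemma abel_block (M N : nat) b c p A C : 1 <= p -> 0 < A -> 0 < C ->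
  (forall j, (M <= j < N)%N -> 0 <= c j <= C) ->
  ((forall j, (M <= j)%N -> (j.+1 < N)%N -> c j.+1 <= c j) \/
   (forall j, (M <= j)%N -> (j.+1 < N)%N -> c j <= c j.+1)) ->
  blockb p A M N b -> blockb p (C * A) M N (fun j => c j * b j).
Proof.
move=> p1 A0 C0 cC mono bA m n Mm mn nN; have p0 : 0 <= p by lra.
have CA : 0 < C * A by rewrite mulr_gt0.
move: mn; rewrite leq_eqVlt => /predU1P[<-|].
  rewrite (@I_ext _ _ (fun=> 0)) ?I_cst ?powR_ge0// => x.
  by rewrite /Emod /Ere /Eim !big_geq// cmod0 powR0//; lra.
case: n nN => // n nN; rewrite ltnS => mn.
have cn : 0 <= c n <= C by apply: cC; rewrite (leq_trans Mm mn).
have cm : 0 <= c m <= C by apply: cC; rewrite Mm (leq_ltn_trans mn).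
pose idx := n :: index_iota m n.
case: mono => mono.
  (* The index [n] carries the boundary term. The maximum with [0] only serves to make [w]
     nonnegative at every index; it changes nothing for [m <= k < n]. *)
  pose w k := if k == n then c n else Order.max 0 (if (m <= k < n)%N then c k - c k.+1 else 0).
  have w0 k : 0 <= w k.
    by rewrite /w; case: ifP => _; [case/andP: cn | rewrite le_max lexx].
  have wk k : (m <= k < n)%N -> w k = c k - c k.+1.
    move=> /andP[mk kn]; rewrite /w (ltn_eqF kn) mk kn /=; apply/max_idPr.
    by rewrite subr_ge0 mono ?(leq_trans Mm)// (leq_trans _ nN)// ltnS.
  have wn : w n = c n by rewrite /w eqxx.
  have sumw : \sum_(k <- idx) w k = c m.
    rewrite big_cons wn; have -> : \sum_(m <= k < n) w k = - \sum_(m <= k < n) (c k.+1 - c k).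
      by rewrite -sumrN; apply: eq_big_nat => k kmn; rewrite wk// opprB.
    by rewrite telescope_sumr//; ring.
  apply: (@le_trans _ _ (I (fun x => (\sum_(k <- idx) w k * Emod b m k.+1 x) `^ p))).
    apply: I_powR_le => // [x|]; last by apply: bm_sum => k _; exact: bmZ.
    have -> : Emod (fun j => c j * b j) m n.+1 x =
        cmod (\sum_(k <- idx) w k * Ere b m k.+1 x) (\sum_(k <- idx) w k * Eim b m k.+1 x).
      rewrite /Emod /Ere /Eim.
      under eq_bigr do rewrite -mulrA; under [X in cmod _ X = _]eq_bigr do rewrite -mulrA.
      rewrite !(abel_dec c)// !big_cons wn; congr cmod; congr (_ + _);
        by apply: eq_big_nat => k kmn; rewrite wk.
    apply: le_trans (cmod_sum _ _ _ _) _; apply: ler_sum => k _.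
    by rewrite cmodZ ger0_norm.
  apply: le_trans (I_powR_wsum (A := A) idx p1 A0 w0 _ _ _) _ => //.
    move=> k wk0; have [->|kn] := eqVneq k n; first by apply: bA => //; exact: leqW.
    have kmn : (m <= k < n)%N.
      by move: wk0; rewrite /w (negPf kn); case: ifP => // _; rewrite maxxx ltxx.
    case/andP: kmn => mk kn'; apply: bA => //; first exact: leqW.
    by rewrite (leq_trans _ nN)// ltnS ltnW.
  rewrite sumw ler_pow ?mulr_ge0 ?(ltW A0) ?ler_wpM2r//; [by case/andP: cm | exact: ltW | by case/andP: cm].
pose w k := if k == n then c m else Order.max 0 (if (m <= k < n)%N then c k.+1 - c k else 0).
pose f k := if k == n then Emod b m n.+1 else Emod b k.+1 n.+1.
have w0 k : 0 <= w k.
  by rewrite /w; case: ifP => _; [case/andP: cm | rewrite le_max lexx].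
have wk k : (m <= k < n)%N -> w k = c k.+1 - c k.
  move=> /andP[mk kn]; rewrite /w (ltn_eqF kn) mk kn /=; apply/max_idPr.
  by rewrite subr_ge0 mono ?(leq_trans Mm)// (leq_trans _ nN)// ltnS.
have wn : w n = c m by rewrite /w eqxx.
have sumw : \sum_(k <- idx) w k = c n.
  rewrite big_cons wn; have -> : \sum_(m <= k < n) w k = \sum_(m <= k < n) (c k.+1 - c k).
    by apply: eq_big_nat => k kmn; rewrite wk.
  by rewrite telescope_sumr//; ring.
apply: (@le_trans _ _ (I (fun x => (\sum_(k <- idx) w k * f k x) `^ p))).
  apply: I_powR_le => // [x|]; last by apply: bm_sum => k _; apply: bmZ; rewrite /f; case: ifP.
  rewrite /Emod /Ere /Eim.
  under eq_bigr do rewrite -mulrA; under [X in cmod _ X <= _]eq_bigr do rewrite -mulrA.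
  rewrite !(abel_inc c)// big_cons wn {1}/f eqxx.
  apply: le_trans (cmodD _ _ _ _) _; rewrite cmodZ ger0_norm ?lerD2l; last by case/andP: cm.
  apply: le_trans (cmod_sum _ _ _ _) _.
  apply: ler_sum_nat => k kmn; rewrite cmodZ wk// /f (ltn_eqF (_ : k < n)%N); last by case/andP: kmn.
  by rewrite ger0_norm// -wk.
apply: le_trans (I_powR_wsum (A := A) idx p1 A0 w0 _ _ _) _ => //.
- by move=> k x; rewrite /f; case: ifP => _; exact: Emod_ge0.
- by move=> k; rewrite /f; case: ifP.
- move=> k wk0; rewrite /f; have [kE|kn] := eqVneq k n; first by apply: bA => //; exact: leqW.
  have kmn : (m <= k < n)%N.
    by move: wk0; rewrite /w (negPf kn); case: ifP => // _; rewrite maxxx ltxx.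
  case/andP: kmn => mk kn'; apply: bA => //; last exact: leqW.
  by rewrite (leq_trans Mm)// leqW.
rewrite sumw ler_pow ?mulr_ge0 ?(ltW A0) ?ler_wpM2r//; [by case/andP: cn | exact: ltW | by case/andP: cn].
Qed.

End square_sums.

(** * Moments of sums over intervals *)

Section interval_sums.
Variable R : realType.
Implicit Types (a : nat -> R) (x p : R) (m n k K : nat).

Definition wb p k : R :=
  ((2 ^+ k) `^ (p / 2) * (1 + cM (p / 2) * \sum_(0 <= i < k + 5) (2 `^ (p / 2 - 2)) ^+ i)) `^ p^-1.

Lemma cM_gt0 r : 0 < cM r :> R.
Proof. by rewrite /cM /cW; have := powR_gt0 r (ltr0Sn R 1); nra. Qed.

Lemma wb_base_gt0 p n : 0 < 1 + cM p * \sum_(0 <= i < n) (2 `^ (p - 2)) ^+ i :> R.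
Proof.
rewrite ltr_pwDl// mulr_ge0//; first by apply: ltW; exact: cM_gt0.
by rewrite sumr_ge0// => i _; apply: exprn_ge0; exact: powR_ge0.
Qed.

Lemma wb_gt0 p k : 0 < wb p k.
Proof.
by apply: powR_gt0; apply: mulr_gt0; [rewrite powR_gt0// exprn_gt0 | exact: wb_base_gt0].
Qed.

(** Subtracting [2] undoes the two leading zeros of the weights. The subtraction is made in [R], so
    the phase is an exact quadratic polynomial even for [i < 2]. *)
Definition cosq x (i : nat) : R := cos (2 * pi * ((i%:R - 2) ^+ 2 * x)).
Definition sinq x (i : nat) : R := sin (2 * pi * ((i%:R - 2) ^+ 2 * x)).

Definition bmod H a m x : R := cmod (bsum H a (cosq x) m) (bsum H a (sinq x) m).

Lemma bm_bmod H a m : bm (bmod H a m).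
Proof.
apply: bm_cmod; apply: bm_sum => j _; apply: bmZ; rewrite /cosq /sinq.
  by under eq_fun do rewrite mulrA; exact: bm_cosZ.
by under eq_fun do rewrite mulrA; exact: bm_sinZ.
Qed.

Lemma bmod_sqr H a m x : bmod H a m x ^+ 2 =
  TS a (quad_phase x (2 * pi * (2 * (m%:R - 2) * x)) (2 * pi * ((m%:R - 2) ^+ 2 * x))) (2 * H + 2).
Proof.
have phE j : 2 * pi * (((m + j)%:R - 2) ^+ 2 * x) =
    quad_phase x (2 * pi * (2 * (m%:R - 2) * x)) (2 * pi * ((m%:R - 2) ^+ 2 * x)) j.
  by rewrite /quad_phase natrD; ring.
rewrite sqr_cmod /TS /bsum; congr (_ ^+ 2 + _ ^+ 2).
  by apply: eq_bigr => j _; rewrite /cosq phE.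
by apply: eq_bigr => j _; rewrite /sinq phE.
Qed.

Lemma powR_sqr x p : 0 <= x -> (x ^+ 2) `^ (p / 2) = x `^ p.
Proof.
by move=> x0; rewrite -powR2// -powRrM; congr powR; field.
Qed.

Lemma bmod_moment k a m p : 0 < p -> bump (2 ^ k) a ->
  I (fun x => bmod (2 ^ k) a m x `^ p) <= wb p k `^ p.
Proof.
move=> p0 bmp; have b0 x : 0 <= bmod (2 ^ k) a m x by exact: cmod_ge0.
under [X in I X]eq_fun do rewrite -powR_sqr// bmod_sqr.
rewrite /wb powRVK//; last first.
  by apply: mulr_ge0; [exact: powR_ge0 | exact: ltW (wb_base_gt0 _ _)].
apply: bump_moment => //; first by rewrite divr_gt0.
by under eq_fun do rewrite -bmod_sqr; apply: bmX; exact: bm_bmod.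
Qed.

Lemma interval_moment p m L K : 1 <= p -> (L <= 2 ^ K)%N ->
  I (fun x => Emod (fun=> 1) m (m + L) x `^ p) <=
    (wb p K + \sum_(0 <= k < K) (wb p k + wb p k)) `^ p.
Proof.
move=> p1 LK; have p0 : 0 < p by lra.
pose f k x := bmod (2 ^ k) (tent R (2 ^ k)) m x + bmod (2 ^ k) (tent R (2 ^ k)) (m + L) x.
pose g x := bmod (2 ^ K) (trapezoid R (2 ^ K) L) m x.
have pow0 k : (0 < 2 ^ k)%N by rewrite expn_gt0.
have f0 k x : 0 <= f k x by rewrite addr_ge0 ?cmod_ge0.
have bf k : bm (f k) by apply: bmD; exact: bm_bmod.
have bg : bm g by exact: bm_bmod.
apply: (@le_trans _ _ (I (fun x => (g x + \sum_(0 <= k < K) f k x) `^ p))).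
  apply: I_powR_le => [|x|x||]; [exact: ltW|exact: cmod_ge0| |exact: bm_Emod|]; last first.
    by apply: bmD => //; exact: bm_sum.
  have -> : Emod (fun=> 1) m (m + L) x = cmod (\sum_(m <= n < m + L) cosq x n.+2)
      (\sum_(m <= n < m + L) sinq x n.+2).
    have e n : n.+2%:R - 2 = n%:R :> R by rewrite -[n.+2]addn2 natrD addrK.
    congr cmod; apply: eq_bigr => n _.
      by rewrite mul1r /cosq e natrX [in RHS]mulrA.
    by rewrite mul1r /sinq e natrX [in RHS]mulrA.
  rewrite !(interval_decomposition _ _ LK); apply: le_trans (cmodD _ _ _ _) _.
  rewrite lerD2l; apply: le_trans (cmod_sum _ _ _ _) _; apply: ler_sum => k _.
  by apply: le_trans (cmodD _ _ _ _) _; rewrite cmodN.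
have gm : I (fun x => g x `^ p) <= wb p K `^ p.
  exact: (@bmod_moment K (trapezoid R (2 ^ K) L) m p p0 (bump_trapezoid R (pow0 K) LK)).
have [K0|K0] := posnP K.
  have nil (h : nat -> R) : \sum_(0 <= k < K) h k = 0 by rewrite K0 big_geq.
  under [X in I X]eq_fun do rewrite nil addr0.
  rewrite nil addr0; exact: gm.
have fm k : I (fun x => f k x `^ p) <= (wb p k + wb p k) `^ p.
  apply: (@I_powR_add R (bmod (2 ^ k) (tent R (2 ^ k)) m) (bmod (2 ^ k) (tent R (2 ^ k)) (m + L))
    (wb p k) (wb p k) p p1 (wb_gt0 p k) (wb_gt0 p k)).
  - by move=> x; exact: cmod_ge0.
  - by move=> x; exact: cmod_ge0.
  - exact: bm_bmod.
  - exact: bm_bmod.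
  - exact: (@bmod_moment k (tent R (2 ^ k)) m p p0 (bump_tent R (pow0 k))).
  - exact: (@bmod_moment k (tent R (2 ^ k)) (m + L) p p0 (bump_tent R (pow0 k))).
have w2 k : 0 < wb p k + wb p k by rewrite addr_gt0 ?wb_gt0.
apply: (@I_powR_add R g (fun x => \sum_(0 <= k < K) f k x) (wb p K) _ p p1 (wb_gt0 p K)).
- rewrite big_ltn// ltr_pwDl//; apply: sumr_ge0 => k _; exact: ltW.
- by move=> x; exact: cmod_ge0.
- by move=> x; apply: sumr_ge0 => k _; exact: f0.
- exact: bg.
- by apply: bm_sum => k _; exact: bf.
- exact: gm.
- apply: (@I_powR_sum R nat (index_iota 0 K) xpredT (fun k => wb p k + wb p k) f p p1) => k *.
  + exact: w2.
  + exact: f0.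
  + exact: bf.
  + exact: fm.
Qed.

(* The factor [w] is there for the logarithm lost at [p = 4]. *)
Definition Wbound p (v : R) (w : nat -> R) : Prop := exists2 C : R, 0 < C &
  forall m L K, (L <= 2 ^ K)%N ->
    I (fun x => Emod (fun=> 1) m (m + L) x `^ p) <= (C * v ^+ K * w K) `^ p.

Lemma geometric_le (v : R) K : 1 < v -> \sum_(0 <= k < K.+1) v ^+ k <= v / (v - 1) * v ^+ K.
Proof.
move=> v1; elim: K => [|K IHK].
  rewrite big_nat1 expr0 mulr1 ler_pdivlMr; lra.
rewrite big_nat_recr//=; apply: le_trans (lerD IHK (lexx _)) _.
by rewrite exprS le_eqVlt; apply/orP; left; apply/eqP; field; lra.
Qed.

Lemma Wbound_of_wb p (v D : R) (w : nat -> R) : 1 <= p -> 1 < v -> 0 < D ->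
  (forall k, 0 < w k) -> (forall k K, (k <= K)%N -> w k <= w K) ->
  (forall k, wb p k <= D * v ^+ k * w k) -> Wbound p v w.
Proof.
move=> p1 v1 D0 w0 wmono wbD; pose C := D * (1 + 2 * (v / (v - 1))).
have v0 : 0 < v by lra.
have C0 : 0 < C by rewrite mulr_gt0// addr_gt0// mulr_gt0// divr_gt0//; lra.
exists C => // m L K LK; apply: le_trans (interval_moment m p1 LK) _.
have vK0 k : 0 < v ^+ k by rewrite exprn_gt0.
rewrite ler_pow//; first by lra.
  by rewrite addr_ge0 ?(ltW (wb_gt0 _ _))// sumr_ge0// => k _; rewrite addr_ge0// ltW// wb_gt0.
apply: (@le_trans _ _ (D * v ^+ K * w K + \sum_(0 <= k < K.+1) (2 * D * w K) * v ^+ k)).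
  rewrite lerD//; apply: (@le_trans _ _ (\sum_(0 <= k < K) (2 * D * w K) * v ^+ k)).
    apply: ler_sum_nat => k /andP[_ kK].
    have : wb p k <= D * v ^+ k * w K.
      apply: le_trans (wbD k) _; rewrite ler_wpM2l ?wmono// ?(ltnW kK)// mulr_ge0 ?(ltW D0)//.
      exact: ltW.
    lra.
  rewrite [X in _ <= X]big_nat_recr//= lerDl mulr_ge0 ?(ltW (vK0 _))// !mulr_ge0//; exact: ltW.
have c0 : 0 <= 2 * D * w K by rewrite !mulr_ge0//; exact: ltW.
rewrite -mulr_sumr; apply: le_trans (lerD (lexx _) (ler_wpM2l c0 (geometric_le K v1))) _.
by rewrite /C le_eqVlt; apply/orP; left; apply/eqP; ring.
Qed.

Lemma powR_exprn x p n : 0 <= x -> (x ^+ n) `^ p = (x `^ p) ^+ n.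
Proof.
by move=> x0; rewrite -powR_mulrn// -powRrM mulrC powRrM powR_mulrn// powR_ge0.
Qed.

Lemma wb_le p k (S : R) : 0 < p -> \sum_(0 <= i < k + 5) (2 `^ (p / 2 - 2)) ^+ i <= S ->
  wb p k <= (2 `^ 2^-1) ^+ k * (1 + cM (p / 2) * S) `^ p^-1.
Proof.
move=> p0 hS; have S0 : 0 <= S.
  by apply: le_trans hS; rewrite sumr_ge0// => i _; rewrite exprn_ge0// powR_ge0.
have c0 := ltW (cM_gt0 (p / 2)).
rewrite /wb powRM ?powR_ge0//; last exact: ltW (wb_base_gt0 _ _).
rewrite -powRrM (_ : p / 2 * p^-1 = 2^-1); last by field; lra.
rewrite powR_exprn// ler_wpM2l ?exprn_ge0 ?powR_ge0//.
rewrite ler_pow ?invr_ge0 ?(ltW p0)//; first exact: ltW (wb_base_gt0 _ _).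
by rewrite lerD2l ler_wpM2l.
Qed.

Lemma powR2_gt1 x : 0 < x -> 1 < 2 `^ x :> R.
Proof.
move=> x0; have h : 1 < 2 :> R by rewrite ltr1n.
by have := ltr_pow x0 ler01 h; rewrite powR1.
Qed.

(** The ratio [2^(p/2 - 2)] of the level contributions is below [1]: the bottom level dominates and
    gives the square root size [H^(1/2)]. *)
Lemma Wbound_lt4 p : 1 <= p < 4 -> Wbound p (2 `^ 2^-1) (fun=> 1).
Proof.
move=> /andP[p1 p4]; have p0 : 0 < p by lra.
set v := 2 `^ (p / 2 - 2); have v0 : 0 < v by rewrite powR_gt0.
have v1 : v < 1.
  rewrite /v -[p / 2 - 2]opprB powRN invf_lt1 ?powR_gt0// powR2_gt1//; lra.
have D0 : 0 < (1 + cM (p / 2) * (1 - v)^-1) `^ p^-1.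
  by rewrite powR_gt0// addr_gt0// mulr_gt0 ?cM_gt0// invr_gt0; lra.
apply: (Wbound_of_wb p1 _ D0) => // [|k]; first by rewrite powR2_gt1// invr_gt0.
rewrite mulr1 mulrC; apply: wb_le => //; rewrite -/v.
suff h n : \sum_(0 <= i < n) v ^+ i <= (1 - v)^-1 * (1 - v ^+ n).
  have i0 : 0 <= (1 - v)^-1 by rewrite invr_ge0; lra.
  by apply: le_trans (h _) _; rewrite -[X in _ <= X]mulr1 ler_wpM2l// gerBl exprn_ge0// ltW.
elim: n => [|n IHn]; first by rewrite big_geq// expr0 subrr mulr0.
rewrite big_nat_recr//=; apply: le_trans (lerD IHn (lexx _)) _.
by rewrite exprS le_eqVlt; apply/orP; left; apply/eqP; field; lra.
Qed.

(** The ratio is [1]: the [K + 5] levels contribute equally, whence the fourth root of [K + 1]. *)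
Lemma Wbound_eq4 : Wbound 4 (2 `^ 2^-1) (fun K => K.+1%:R `^ 4^-1).
Proof.
pose D : R := (1 + cM 2 * 5) `^ 4^-1.
have c0 : 0 < cM 2 :> R by exact: cM_gt0.
have D0 : 0 < D by rewrite powR_gt0//; lra.
apply: (Wbound_of_wb _ _ D0) => [||k|k K kK|k].
- lra.
- by rewrite powR2_gt1// invr_gt0.
- by rewrite powR_gt0.
- by rewrite ler_pow ?invr_ge0// ler_nat ltnS.
have kR : 0 <= k%:R :> R by exact: ler0n.
have e : (4 / 2 : R) = 2 by lra.
apply: le_trans (wb_le (S := 5 * k.+1%:R) _ _) _ => //.
  rewrite e subrr powRr0; under eq_bigr do rewrite expr1n.
  by rewrite sumr_const_nat subn0 -[k.+1%:R]natr1 -[X in X <= _]mulr_natl natrD; lra.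
rewrite [X in _ <= X](_ : _ = (2 `^ 2^-1) ^+ k * (D * k.+1%:R `^ 4^-1)); last by rewrite mulrA [_ * D]mulrC.
rewrite ler_wpM2l// /D -powRM; [|lra|exact: ler0n].
rewrite e -[k.+1%:R]natr1 ler_pow ?invr_ge0//; first by nra.
nra.
Qed.

(** The top level dominates, and [2^(k/2) 2^(k (p/2 - 2) / p) = 2^(k (1 - 2/p))]. *)
Lemma Wbound_gt4 p : 4 < p -> Wbound p (2 `^ (1 - 2 / p)) (fun=> 1).
Proof.
move=> p4; have p0 : 0 < p by lra.
set v := 2 `^ (p / 2 - 2); have v1 : 1 < v by rewrite /v powR2_gt1//; lra.
pose E := v ^+ 5 / (v - 1); have E0 : 0 < E by rewrite divr_gt0 ?exprn_gt0//; lra.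
have D0 : 0 < (1 + cM (p / 2) * E) `^ p^-1.
  by rewrite powR_gt0// addr_gt0// mulr_gt0 ?cM_gt0.
have p2 : 0 < 1 - 2 / p.
  by rewrite subr_gt0 ltr_pdivrMr//; lra.
apply: (Wbound_of_wb _ _ D0) => // [||k]; [by lra | exact: powR2_gt1 |].
have vk : 1 <= v ^+ k by rewrite exprn_ege1// ltW.
apply: le_trans (wb_le (S := E * v ^+ k) _ _) _ => //.
  rewrite -/v -addSnnS; apply: le_trans (geometric_le _ v1) _.
  by rewrite /E exprD le_eqVlt; apply/orP; left; apply/eqP; rewrite exprS; field; lra.
rewrite mulr1 mulrC.
apply: (@le_trans _ _ (((1 + cM (p / 2) * E) * v ^+ k) `^ p^-1 * (2 `^ 2^-1) ^+ k)).
  have c0 := cM_gt0 (p / 2).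
  rewrite ler_wpM2r ?exprn_ge0 ?powR_ge0// ler_pow ?invr_ge0 ?(ltW p0)//.
    have := mulr_gt0 c0 (mulr_gt0 E0 (lt_le_trans ltr01 vk)); lra.
  have := mulr_gt0 c0 E0; lra.
have cE : 0 < cM (p / 2) * E by apply: mulr_gt0 => //; exact: cM_gt0.
rewrite powRM; [|lra|lra].
rewrite -mulrA ler_wpM2l ?powR_ge0// powR_exprn; last by lra.
rewrite -exprMn le_eqVlt; apply/orP; left; apply/eqP; congr (_ ^+ _).
rewrite /v -powRrM -powRDp//; congr powR; field; lra.
Qed.

End interval_sums.

(** * Upper bounds for the increments *)

Section increments.
Variable R : realType.
Implicit Types (s p l x A C : R) (m n j J T : nat) (b c : nat -> R).

Lemma four_pow k : 4 ^+ k = (2 ^+ k) ^+ 2 :> R.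
Proof.
have -> : 4 = 2 ^+ 2 :> R by rewrite -natrX.
by rewrite -!exprM mulnC.
Qed.

(* [e(n^2 (x + l)) - e(n^2 x) = 2 i sin(pi n^2 l) e(n^2 (x + l / 2))], so the increment of a partial
   sum has the modulus at [x + l / 2] of the sum with the real coefficients [ac s l]. *)
Definition rc s n : R := n%:R `^ (- (2 * s)).
Definition ac s l n : R := rc s n * (2 * sin (pi * n%:R ^+ 2 * l)).

Lemma delta_modulus s l m n x :
  cmod (Ere (rc s) m n (x + l) - Ere (rc s) m n x) (Eim (rc s) m n (x + l) - Eim (rc s) m n x) =
  Emod (ac s l) m n (x + l / 2).
Proof.
have key j : 2 * pi * (j ^ 2)%N%:R * (x + l) = 2 * pi * (j ^ 2)%N%:R * (x + l / 2) + pi * j%:R ^+ 2 * l /\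
    2 * pi * (j ^ 2)%N%:R * x = 2 * pi * (j ^ 2)%N%:R * (x + l / 2) - pi * j%:R ^+ 2 * l.
  by rewrite natrX; split; field.
have -> : Ere (rc s) m n (x + l) - Ere (rc s) m n x = - Eim (ac s l) m n (x + l / 2).
  rewrite /Ere /Eim -sumrB -sumrN; apply: eq_bigr => j _; have [-> ->] := key j.
  by rewrite cosD cosB /ac; ring.
have -> : Eim (rc s) m n (x + l) - Eim (rc s) m n x = Ere (ac s l) m n (x + l / 2).
  rewrite /Ere /Eim -sumrB; apply: eq_bigr => j _; have [-> ->] := key j.
  by rewrite sinD sinB /ac; ring.
by rewrite /Emod /cmod sqrrN addrC.
Qed.

Lemma Emod_periodic c m n x : Emod c m n (x + 1) = Emod c m n x.
Proof.
have e j : 2 * pi * (j ^ 2)%N%:R * (x + 1) = 2 * pi * (j ^ 2)%N%:R * x + 2 * pi * (j ^ 2)%N%:Z%:~R.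
  by rewrite -[(j ^ 2)%N%:Z%:~R]/((j ^ 2)%N%:R); ring.
by congr cmod; apply: eq_bigr => j _; rewrite e ?cos_2pi_int ?sin_2pi_int.
Qed.

Lemma I_Emod_shift c m n p l : 0 <= l <= 1 -> 0 <= p ->
  I (fun x => Emod c m n (x + l) `^ p) = I (fun x => Emod c m n x `^ p).
Proof.
move=> l01 p0; apply: (@I_shift R (fun x => Emod c m n x `^ p)) => // [|x|x].
- by apply: bm_powR => // [x|]; [exact: Emod_ge0 | exact: bm_Emod].
- exact: powR_ge0.
- by rewrite Emod_periodic.
Qed.

Lemma one_block p (v : R) (w : nat -> R) : 0 < v -> (forall j, 0 < w j) -> Wbound p v w ->
  exists2 C : R, 0 < C & forall j, blockb p (C * v ^+ j * w j) (2 ^ j) (2 ^ j.+1) (fun=> 1).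
Proof.
move=> v0 w0 [C C0 HC]; exists C => // j m n Mm mn nN.
rewrite -(subnKC mn); apply: HC; rewrite leq_subLR (leq_trans nN)// expnS mul2n -addnn.
by rewrite leq_add2r.
Qed.

Lemma ler_pow_neg (e x y : R) : e <= 0 -> 0 < x -> x <= y -> y `^ e <= x `^ e.
Proof.
move=> e0 x0 xy; have y0 : 0 < y by exact: lt_le_trans xy.
have ne : 0 <= - e by rewrite oppr_ge0.
have h := ler_pow ne (ltW x0) xy; rewrite !powRN in h.
by rewrite -lef_pV2 ?posrE ?powR_gt0.
Qed.

(** On a block [n] varies by a factor at most [2], whence the constant [2^|e|], and [n^e] is
    monotone one way or the other. *)
Lemma pow_block (e : R) : exists2 K : R, 0 < K & forall j p A b, 1 <= p -> 0 < A ->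
  blockb p A (2 ^ j) (2 ^ j.+1) b ->
  blockb p (K * (2 `^ e) ^+ j * A) (2 ^ j) (2 ^ j.+1) (fun n => n%:R `^ e * b n).
Proof.
exists (2 `^ `|e|) => [|j p A b p1 A0 bA]; first by rewrite powR_gt0.
have j0 : 0 < 2 ^+ j :> R by rewrite exprn_gt0.
have ej : 0 < (2 `^ e) ^+ j :> R by rewrite exprn_gt0// powR_gt0.
have e2 : 1 <= 2 `^ `|e| :> R.
  by have := @ler_powR R 2 (ler1n _ 2) 0 `|e| (normr_ge0 _); rewrite powRr0.
have natp n : (2 ^ j <= n)%N -> 0 < n%:R :> R.
  by move=> jn; rewrite ltr0n (leq_trans _ jn)// expn_gt0.
apply: abel_block => //.
- move=> n /andP[jn nj]; rewrite powR_ge0/= -powR_exprn//.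
  have n1 : 2 ^+ j <= n%:R :> R by rewrite -natrX ler_nat.
  have n2 : n%:R <= 2 * 2 ^+ j :> R by rewrite -exprS -natrX ler_nat ltnW.
  have n0 := natp n jn.
  have [e0|e0] := leP 0 e.
    rewrite ger0_norm// -powRM ?(ltW j0)//; apply: ler_pow => //; exact: ltW.
  apply: (@le_trans _ _ ((2 ^+ j) `^ e)).
    by apply: ler_pow_neg => //; exact: ltW.
  by rewrite -[X in X <= _]mul1r ler_wpM2r ?powR_ge0.
have [e0|e0] := leP 0 e; [right|left] => n jn _.
  by apply: ler_pow => //; rewrite ler_nat.
by apply: ler_pow_neg; [exact: ltW | exact: natp | rewrite ler_nat].
Qed.

(** The condition on [l] keeps [pi n^2 l] in [[0, pi / 2]], where the sine increases, so that
    partial summation applies. *)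
Lemma sin_block l j p A b : 1 <= p -> 0 < A -> 0 < l -> 4 ^+ j.+1 * l <= 2^-1 ->
  blockb p A (2 ^ j) (2 ^ j.+1) b ->
  blockb p (8 * pi * 4 ^+ j * l * A) (2 ^ j) (2 ^ j.+1) (fun n => 2 * sin (pi * n%:R ^+ 2 * l) * b n).
Proof.
move=> p1 A0 l0 jl bA; have pi0 := @pi_gt0 R.
have arg n : (n < 2 ^ j.+1)%N -> 0 <= pi * n%:R ^+ 2 * l <= pi / 2 /\ n%:R ^+ 2 <= 4 ^+ j.+1 :> R.
  move=> nj; have n4 : n%:R ^+ 2 <= 4 ^+ j.+1 :> R.
    rewrite four_pow ler_pXn2r ?nnegrE ?exprn_ge0// -natrX ler_nat; exact: ltnW.
  split=> //; rewrite !mulr_ge0 ?(ltW pi0) ?(ltW l0) ?sqr_ge0//=.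
  rewrite -mulrA ler_pM2l//; apply: le_trans jl; rewrite ler_wpM2r//; exact: ltW.
apply: abel_block => //.
- by rewrite !mulr_gt0// exprn_gt0.
- move=> n /andP[_ nj]; have [/andP[a0 a1] n4] := arg n nj.
  rewrite mulr_ge0/=; last first.
  + by apply: sin_ge0_pi; rewrite a0 (le_trans a1)//; move: pi0; clear; lra.
  + by [].
  have := sin_le_id a0; rewrite [4 ^+ j.+1]exprS in n4.
  have : pi * n%:R ^+ 2 * l <= pi * (4 * 4 ^+ j) * l.
    by rewrite ler_wpM2r ?(ltW l0)// ler_wpM2l// ltW.
  clear; lra.
right => n jn nj; rewrite ler_pM2l//.
have [/andP[a0 a1] _] := arg n (ltnW nj); have [/andP[b0 b1] _] := arg n.+1 nj.
rewrite leNgt ltr_sin ?in_itv/=; last 2 first.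
- by rewrite b1 andbT (le_trans _ b0)// oppr_le0 divr_ge0 ?pi_ge0.
- by rewrite a1 andbT (le_trans _ a0)// oppr_le0 divr_ge0 ?pi_ge0.
rewrite -leNgt ler_wpM2r ?(ltW l0)// ler_wpM2l ?(ltW pi0)// ler_pXn2r ?nnegrE//.
by rewrite ler_nat.
Qed.

Lemma blockb_ext p A M N b b' : (forall n, b n = b' n) -> blockb p A M N b -> blockb p A M N b'.
Proof. by move=> bb; have -> : b' = b by apply/funext => n; rewrite bb. Qed.

Lemma rc_block p (v : R) (w : nat -> R) s : 1 <= p -> 0 < v -> (forall j, 0 < w j) ->
  Wbound p v w -> exists2 C : R, 0 < C &
  forall j, blockb p (C * (2 `^ (- (2 * s)) * v) ^+ j * w j) (2 ^ j) (2 ^ j.+1) (rc s).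
Proof.
move=> p1 v0 w0 W; have [C C0 HC] := one_block v0 w0 W.
have [K K0 HK] := pow_block (- (2 * s)).
exists (K * C) => [|j]; first exact: mulr_gt0.
have A0 : 0 < C * v ^+ j * w j by rewrite !mulr_gt0// exprn_gt0.
have := HK j p _ _ p1 A0 (HC j).
have -> : K * (2 `^ (- (2 * s))) ^+ j * (C * v ^+ j * w j) = K * C * (2 `^ (- (2 * s)) * v) ^+ j * w j.
  by rewrite exprMn; ring.
by apply: blockb_ext => n; rewrite mulr1.
Qed.

Lemma ac_block p (v : R) (w : nat -> R) s : 1 <= p -> 0 < v -> (forall j, 0 < w j) ->
  Wbound p v w -> exists2 C : R, 0 < C &
  forall l j, 0 < l -> 4 ^+ j.+1 * l <= 2^-1 ->
    blockb p (C * l * (2 `^ (2 - 2 * s) * v) ^+ j * w j) (2 ^ j) (2 ^ j.+1) (ac s l).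
Proof.
move=> p1 v0 w0 W; have [C C0 HC] := rc_block s p1 v0 w0 W; have pi0 := @pi_gt0 R.
exists (8 * pi * C) => [|l j l0 jl]; first by rewrite !mulr_gt0.
have A0 : 0 < C * (2 `^ (- (2 * s)) * v) ^+ j * w j.
  by rewrite !mulr_gt0// exprn_gt0// mulr_gt0// powR_gt0.
have := sin_block p1 A0 l0 jl (HC j).
have -> : 2 `^ (2 - 2 * s) = 4 * 2 `^ (- (2 * s)) :> R.
  by rewrite powRDp// powR2// -natrX.
have -> : 8 * pi * 4 ^+ j * l * (C * (2 `^ (- (2 * s)) * v) ^+ j * w j) =
   8 * pi * C * l * (4 * 2 `^ (- (2 * s)) * v) ^+ j * w j by rewrite !exprMn; ring.
by apply: blockb_ext => n; rewrite /ac mulrC.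
Qed.

Lemma dyadic_sum p c (A : nat -> R) J T : 1 <= p -> (J <= T)%N -> (forall j, 0 < A j) ->
  (forall j, (J <= j < T)%N -> I (fun x => Emod c (2 ^ j) (2 ^ j.+1) x `^ p) <= A j `^ p) ->
  I (fun x => Emod c (2 ^ J) (2 ^ T) x `^ p) <= (\sum_(J <= j < T) A j) `^ p.
Proof.
move=> p1 JT A0 HA; have p0 : 0 <= p by move: p1; clear; lra.
apply: (@le_trans _ _ (I (fun x => (\sum_(J <= j < T | (J <= j < T)%N) Emod c (2 ^ j) (2 ^ j.+1) x) `^ p))).
  apply: I_powR_le => // [x|x||].
  - exact: Emod_ge0.
  - rewrite -big_nat; elim: T JT {HA} => [|T IHT].
      by rewrite leqn0 => /eqP ->; rewrite big_geq// /Emod /Ere /Eim !big_geq// cmod0.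
    rewrite leq_eqVlt => /predU1P[<-|JT].
      by rewrite big_geq// /Emod /Ere /Eim !big_geq// cmod0.
    rewrite big_nat_recr//=; apply: le_trans (Emod_cat _ _ (k := 2 ^ T) _) _.
      by rewrite !leq_exp2l// leqnSn -ltnS JT.
    by rewrite lerD2r IHT// -ltnS.
  - exact: bm_Emod.
  - by apply: bm_sum => j _; exact: bm_Emod.
rewrite [X in X `^ p]big_nat; apply: I_powR_sum => // [j x _|j _].
- exact: Emod_ge0.
- exact: bm_Emod.
Qed.

Definition D s l T x : R :=
  cmod (Ere (rc s) 1 (2 ^ T) (x + l) - Ere (rc s) 1 (2 ^ T) x)
       (Eim (rc s) 1 (2 ^ T) (x + l) - Eim (rc s) 1 (2 ^ T) x).

Lemma D_Emod s l T x : D s l T x = Emod (ac s l) 1 (2 ^ T) (x + l / 2).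
Proof. exact: delta_modulus. Qed.

Lemma bm_D s l T : bm (D s l T).
Proof.
have -> : D s l T = fun x => Emod (ac s l) 1 (2 ^ T) (x + l / 2).
  by apply/funext => x; rewrite D_Emod.
by apply: bm_shift; exact: bm_Emod.
Qed.

Lemma I_D s l T p : 0 <= l <= 1 -> 0 <= p ->
  I (fun x => D s l T x `^ p) = I (fun x => Emod (ac s l) 1 (2 ^ T) x `^ p).
Proof.
move=> l01 p0; under [X in I X]eq_fun do rewrite D_Emod.
by apply: I_Emod_shift => //; move: l01; clear; lra.
Qed.

(** Below [2^J] the smallness of the sines is used. Above, the increment is just the difference of
    the tail at [x + l] and at [x], which costs [B + B]. *)
Lemma upper_combine p s l J T (A B : R) : 1 <= p -> 0 < l <= 1 -> (J <= T)%N -> 0 < A -> 0 < B ->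
  I (fun x => Emod (ac s l) 1 (2 ^ J) x `^ p) <= A `^ p ->
  I (fun x => Emod (rc s) (2 ^ J) (2 ^ T) x `^ p) <= B `^ p ->
  I (fun x => D s l T x `^ p) <= (A + (B + B)) `^ p.
Proof.
move=> p1 l01 JT A0 B0 HA HB; have p0 : 0 <= p by move: p1; clear; lra.
have l1 : 0 <= l <= 1 by move: l01; clear; lra.
have l2 : 0 <= l / 2 <= 1 by move: l01; clear; lra.
pose hi x := Emod (rc s) (2 ^ J) (2 ^ T) x.
pose lo x := Emod (ac s l) 1 (2 ^ J) x.
have bhi : bm hi by exact: bm_Emod.
have blo : bm lo by exact: bm_Emod.
have hi0 x : 0 <= hi x by exact: Emod_ge0.
have lo0 x : 0 <= lo x by exact: Emod_ge0.
have bhl : bm (fun x => hi (x + l)) by exact: bm_shift.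
have bll : bm (fun x => lo (x + l / 2)) by exact: bm_shift.
apply: (@le_trans _ _ (I (fun x => (lo (x + l / 2) + (hi (x + l) + hi x)) `^ p))).
  apply: I_powR_le => // [x|x||].
  - exact: cmod_ge0.
  - rewrite D_Emod; apply: le_trans (Emod_cat _ _ (k := 2 ^ J) _) _.
      by rewrite expn_gt0 leq_exp2l.
    rewrite lerD2l -delta_modulus; apply: le_trans (cmodD _ _ _ _) _.
    by rewrite cmodN.
  - exact: bm_D.
  - by apply: bmD => //; exact: bmD.
have BB : 0 < B + B by exact: addr_gt0.
have lo0' x : 0 <= lo (x + l / 2) by exact: lo0.
have hi0' x : 0 <= hi (x + l) by exact: hi0.
have hh0 x : 0 <= hi (x + l) + hi x by exact: addr_ge0.
have hl : I (fun x => hi (x + l) `^ p) <= B `^ p by rewrite I_Emod_shift.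
have ll : I (fun x => lo (x + l / 2) `^ p) <= A `^ p by rewrite I_Emod_shift.
have hh := @I_powR_add R (fun x => hi (x + l)) hi B B p p1 B0 B0 hi0' hi0 bhl bhi hl HB.
exact: (@I_powR_add R (fun x => lo (x + l / 2)) (fun x => hi (x + l) + hi x) A (B + B) p p1 A0 BB
  lo0' hh0 bll (bmD bhl bhi) ll hh).
Qed.

Lemma exists_scale l : 0 < l <= 2^-1 -> exists J, 4 ^+ J * l <= 2^-1 < 4 ^+ J.+1 * l.
Proof.
move=> /andP[l0 l2]; have ex : exists n, 2^-1 < 4 ^+ n * l.
  exists (Num.truncn (2^-1 / l)).+1; rewrite -ltr_pdivrMr//.
  apply: lt_le_trans (truncnS_gt _) _; rewrite -natrX ler_nat ltnW//.
  exact: ltn_expl.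
case: (ex_minnP ex) => -[|n] h1 h2.
  by move: h1; rewrite expr0 mul1r ltNge l2.
exists n; rewrite h1 andbT leNgt; apply/negP => /h2; by rewrite ltnn.
Qed.

(** [4^J l] lies between [1/8] and [1/2], so [2^J] is comparable with [l^(-1/2)]. *)
Lemma scale_powR (e : R) : exists2 K : R, 0 < K & forall l J, 0 < l ->
  4 ^+ J * l <= 2^-1 < 4 ^+ J.+1 * l ->
  (2 ^+ J) `^ e <= K * l `^ (- (e / 2)) /\ l `^ (- (e / 2)) <= K * (2 ^+ J) `^ e.
Proof.
exists (8 `^ (`|e| / 2)) => [|l J l0 /andP[Jl lJ]]; first by rewrite powR_gt0.
pose t := 4 ^+ J * l.
have t1 : t <= 8 by rewrite /t; move: Jl; clear; lra.
have t2 : 8^-1 <= t by rewrite /t; move: lJ; rewrite exprS; clear; lra.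
have t0 : 0 < t by apply: lt_le_trans t2; rewrite invr_gt0.
have two x : 8^-1 <= x -> x <= 8 -> forall a, x `^ a <= 8 `^ `|a|.
  move=> x1 x8 a; have x0 : 0 < x by apply: lt_le_trans x1; rewrite invr_gt0.
  have [a0|a0] := leP 0 a; first by rewrite ger0_norm// ler_pow// ltW.
  rewrite ltr0_norm// -[a in x `^ a]opprK powRN -(invrK (8 `^ _)) lef_pV2 ?posrE ?invr_gt0 ?powR_gt0//.
  have -> : (8 `^ (- a))^-1 = (8^-1) `^ (- a) :> R.
    by rewrite -powRN opprK -(powR_inv1 (_ : 0 <= 8))// -powRrM mulrNN mul1r.
  by apply: ler_pow => //; rewrite oppr_ge0 ltW.
have tE : (2 ^+ J) `^ e = t `^ (e / 2) * l `^ (- (e / 2)).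
  rewrite /t powRM ?exprn_ge0 ?(ltW l0)// -mulrA -powRDp// subrr powRr0 mulr1.
  by rewrite four_pow powR_sqr ?exprn_ge0.
have nE : `|e / 2| = `|e| / 2 by rewrite normrM [`|2^-1|]ger0_norm ?invr_ge0.
split.
  by rewrite tE ler_wpM2r ?powR_ge0// -nE; exact: two.
rewrite tE mulrA -[X in X <= _]mul1r ler_wpM2r ?powR_ge0//.
have := two t t2 t1 (- (e / 2)); rewrite normrN nE powRN => h.
by rewrite -ler_pdivrMr ?powR_gt0// div1r.
Qed.

End increments.

(** * Growth of the energy from one scale to the next *)

Section energy_increment.
Variable R : realType.
Implicit Types (a b c d r x : R).

Lemma powR_pred u r : 0 < u -> u `^ r = u * u `^ (r - 1).
Proof. by move=> u0; rewrite -[in LHS](subrK 1 r) powRS// mulrC. Qed.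

(** Let [u = 1 + |F|^2], [q = |f|^2] and [t] be the inner product, so [t^2 <= u q]. If [q <= u] the
    new value is at most [4 u] and [powR_quadratic] applies to its quotient by [u]; otherwise every
    term is [O(q^r)]. *)
Lemma energy_pointwise r : 1 <= r -> exists2 C : R, 0 < C & forall a b c d,
  (1 + (a + c) ^+ 2 + (b + d) ^+ 2) `^ r <=
  (1 + a ^+ 2 + b ^+ 2) `^ r + 2 * r * ((1 + a ^+ 2 + b ^+ 2) `^ (r - 1) * (a * c + b * d)) +
  C * ((1 + a ^+ 2 + b ^+ 2) `^ (r - 1) * (c ^+ 2 + d ^+ 2) + (c ^+ 2 + d ^+ 2) `^ r).
Proof.
move=> r1; have [C C0 HC] := powR_quadratic r1.
have r0 : 0 < r by lra.
have p4 : 0 < 4 `^ r :> R by rewrite powR_gt0.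
exists (r + 10 * C + 4 `^ r + 2 * r) => [|a b c d]; first by lra.
have sa := sqr_ge0 a; have sb := sqr_ge0 b; have sc := sqr_ge0 c; have sd := sqr_ge0 d.
set u := 1 + a ^+ 2 + b ^+ 2; set q := c ^+ 2 + d ^+ 2; set t := a * c + b * d.
have u1 : 1 <= u by rewrite /u; lra.
have u0 : 0 < u by lra.
have q0 : 0 <= q by rewrite /q; lra.
have tq : t ^+ 2 <= u * q.
  have := sqr_ge0 (a * d - b * c); rewrite /t /u /q => h.
  have : 0 <= c ^+ 2 + d ^+ 2 by lra.
  nra.
set w := (X in X `^ r <= _); have wE : w = u + (2 * t + q) by rewrite /w /u /t /q; ring.
have w0 : 0 <= w by rewrite /w; have := sqr_ge0 (a + c); have := sqr_ge0 (b + d); lra.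
have ur1 : 0 <= u `^ (r - 1) by exact: powR_ge0.
have qr : 0 <= q `^ r by exact: powR_ge0.
have urq : 0 <= u `^ (r - 1) * q by exact: mulr_ge0.
have [qu|uq] := leP q u.
  have t_le : `|t| <= u.
    rewrite -(@ler_pXn2r _ 2)// ?nnegrE ?(ltW u0)// real_normK ?num_real//.
    by apply: le_trans tq _; rewrite expr2 ler_wpM2l// ltW.
  have w4 : w <= 4 * u by move: t_le; rewrite ler_norml => /andP[]; lra.
  have w2 : (2 * t + q) ^+ 2 <= 10 * (u * q).
    have : q ^+ 2 <= u * q by rewrite expr2 ler_wpM2r.
    have := sqr_ge0 (2 * t - q); lra.
  have ywu : w = u * (w / u) by field; lra.
  rewrite ywu powRM ?divr_ge0 ?(ltW u0)//.
  have y4 : 0 <= w / u <= 4 by rewrite divr_ge0 ?(ltW u0)//= ler_pdivrMr.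
  apply: le_trans (ler_wpM2l (powR_ge0 u r) (HC _ y4)) _.
  have ur := powR_pred r u0.
  have e1 : u `^ r * (w / u - 1) = u `^ (r - 1) * (2 * t + q).
    by rewrite ur wE; field; lra.
  have e2 : u `^ r * (w / u - 1) ^+ 2 = u `^ (r - 1) * ((2 * t + q) ^+ 2 / u).
    by rewrite ur wE; field; lra.
  have e3 : u `^ (r - 1) * ((2 * t + q) ^+ 2 / u) <= 10 * (u `^ (r - 1) * q).
    rewrite [X in _ <= X]mulrCA ler_wpM2l// ler_pdivrMr//; lra.
  have -> : u `^ r * (1 + r * (w / u - 1) + C * (w / u - 1) ^+ 2) =
     u `^ r + r * (u `^ r * (w / u - 1)) + C * (u `^ r * (w / u - 1) ^+ 2) by ring.
  rewrite e1 e2; have := ler_wpM2l (ltW C0) e3.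
  have := mulr_ge0 (ltW C0) qr; have := mulr_ge0 (ltW r0) qr.
  have := mulr_ge0 (ltW p4) qr; have := mulr_ge0 (ltW p4) urq; have := mulr_ge0 (ltW r0) urq.
  lra.
have q0' : 0 < q by lra.
have t_le : `|t| <= q.
  rewrite -(@ler_pXn2r _ 2)// ?nnegrE// real_normK ?num_real//.
  by apply: le_trans tq _; rewrite expr2 ler_wpM2r// ltW.
have w4 : w <= 4 * q by move: t_le; rewrite ler_norml => /andP[]; lra.
have wr : w `^ r <= 4 `^ r * q `^ r by rewrite -powRM// ler_pow// ltW.
have lin : - (u `^ (r - 1) * t) <= q `^ r.
  have tq' : - t <= q by move: t_le; rewrite ler_norml => /andP[]; lra.
  have h1 := ler_wpM2l ur1 tq'.
  have u_q : u `^ (r - 1) <= q `^ (r - 1) by apply: ler_pow; lra.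
  have h2 := ler_wpM2r q0 u_q.
  rewrite (powR_pred r q0'); lra.
have := powR_ge0 u r; have := mulr_ge0 (ltW C0) qr; have := mulr_ge0 (ltW r0) qr.
have := mulr_ge0 (ltW p4) qr; have := mulr_ge0 (ltW p4) urq; have := mulr_ge0 (ltW r0) urq.
have := mulr_ge0 (ltW C0) urq; have := ler_wpM2l (ltW r0) lin.
lra.
Qed.

(** Young's inequality with a parameter, by comparing [lam * Z] with [u]. *)
Lemma young_energy r u Z lam : 1 <= r -> 0 < u -> 0 <= Z -> 0 < lam ->
  u `^ (r - 1) * Z <= lam^-1 * u `^ r + lam `^ (r - 1) * Z `^ r.
Proof.
move=> r1 u0 Z0 l0; have [h|h] := leP (lam * Z) u.
  rewrite ler_wpDr ?mulr_ge0 ?powR_ge0// (powR_pred r u0) mulrA mulrC ler_wpM2r ?powR_ge0//.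
  by rewrite mulrC ler_pdivlMr// mulrC.
rewrite ler_wpDl ?mulr_ge0 ?powR_ge0 ?invr_ge0 ?(ltW l0)//.
have Zgt0 : 0 < Z by rewrite -(pmulr_rgt0 _ l0); exact: lt_trans h.
rewrite (powR_pred r Zgt0) mulrCA [X in _ <= X]mulrC ler_wpM2r//.
rewrite -powRM ?(ltW l0)//; apply: ler_pow; [lra | exact: ltW | exact: ltW].
Qed.

Lemma is_derive_mul (f g : R -> R) x a b : is_derive x 1 f a -> is_derive x 1 g b ->
  is_derive x 1 (fun y => f y * g y) (f x * b + g x * a).
Proof. by move=> df dg; exact: is_deriveM. Qed.

Lemma is_derive_add (f g : R -> R) x a b : is_derive x 1 f a -> is_derive x 1 g b ->
  is_derive x 1 (fun y => f y + g y) (a + b).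
Proof. by move=> df dg; exact: is_deriveD. Qed.

Lemma is_derive_powR (f : R -> R) x a (p : R) : is_derive x 1 f a -> 0 < f x ->
  is_derive x 1 (fun y => f y `^ p) (p * f x `^ (p - 1) * a).
Proof. by move=> df f0; apply: (@is_derive1_comp _ (fun y => y `^ p)); exact: is_derive1_powR. Qed.

Lemma is_derive_continuous (f f' : R -> R) : (forall x, is_derive x 1 f (f' x)) -> continuous f.
Proof. by move=> df x; apply: differentiable_continuous; apply/derivable1_diffP; case: (df x). Qed.

Lemma bm_dominated (f g : R -> R) : continuous f -> (forall x, `|f x| <= g x) -> bm g -> bm f.
Proof.
move=> cf fg [_ [M gM]]; split; first exact: continuous_measurable_fun.
by exists M => x; rewrite (le_trans (fg x))// (le_trans (ler_norm _)).
Qed.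

(** The added [1] keeps the base positive, so the power is differentiable also where [F] vanishes,
    even for exponents below [1]. *)
Definition energy r (F1 F2 : R -> R) x : R := (1 + F1 x ^+ 2 + F2 x ^+ 2) `^ r.

Lemma bm_energy r F1 F2 : 0 <= r -> bm F1 -> bm F2 -> bm (energy r F1 F2).
Proof.
move=> r0 b1 b2; apply: bm_powR => // [x|].
  by rewrite !addr_ge0 ?sqr_ge0.
by apply: bmD; [apply: bmD; [exact: bm_cst | exact: bmX] | exact: bmX].
Qed.

Lemma bm_square_sum (F1 F2 : R -> R) : bm F1 -> bm F2 -> bm (fun x => F1 x ^+ 2 + F2 x ^+ 2).
Proof. by move=> b1 b2; apply: bmD; exact: bmX. Qed.

(* Orthogonality of the scales: as [f = g'] oscillates faster than [F], the
   first-order term of the increment of the energy is integrated by parts. *)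
Lemma energy_first_order r (F1 F2 dF1 dF2 g1 g2 f1 f2 : R -> R) (k lam : R) : 1 <= r ->
  (forall x, is_derive x 1 F1 (dF1 x)) -> (forall x, is_derive x 1 F2 (dF2 x)) ->
  (forall x, is_derive x 1 g1 (f1 x)) -> (forall x, is_derive x 1 g2 (f2 x)) ->
  continuous dF1 -> continuous dF2 -> continuous f1 -> continuous f2 ->
  bm F1 -> bm F2 -> bm dF1 -> bm dF2 -> bm g1 -> bm g2 -> bm f1 -> bm f2 ->
  F1 1 = F1 0 -> F2 1 = F2 0 -> g1 1 = g1 0 -> g2 1 = g2 0 -> 0 < k -> 0 < lam ->
  I (fun x => (dF1 x ^+ 2 + dF2 x ^+ 2) `^ r) <= (k ^+ 2) `^ r ->
  I (fun x => (g1 x ^+ 2 + g2 x ^+ 2) `^ r) <= (k ^- 2) `^ r ->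
  I (fun x => energy (r - 1) F1 F2 x * (F1 x * f1 x + F2 x * f2 x)) <=
    (2 * r - 1) * (lam^-1 * I (energy r F1 F2) + lam `^ (r - 1)).
Proof.
move=> r1 dF1P dF2P dg1 dg2 cdF1 cdF2 cf1 cf2 bF1 bF2 bdF1 bdF2 bg1 bg2 bf1 bf2 F1p F2p g1p g2p k0 l0 IF Ig.
have r0 : 0 <= r by move: r1; clear; lra.
have r10 : 0 <= r - 1 by rewrite subr_ge0.
have r21 : 0 <= 2 * r - 1 by move: r1; clear; lra.
pose u x := 1 + F1 x ^+ 2 + F2 x ^+ 2.
have u1 x : 1 <= u x by rewrite /u -addrA lerDl addr_ge0 ?sqr_ge0.
have u0 x : 0 < u x by exact: lt_le_trans (u1 x).
pose du x := 2 * (F1 x * dF1 x + F2 x * dF2 x).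
have duP x : is_derive x 1 u (du x).
  have -> : u = fun y => 1 + F1 y * F1 y + F2 y * F2 y by apply/funext => y; rewrite /u !expr2.
  have h1 := is_derive_mul (dF1P x) (dF1P x); have h2 := is_derive_mul (dF2P x) (dF2P x).
  have -> : du x = 0 + (F1 x * dF1 x + F1 x * dF1 x) + (F2 x * dF2 x + F2 x * dF2 x).
    by rewrite /du; ring.
  by apply: is_derive_add => //; apply: is_derive_add => //; exact: is_derive_cst.
pose Fg x := F1 x * g1 x + F2 x * g2 x.
pose H x := u x `^ (r - 1) * Fg x.
(* [rest] collects the terms of the derivative of [H] in which [F] is differentiated; by periodicity
   [I main = - I rest]. *)
pose rest x := u x `^ (r - 1) * (g1 x * dF1 x + g2 x * dF2 x) +
  Fg x * ((r - 1) * u x `^ (r - 1 - 1) * du x).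
pose main x := energy (r - 1) F1 F2 x * (F1 x * f1 x + F2 x * f2 x).
have HP x : is_derive x 1 H (main x + rest x).
  have h1 := is_derive_powR (r - 1) (duP x) (u0 x).
  have h2 : is_derive x 1 Fg (F1 x * f1 x + g1 x * dF1 x + (F2 x * f2 x + g2 x * dF2 x)).
    exact: is_derive_add (is_derive_mul (dF1P x) (dg1 x)) (is_derive_mul (dF2P x) (dg2 x)).
  have -> : main x + rest x = u x `^ (r - 1) *
      (F1 x * f1 x + g1 x * dF1 x + (F2 x * f2 x + g2 x * dF2 x)) +
      Fg x * ((r - 1) * u x `^ (r - 1 - 1) * du x).
    by rewrite /main /rest /energy -/(u x); ring.
  exact: is_derive_mul.
have cF1 := is_derive_continuous dF1P; have cF2 := is_derive_continuous dF2P.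
have cg1 := is_derive_continuous dg1; have cg2 := is_derive_continuous dg2.
have cu p : continuous (fun x => u x `^ p).
  by apply: is_derive_continuous => x; exact: is_derive_powR (duP x) (u0 x).
have cM (f g : R -> R) : continuous f -> continuous g -> continuous (fun x => f x * g x).
  by move=> cf cg x; apply: cvgM; [exact: cf | exact: cg].
have cD (f g : R -> R) : continuous f -> continuous g -> continuous (fun x => f x + g x).
  by move=> cf cg x; apply: cvgD; [exact: cf | exact: cg].
have cc (c : R) : continuous (fun _ : R => c) by move=> x; exact: cvg_cst.
have cFg : continuous Fg by apply: (cD (fun x => F1 x * g1 x) (fun x => F2 x * g2 x)); exact: cM.
have cdu : continuous du.
  apply: (cM (fun=> 2) (fun x => F1 x * dF1 x + F2 x * dF2 x)); first exact: cc.
  by apply: (cD (fun x => F1 x * dF1 x) (fun x => F2 x * dF2 x)); exact: cM.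
have cmain : continuous main.
  apply: (cM (fun x => u x `^ (r - 1)) (fun x => F1 x * f1 x + F2 x * f2 x)); first exact: cu.
  by apply: (cD (fun x => F1 x * f1 x) (fun x => F2 x * f2 x)); exact: cM.
have crest : continuous rest.
  apply: (cD (fun x => u x `^ (r - 1) * (g1 x * dF1 x + g2 x * dF2 x))
    (fun x => Fg x * ((r - 1) * u x `^ (r - 1 - 1) * du x))).
    apply: (cM (fun x => u x `^ (r - 1)) (fun x => g1 x * dF1 x + g2 x * dF2 x)); first exact: cu.
    by apply: (cD (fun x => g1 x * dF1 x) (fun x => g2 x * dF2 x)); exact: cM.
  apply: (cM Fg (fun x => (r - 1) * u x `^ (r - 1 - 1) * du x)) => //.
  apply: (cM (fun x => (r - 1) * u x `^ (r - 1 - 1)) du) => //.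
  by apply: (cM (fun=> r - 1) (fun x => u x `^ (r - 1 - 1))); [exact: cc | exact: cu].
(* The squares of [|F'| / k] and [k |g|], normalised so that their moments of order [r] are at most
   [1]; the factors [k] cancel in every product of [F'] and [g]. *)
pose X2 x := k ^- 2 * (dF1 x ^+ 2 + dF2 x ^+ 2); pose Y2 x := k ^+ 2 * (g1 x ^+ 2 + g2 x ^+ 2).
have kk : k ^- 2 * k ^+ 2 = 1 by rewrite mulVf// expf_neq0// gt_eqF.
have k20 : 0 < k ^+ 2 by rewrite exprn_gt0.
have k2V0 : 0 < k ^- 2 by rewrite invr_gt0.
have X20 x : 0 <= X2 x by rewrite mulr_ge0 ?addr_ge0 ?sqr_ge0// ltW.
have Y20 x : 0 <= Y2 x by rewrite mulr_ge0 ?addr_ge0 ?sqr_ge0// ltW.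
have amgm (s t : R) : 2 * `|s * t| <= k ^- 2 * s ^+ 2 + k ^+ 2 * t ^+ 2.
  have -> : k ^- 2 * s ^+ 2 + k ^+ 2 * t ^+ 2 = (k^-1 * `|s|) ^+ 2 + (k * `|t|) ^+ 2.
    by rewrite !exprMn !real_normK ?num_real// exprVn.
  have -> : `|s * t| = (k^-1 * `|s|) * (k * `|t|) by rewrite normrM; field; rewrite gt_eqF.
  by have := sqr_ge0 (k^-1 * `|s| - k * `|t|); clear; lra.
have cs (a b c d : R) : (a * c + b * d) ^+ 2 <= (a ^+ 2 + b ^+ 2) * (c ^+ 2 + d ^+ 2).
  by have := sqr_ge0 (a * d - b * c); clear; lra.
have bound x : `|rest x| <= (2 * r - 1) * (2^-1 * (u x `^ (r - 1) * X2 x + u x `^ (r - 1) * Y2 x)).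
  have ur0 : 0 <= u x `^ (r - 1) by exact: powR_ge0.
  have b1 : `|g1 x * dF1 x + g2 x * dF2 x| <= 2^-1 * (X2 x + Y2 x).
    apply: le_trans (ler_normD _ _) _; rewrite [g1 x * _]mulrC [g2 x * _]mulrC.
    have := amgm (dF1 x) (g1 x); have := amgm (dF2 x) (g2 x); rewrite /X2 /Y2; clear; lra.
  have b2 : `|Fg x * (F1 x * dF1 x + F2 x * dF2 x)| <= 2^-1 * (u x * (X2 x + Y2 x)).
    rewrite mulrC; have := amgm (F1 x * dF1 x + F2 x * dF2 x) (Fg x).
    have h1 := ler_wpM2l (ltW k2V0) (cs (F1 x) (F2 x) (dF1 x) (dF2 x)).
    have h2 := ler_wpM2l (ltW k20) (cs (F1 x) (F2 x) (g1 x) (g2 x)).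
    have e1 : k ^- 2 * ((F1 x ^+ 2 + F2 x ^+ 2) * (dF1 x ^+ 2 + dF2 x ^+ 2)) = (u x - 1) * X2 x.
      by rewrite /u /X2; ring.
    have e2 : k ^+ 2 * ((F1 x ^+ 2 + F2 x ^+ 2) * (g1 x ^+ 2 + g2 x ^+ 2)) = (u x - 1) * Y2 x.
      by rewrite /u /Y2; ring.
    rewrite e1 in h1; rewrite e2 in h2; have := X20 x; have := Y20 x.
    rewrite -/(Fg x) in h2 *; move: h1 h2; clear; lra.
  apply: le_trans (ler_normD _ _) _; rewrite normrM (ger0_norm ur0).
  have -> : Fg x * ((r - 1) * u x `^ (r - 1 - 1) * du x) =
     2 * (r - 1) * u x `^ (r - 1 - 1) * (Fg x * (F1 x * dF1 x + F2 x * dF2 x)).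
    by rewrite /du; ring.
  have c0 : 0 <= 2 * (r - 1) * u x `^ (r - 1 - 1).
    by apply: mulr_ge0; [exact: mulr_ge0 | exact: powR_ge0].
  rewrite normrM (ger0_norm c0); apply: le_trans (lerD (ler_wpM2l ur0 b1) (ler_wpM2l c0 b2)) _.
  rewrite (powR_pred (r - 1) (u0 x)) le_eqVlt; apply/orP; left; apply/eqP; ring.
have be1 : bm (fun x => u x `^ (r - 1)) by exact: (@bm_energy (r - 1)).
have be : bm (energy r F1 F2) by exact: bm_energy.
have bX2 : bm X2 by apply: bmZ; exact: bm_square_sum.
have bY2 : bm Y2 by apply: bmZ; exact: bm_square_sum.
pose rhs x := (2 * r - 1) * (2^-1 * (u x `^ (r - 1) * X2 x + u x `^ (r - 1) * Y2 x)).
have brhs : bm rhs by apply: bmZ; apply: bmZ; apply: bmD; exact: bmM.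
have brest : bm rest by exact: bm_dominated crest bound brhs.
have bmain : bm main.
  by apply: bmM => //; apply: bmD; exact: bmM.
have I0 : I (fun x => main x + rest x) = 0.
  apply: (I_derive HP).
    by move=> x; apply: cvgD; [exact: cmain | exact: crest].
  by rewrite /H /u /Fg F1p F2p g1p g2p.
rewrite ID// in I0; have -> : I main = - I rest by apply/eqP; rewrite -addr_eq0 I0.
have -> : - I rest = I (fun x => - 1 * rest x) by rewrite IZ// mulN1r.
apply: (@le_trans _ _ (I rhs)).
  apply: I_le => // [|x _]; first exact: bmZ.
  by rewrite mulN1r (le_trans (ler_norm _))// normrN bound.
rewrite /rhs IZ; last by apply: bmZ; apply: bmD; exact: bmM.
rewrite ler_wpM2l//.
have half (Z : R -> R) : bm Z -> (forall x, 0 <= Z x) -> I (fun x => Z x `^ r) <= 1 ->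
    I (fun x => u x `^ (r - 1) * Z x) <= lam^-1 * I (energy r F1 F2) + lam `^ (r - 1).
  move=> bZ Z0 IZ1; have bZr : bm (fun x => Z x `^ r) by exact: bm_powR.
  apply: (@le_trans _ _ (I (fun x => lam^-1 * energy r F1 F2 x + lam `^ (r - 1) * Z x `^ r))).
    apply: I_le => // [||x _]; [exact: bmM | by apply: bmD; exact: bmZ |].
    exact: young_energy.
  rewrite ID; [|exact: bmZ|exact: bmZ]; rewrite !IZ// lerD2l.
  by rewrite -[X in _ <= X]mulr1 ler_wpM2l ?powR_ge0.
have X21 : I (fun x => X2 x `^ r) <= 1.
  have e x : X2 x `^ r = (k ^- 2) `^ r * (dF1 x ^+ 2 + dF2 x ^+ 2) `^ r.
    by rewrite powRM ?(ltW k2V0)// addr_ge0 ?sqr_ge0.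
  under [X in I X]eq_fun do rewrite e.
  rewrite IZ; last by apply: bm_powR => // [x|]; [rewrite addr_ge0 ?sqr_ge0 | exact: bm_square_sum].
  apply: le_trans (ler_wpM2l (powR_ge0 _ _) IF) _.
  by rewrite -powRM ?(ltW k2V0) ?(ltW k20)// kk powR1.
have Y21 : I (fun x => Y2 x `^ r) <= 1.
  have e x : Y2 x `^ r = (k ^+ 2) `^ r * (g1 x ^+ 2 + g2 x ^+ 2) `^ r.
    by rewrite powRM ?(ltW k20)// addr_ge0 ?sqr_ge0.
  under [X in I X]eq_fun do rewrite e.
  rewrite IZ; last by apply: bm_powR => // [x|]; [rewrite addr_ge0 ?sqr_ge0 | exact: bm_square_sum].
  apply: le_trans (ler_wpM2l (powR_ge0 _ _) Ig) _.
  by rewrite -powRM ?(ltW k2V0) ?(ltW k20)// mulrC kk powR1.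
rewrite IZ; last by apply: bmD; exact: bmM.
rewrite ID; [|exact: bmM|exact: bmM].
have := half _ bX2 X20 X21; have := half _ bY2 Y20 Y21; clear; lra.
Qed.

(** The first order term is integrated by parts and the quadratic one is split by Young's
    inequality. The parameter [lam] stays free, to be adapted to the size of the energy at each
    step. *)
Lemma energy_step r : 1 <= r -> exists2 C : R, 0 < C &
  forall (F1 F2 dF1 dF2 g1 g2 f1 f2 : R -> R) (k lam : R),
  (forall x, is_derive x 1 F1 (dF1 x)) -> (forall x, is_derive x 1 F2 (dF2 x)) ->
  (forall x, is_derive x 1 g1 (f1 x)) -> (forall x, is_derive x 1 g2 (f2 x)) ->
  continuous dF1 -> continuous dF2 -> continuous f1 -> continuous f2 ->
  bm F1 -> bm F2 -> bm dF1 -> bm dF2 -> bm g1 -> bm g2 -> bm f1 -> bm f2 ->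
  F1 1 = F1 0 -> F2 1 = F2 0 -> g1 1 = g1 0 -> g2 1 = g2 0 -> 0 < k -> 1 <= lam ->
  I (fun x => (dF1 x ^+ 2 + dF2 x ^+ 2) `^ r) <= (k ^+ 2) `^ r ->
  I (fun x => (g1 x ^+ 2 + g2 x ^+ 2) `^ r) <= (k ^- 2) `^ r ->
  I (fun x => (f1 x ^+ 2 + f2 x ^+ 2) `^ r) <= 1 ->
  I (energy r (fun x => F1 x + f1 x) (fun x => F2 x + f2 x)) <=
    I (energy r F1 F2) + C * (lam^-1 * I (energy r F1 F2) + lam `^ (r - 1)).
Proof.
move=> r1; have [C C0 HC] := energy_pointwise r1.
exists (2 * r * (2 * r - 1) + 2 * C) => [|F1 F2 dF1 dF2 g1 g2 f1 f2 k lam dF1P dF2P dg1 dg2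
  cdF1 cdF2 cf1 cf2 bF1 bF2 bdF1 bdF2 bg1 bg2 bf1 bf2 F1p F2p g1p g2p k0 l1 IF Ig If].
  by rewrite addr_gt0 ?mulr_gt0//; move: r1; clear; lra.
have r0 : 0 <= r by move: r1; clear; lra.
have r10 : 0 <= r - 1 by rewrite subr_ge0.
have l0 : 0 < lam by exact: lt_le_trans l1.
have first := energy_first_order r1 dF1P dF2P dg1 dg2 cdF1 cdF2 cf1 cf2 bF1 bF2 bdF1 bdF2
  bg1 bg2 bf1 bf2 F1p F2p g1p g2p k0 l0 IF Ig.
have be : bm (energy r F1 F2) by exact: bm_energy.
have be1 : bm (energy (r - 1) F1 F2) by exact: bm_energy.
have bq : bm (fun x => f1 x ^+ 2 + f2 x ^+ 2) by exact: bm_square_sum.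
have q0 x : 0 <= f1 x ^+ 2 + f2 x ^+ 2 by rewrite addr_ge0 ?sqr_ge0.
have bqr : bm (fun x => (f1 x ^+ 2 + f2 x ^+ 2) `^ r) by exact: bm_powR.
pose main x := energy (r - 1) F1 F2 x * (F1 x * f1 x + F2 x * f2 x).
have bmain : bm main by apply: bmM => //; apply: bmD; exact: bmM.
pose err x := lam^-1 * energy r F1 F2 x + (lam `^ (r - 1) + 1) * (f1 x ^+ 2 + f2 x ^+ 2) `^ r.
have berr : bm err by apply: bmD; exact: bmZ.
apply: (@le_trans _ _ (I (fun x => energy r F1 F2 x + 2 * r * main x + C * err x))).
  apply: I_le.
  - by apply: bm_energy => //; exact: bmD.
  - by apply: bmD; [apply: bmD => //; exact: bmZ | exact: bmZ].
  move=> x _; apply: le_trans (HC _ _ _ _) _; rewrite lerD2l ler_pM2l// /err.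
  rewrite mulrDl mul1r addrA lerD2r; apply: young_energy => //.
  by rewrite -addrA ltr_pwDl// addr_ge0 ?sqr_ge0.
rewrite ID; [|by apply: bmD => //; exact: bmZ|exact: bmZ].
rewrite ID//; last exact: bmZ.
rewrite !IZ// -addrA lerD2l /err ID; [|exact: bmZ|exact: bmZ]; rewrite !IZ//.
have L1 : 1 <= lam `^ (r - 1).
  have : 1 `^ (r - 1) <= lam `^ (r - 1) by exact: ler_pow.
  by rewrite powR1.
set E := I (energy r F1 F2) in first *; set Lr := lam `^ (r - 1) in first L1 *.
have E0 : 0 <= E by apply: I_ge0 => x; exact: powR_ge0.
have lE : 0 <= lam^-1 * E by rewrite mulr_ge0// invr_ge0 ltW.
have f' : (Lr + 1) * I (fun x => (f1 x ^+ 2 + f2 x ^+ 2) `^ r) <= 2 * Lr.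
  have Lr1 : 0 <= Lr + 1 by rewrite addr_ge0// powR_ge0.
  apply: le_trans (ler_wpM2l Lr1 If) _; move: L1; clear; lra.
have h2 : 2 * r * I main <= 2 * r * ((2 * r - 1) * (lam^-1 * E + Lr)).
  by rewrite ler_wpM2l// mulr_ge0.
have h3 : C * (lam^-1 * E + (Lr + 1) * I (fun x => (f1 x ^+ 2 + f2 x ^+ 2) `^ r)) <= C * (lam^-1 * E + 2 * Lr).
  by rewrite ler_pM2l// lerD2l.
have : 0 <= C * (lam^-1 * E) by rewrite mulr_ge0// ltW.
move: h2 h3; move: (I main) (I _) => IM J; clear; lra.
Qed.

End energy_increment.

(** * Frequencies below and above the scale *)

Section low_and_high_frequencies.
Variable R : realType.
Implicit Types (s p l x A C v : R) (m n j J T : nat) (w c : nat -> R).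

(** Monotonicity serves the blocks below the scale, where [w j] is replaced by [w J]; the linear
    growth serves the tail, where it is beaten by geometric decay. *)
Definition tame w := [/\ forall j, 0 < w j, forall j k, (j <= k)%N -> w j <= w k &
  forall j i, w (j + i)%N <= i.+1%:R * w j].

Lemma tame1 : tame (fun=> 1).
Proof. by split=> // j i; rewrite mulr1 (ler_nat _ 1). Qed.

Lemma tame_quarter : tame (fun K => K.+1%:R `^ 4^-1).
Proof.
split=> [j|j k jk|j i]; first by rewrite powR_gt0.
  by rewrite ler_pow ?invr_ge0// ler_nat.
have i1 : 1 <= i.+1%:R :> R by rewrite (ler_nat _ 1).
apply: (@le_trans _ _ ((i.+1%:R * j.+1%:R) `^ 4^-1)).
  by rewrite ler_pow ?invr_ge0// -natrM ler_nat; lia.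
rewrite powRM// ler_wpM2r ?powR_ge0//; apply: ler1_powR => //.
by rewrite invf_le1// (ler_nat _ 1).
Qed.

Lemma sum_arith_geometric (t : R) n : 0 <= t < 1 ->
  \sum_(0 <= i < n) i.+1%:R * t ^+ i <= (1 - t) ^- 2.
Proof.
move=> /andP[t0 t1]; have t1' : 0 < 1 - t by rewrite subr_gt0.
have t1N : 1 - t != 0 by rewrite gt_eqF.
have -> : \sum_(0 <= i < n) i.+1%:R * t ^+ i = (1 - t) ^- 2 * (1 - (1 + n%:R * (1 - t)) * t ^+ n).
  elim: n => [|n IHn]; first by rewrite big_geq// mul0r addr0 mul1r expr0 subrr mulr0.
  by rewrite big_nat_recr//= IHn -[n.+1%:R]natr1 [t ^+ n.+1]exprS; field.
rewrite -[X in _ <= X]mulr1 ler_wpM2l ?invr_ge0 ?sqr_ge0// gerBl.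
by rewrite mulr_ge0 ?exprn_ge0// addr_ge0// mulr_ge0// ltW.
Qed.

Section with_Wbound.
Variables (p v : R) (w : nat -> R).
Hypotheses (p1 : 1 <= p) (v0 : 0 < v) (tw : tame w) (W : Wbound p v w).

Let w0 j : 0 < w j. Proof. by case: tw. Qed.
Let wmono j k : (j <= k)%N -> w j <= w k. Proof. by case: tw => _ + _; apply. Qed.
Let wgrow j i : w (j + i)%N <= i.+1%:R * w j. Proof. by case: tw => _ _; apply. Qed.
Let p0 : 0 <= p. Proof. exact: le_trans ler01 p1. Qed.

Lemma I_Emod_nil c m n : (n <= m)%N -> I (fun x => Emod c m n x `^ p) = 0.
Proof.
move=> nm; rewrite (@I_ext _ _ (fun=> 0)) ?I_cst// => x.
by rewrite /Emod /Ere /Eim !big_geq// cmod0 powR0// gt_eqF// (lt_le_trans ltr01).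
Qed.

(** The growth condition on [w] leaves an arithmetico-geometric series; the first block
    dominates. *)
Lemma high_frequencies s : 2 `^ (- (2 * s)) * v < 1 -> exists2 C : R, 0 < C & forall J T, (J <= T)%N ->
  I (fun x => Emod (rc s) (2 ^ J) (2 ^ T) x `^ p) <= (C * (2 `^ (- (2 * s)) * v) ^+ J * w J) `^ p.
Proof.
set t := _ * v => t1; have [C C0 HC] := rc_block s p1 v0 w0 W.
have t0 : 0 < t by rewrite mulr_gt0// powR_gt0.
exists (C * (1 - t) ^- 2) => [|J T JT].
  by rewrite mulr_gt0// invr_gt0 exprn_gt0// subr_gt0.
apply: (@le_trans _ _ ((\sum_(J <= j < T) C * t ^+ j * w j) `^ p)).
  apply: dyadic_sum => // [j|j /andP[Jj jT]]; first by rewrite !mulr_gt0// exprn_gt0.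
  by apply: (HC j) => //; rewrite leq_exp2l.
apply: ler_pow; first exact: p0.
  by apply: sumr_ge0 => j _; apply: ltW; rewrite !mulr_gt0// exprn_gt0.
rewrite -{1}[J]add0n big_addn.
apply: (@le_trans _ _ (\sum_(0 <= i < T - J) C * t ^+ J * w J * (i.+1%:R * t ^+ i))).
  apply: ler_sum => i _; rewrite addnC exprD.
  have -> : C * t ^+ J * w J * (i.+1%:R * t ^+ i) = C * (t ^+ J * t ^+ i) * (i.+1%:R * w J) by ring.
  by rewrite ler_wpM2l// ltW// !mulr_gt0// exprn_gt0.
rewrite -mulr_sumr; have c0 : 0 <= C * t ^+ J * w J by rewrite ltW// !mulr_gt0// exprn_gt0.
have t01 : 0 <= t < 1 by rewrite ltW.
apply: le_trans (ler_wpM2l c0 (sum_arith_geometric (T - J) t01)) _.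
by rewrite le_eqVlt; apply/orP; left; apply/eqP; ring.
Qed.

Lemma low_frequencies_sum s : exists2 C : R, 0 < C & forall l J, 0 < l -> 4 ^+ J * l <= 2^-1 ->
  I (fun x => Emod (ac s l) 1 (2 ^ J) x `^ p) <=
    (C * l * w J * \sum_(0 <= j < J) (2 `^ (2 - 2 * s) * v) ^+ j) `^ p.
Proof.
set t := _ * v; have [C C0 HC] := ac_block s p1 v0 w0 W.
have t0 : 0 < t by rewrite mulr_gt0// powR_gt0.
exists C => // l J l0 Jl.
have [J0|J0] := posnP J.
  by rewrite J0 I_Emod_nil// powR_ge0.
apply: (@le_trans _ _ ((\sum_(0 <= j < J) C * l * t ^+ j * w j) `^ p)).
  apply: (@dyadic_sum _ p (ac s l) _ 0 J) => // [j|j /andP[_ jJ]].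
    by rewrite !mulr_gt0// exprn_gt0.
  apply: (HC l j) => //; last by rewrite leq_exp2l.
  apply: le_trans Jl; rewrite ler_wpM2r ?(ltW l0)// ler_weXn2l//; lra.
apply: ler_pow; first exact: p0.
  by apply: sumr_ge0 => j _; apply: ltW; rewrite !mulr_gt0// exprn_gt0.
rewrite mulr_sumr; apply: ler_sum_nat => j /andP[_ jJ].
have -> : C * l * w J * t ^+ j = C * l * t ^+ j * w J by ring.
by rewrite ler_wpM2l ?wmono ?(ltnW jJ)// ltW// !mulr_gt0// exprn_gt0.
Qed.

(** The last block dominates. Its factor [4^J l <= 1/2] turns [2^(2 - 2s)] into [2^(-2s)], so the
    bound takes the same shape as that of the tail. *)
Lemma low_frequencies_gt s : 1 < 2 `^ (2 - 2 * s) * v -> exists2 C : R, 0 < C &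
  forall l J, 0 < l -> 4 ^+ J * l <= 2^-1 ->
  I (fun x => Emod (ac s l) 1 (2 ^ J) x `^ p) <=
    (C * (2 `^ (- (2 * s)) * v) ^+ J * w J) `^ p.
Proof.
set t := _ * v => t1; have [C C0 HC] := low_frequencies_sum s; rewrite -/t in HC.
have t10 : 0 < t - 1 by rewrite subr_gt0.
have tpos : 0 < t by exact: lt_trans t1.
exists (C * (t / (t - 1))) => [|l J l0 Jl]; first by rewrite mulr_gt0// divr_gt0.
apply: le_trans (HC l J l0 Jl) _.
have u0 : 0 < 2 `^ (- (2 * s)) * v by rewrite mulr_gt0// powR_gt0.
have tE : t = 4 * (2 `^ (- (2 * s)) * v).
  by rewrite /t powRDp// powR2// -natrX mulrA.
have s0 : 0 <= \sum_(0 <= j < J) t ^+ j by apply: sumr_ge0 => j _; rewrite exprn_ge0// ltW.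
apply: ler_pow; first exact: p0.
  by rewrite !mulr_ge0// ltW.
have sJ : \sum_(0 <= j < J) t ^+ j <= t / (t - 1) * t ^+ J.
  apply: le_trans (geometric_le J t1); rewrite big_nat_recr//= lerDl; apply: exprn_ge0.
  exact: ltW.
have c0 : 0 <= C * l * w J by rewrite ltW// !mulr_gt0.
apply: le_trans (ler_wpM2l c0 sJ) _.
set u := _ * v in u0 tE *.
have -> : C * l * w J * (t / (t - 1) * t ^+ J) = C * (t / (t - 1)) * (t ^+ J * l) * w J by ring.
rewrite ler_wpM2r ?(ltW (w0 J))// ler_wpM2l//.
  by rewrite ltW// mulr_gt0// divr_gt0.
rewrite tE exprMn mulrAC -[X in _ <= X]mul1r ler_wpM2r ?exprn_ge0 ?(ltW u0)//.
by apply: le_trans Jl _; lra.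
Qed.

(** The first block dominates: the function behaves as if it were differentiable in [L^p], and only
    the factor [l] remains. *)
Lemma low_frequencies_lt s : (forall j, w j = 1) -> 2 `^ (2 - 2 * s) * v < 1 -> exists2 C : R, 0 < C &
  forall l J, 0 < l -> 4 ^+ J * l <= 2^-1 ->
  I (fun x => Emod (ac s l) 1 (2 ^ J) x `^ p) <= (C * l) `^ p.
Proof.
set t := _ * v => w1 t1; have [C C0 HC] := low_frequencies_sum s; rewrite -/t in HC.
have t0 : 0 < t by rewrite mulr_gt0// powR_gt0.
exists (C * (1 - t) ^- 2) => [|l J l0 Jl].
  by rewrite mulr_gt0// invr_gt0 exprn_gt0// subr_gt0.
apply: le_trans (HC l J l0 Jl) _.
have s0 : 0 <= \sum_(0 <= j < J) t ^+ j by apply: sumr_ge0 => j _; rewrite exprn_ge0// ltW.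
apply: ler_pow; [exact: p0 | by rewrite !mulr_ge0// ltW |].
rewrite w1 mulr1 mulrAC ler_wpM2r ?(ltW l0)// ler_wpM2l ?(ltW C0)//.
have t01 : 0 <= t < 1 by rewrite ltW.
apply: le_trans (sum_arith_geometric J t01); apply: ler_sum => j _.
by rewrite ler_peMl ?exprn_ge0 ?(ltW t0)// (ler_nat _ 1).
Qed.

End with_Wbound.

Lemma eq_Ere c c' m n x : (forall j, (m <= j < n)%N -> c j = c' j) -> Ere c m n x = Ere c' m n x.
Proof. by move=> cc'; apply: eq_big_nat => j mjn; rewrite cc'. Qed.

Lemma eq_Eim c c' m n x : (forall j, (m <= j < n)%N -> c j = c' j) -> Eim c m n x = Eim c' m n x.
Proof. by move=> cc'; apply: eq_big_nat => j mjn; rewrite cc'. Qed.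

Lemma is_derive_sum_seq (s : seq nat) (f : nat -> R -> R) (df : nat -> R) x :
  (forall j, is_derive x 1 (f j) (df j)) ->
  is_derive x 1 (fun y => \sum_(j <- s) f j y) (\sum_(j <- s) df j).
Proof.
move=> fP; elim: s => [|j s IHs].
  under eq_fun do rewrite big_nil; rewrite big_nil; exact: is_derive_cst.
by under eq_fun do rewrite big_cons; rewrite big_cons; exact: is_derive_add.
Qed.

Lemma is_derive_linear (a x : R) : is_derive x 1 (fun y => a * y) a.
Proof.
have := is_derive_mul (is_derive_cst a x 1) (is_derive_id x 1).
by rewrite mulr1 mulr0 addr0.
Qed.

(** The factor [n^2] is written as a real power so that [pow_block] controls derivatives, with
    exponent [2], and primitives, with exponent [-2], alike. *)
Lemma is_derive_Ere c m n x :
  is_derive x 1 (Ere c m n) (- (2 * pi) * Eim (fun j => j%:R `^ 2 * c j) m n x).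
Proof.
rewrite /Eim mulr_sumr; apply: is_derive_sum_seq => j.
have h := is_derive1_comp (is_derive_cos _) (is_derive_linear (2 * pi * (j ^ 2)%N%:R) x).
have := is_derive_mul (is_derive_cst (c j) x 1) h.
have -> : c j * (- sin (2 * pi * (j ^ 2)%N%:R * x) * (2 * pi * (j ^ 2)%N%:R)) +
  cos (2 * pi * (j ^ 2)%N%:R * x) * 0 =
  - (2 * pi) * (j%:R `^ 2 * c j * sin (2 * pi * (j ^ 2)%N%:R * x)).
  by rewrite powR2// -natrX; ring.
by [].
Qed.

Lemma is_derive_Eim c m n x :
  is_derive x 1 (Eim c m n) (2 * pi * Ere (fun j => j%:R `^ 2 * c j) m n x).
Proof.
rewrite /Ere mulr_sumr; apply: is_derive_sum_seq => j.
have h := is_derive1_comp (is_derive_sin _) (is_derive_linear (2 * pi * (j ^ 2)%N%:R) x).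
have := is_derive_mul (is_derive_cst (c j) x 1) h.
have -> : c j * (cos (2 * pi * (j ^ 2)%N%:R * x) * (2 * pi * (j ^ 2)%N%:R)) +
  sin (2 * pi * (j ^ 2)%N%:R * x) * 0 =
  2 * pi * (j%:R `^ 2 * c j * cos (2 * pi * (j ^ 2)%N%:R * x)).
  by rewrite powR2// -natrX; ring.
by [].
Qed.

Lemma Ere_periodic01 c m n : Ere c m n 1 = Ere c m n 0.
Proof.
apply: eq_bigr => j _; congr (_ * _); rewrite mulr1 mulr0 -[RHS](cos_2pi_int _ (j ^ 2)%N%:Z).
by rewrite add0r.
Qed.

Lemma Eim_periodic01 c m n : Eim c m n 1 = Eim c m n 0.
Proof.
apply: eq_bigr => j _; congr (_ * _); rewrite mulr1 mulr0 -[RHS](sin_2pi_int _ (j ^ 2)%N%:Z).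
by rewrite add0r.
Qed.

Lemma continuous_Ere c m n : continuous (Ere c m n).
Proof. exact: is_derive_continuous (is_derive_Ere c m n). Qed.

Lemma continuous_Eim c m n : continuous (Eim c m n).
Proof. exact: is_derive_continuous (is_derive_Eim c m n). Qed.

Lemma continuousZ (a : R) (f : R -> R) : continuous f -> continuous (fun x => a * f x).
Proof. by move=> cf x; apply: cvgM; [exact: cvg_cst | exact: cf]. Qed.

Lemma is_deriveZl (a d : R) (f : R -> R) x : is_derive x 1 f d -> is_derive x 1 (fun y => a * f y) (a * d).
Proof. by move=> df; have := is_derive_mul (is_derive_cst a x 1) df; rewrite mulr0 addr0. Qed.

End low_and_high_frequencies.

(** * The critical case of equal blocks *)

Section critical_low_frequencies.
Variable R : realType.
Implicit Types (s p l x A C v : R) (m n j J T : nat) (w c : nat -> R).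

Lemma blockb_le p A B M N c : 0 <= p -> 0 <= A -> A <= B -> blockb p A M N c -> blockb p B M N c.
Proof.
move=> p0 A0 AB cA m n Mm mn nN; apply: le_trans (cA m n Mm mn nN) _; exact: ler_pow.
Qed.

Lemma bm_Emod_powR c m n p : 0 <= p -> bm (fun x => Emod c m n x `^ p).
Proof. by move=> p0; apply: bm_powR => // [x|]; [exact: Emod_ge0 | exact: bm_Emod]. Qed.

Lemma I_scaled_square p (al B : R) c m n (f g : R -> R) : 0 < p -> 0 <= al -> 0 <= B ->
  (forall x, f x ^+ 2 + g x ^+ 2 = (al * Emod c m n x) ^+ 2) ->
  I (fun x => Emod c m n x `^ p) <= B `^ p ->
  I (fun x => (f x ^+ 2 + g x ^+ 2) `^ (p / 2)) <= (al * B) `^ p.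
Proof.
move=> p0 al0 B0 fg cB.
have e x : (f x ^+ 2 + g x ^+ 2) `^ (p / 2) = al `^ p * Emod c m n x `^ p.
  by rewrite fg powR_sqr ?mulr_ge0 ?Emod_ge0// powRM// Emod_ge0.
under [X in I X]eq_fun do rewrite e.
rewrite IZ; last by apply: bm_Emod_powR; exact: ltW.
by rewrite powRM// ler_wpM2l ?powR_ge0.
Qed.

(** A discrete form of [E' <= 2 C E^(1 - 1/r)]. With [lam = B (j + 1)] both error terms are at most
    [lam^(r - 1)], and convexity gives [lam^r + B lam^(r - 1) <= (lam + B)^r]. *)
Lemma energy_iteration (r B C : R) (E : nat -> R) J : 1 <= r -> 0 < C -> 2 * C <= B -> 1 <= B ->
  E 0 <= B `^ r ->
  (forall j lam, (j < J)%N -> 1 <= lam -> E j.+1 <= E j + C * (lam^-1 * E j + lam `^ (r - 1))) ->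
  forall j, (j <= J)%N -> E j <= (B * j.+1%:R) `^ r.
Proof.
move=> r1 C0 CB B1 E0 HE; elim=> [|j IHj] jJ; first by rewrite mulr1.
pose lam := B * j.+1%:R.
have jR : 1 <= j.+1%:R :> R by rewrite (ler_nat _ 1).
have lB : B <= lam by rewrite /lam -[X in X <= _]mulr1 ler_wpM2l//; move: B1; clear; lra.
have l1 : 1 <= lam by exact: le_trans lB.
have l0 : 0 < lam by exact: lt_le_trans l1.
apply: le_trans (HE j lam jJ l1) _.
have IH : E j <= lam `^ r by apply: IHj; exact: ltnW.
have h1 : lam^-1 * E j <= lam `^ (r - 1).
  by rewrite mulrC ler_pdivrMr// mulrC -powR_pred.
have -> : B * j.+2%:R = lam + B by rewrite /lam -[j.+2%:R]natr1; ring.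
have B0 : 0 <= B by move: B1; clear; lra.
apply: (@le_trans _ _ (lam `^ r + B * lam `^ (r - 1))).
  rewrite lerD//; apply: (@le_trans _ _ (2 * C * lam `^ (r - 1))).
    by move: (ler_wpM2l (ltW C0) h1); clear; lra.
  by rewrite ler_wpM2r// powR_ge0.
apply: le_trans (powR_tangent r1 l0 (addr_ge0 (ltW l0) B0)).
rewrite (powR_pred r l0).
have -> : lam * lam `^ (r - 1) * (1 + r * ((lam + B) / lam - 1)) =
  lam * lam `^ (r - 1) + r * (B * lam `^ (r - 1)) by field; rewrite gt_eqF.
by rewrite lerD2l ler_peMl// mulr_ge0// powR_ge0.
Qed.

(** All blocks have the same bound, up to [w]. Minkowski's inequality would give a factor [J]; an
    energy of order [(J + 1)^(p/2)] gives its square root. *)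
Lemma low_frequencies_eq p v w s : 2 <= p -> 0 < v -> tame w -> Wbound p v w ->
  2 `^ (2 - 2 * s) * v = 1 -> exists2 C : R, 0 < C & forall l J, 0 < l -> 4 ^+ J * l <= 2^-1 ->
  I (fun x => Emod (ac s l) 1 (2 ^ J) x `^ p) <= (C * l * w J * J.+1%:R `^ 2^-1) `^ p.
Proof.
move=> p2 v0 [w0 wmono _] W t1.
have p1 : 1 <= p by move: p2; clear; lra.
have p0 : 0 < p by move: p2; clear; lra.
have r1 : 1 <= p / 2 by move: p2; clear; lra.
have [C0 C00 HC] := ac_block s p1 v0 w0 W.
have [K1 K10 HK1] := @pow_block R 2; have [K2 K20 HK2] := @pow_block R (- 2).
have [C CC0 HE] := energy_step r1.
pose B := 1 + 2 * C.
have B1 : 1 <= B by rewrite lerDl mulr_ge0// ltW.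
have B0 : 0 < B by exact: lt_le_trans B1.
have kk0 : 0 < K1 * K2 by exact: mulr_gt0.
exists (C0 * (1 + K1 * K2) * B `^ 2^-1) => [|l J l0 Jl].
  by rewrite !mulr_gt0 ?powR_gt0// addr_gt0.
pose Ab := C0 * l * w J.
have Ab0 : 0 < Ab by rewrite !mulr_gt0.
(* [K1] and [K2] are lost when the coefficients are multiplied by [n^2] and [n^(-2)]; dividing by
   [A] instead of the block bound [Ab] absorbs the product of the two losses. *)
pose A := Ab * (1 + K1 * K2).
have A0 : 0 < A by rewrite mulr_gt0// addr_gt0.
have AbA : Ab <= A by rewrite ler_peMr ?(ltW Ab0)// lerDl ltW.
pose a := ac s l.
have blk j : (j < J)%N -> blockb p Ab (2 ^ j) (2 ^ j.+1) a.
  move=> jJ; have jl : 4 ^+ j.+1 * l <= 2^-1.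
    by apply: le_trans Jl; rewrite ler_wpM2r ?(ltW l0)// ler_weXn2l// (ler_nat _ 1).
  apply: blockb_le (HC l j l0 jl); first exact: ltW.
    by rewrite t1 expr1n mulr1 !mulr_ge0// ltW.
  by rewrite t1 expr1n mulr1 ler_wpM2l ?wmono ?(ltnW jJ)// ltW// mulr_gt0.
pose a2 n := n%:R `^ 2 * a n; pose am n := n%:R `^ (- 2) * a n.
have pi2 : 0 < 2 * pi :> R by rewrite mulr_gt0// pi_gt0.
have four : 2 `^ 2 = 4 :> R by rewrite powR2// -natrX.
have fourm : 2 `^ (- 2) = 4^-1 :> R by rewrite powRN four.
have high j : (j <= J)%N -> I (fun x => Emod a2 1 (2 ^ j) x `^ p) <= (K1 * 4 ^+ j * Ab) `^ p.
  move=> jJ; have [->|j0] := posnP j.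
    by rewrite I_Emod_nil// powR_ge0.
  apply: (@le_trans _ _ ((\sum_(0 <= i < j) K1 * 4 ^+ i * Ab) `^ p)).
    apply: (@dyadic_sum _ p a2 _ 0 j) => // [i|i /andP[_ ij]].
      by rewrite !mulr_gt0// exprn_gt0.
    have := HK1 i p Ab a p1 Ab0 (blk i (leq_trans ij jJ)); rewrite four => h.
    by apply: h => //; rewrite leq_exp2l.
  apply: ler_pow; first exact: ltW.
    by apply: sumr_ge0 => i _; apply: ltW; rewrite !mulr_gt0// exprn_gt0.
  rewrite -mulr_suml -mulr_sumr ler_wpM2r ?(ltW Ab0)// ler_wpM2l ?(ltW K10)//.
  elim: (j) => [|i IHi]; first by rewrite big_geq// expr0.
  rewrite big_nat_recr//= exprS; move: IHi (exprn_ge0 i (ler0n R 4)); clear; lra.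
have step j lam : (j < J)%N -> 1 <= lam ->
  I (energy (p / 2) (fun x => A^-1 * Ere a 1 (2 ^ j.+1) x) (fun x => A^-1 * Eim a 1 (2 ^ j.+1) x)) <=
  I (energy (p / 2) (fun x => A^-1 * Ere a 1 (2 ^ j) x) (fun x => A^-1 * Eim a 1 (2 ^ j) x)) +
  C * (lam^-1 * I (energy (p / 2) (fun x => A^-1 * Ere a 1 (2 ^ j) x) (fun x => A^-1 * Eim a 1 (2 ^ j) x))
    + lam `^ (p / 2 - 1)).
  move=> jJ l1; have catE (F : (nat -> R) -> nat -> nat -> R -> R) x :
      (forall c m n k, (m <= k <= n)%N -> F c m n x = F c m k x + F c k n x) ->
      A^-1 * F a 1 (2 ^ j.+1)%N x = A^-1 * F a 1 (2 ^ j)%N x + A^-1 * F a (2 ^ j)%N (2 ^ j.+1)%N x.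
    move=> Fcat; rewrite -mulrDr -Fcat//; by rewrite expn_gt0 leq_exp2l/=.
  have e1 x : A^-1 * Ere a 1 (2 ^ j.+1) x = A^-1 * Ere a 1 (2 ^ j) x + A^-1 * Ere a (2 ^ j) (2 ^ j.+1) x.
    by apply: catE => c m n k /andP[mk kn]; rewrite /Ere (@big_cat_nat _ _ _ k).
  have e2 x : A^-1 * Eim a 1 (2 ^ j.+1) x = A^-1 * Eim a 1 (2 ^ j) x + A^-1 * Eim a (2 ^ j) (2 ^ j.+1) x.
    by apply: catE => c m n k /andP[mk kn]; rewrite /Eim (@big_cat_nat _ _ _ k).
  under [X in I (energy _ X _) <= _]eq_fun do rewrite e1.
  under [X in I (energy _ _ X) <= _]eq_fun do rewrite e2.
  have Ai0 : 0 < A^-1 by rewrite invr_gt0.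
  have i2 : 0 < (2 * pi)^-1 :> R by rewrite invr_gt0.
  (* The frequency between the two scales: after division by [A], the derivative of the old sum is
     at most [k] in [L^p], and the primitive of the new block, with coefficients [am], at most
     [1 / k]. *)
  pose k := 2 * pi * (K1 * 4 ^+ j); have k0 : 0 < k.
    by apply: mulr_gt0 => //; apply: mulr_gt0 => //; exact: exprn_gt0.
  have aE n : (0 < n)%N -> n%:R `^ 2 * am n = a n.
    move=> n0; have nR : 0 < n%:R :> R by rewrite ltr0n.
    by rewrite /am mulrA -powRDp// subrr powRr0 mul1r.
  have nblk n : (2 ^ j <= n < 2 ^ j.+1)%N -> n%:R `^ 2 * am n = a n.
    by move=> /andP[jn _]; apply: aE; rewrite (leq_trans _ jn)// expn_gt0.
  have HH := HE (fun x => A^-1 * Ere a 1 (2 ^ j) x) (fun x => A^-1 * Eim a 1 (2 ^ j) x)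
    (fun x => A^-1 * (- (2 * pi) * Eim a2 1 (2 ^ j) x))
    (fun x => A^-1 * (2 * pi * Ere a2 1 (2 ^ j) x))
    (fun x => A^-1 * ((2 * pi)^-1 * Eim am (2 ^ j) (2 ^ j.+1) x))
    (fun x => A^-1 * (- (2 * pi)^-1 * Ere am (2 ^ j) (2 ^ j.+1) x))
    (fun x => A^-1 * Ere a (2 ^ j) (2 ^ j.+1) x) (fun x => A^-1 * Eim a (2 ^ j) (2 ^ j.+1) x) k lam.
  apply: HH.
  - by move=> x; apply: is_deriveZl; exact: is_derive_Ere.
  - by move=> x; apply: is_deriveZl; exact: is_derive_Eim.
  - move=> x; apply: is_deriveZl.
    have := is_deriveZl (2 * pi)^-1 (is_derive_Eim am (2 ^ j) (2 ^ j.+1) x).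
    by rewrite mulrA mulVf ?gt_eqF// mul1r (eq_Ere _ nblk).
  - move=> x; apply: is_deriveZl.
    have := is_deriveZl (- (2 * pi)^-1) (is_derive_Ere am (2 ^ j) (2 ^ j.+1) x).
    by rewrite mulrA mulrNN mulVf ?gt_eqF// mul1r (eq_Eim _ nblk).
  - by do 2 apply: continuousZ; exact: continuous_Eim.
  - by do 2 apply: continuousZ; exact: continuous_Ere.
  - by apply: continuousZ; exact: continuous_Ere.
  - by apply: continuousZ; exact: continuous_Eim.
  - by apply: bmZ; exact: bm_Ere.
  - by apply: bmZ; exact: bm_Eim.
  - by do 2 apply: bmZ; exact: bm_Eim.
  - by do 2 apply: bmZ; exact: bm_Ere.
  - by do 2 apply: bmZ; exact: bm_Eim.
  - by do 2 apply: bmZ; exact: bm_Ere.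
  - by apply: bmZ; exact: bm_Ere.
  - by apply: bmZ; exact: bm_Eim.
  - by rewrite Ere_periodic01.
  - by rewrite Eim_periodic01.
  - by rewrite Eim_periodic01.
  - by rewrite Ere_periodic01.
  - exact: k0.
  - exact: l1.
  - rewrite powR_sqr ?(ltW k0)//.
    apply: le_trans (@I_scaled_square p (A^-1 * (2 * pi)) (K1 * 4 ^+ j * Ab) a2 1 (2 ^ j) _ _ p0 _ _ _
      (high j (ltnW jJ))) _.
    + by rewrite mulr_ge0// ltW.
    + by apply: ltW; rewrite !mulr_gt0// exprn_gt0.
    + by move=> x; rewrite !exprMn /Emod sqr_cmod; ring.
    apply: ler_pow; first exact: ltW.
      apply: ltW; apply: mulr_gt0; first exact: mulr_gt0.
      by rewrite !mulr_gt0// exprn_gt0.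
    have -> : A^-1 * (2 * pi) * (K1 * 4 ^+ j * Ab) = k * (Ab / A) by rewrite /k; ring.
    by rewrite -[X in _ <= X]mulr1 ler_wpM2l ?(ltW k0)// ler_pdivrMr// mul1r.
  - have -> : (k ^- 2) `^ (p / 2) = (k^-1) `^ p by rewrite -exprVn powR_sqr// invr_ge0 ltW.
    have amblk : I (fun x => Emod am (2 ^ j) (2 ^ j.+1) x `^ p) <= (K2 * 4^-1 ^+ j * Ab) `^ p.
      have := HK2 j p Ab a p1 Ab0 (blk j jJ); rewrite fourm => h.
      by apply: h => //; rewrite leq_exp2l.
    apply: le_trans (@I_scaled_square p (A^-1 * (2 * pi)^-1) (K2 * 4^-1 ^+ j * Ab) am (2 ^ j) (2 ^ j.+1)
      _ _ p0 _ _ _ amblk) _.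
    + by rewrite mulr_ge0// ltW.
    + by apply: ltW; rewrite !mulr_gt0// exprn_gt0// invr_gt0.
    + by move=> x; rewrite !exprMn /Emod sqr_cmod; ring.
    apply: ler_pow; first exact: ltW.
      apply: ltW; apply: mulr_gt0; first exact: mulr_gt0.
      by rewrite !mulr_gt0// exprn_gt0// invr_gt0.
    have -> : A^-1 / (2 * pi) * (K2 * 4^-1 ^+ j * Ab) = k^-1 * (K1 * K2 * Ab / A).
      have jN : 4 ^+ j != 0 :> R by rewrite expf_neq0.
      have piN : pi != 0 :> R by rewrite gt_eqF// pi_gt0.
      have AN : A != 0 by rewrite gt_eqF.
      have K1N : K1 != 0 by rewrite gt_eqF.
      by rewrite /k exprVn; move: (@pi R) piN => P piN; field; rewrite piN AN K1N jN.
    rewrite -[X in _ <= X]mulr1 ler_wpM2l ?invr_ge0 ?(ltW k0)// ler_pdivrMr// mul1r /A.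
    by rewrite mulrC ler_wpM2l ?(ltW Ab0)// lerDr.
  - have ablk : I (fun x => Emod a (2 ^ j) (2 ^ j.+1) x `^ p) <= Ab `^ p.
      by apply: (blk j jJ) => //; rewrite leq_exp2l.
    have A10 : 0 <= A^-1 by rewrite ltW.
    have fgE x : (A^-1 * Ere a (2 ^ j) (2 ^ j.+1) x) ^+ 2 + (A^-1 * Eim a (2 ^ j) (2 ^ j.+1) x) ^+ 2 =
        (A^-1 * Emod a (2 ^ j) (2 ^ j.+1) x) ^+ 2.
      by rewrite !exprMn /Emod sqr_cmod; ring.
    apply: le_trans (I_scaled_square p0 A10 (ltW Ab0) fgE ablk) _.
    have q1 : A^-1 * Ab <= 1 by rewrite mulrC ler_pdivrMr// mul1r.
    have q0 : 0 <= A^-1 * Ab by rewrite mulr_ge0// ltW.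
    by have := ler_pow (ltW p0) q0 q1; rewrite powR1.
pose E j := I (energy (p / 2) (fun x => A^-1 * Ere a 1 (2 ^ j) x) (fun x => A^-1 * Eim a 1 (2 ^ j) x)).
have CB : 2 * C <= B by rewrite lerDr.
have E0 : E 0 <= B `^ (p / 2).
  have -> : E 0 = 1.
    rewrite /E (@I_ext _ _ (fun=> 1)) ?I_cst// => x.
    by rewrite /energy /Ere /Eim expn0 !big_geq// mulr0 expr0n/= !addr0 powR1.
  have pp : 0 <= p / 2 by move: r1; clear; lra.
  by have := ler_pow pp ler01 B1; rewrite powR1.
have EJ := energy_iteration r1 CC0 CB B1 E0 step (leqnn J).
have JR : 0 <= J.+1%:R :> R by exact: ler0n.
have -> : C0 * (1 + K1 * K2) * B `^ 2^-1 * l * w J * J.+1%:R `^ 2^-1 = A * (B * J.+1%:R) `^ 2^-1.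
  by rewrite /A /Ab powRM// ?(ltW B0)//; ring.
rewrite powRM ?powR_ge0 ?(ltW A0)// -powRrM [2^-1 * p]mulrC.
have Ap0 : 0 < A `^ p by exact: powR_gt0.
rewrite -ler_pdivrMl//; apply: le_trans EJ.
rewrite -IZ; last by apply: bm_Emod_powR; exact: ltW.
apply: I_le.
- by apply: bmZ; apply: bm_Emod_powR; exact: ltW.
- apply: bm_energy; first by move: r1; clear; lra.
    by apply: bmZ; exact: bm_Ere.
  by apply: bmZ; exact: bm_Eim.
move=> x _; rewrite -powRN /energy.
have -> : A `^ (- p) * Emod a 1 (2 ^ J) x `^ p = ((A^-1 * Emod a 1 (2 ^ J) x) ^+ 2) `^ (p / 2).
  have Ai0 : 0 <= A^-1 by rewrite invr_ge0 ltW.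
  have AE0 : 0 <= A^-1 * Emod a 1 (2 ^ J) x by apply: mulr_ge0 => //; exact: Emod_ge0.
  have AV : A^-1 `^ p = A `^ (- p) by rewrite -powR_inv1 ?(ltW A0)// -powRrM mulN1r.
  by rewrite (powR_sqr p AE0) (powRM p Ai0 (Emod_ge0 _ _ _ _)) AV.
apply: ler_pow; [by move: r1; clear; lra | exact: sqr_ge0 |].
rewrite !exprMn /Emod sqr_cmod mulrDr -addrA; rewrite lerDr.
exact: ler01.
Qed.

End critical_low_frequencies.

(** * Upper bounds in terms of the increment *)

Section upper_bounds.
Variable R : realType.
Implicit Types (s p l x A C v sg : R) (m n j J T : nat) (w c : nat -> R) (g wl : R -> R).

(* Bounds for the increments of the partial sums of [2 ^ T - 1] terms, eventually in [T]. *)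
Definition UB p s g : Prop := exists C d : R, [/\ 0 < C, 0 < d & forall l, 0 < l < d ->
  exists T0, forall T, (T0 <= T)%N -> I (fun x => D s l T x `^ p) <= (C * g l) `^ p].

Lemma bm_D_powR s l T p : 0 <= p -> bm (fun x => D s l T x `^ p).
Proof. by move=> p0; apply: bm_powR => // [x|]; [exact: cmod_ge0 | exact: bm_D]. Qed.

Lemma D_ge0 s l T x : 0 <= D s l T x. Proof. exact: cmod_ge0. Qed.

Lemma I_D_div s l T p (G : R) : 0 <= p -> 0 < G ->
  I (fun x => (D s l T x / G) `^ p) = I (fun x => D s l T x `^ p) / G `^ p.
Proof.
move=> p0 G0; rewrite mulrC -IZ; last exact: bm_D_powR.
by apply: I_ext => x; rewrite powR_div ?D_ge0// mulrC.
Qed.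

Lemma bm_D_div s l T (G : R) : bm (fun x => D s l T x / G).
Proof. by under eq_fun do rewrite mulrC; apply: bmZ; exact: bm_D. Qed.

(** After division by [g l], the inequality [y^p <= 1 + y^q] on a space of mass [1] does the work of
    Hölder's. *)
Lemma UB_mono p q s g (d0 : R) : 0 < d0 -> (forall l, 0 < l < d0 -> 0 < g l) ->
  0 < p <= q -> UB q s g -> UB p s g.
Proof.
move=> d00 g0 /andP[p0 pq] [C [d [C0 dd0 H]]].
have q0 : 0 < q by exact: lt_le_trans pq.
pose C1 := 1 + C `^ q; have C10 : 0 < C1 by rewrite addr_gt0// powR_gt0.
exists (C1 `^ p^-1), (Order.min d d0); split; [by rewrite powR_gt0 | by rewrite lt_min dd0 d00 |].
move=> l /andP[l0]; rewrite lt_min => /andP[ld ld0].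
have G0 : 0 < g l by apply: g0; rewrite l0.
have [|T0 HT] := H l; first by rewrite l0.
exists T0 => T TT; have h := HT T TT.
rewrite powRM ?powR_ge0 ?(ltW G0)// powRVK ?(ltW C10)//.
rewrite -ler_pdivrMr ?powR_gt0// -I_D_div ?(ltW p0)//.
have Y0 x : 0 <= D s l T x / g l by rewrite divr_ge0 ?D_ge0// ltW.
have bY := bm_D_div s l T (g l).
have bYp : bm (fun x => (D s l T x / g l) `^ p) by apply: bm_powR => //; exact: ltW.
have bYq : bm (fun x => (D s l T x / g l) `^ q) by apply: bm_powR => //; exact: ltW.
apply: (@le_trans _ _ (I (fun x => 1 + (D s l T x / g l) `^ q))).
  apply: I_le => // [|x _]; first by apply: bmD => //; exact: bm_cst.
  by apply: powR_le1D; rewrite ?(ltW p0).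
rewrite ID//; last exact: bm_cst.
rewrite I_cst lerD2l I_D_div ?(ltW q0)// ler_pdivrMr ?powR_gt0//.
by rewrite -powRM ?(ltW C0)// ltW.
Qed.

Lemma inv_scale l J : 0 < l -> 4 ^+ J * l <= 2^-1 < 4 ^+ J.+1 * l -> 4^-1 ^+ J <= 8 * l.
Proof.
move=> l0 /andP[_ h]; have j0 : 0 < 4 ^+ J :> R by rewrite exprn_gt0.
rewrite exprVn -[X in X <= _]div1r ler_pdivrMr//.
by move: h; rewrite exprS; clear; lra.
Qed.

(** The block [j] has size [2^(j (sg - 2s)) min(1, 4^j l)], increasing below the scale and
    decreasing above it. The blocks at the scale [2^J] of order [l^(-1/2)] dominate and give
    [l^(s - sg/2)]. *)
Lemma UB_gt p sg s w wl : 1 <= p -> tame w -> Wbound p (2 `^ sg) w ->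
  0 < 2 - 2 * s + sg -> sg < 2 * s ->
  (exists C d : R, [/\ 0 < C, 0 < d & forall l J, 0 < l < d ->
      4 ^+ J * l <= 2^-1 < 4 ^+ J.+1 * l -> w J <= C * wl l]) ->
  UB p s (fun l => l `^ (s - sg / 2) * wl l).
Proof.
move=> p1 tw W th1 th2 [Cw [dw [Cw0 dw0 Hw]]].
have v0 : 0 < 2 `^ sg :> R by rewrite powR_gt0.
have [w0 _ _] := tw.
have t1 : 1 < 2 `^ (2 - 2 * s) * 2 `^ sg :> R by rewrite -powRDp// powR2_gt1.
have uE : 2 `^ (- (2 * s)) * 2 `^ sg = 2 `^ (sg - 2 * s) :> R by rewrite -powRDp// addrC.
have t2 : 2 `^ (- (2 * s)) * 2 `^ sg < 1 :> R.
  by rewrite uE -opprB powRN invf_lt1 ?powR_gt0// powR2_gt1// subr_gt0.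
have [C1 C10 H1] := low_frequencies_gt p1 v0 tw W t1.
have [C2 C20 H2] := high_frequencies p1 v0 tw W t2.
have [K K0 HK] := scale_powR (sg - 2 * s).
exists ((C1 + (C2 + C2)) * K * Cw), (Order.min 2^-1 dw); split.
- by rewrite !mulr_gt0// !addr_gt0.
- by rewrite lt_min dw0 invr_gt0 ltr0n.
move=> l /andP[l0]; rewrite lt_min => /andP[l2 ldw].
have l12 : 0 < l <= 2^-1 by rewrite l0 ltW.
have [J JP] := exists_scale l12; have /andP[Jl _] := JP.
exists J => T JT; set u := _ * _ in uE t2 H1 H2.
have u0 : 0 < u by rewrite uE powR_gt0.
have A0 : 0 < C1 * u ^+ J * w J by rewrite !mulr_gt0// exprn_gt0.
have B0 : 0 < C2 * u ^+ J * w J by rewrite !mulr_gt0// exprn_gt0.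
have l01 : 0 < l <= 1 by move: l12; clear; lra.
apply: le_trans (upper_combine p1 l01 JT A0 B0 (H1 l J l0 Jl) (H2 J T JT)) _.
have p0 : 0 <= p by exact: le_trans ler01 p1.
apply: ler_pow => //; first by rewrite ltW// !addr_gt0.
have [hu _] := HK l J l0 JP.
have eu : u ^+ J = (2 ^+ J) `^ (sg - 2 * s) by rewrite powR_exprn// uE.
have e2 : - ((sg - 2 * s) / 2) = s - sg / 2 by field.
rewrite e2 -eu in hu.
have hw := Hw l J (_ : 0 < l < dw) JP; rewrite l0 ldw in hw; have {hw} hw := hw isT.
have -> : C1 * u ^+ J * w J + (C2 * u ^+ J * w J + C2 * u ^+ J * w J) =
   (C1 + (C2 + C2)) * (u ^+ J * w J) by ring.
have -> : (C1 + (C2 + C2)) * K * Cw * (l `^ (s - sg / 2) * wl l) =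
   (C1 + (C2 + C2)) * ((K * l `^ (s - sg / 2)) * (Cw * wl l)) by ring.
rewrite ler_wpM2l//; first by rewrite ltW// !addr_gt0.
by apply: ler_pM => //; [rewrite exprn_ge0// ltW | exact: ltW].
Qed.

Lemma UB_lt p sg s : 1 <= p -> Wbound p (2 `^ sg) (fun=> 1) ->
  2 - 2 * s + sg < 0 -> UB p s (fun l => l).
Proof.
move=> p1 W th; have tw := @tame1 R.
have v0 : 0 < 2 `^ sg :> R by rewrite powR_gt0.
have small (e : R) : e < 0 -> 2 `^ e < 1 :> R.
  by move=> e0; rewrite -[e]opprK powRN invf_lt1 ?powR_gt0// powR2_gt1// oppr_gt0.
have tE : 2 `^ (2 - 2 * s) * 2 `^ sg = 2 `^ (2 - 2 * s + sg) :> R by rewrite -powRDp.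
have t1 : 2 `^ (2 - 2 * s) * 2 `^ sg < 1 :> R by rewrite tE small.
(* The tail decays faster than [4^-j], so from the scale on it is [O(4^-J) = O(l)], no larger than
   the low frequencies. *)
have uE : 2 `^ (- (2 * s)) * 2 `^ sg = 4^-1 * 2 `^ (2 - 2 * s + sg) :> R.
  rewrite (_ : 4^-1 = 2 `^ (- 2)); last by rewrite powRN powR2// -natrX.
  by rewrite -!powRDp//; congr powR; ring.
have t2 : 2 `^ (- (2 * s)) * 2 `^ sg < 1 :> R.
  by rewrite -powRDp// small//; move: th; clear; lra.
have [C1 C10 H1] := low_frequencies_lt p1 v0 tw W (fun=> erefl) t1.
have [C2 C20 H2] := high_frequencies p1 v0 tw W t2.
exists (C1 + (C2 * 8 + C2 * 8)), 2^-1; split.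
- by rewrite !addr_gt0 ?mulr_gt0.
- by rewrite invr_gt0 ltr0n.
move=> l /andP[l0 l2].
have l12 : 0 < l <= 2^-1 by rewrite l0 ltW.
have [J JP] := exists_scale l12; have /andP[Jl _] := JP.
exists J => T JT; have l01 : 0 < l <= 1 by move: l12; clear; lra.
have A0 : 0 < C1 * l by exact: mulr_gt0.
have B0 : 0 < C2 * 8 * l by rewrite !mulr_gt0.
have p0 : 0 <= p by exact: le_trans ler01 p1.
have hB : I (fun x => Emod (rc s) (2 ^ J) (2 ^ T) x `^ p) <= (C2 * 8 * l) `^ p.
  apply: le_trans (H2 J T JT) _; rewrite mulr1.
  apply: ler_pow => //.
    by rewrite mulr_ge0 ?(ltW C20)// exprn_ge0// mulr_ge0 ?powR_ge0.
  rewrite -mulrA ler_pM2l// uE exprMn; apply: le_trans (inv_scale l0 JP).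
  rewrite -[X in _ <= X]mulr1 ler_wpM2l ?exprn_ge0 ?invr_ge0//.
  by rewrite exprn_ile1 ?powR_ge0// ltW// small.
apply: le_trans (upper_combine p1 l01 JT A0 B0 (H1 l J l0 Jl) hB) _.
by rewrite !mulrDl.
Qed.

(** The tail has ratio [1/4] and adds only [O(l w J)]; the low frequencies add the square root of
    the number [J + 1] of blocks. *)
Lemma UB_eq p sg s w wl : 2 <= p -> tame w -> Wbound p (2 `^ sg) w ->
  2 - 2 * s + sg = 0 ->
  (exists C d : R, [/\ 0 < C, 0 < d & forall l J, 0 < l < d ->
      4 ^+ J * l <= 2^-1 < 4 ^+ J.+1 * l -> w J * J.+1%:R `^ 2^-1 <= C * wl l]) ->
  UB p s (fun l => l * wl l).
Proof.
move=> p2 tw W th [Cw [dw [Cw0 dw0 Hw]]]; have p1 : 1 <= p by move: p2; clear; lra.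
have v0 : 0 < 2 `^ sg :> R by rewrite powR_gt0.
have [w0 _ _] := tw.
have t1 : 2 `^ (2 - 2 * s) * 2 `^ sg = 1 :> R by rewrite -powRDp// th powRr0.
have uE : 2 `^ (- (2 * s)) * 2 `^ sg = 4^-1 :> R.
  rewrite (_ : 4^-1 = 2 `^ (- 2)); last by rewrite powRN powR2// -natrX.
  by rewrite -powRDp//; congr powR; move: th; clear; lra.
have t2 : 2 `^ (- (2 * s)) * 2 `^ sg < 1 :> R by rewrite uE; clear; lra.
have [C1 C10 H1] := low_frequencies_eq p2 v0 tw W t1.
have [C2 C20 H2] := high_frequencies p1 v0 tw W t2.
exists ((C1 + (C2 * 8 + C2 * 8)) * Cw), (Order.min 2^-1 dw); split.
- by rewrite !mulr_gt0// !addr_gt0 ?mulr_gt0.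
- by rewrite lt_min dw0 invr_gt0 ltr0n.
move=> l /andP[l0]; rewrite lt_min => /andP[l2 ldw].
have l12 : 0 < l <= 2^-1 by rewrite l0 ltW.
have [J JP] := exists_scale l12; have /andP[Jl _] := JP.
exists J => T JT; have l01 : 0 < l <= 1 by move: l12; clear; lra.
pose W1 := w J * J.+1%:R `^ 2^-1.
have J1 : 1 <= J.+1%:R `^ 2^-1 :> R.
  have h : 1 <= J.+1%:R :> R by rewrite (ler_nat _ 1).
  have i2 : 0 <= 2^-1 :> R by rewrite invr_ge0.
  by have := ler_pow i2 ler01 h; rewrite powR1.
have W10 : 0 < W1 by rewrite mulr_gt0// (lt_le_trans ltr01).
have A0 : 0 < C1 * l * W1 by rewrite !mulr_gt0.
have B0 : 0 < C2 * 8 * l * W1 by rewrite !mulr_gt0.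
have p0 : 0 <= p by exact: le_trans ler01 p1.
have hA : I (fun x => Emod (ac s l) 1 (2 ^ J) x `^ p) <= (C1 * l * W1) `^ p.
  by apply: le_trans (H1 l J l0 Jl) _; rewrite /W1 mulrA.
have hB : I (fun x => Emod (rc s) (2 ^ J) (2 ^ T) x `^ p) <= (C2 * 8 * l * W1) `^ p.
  apply: le_trans (H2 J T JT) _; apply: ler_pow => //.
    by rewrite !mulr_ge0 ?(ltW C20) ?(ltW (w0 J))// exprn_ge0// uE invr_ge0.
  rewrite uE; apply: ler_pM.
  - by rewrite mulr_ge0 ?(ltW C20)// exprn_ge0// invr_ge0.
  - exact: ltW.
  - by rewrite -mulrA ler_pM2l//; exact: inv_scale JP.
  - by rewrite /W1 ler_peMr// ltW.
apply: le_trans (upper_combine p1 l01 JT A0 B0 hA hB) _.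
apply: ler_pow => //; first by rewrite ltW// !addr_gt0.
have hw := Hw l J (_ : 0 < l < dw) JP; rewrite l0 ldw in hw; have {hw} hw := hw isT.
have -> : C1 * l * W1 + (C2 * 8 * l * W1 + C2 * 8 * l * W1) = (C1 + (C2 * 8 + C2 * 8)) * l * W1 by ring.
have -> : (C1 + (C2 * 8 + C2 * 8)) * Cw * (l * wl l) = (C1 + (C2 * 8 + C2 * 8)) * l * (Cw * wl l) by ring.
by rewrite ler_wpM2l// mulr_ge0 ?(ltW l0)// ltW// !addr_gt0 ?mulr_gt0.
Qed.

Lemma ln4_bounds : 2^-1 <= ln (4 : R) <= 3.
Proof.
apply/andP; split.
  rewrite -ler_expR lnK ?posrE//; apply: (@le_trans _ _ (expR 1)).
    by rewrite ler_expR invf_le1// (ler_nat _ 1).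
  have h : expR (2^-1) ^+ 2 = expR 1 :> R by rewrite -expRM_natl; congr expR; field.
  have h2 : expR (- 2^-1) >= 1 - 2^-1 :> R by have := @expR_ge1Dx R (- 2^-1).
  have h3 : expR (2^-1) <= 2 :> R.
    rewrite -[2^-1]opprK expRN -[X in _ <= X]invrK lef_pV2 ?posrE ?expR_gt0 ?invr_gt0//.
    by apply: le_trans h2; clear; lra.
  rewrite -h (_ : 4 = 2 ^+ 2); last by rewrite -natrX.
  by rewrite ler_pXn2r ?nnegrE ?expR_ge0.
have := @le_ln1Dx R 3; rewrite (_ : 1 + 3 = 4); last by clear; lra.
by apply; clear; lra.
Qed.

(** [J] is of order [log(1 / l)]. Taking [l < exp(-1)] makes the logarithm at least [1], which
    absorbs the additive constants. *)
Lemma scale_log : exists2 d : R, 0 < d <= 4^-1 & forall l J, 0 < l < d ->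
  4 ^+ J * l <= 2^-1 < 4 ^+ J.+1 * l -> J.+1%:R <= 3 * logi l /\ logi l <= 6 * J.+1%:R.
Proof.
exists (Order.min 4^-1 (expR (- 1))).
  by rewrite lt_min expR_gt0 invr_gt0 ltr0n/= ge_min lexx.
move=> l J /andP[l0]; rewrite lt_min => /andP[l4 le] /andP[h1 h2].
have /andP[a1 a2] := ln4_bounds.
have lE : logi l = - ln l by rewrite /logi lnV.
have L1 : 1 <= logi l.
  by rewrite lE lerNr -[X in _ <= X]expRK ler_ln ?posrE ?expR_gt0// ltW.
have J0 : 0 <= J%:R :> R by exact: ler0n.
have JE : J.+1%:R = J%:R + 1 :> R by rewrite natr1.
split.
  have : ln (4 ^+ J * l) <= ln 1 by rewrite ler_ln ?posrE ?mulr_gt0 ?exprn_gt0//; move: h1; clear; lra.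
  rewrite ln1 lnM ?posrE ?exprn_gt0// lnXn// -[ln 4 *+ J]mulr_natl => h.
  have h' := ler_wpM2l J0 a1.
  rewrite lE JE in L1 *; move: h h' L1; clear; lra.
have : ln (2^-1) <= ln (4 ^+ J.+1 * l) by rewrite ler_ln ?posrE ?mulr_gt0 ?exprn_gt0// ltW.
rewrite lnM ?posrE ?exprn_gt0// lnXn// -[ln 4 *+ J.+1]mulr_natl lnV ?posrE// => h.
have h4 : 2 * ln 2 = ln 4 :> R.
  by rewrite mulr_natl -lnXn// -natrX.
have l4' : ln l <= - ln 4 by rewrite -lnV ?posrE// ler_ln ?posrE ?invr_gt0// ltW.
have : J.+1%:R * ln 4 <= J.+1%:R * 3 :> R by rewrite ler_wpM2l.
rewrite lE; move: h h4 l4'; clear; lra.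
Qed.

End upper_bounds.

(** * Lower bounds for the increments *)

Section trigonometric_polynomials.
Variable R : realType.
Implicit Types (P Q A B : {poly R}) (h : nat -> R) (x : R).

(* Polynomials in [e(x)]: [Cp P x] and [Sp P x] are the real and imaginary parts of [P] at
   [e(x)], both instances of the linear form [Lp h] sending ['X^i] to [h i]. *)
Definition Lp h P : R := \sum_(i < size P) P`_i * h i.

Lemma Lp_wide h P N : (size P <= N)%N -> Lp h P = \sum_(i < N) P`_i * h i.
Proof.
move=> PN; rewrite /Lp (big_ord_widen N (fun i => P`_i * h i))// big_mkcond /=.
by apply: eq_bigr => i _; case: ltnP => // iP; rewrite nth_default ?mul0r.
Qed.

Lemma LpD h P Q : Lp h (P + Q) = Lp h P + Lp h Q.
Proof.
pose N := maxn (size P) (size Q).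
rewrite (@Lp_wide h P N) ?leq_maxl// (@Lp_wide h Q N) ?leq_maxr//.
rewrite (@Lp_wide h (P + Q) N) ?size_polyD// -big_split/=.
by apply: eq_bigr => i _; rewrite coefD mulrDl.
Qed.

Lemma Lp0 h : Lp h 0 = 0.
Proof. by rewrite /Lp size_poly0 big_ord0. Qed.

Lemma LpZ h (c : R) P : Lp h (c *: P) = c * Lp h P.
Proof.
rewrite (@Lp_wide h (c *: P) (size P)) ?size_scale_leq// mulr_sumr.
by apply: eq_bigr => i _; rewrite coefZ mulrA.
Qed.

Lemma Lp_sum h (T : Type) (s : seq T) (p : pred T) (F : T -> {poly R}) :
  Lp h (\sum_(i <- s | p i) F i) = \sum_(i <- s | p i) Lp h (F i).
Proof.
elim: s => [|i s IHs]; first by rewrite !big_nil Lp0.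
by rewrite !big_cons; case: ifP => // _; rewrite LpD IHs.
Qed.

Lemma LpXn h k : Lp h 'X^k = h k.
Proof.
rewrite /Lp size_polyXn big_ord_recr/= coefXn eqxx mul1r big1 ?add0r// => i _.
by rewrite coefXn (ltn_eqF (ltn_ord i)) mul0r.
Qed.

Lemma LpMXn h k P : Lp h (P * 'X^k) = Lp (fun i => h (i + k)%N) P.
Proof.
have PE : P = \sum_(i < size P) P`_i *: 'X^i by rewrite -poly_def coefK.
rewrite {1}PE mulr_suml Lp_sum; apply: eq_bigr => i _.
by rewrite -scalerAl -exprD LpZ LpXn.
Qed.

Lemma LpM h P Q : Lp h (P * Q) = \sum_(i < size Q) Q`_i * Lp (fun j => h (j + i)%N) P.
Proof.
have QE : Q = \sum_(i < size Q) Q`_i *: 'X^i by rewrite -poly_def coefK.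
rewrite {1}QE mulr_sumr Lp_sum; apply: eq_bigr => i _.
by rewrite -scalerAr LpZ LpMXn.
Qed.

Definition Cp P x : R := Lp (fun i => cos (2 * pi * i%:R * x)) P.
Definition Sp P x : R := Lp (fun i => sin (2 * pi * i%:R * x)) P.
Definition Mp P x : R := cmod (Cp P x) (Sp P x).

Lemma CpM P Q x : Cp (P * Q) x = Cp P x * Cp Q x - Sp P x * Sp Q x.
Proof.
rewrite {1}/Cp LpM /Cp /Sp {3 5}/Lp !mulr_sumr -sumrB; apply: eq_bigr => i _.
rewrite /Lp !mulr_sumr !mulr_suml -sumrB; apply: eq_bigr => j _.
by rewrite natrD mulrDr mulrDl cosD; ring.
Qed.

Lemma SpM P Q x : Sp (P * Q) x = Sp P x * Cp Q x + Cp P x * Sp Q x.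
Proof.
rewrite {1}/Sp LpM /Cp /Sp {3 5}/Lp !mulr_sumr -big_split; apply: eq_bigr => i _ /=.
rewrite /Lp !mulr_sumr !mulr_suml -big_split; apply: eq_bigr => j _ /=.
by rewrite natrD mulrDr mulrDl sinD; ring.
Qed.

Lemma Mp_ge0 P x : 0 <= Mp P x. Proof. exact: cmod_ge0. Qed.

Lemma MpM P Q x : Mp (P * Q) x = Mp P x * Mp Q x.
Proof.
apply/eqP; rewrite -(@eqrXn2 _ 2)// ?mulr_ge0 ?Mp_ge0//.
by rewrite exprMn !sqr_cmod CpM SpM; apply/eqP; ring.
Qed.

Lemma MpX P k x : Mp (P ^+ k) x = Mp P x ^+ k.
Proof.
elim: k => [|k IHk]; last by rewrite !exprS MpM IHk.
rewrite !expr0 /Mp /Cp /Sp -(expr0 'X) !LpXn /cmod.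
by rewrite mulr0 mul0r cos0 sin0 expr1n expr0n/= addr0 sqrtr1.
Qed.

Lemma bm_Cp P : bm (Cp P).
Proof. by apply: bm_sum => i _; apply: bmZ; exact: bm_cosZ. Qed.

Lemma bm_Sp P : bm (Sp P).
Proof. by apply: bm_sum => i _; apply: bmZ; exact: bm_sinZ. Qed.

Lemma bm_Mp P : bm (Mp P).
Proof. by apply: bm_cmod; [exact: bm_Cp | exact: bm_Sp]. Qed.

Lemma I_cos_nat (n : nat) : I (fun x : R => cos (2 * pi * n%:R * x)) = (n == 0)%:R.
Proof.
have [->|n0] := posnP n.
  by rewrite (@I_ext _ _ (fun=> 1)) ?I_cst// => x; rewrite mulr0 mul0r cos0.
have c0 : 2 * pi * n%:R != 0 :> R.
  by rewrite gt_eqF// !mulr_gt0 ?pi_gt0// ltr0n.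
apply: (@I_derive R (fun x => (2 * pi * n%:R)^-1 * sin (2 * pi * n%:R * x))).
- move=> x; have h := is_derive1_comp (is_derive_sin _) (is_derive_linear (2 * pi * n%:R) x).
  have := is_deriveZl (2 * pi * n%:R)^-1 h.
  by rewrite mulrCA mulVf// mulr1.
- move=> x; apply: continuous_comp; last exact: continuous_cos.
  by have := @continuous_affine R (2 * pi * n%:R) 0 x; under eq_fun do rewrite addr0.
- congr (_ * _); rewrite mulr1 mulr0 -(sin_2pi_int 0 n%:Z) add0r.
  by [].
Qed.

Lemma I_cos_diff (i j : nat) :
  I (fun x : R => cos (2 * pi * i%:R * x - 2 * pi * j%:R * x)) = (i == j)%:R.
Proof.
wlog ij : i j / (j <= i)%N.
  move=> hw; have [ji|/ltnW ij] := leqP j i; first exact: hw.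
  rewrite eq_sym -(hw _ _ ij); apply: I_ext => x; rewrite -[RHS]cosN; congr cos; ring.
have -> : (i == j) = (i - j == 0)%N by rewrite subn_eq0 eqn_leq ij andbT.
rewrite -I_cos_nat; apply: I_ext => x; rewrite natrB//; congr cos; ring.
Qed.

Lemma parseval A B : I (fun x => Cp A x * Cp B x + Sp A x * Sp B x) =
  \sum_(i < size B) A`_i * B`_i.
Proof.
pose F i j x : R := A`_i * B`_j * cos (2 * pi * i%:R * x - 2 * pi * j%:R * x).
have bF i j : bm (F i j).
  apply: bmZ; under eq_fun do rewrite -mulrBl; exact: bm_cosZ.
rewrite (@I_ext _ _ (fun x => \sum_(j < size B) \sum_(i < size A) F i j x)); last first.
  move=> x; rewrite /Cp /Sp /Lp !mulr_sumr -big_split; apply: eq_bigr => j _ /=.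
  rewrite !mulr_suml -big_split; apply: eq_bigr => i _ /=.
  by rewrite /F cosB; ring.
rewrite I_sum; last by move=> j _; exact: bm_sum.
apply: eq_bigr => j _; rewrite I_sum//.
have IF i : I (F i j) = A`_i * B`_j * (i == j)%:R.
  rewrite /F IZ ?I_cos_diff//; under eq_fun do rewrite -mulrBl; exact: bm_cosZ.
under eq_bigr do rewrite IF.
have [jA|Aj] := ltnP j (size A).
  rewrite (bigD1 (Ordinal jA))//= eqxx mulr1 big1 ?addr0// => i ij.
  rewrite (_ : (i == j :> nat) = false) ?mulr0//; apply/negbTE; move: ij; rewrite -(inj_eq val_inj).
  by [].
rewrite big1 ?(nth_default _ Aj) ?mul0r// => i _.
by rewrite ltn_eqF ?mulr0// (leq_trans (ltn_ord i)).
Qed.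

Lemma sqr_Mp_parseval A : I (fun x => Mp A x ^+ 2) = \sum_(i < size A) A`_i ^+ 2.
Proof.
rewrite (@I_ext _ _ (fun x => Cp A x * Cp A x + Sp A x * Sp A x)); last first.
  by move=> x; rewrite /Mp sqr_cmod !expr2.
by rewrite parseval; apply: eq_bigr => i _; rewrite expr2.
Qed.

(* Integrates [A Q \bar B]. *)
Lemma duality A Q B : \sum_(i < size B) (A * Q)`_i * B`_i <= I (fun x => Mp A x * (Mp Q x * Mp B x)).
Proof.
rewrite -parseval; apply: I_le.
- by apply: bmD; apply: bmM; [exact: bm_Cp|exact: bm_Cp|exact: bm_Sp|exact: bm_Sp].
- by apply: bmM; [exact: bm_Mp | apply: bmM; exact: bm_Mp].
move=> x _; rewrite mulrA -MpM; set P := A * Q.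
have [h|h] := leP (Cp P x * Cp B x + Sp P x * Sp B x) 0.
  by apply: le_trans h _; rewrite mulr_ge0 ?Mp_ge0.
rewrite -(@ler_pXn2r _ 2)// ?nnegrE ?mulr_ge0 ?Mp_ge0 ?(ltW h)//.
rewrite exprMn !sqr_cmod; have := sqr_ge0 (Cp P x * Sp B x - Sp P x * Cp B x).
by clear; lra.
Qed.

(** As polynomials in [e(x)], sums over the squares can be multiplied and raised to powers, and
    their Fourier coefficients are polynomial coefficients. *)
Definition sqpoly (c : nat -> R) m n : {poly R} := \sum_(m <= j < n) c j *: 'X^(j ^ 2).

Lemma Mp_sqpoly c m n x : Mp (sqpoly c m n) x = Emod c m n x.
Proof.
rewrite /Mp /Cp /Sp /sqpoly !Lp_sum /Emod /Ere /Eim; congr cmod; apply: eq_bigr => j _;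
  by rewrite LpZ LpXn.
Qed.

Lemma coef_sqpoly c m n k : (sqpoly c m n)`_(k ^ 2) = if (m <= k < n)%N then c k else 0.
Proof.
rewrite /sqpoly coef_sum; under eq_bigr do rewrite coefZ coefXn eqn_exp2r//.
case: ifPn => [/andP[mk kn]|kmn].
  rewrite (@big_cat_nat _ _ _ k)//=; last exact: ltnW.
  rewrite [X in _ + X]big_ltn// eqxx mulr1 big_nat big1 ?add0r; last first.
    by move=> i /andP[_ ik]; rewrite (gtn_eqF ik) mulr0.
  rewrite big_nat big1 ?addr0// => i /andP[ki _]; by rewrite (ltn_eqF ki) mulr0.
rewrite big_nat big1// => i imn; case: eqP => [ki|_]; last by rewrite mulr0.
by move: kmn; rewrite ki imn.
Qed.

Lemma coef_sqpoly_nonsquare c m n i : (forall k, i != (k ^ 2)%N) -> (sqpoly c m n)`_i = 0.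
Proof.
move=> ik; rewrite /sqpoly coef_sum big1// => j _.
by rewrite coefZ coefXn (negPf (ik j)) mulr0.
Qed.

Lemma sqpoly_coef_ind (p : nat -> R -> Prop) c m n : (forall i, p i 0) ->
  (forall k, (m <= k < n)%N -> p (k ^ 2)%N (c k)) -> forall i, p i (sqpoly c m n)`_i.
Proof.
move=> p0 pc i; have [[k ->]|ni] := pselect (exists k, i = (k ^ 2)%N).
  by rewrite coef_sqpoly; case: ifPn => // kmn; exact: pc.
rewrite coef_sqpoly_nonsquare// => k; apply/eqP => ik; apply: ni; by exists k.
Qed.

End trigonometric_polynomials.

(** * Parseval's formula and changes of exponent *)

Section lower_bounds.
Variable R : realType.
Implicit Types (s p l x A C v sg : R) (m n j J T : nat) (c : nat -> R) (g : R -> R).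

Definition LB p s g : Prop := exists C d : R, [/\ 0 < C, 0 < d & forall l, 0 < l < d ->
  exists T0, forall T, (T0 <= T)%N -> (C * g l) `^ p <= I (fun x => D s l T x `^ p)].

(** Divided by its lower bound the increment has a [q]-th moment at least [1]; of this,
    [y^q <= 1/2 + K y^p] leaves half for the [p]-th moment. *)
Lemma LB_ge p q s g (d0 : R) : 0 < d0 -> (forall l, 0 < l < d0 -> 0 < g l) ->
  0 < q <= p -> LB q s g -> LB p s g.
Proof.
move=> d00 g0 /andP[q0 qp] [C [d [C0 dd0 H]]].
have p0 : 0 < p by exact: lt_le_trans qp.
have h2 : 0 < 2^-1 :> R by rewrite invr_gt0.
have qp' : 0 < q <= p by rewrite q0.
have [K K0 HK] := @powR_le_epsD R q p _ qp' h2.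
have C10 : 0 < (2 * K)^-1 by rewrite invr_gt0 mulr_gt0.
exists (C * (2 * K)^-1 `^ p^-1), (Order.min d d0); split.
- by rewrite mulr_gt0// powR_gt0.
- by rewrite lt_min dd0 d00.
move=> l /andP[l0]; rewrite lt_min => /andP[ld ld0].
have G0 : 0 < C * g l by rewrite mulr_gt0// g0// l0.
have [|T0 HT] := H l; first by rewrite l0.
exists T0 => T TT; have h := HT T TT.
rewrite mulrAC (powRM _ (ltW G0) (powR_ge0 _ _)) (powRVK p0 (ltW C10)).
rewrite mulrC -(ler_pdivlMr _ _ (powR_gt0 p G0)) -(I_D_div _ _ _ (ltW p0) G0).
have bY := bm_D_div s l T (C * g l).
have Y0 x : 0 <= D s l T x / (C * g l) by rewrite divr_ge0 ?D_ge0// ltW.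
have bYp : bm (fun x => (D s l T x / (C * g l)) `^ p) by apply: bm_powR => //; exact: ltW.
have bYq : bm (fun x => (D s l T x / (C * g l)) `^ q) by apply: bm_powR => //; exact: ltW.
have h1 : 1 <= I (fun x => (D s l T x / (C * g l)) `^ q).
  by rewrite I_D_div ?(ltW q0)// ler_pdivlMr ?powR_gt0// mul1r.
have h3 : I (fun x => (D s l T x / (C * g l)) `^ q) <=
    I (fun x => 2^-1 + K * (D s l T x / (C * g l)) `^ p).
  by apply: I_le => //; [apply: bmD; [exact: bm_cst | exact: bmZ] | move=> x _; exact: HK].
rewrite (ID (bm_cst _) (bmZ _ bYp)) I_cst (IZ _ bYp) in h3.
rewrite -[X in X <= _]div1r ler_pdivrMr ?mulr_gt0//.
by move: h1 h3; set u := I _; set v := I _; clearbody u v; clear; lra.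
Qed.

(* Lower norms: [L^q] is interpolated between [L^p] and [L^r]. *)
Lemma LB_le p q r s g (d0 : R) : 0 < d0 -> (forall l, 0 < l < d0 -> 0 < g l) ->
  0 < p -> p <= q -> q < r -> LB q s g -> UB r s g -> LB p s g.
Proof.
move=> d00 g0 p0 pq qr [C [d [C0 dd0 H]]] [C' [d' [C'0 dd'0 H']]].
have q0 : 0 < q by exact: lt_le_trans pq.
have r0 : 0 < r by exact: lt_trans qr.
have c0 : 0 < C `^ q by rewrite powR_gt0.
have c'0 : 0 < C' `^ r by rewrite powR_gt0.
(* With this [eps] the [r]-th moment takes at most half of the lower bound [C^q]. *)
have e0 : 0 < C `^ q / (2 * C' `^ r) by rewrite divr_gt0// mulr_gt0.
have [K K0 HK] := @powR_interpolate R p q r _ p0 pq qr e0.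
have C10 : 0 < C `^ q / (2 * K) by rewrite divr_gt0// mulr_gt0.
exists ((C `^ q / (2 * K)) `^ p^-1), (Order.min (Order.min d d') d0); split.
- by rewrite powR_gt0.
- by rewrite !lt_min dd0 dd'0 d00.
move=> l /andP[l0]; rewrite !lt_min => /andP[/andP[ld ld'] ld0].
have G0 : 0 < g l by rewrite g0// l0.
have [|T0 HT] := H l; first by rewrite l0.
have [|T0' HT'] := H' l; first by rewrite l0.
exists (maxn T0 T0') => T; rewrite geq_max => /andP[TT TT'].
have h := HT T TT; have h' := HT' T TT'.
rewrite (powRM _ (powR_ge0 _ _) (ltW G0)) (powRVK p0 (ltW C10)).
rewrite -(ler_pdivlMr _ _ (powR_gt0 p G0)) -(I_D_div _ _ _ (ltW p0) G0).
have bY := bm_D_div s l T (g l).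
have Y0 x : 0 <= D s l T x / g l by rewrite divr_ge0 ?D_ge0// ltW.
have bYe (e : R) : 0 < e -> bm (fun x => (D s l T x / g l) `^ e) by move=> ?; apply: bm_powR => //; exact: ltW.
have h1 : C `^ q <= I (fun x => (D s l T x / g l) `^ q).
  by rewrite I_D_div ?(ltW q0)// ler_pdivlMr ?powR_gt0// -powRM// ltW.
have h2 : I (fun x => (D s l T x / g l) `^ r) <= C' `^ r.
  by rewrite I_D_div ?(ltW r0)// ler_pdivrMr ?powR_gt0// -powRM// ltW.
have h3 : I (fun x => (D s l T x / g l) `^ q) <=
    I (fun x => C `^ q / (2 * C' `^ r) * (D s l T x / g l) `^ r + K * (D s l T x / g l) `^ p).
  apply: I_le => [||x _]; [exact: bYe|by apply: bmD; apply: bmZ; exact: bYe|exact: HK].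
rewrite ID ?IZ in h3; try (by apply: bYe) || (by apply: bmZ; exact: bYe).
have h4 := ler_wpM2l (ltW e0) h2.
rewrite ler_pdivrMr ?mulr_gt0//.
have e1 : C `^ q / (2 * C' `^ r) * C' `^ r = C `^ q / 2 by field; rewrite gt_eqF.
rewrite e1 in h4; move: h1 h3 h4; set u := I _; set v := I _; set w := I _; clearbody u v w; clear; lra.
Qed.

Lemma Lp_sqpoly (h : nat -> R) c m n : Lp h (sqpoly c m n) = \sum_(m <= j < n) c j * h (j ^ 2)%N.
Proof. by rewrite /sqpoly Lp_sum; apply: eq_bigr => j _; rewrite LpZ LpXn. Qed.

Lemma sqr_Emod_parseval c m n : I (fun x => Emod c m n x ^+ 2) = \sum_(m <= j < n) c j ^+ 2.
Proof.
rewrite -(@I_ext _ (fun x => Mp (sqpoly c m n) x ^+ 2)); last by move=> x; rewrite Mp_sqpoly.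
rewrite sqr_Mp_parseval.
transitivity (Lp (fun i => (sqpoly c m n)`_i) (sqpoly c m n)).
  by apply: eq_bigr => i _; rewrite expr2.
rewrite Lp_sqpoly big_nat [RHS]big_nat; apply: eq_bigr => j jmn.
by rewrite coef_sqpoly jmn expr2.
Qed.

Lemma ac_ge s l n : 0 < l -> (0 < n)%N -> n%:R ^+ 2 * l <= 2^-1 ->
  l * n%:R `^ (2 - 2 * s) <= ac s l n.
Proof.
move=> l0 n0 nl; have n0' : 0 < n%:R :> R by rewrite ltr0n.
have pi2 : 2 <= pi :> R := pi_ge2 R.
have u0 : 0 <= n%:R ^+ 2 * l by rewrite mulr_ge0 ?sqr_ge0 ?(ltW l0).
rewrite /ac /rc powRDp// powR2 ?ler0n// mulrA mulrC.
rewrite ler_wpM2l ?powR_ge0//.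
have h : pi * n%:R ^+ 2 * l / 4 <= sin (pi * n%:R ^+ 2 * l).
  apply: sin_ge_quarter; rewrite -mulrA mulr_ge0 ?pi_ge0//= ler_wpM2l ?pi_ge0//.
have h2 := ler_wpM2r u0 pi2; rewrite mulrA in h2.
by move: h h2; rewrite [l * _]mulrC; clear; lra.
Qed.

Lemma pow_window (e : R) : exists2 c : R, 0 < c & forall J n,
  (2 ^ J <= n <= 2 ^ J.+1)%N -> c * (2 ^+ J) `^ e <= n%:R `^ e.
Proof.
exists (Order.min 1 (2 `^ e)); first by rewrite lt_min ltr01 powR_gt0.
move=> J n /andP[h1 h2]; have x0 : 0 < 2 ^+ J :> R by rewrite exprn_gt0.
have h1' : 2 ^+ J <= n%:R :> R by rewrite -natrX ler_nat.
have h2' : n%:R <= 2 * 2 ^+ J :> R by rewrite -exprS -natrX ler_nat.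
have [e0|e0] := leP 0 e.
  apply: (@le_trans _ _ (1 * (2 ^+ J) `^ e)); last by rewrite mul1r ler_pow ?(ltW x0).
  by rewrite ler_wpM2r ?powR_ge0// ge_min lexx.
apply: (@le_trans _ _ (2 `^ e * (2 ^+ J) `^ e)); first by rewrite ler_wpM2r ?powR_ge0// ge_min lexx orbT.
rewrite -powRM ?(ltW x0)//; apply: ler_pow_neg => //; [exact: ltW | exact: lt_le_trans h1'].
Qed.

Lemma scale_pos l J : 4 ^+ J * l <= 2^-1 < 4 ^+ J.+1 * l -> l < 8^-1 -> (0 < J)%N.
Proof. by case: J => // /andP[_]; rewrite expr1 => h1 h2; move: h1 h2; clear; lra. Qed.

Lemma scale_index l J n : 0 < l -> 4 ^+ J * l <= 2^-1 -> (n <= 2 ^ J)%N -> n%:R ^+ 2 * l <= 2^-1.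
Proof.
move=> l0 h nJ; apply: le_trans h; rewrite ler_wpM2r ?(ltW l0)// four_pow.
by rewrite ler_pXn2r ?nnegrE ?ler0n ?exprn_ge0// -natrX ler_nat.
Qed.

(* Only the coefficients with [n ^ 2 * l <= 1 / 2] are kept in Parseval's formula. *)
Lemma energy_ge s l J T : 0 < l <= 2^-1 -> 4 ^+ J * l <= 2^-1 -> (J <= T)%N ->
  l ^+ 2 * \sum_(1 <= n < 2 ^ J) (n%:R `^ (2 - 2 * s)) ^+ 2 <= I (fun x => D s l T x `^ 2).
Proof.
move=> /andP[l0 l2] Jl JT; rewrite I_D//; last by move: l0 l2; clear; lra.
rewrite (@I_ext _ _ (fun x => Emod (ac s l) 1 (2 ^ T) x ^+ 2)); last first.
  by move=> x; rewrite powR2 ?Emod_ge0.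
have j1 : (1 <= 2 ^ J)%N by rewrite expn_gt0.
have j2 : (2 ^ J <= 2 ^ T)%N by rewrite leq_exp2l.
rewrite sqr_Emod_parseval.
apply: (@le_trans _ _ (\sum_(1 <= n < 2 ^ J) ac s l n ^+ 2)); last first.
  by rewrite [X in _ <= X](@big_cat_nat _ _ _ (2 ^ J))//= lerDl sumr_ge0// => i _; exact: sqr_ge0.
rewrite mulr_sumr; apply: ler_sum_nat => n /andP[n0 nJ]; rewrite -exprMn.
have h := ac_ge s l0 n0 (scale_index l0 Jl (ltnW nJ)).
have h0 : 0 <= l * n%:R `^ (2 - 2 * s) by rewrite mulr_ge0 ?powR_ge0// ltW.
by rewrite ler_pXn2r ?nnegrE// (le_trans h0).
Qed.

(** One dyadic block just below the scale suffices: [2^J] coefficients of size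
    [l 2^(J (2 - 2s))]. *)
Lemma LB2_power s : LB 2 s (fun l => l `^ (s - 4^-1)).
Proof.
have [c c0 Hc] := pow_window (2 - 2 * s).
have [K K0 HK] := scale_powR (2^-1 + (2 - 2 * s)).
(* The scale is [2 X] with [X] the left end of the block; the factor [2^(2s - 3)] pays for replacing
   [2 X] by [X]. *)
exists (c * K^-1 * (2 `^ (2 * s - 3))), 8^-1; split.
- by rewrite !mulr_gt0 ?invr_gt0 ?powR_gt0.
- by rewrite invr_gt0.
move=> l /andP[l0 l8]; have l12 : 0 < l <= 2^-1 by move: l0 l8; clear; lra.
have [J JP] := exists_scale l12; have /andP[Jl _] := JP.
have := scale_pos JP l8; case: J JP Jl => // J JP Jl _.
exists J.+1 => T JT; apply: le_trans (energy_ge s l12 Jl JT).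
rewrite powR2; last by rewrite !mulr_ge0 ?invr_ge0 ?powR_ge0 ?(ltW K0) ?(ltW c0).
set e := 2 - 2 * s in Hc HK *.
set X := 2 ^+ J : R.
have X0 : 0 < X by rewrite exprn_gt0.
have j1 : (1 <= 2 ^ J)%N by rewrite expn_gt0.
have j2 : (2 ^ J <= 2 ^ J.+1)%N by rewrite leq_exp2l.
apply: (@le_trans _ _ (l ^+ 2 * (X * (c * X `^ e) ^+ 2))); last first.
  rewrite ler_wpM2l ?sqr_ge0// (@big_cat_nat _ _ _ (2 ^ J))//=.
  apply: (@le_trans _ _ (\sum_(2 ^ J <= n < 2 ^ J.+1) (n%:R `^ e) ^+ 2)); last first.
    by rewrite lerDr sumr_ge0// => i _; exact: sqr_ge0.
  apply: (@le_trans _ _ (\sum_(2 ^ J <= n < 2 ^ J.+1) (c * X `^ e) ^+ 2)); last first.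
    apply: ler_sum_nat => n /andP[n0 nJ].
    have h : c * X `^ e <= n%:R `^ e by apply: Hc; rewrite n0 ltnW.
    have h0 : 0 <= c * X `^ e by rewrite mulr_ge0 ?powR_ge0// ltW.
    by rewrite ler_pXn2r ?nnegrE// (le_trans h0).
  rewrite sumr_const_nat -[X in _ <= X]mulr_natl expnS mul2n -addnn addnK natrX.
  by [].
have [_] := HK l J.+1 l0 JP.
have -> : - ((2^-1 + e) / 2) = s - 4^-1 - 1 by rewrite /e; field.
rewrite exprS -/X => h.
have hX : X = (X `^ 2^-1) ^+ 2 by rewrite -powR2 ?powR_ge0// powRVK// ltW.
rewrite {1}hX -!exprMn ler_pXn2r ?nnegrE; first last.
- by rewrite !mulr_ge0 ?powR_ge0 ?(ltW l0) ?(ltW c0).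
- by rewrite !mulr_ge0 ?invr_ge0 ?powR_ge0 ?(ltW K0) ?(ltW c0).
- by [].
rewrite -[s - 4^-1](subrK 1) powRS//.
have h' := ler_wpM2l (ltW l0) h.
have -> : c * K^-1 * 2 `^ (2 * s - 3) * (l `^ (s - 4^-1 - 1) * l) =
   c * 2 `^ (2 * s - 3) * K^-1 * (l * l `^ (s - 4^-1 - 1)) by ring.
apply: (@le_trans _ _ (c * 2 `^ (2 * s - 3) * K^-1 * (l * (K * (2 * X) `^ (2^-1 + e))))).
  by rewrite ler_wpM2l// !mulr_ge0 ?invr_ge0 ?powR_ge0 ?(ltW K0) ?(ltW c0).
have -> : c * 2 `^ (2 * s - 3) * K^-1 * (l * (K * (2 * X) `^ (2^-1 + e))) =
  c * 2 `^ (2 * s - 3) * l * (2 * X) `^ (2^-1 + e) by field; rewrite gt_eqF.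
rewrite powRM ?(ltW X0)// [X `^ (2^-1 + e)]powRDp//.
have t1 : 2 `^ (2 * s - 3) * 2 `^ (2^-1 + e) <= 1 :> R.
  rewrite -powRDp// (_ : _ + _ = - 2^-1); last by rewrite /e; field.
  by rewrite powRN invf_le1 ?powR_gt0// ltW// powR2_gt1// invr_gt0.
have -> : c * 2 `^ (2 * s - 3) * l * (2 `^ (2^-1 + e) * (X `^ 2^-1 * X `^ e)) =
  l * (X `^ 2^-1 * (c * X `^ e)) * (2 `^ (2 * s - 3) * 2 `^ (2^-1 + e)) by ring.
by rewrite ler_piMr// !mulr_ge0 ?powR_ge0 ?(ltW l0) ?(ltW c0).
Qed.

(** The single coefficient [n = 1] already gives [l]. *)
Lemma LB2_linear s : LB 2 s (fun l => l).
Proof.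
exists 1, 8^-1; split => //.
move=> l /andP[l0 l8]; have l12 : 0 < l <= 2^-1 by move: l0 l8; clear; lra.
have [J JP] := exists_scale l12; have /andP[Jl _] := JP.
have J0 := scale_pos JP l8.
exists J => T JT; apply: le_trans (energy_ge s l12 Jl JT).
rewrite mul1r powR2 ?(ltW l0)// -[X in X <= _]mulr1 ler_wpM2l ?sqr_ge0//.
rewrite big_ltn; last by rewrite -{1}(expn0 2) ltn_exp2l.
by rewrite powR1 expr1n lerDl sumr_ge0// => i _; exact: sqr_ge0.
Qed.

Lemma harmonic_ge J : J%:R / 2 <= \sum_(1 <= n < 2 ^ J) n%:R^-1 :> R.
Proof.
elim: J => [|J IHJ]; first by rewrite mul0r sumr_ge0// => i _; rewrite invr_ge0.
have j1 : (1 <= 2 ^ J)%N by rewrite expn_gt0.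
have j2 : (2 ^ J <= 2 ^ J.+1)%N by rewrite leq_exp2l.
rewrite (@big_cat_nat _ _ _ (2 ^ J))//= -[J.+1%:R]natr1 mulrDl lerD//.
apply: (@le_trans _ _ (\sum_(2 ^ J <= n < 2 ^ J.+1) (2 ^ J.+1)%N%:R^-1)); last first.
  apply: ler_sum_nat => n /andP[n0 nJ].
  by rewrite lef_pV2 ?posrE ?ltr0n ?expn_gt0// ?(leq_trans j1)// ler_nat ltnW.
rewrite sumr_const_nat expnS mul2n -addnn addnK -[X in _ <= X]mulr_natl natrD.
have h : 0 < (2 ^ J)%:R :> R by rewrite ltr0n expn_gt0.
have -> : (2 ^ J)%:R / ((2 ^ J)%:R + (2 ^ J)%:R) = 1 / 2 :> R by field; rewrite gt_eqF.
by [].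
Qed.

(** For [s = 5/4] the squares [(n^(2 - 2s))^2] are [1 / n], and the harmonic sum up to [2^J] is of
    order [log(1 / l)]. *)
Lemma LB2_log s : s = 5 / 4 -> LB 2 s (fun l => l * logi l `^ 2^-1).
Proof.
move=> sE; have [d /andP[d0 d4] Hd] := @scale_log R.
exists (5^-1), (Order.min 8^-1 d); split => //; first by rewrite lt_min d0 andbT.
move=> l /andP[l0]; rewrite lt_min => /andP[l8 ld].
have l12 : 0 < l <= 2^-1 by move: l0 l8; clear; lra.
have [J JP] := exists_scale l12; have /andP[Jl _] := JP.
have J0 := scale_pos JP l8.
exists J => T JT; apply: le_trans (energy_ge s l12 Jl JT).
have [|h1 h2] := Hd l J _ JP; first by rewrite l0.
have L0 : 0 <= logi l by move: h1 (ler0n R J.+1); clear; lra.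
rewrite powR2; last by rewrite !mulr_ge0 ?powR_ge0 ?(ltW l0).
have hL : (logi l `^ 2^-1) ^+ 2 = logi l by rewrite -powR2 ?powR_ge0// powRVK.
rewrite mulrCA exprMn ler_wpM2l ?sqr_ge0// exprMn hL.
rewrite (eq_bigr (fun n => n%:R^-1)); last first.
  move=> n _; rewrite sE -powR2 ?powR_ge0// -powRrM (_ : _ * 2 = -1); last by field.
  by rewrite powR_inv1// ler0n.
apply: le_trans (harmonic_ge J).
have J1 : 1 <= J%:R :> R by rewrite (ler_nat _ 1).
by rewrite -[J.+1%:R]natr1 in h2; move: h2 J1 L0; rewrite exprVn -natrX; clear; lra.
Qed.

End lower_bounds.

(** * Concentration at the origin *)

Section fejer_kernel_test.
Variable R : realType.
Implicit Types (s p l x C : R) (m n j J T : nat) (c : nat -> R) (A B P Q : {poly R}).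

Lemma sqpoly_duality c m n Q B :
  \sum_(m <= j < n) c j * Lp (fun i => B`_(i + j ^ 2)) Q <= I (fun x => Emod c m n x * (Mp Q x * Mp B x)).
Proof.
rewrite (@I_ext _ _ (fun x => Mp (sqpoly c m n) x * (Mp Q x * Mp B x))); last first.
  by move=> x; rewrite Mp_sqpoly.
apply: le_trans (duality _ _ _); rewrite le_eqVlt; apply/orP; left; apply/eqP.
rewrite -(Lp_sqpoly (fun k => Lp (fun i => B`_(i + k)) Q)).
have <- : Lp (fun i => B`_i) (Q * sqpoly c m n) = Lp (fun k => Lp (fun i => B`_(i + k)) Q) (sqpoly c m n).
  by rewrite LpM.
rewrite [Q * _]mulrC; set P := _ * Q.
transitivity (\sum_(i < maxn (size P) (size B)) P`_i * B`_i).
  by apply: Lp_wide; exact: leq_maxl.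
transitivity (\sum_(i < maxn (size P) (size B)) B`_i * P`_i); first by apply: eq_bigr => i _; rewrite mulrC.
rewrite -(@Lp_wide _ (fun i => P`_i)); last exact: leq_maxr.
by apply: eq_bigr => i _; rewrite mulrC.
Qed.

Definition dirichlet_kernel K : {poly R} := \poly_(i < K) 1.

Lemma coef_dirichlet K i : (dirichlet_kernel K)`_i = (i < K)%N%:R.
Proof. by rewrite coef_poly; case: ifP. Qed.

Lemma Mp_dirichlet_le K x : Mp (dirichlet_kernel K) x <= K%:R.
Proof.
have sz : (size (dirichlet_kernel K) <= K)%N by exact: size_poly.
rewrite /Mp /Cp /Sp !(Lp_wide _ sz); apply: le_trans (cmod_sum _ _ _ _) _.
rewrite -[K in X in _ <= X]card_ord -sum1_card natr_sum; apply: ler_sum => i _.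
by rewrite coef_dirichlet ltn_ord !mul1r /cmod cos2Dsin2 sqrtr1.
Qed.

Lemma I_sqr_dirichlet K : I (fun x => Mp (dirichlet_kernel K) x ^+ 2) <= K%:R.
Proof.
rewrite sqr_Mp_parseval; apply: (@le_trans _ _ (\sum_(i < size (dirichlet_kernel K)) 1)).
  by apply: ler_sum => i _; rewrite coef_dirichlet; case: (_ < _)%N; rewrite ?expr1n ?expr0n/= ?ler01.
by rewrite sumr_const card_ord ler_nat; exact: size_poly.
Qed.

(** The correlation at lag [n] counts the [i < 2 M - n], at least [M] of them; these are the
    coefficients of the Fejer kernel [|D|^2]. *)
Lemma fejer_correlation M n : (n <= M)%N ->
  M%:R <= Lp (fun i => (dirichlet_kernel (2 * M))`_(i + n)) (dirichlet_kernel (2 * M)).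
Proof.
move=> nM; have sz : (size (dirichlet_kernel (2 * M)) <= M + M)%N.
  by rewrite addnn -mul2n; exact: size_poly.
rewrite (Lp_wide _ sz) big_split_ord/= -[X in X <= _]addr0 lerD//; last first.
  by apply: sumr_ge0 => i _; rewrite !coef_dirichlet mulr_ge0.
rewrite -[M in X in X <= _]card_ord -sum1_card natr_sum; apply: ler_sum => i _.
rewrite !coef_dirichlet (_ : (i < 2 * M)%N); last by have := ltn_ord i; lia.
by rewrite (_ : (i + n < 2 * M)%N) ?mulr1//; have := ltn_ord i; lia.
Qed.

Lemma fejer_correlation_ge0 K n :
  0 <= Lp (fun i => (dirichlet_kernel K)`_(i + n)) (dirichlet_kernel K).
Proof. by apply: sumr_ge0 => i _; rewrite !coef_dirichlet mulr_ge0. Qed.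

Lemma fejer_correlation_eq0 K n : (K <= n)%N ->
  Lp (fun i => (dirichlet_kernel K)`_(i + n)) (dirichlet_kernel K) = 0.
Proof.
move=> Kn; apply: big1 => i _; rewrite !coef_dirichlet [X in _ * X](_ : _ = 0) ?mulr0//.
by rewrite ltnNge (leq_trans Kn) ?leq_addl.
Qed.

(** Either [y <= b], or [y <= b^(1 - p) y^p]. *)
Lemma powR_test p b y G K : 1 <= p -> 0 < b -> 0 <= y -> 0 <= G <= K ->
  y * G <= b * G + b `^ (1 - p) * K * y `^ p.
Proof.
move=> p1 b0 y0 /andP[G0 GK]; have K0 := le_trans G0 GK.
have [yb|by'] := leP y b.
  apply: (@le_trans _ _ (b * G)); first by rewrite ler_wpM2r.
  by rewrite lerDl !mulr_ge0 ?powR_ge0.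
have y0' : 0 < y by exact: lt_trans by'.
apply: (@le_trans _ _ (b `^ (1 - p) * K * y `^ p)); last by rewrite lerDr mulr_ge0// ltW.
rewrite mulrAC; apply: ler_pM => //.
have -> : y `^ p = y * y `^ (p - 1) by exact: powR_pred.
rewrite mulrCA ler_peMr// -opprB powRN mulrC ler_pdivlMr ?powR_gt0// mul1r.
by apply: ler_pow; rewrite ?subr_ge0// ltW.
Qed.

(** The kernel has mass at most [K = 2 M] and maximum at most [K^2]. If it gives the sum a mean of
    [2 B], the points where the sum is at most [B] account for half of it, and the others force a
    [p]-th moment of [B^p / K]. *)
Lemma fejer_moment c m n p (M : nat) (B : R) : 1 <= p -> 0 < B -> (0 < M)%N ->
  (2 * M)%:R * (2 * B) <=
    \sum_(m <= j < n) c j * Lp (fun i => (dirichlet_kernel (2 * M))`_(i + j ^ 2)) (dirichlet_kernel (2 * M)) ->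
  B `^ p / (2 * M)%:R <= I (fun x => Emod c m n x `^ p).
Proof.
move=> p1 B0 M0 h; have p0 : 0 <= p by exact: le_trans p1.
set K := (2 * M)%N in h *; set Dk := dirichlet_kernel K in h *.
have K0 : 0 < K%:R :> R by rewrite ltr0n /K mul2n double_gt0.
have bE : bm (fun x => Emod c m n x `^ p) by exact: bm_Emod_powR.
have bG : bm (fun x => Mp Dk x ^+ 2) by apply: bmX; exact: bm_Mp.
pose k := B `^ (1 - p) * K%:R ^+ 2.
have h1 := le_trans h (sqpoly_duality _ _ _ _ _).
have h2 : I (fun x => Emod c m n x * (Mp Dk x * Mp Dk x)) <=
    I (fun x => B * Mp Dk x ^+ 2 + k * Emod c m n x `^ p).
  apply: I_le.
  - by apply: bmM; [exact: bm_Emod | apply: bmM; exact: bm_Mp].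
  - by apply: bmD; apply: bmZ.
  move=> x _; rewrite -expr2; apply: powR_test => //; first exact: Emod_ge0.
  by rewrite sqr_ge0/= ler_pXn2r ?nnegrE ?Mp_ge0 ?(ltW K0)// Mp_dirichlet_le.
rewrite (ID (bmZ _ bG) (bmZ _ bE)) (IZ _ bG) (IZ _ bE) in h2.
have h3 := ler_wpM2l (ltW B0) (I_sqr_dirichlet K).
set Y := I (fun x => Emod c m n x `^ p) in h2 *.
have h4 : K%:R * B <= k * Y.
  by move: h1 h2 h3; set u := I _; set v := I _; clearbody u v Y k; clear; lra.
have q0 : 0 < B `^ (1 - p) by rewrite powR_gt0.
have k0 : 0 < k by rewrite mulr_gt0// exprn_gt0.
have -> : B `^ p / K%:R = K%:R * B / k.
  have -> : B `^ p = B / B `^ (1 - p).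
    apply/eqP; rewrite -(inj_eq (mulIf (lt0r_neq0 q0))) divfK ?lt0r_neq0//.
    by rewrite -powRDp// addrC subrK powRr1// ltW.
  by rewrite /k; field; rewrite !lt0r_neq0.
by rewrite ler_pdivrMr// [Y * k]mulrC.
Qed.

(** The kernel of degree about [4^(J + 1)] sees the sines up to the scale, all nonnegative: near the
    origin they add up to [l 2^(J (3 - 2s))], on a set of measure of order [4^-J]. *)
Lemma LB_fejer p s : 1 <= p -> LB p s (fun l => l `^ (s - 2^-1 + p^-1)).
Proof.
move=> p1; have p0 : 0 < p by exact: lt_le_trans p1.
have [c c0 Hc] := pow_window (2 - 2 * s).
set e := 2 - 2 * s in Hc.
pose e' := 1 + e - 2 / p.
have [K K0 HK] := scale_powR e'.
pose c1 := c / 4 * 8^-1 `^ p^-1.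
have c10 : 0 < c1 by rewrite mulr_gt0 ?powR_gt0// divr_gt0.
have d0 : 0 < K * 2 `^ e' by rewrite mulr_gt0// powR_gt0.
exists (c1 / (K * 2 `^ e')), 8^-1; split.
- by rewrite divr_gt0.
- by rewrite invr_gt0.
move=> l /andP[l0 l8]; have l12 : 0 < l <= 2^-1 by move: l0 l8; clear; lra.
have [J JP] := exists_scale l12; have /andP[Jl _] := JP.
have := scale_pos JP l8; case: J JP Jl => // J JP Jl _.
exists J.+1 => T JT; rewrite I_D ?(ltW p0)//; last by move: l12; clear; lra.
set X := 2 ^+ J : R.
have X0 : 0 < X by rewrite exprn_gt0.
have M0 : (0 < 4 ^ J.+1)%N by rewrite expn_gt0.
have B0 : 0 < l * c * (X * X `^ e) / 4 by rewrite divr_gt0// !mulr_gt0// powR_gt0.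
apply: le_trans (@fejer_moment _ _ _ _ (4 ^ J.+1) _ p1 B0 M0 _); last first.
  pose V (j : nat) : R := Lp (fun i => (dirichlet_kernel (2 * 4 ^ J.+1))`_(i + j ^ 2)) (dirichlet_kernel (2 * 4 ^ J.+1)).
  rewrite -[leRHS]/(\sum_(1 <= j < 2 ^ T) ac s l j * V j).
  have V0 j : 0 <= V j by exact: fejer_correlation_ge0.
  (* Frequencies [j^2 >= 2 * 4^(J + 1)] are invisible to the kernel; for the smaller ones
     [j^2 l <= 1], so the sine is nonnegative. *)
  have VE j : (2 * 4 ^ J.+1 <= j ^ 2)%N -> V j = 0 by exact: fejer_correlation_eq0.
  have a0 j : (0 < j)%N -> 0 <= ac s l j * V j.
    move=> j0; have [jJ|jJ] := leqP (2 * 4 ^ J.+1) (j ^ 2); first by rewrite VE ?mulr0.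
    apply: mulr_ge0 => //; rewrite /ac mulr_ge0 ?powR_ge0// mulr_ge0//.
    apply: sin_ge0_pi; rewrite -mulrA mulr_ge0 ?pi_ge0 ?mulr_ge0 ?sqr_ge0 ?(ltW l0)//=.
    rewrite -[X in _ <= X]mulr1 ler_wpM2l ?pi_ge0//.
    have jJ' : j%:R ^+ 2 <= 2 * 4 ^+ J.+1 :> R by rewrite -!natrX -natrM ler_nat ltnW.
    by have := ler_wpM2r (ltW l0) jJ'; move: Jl; clear; lra.
  have j1 : (1 <= 2 ^ J)%N by rewrite expn_gt0.
  have j2 : (2 ^ J <= 2 ^ J.+1)%N by rewrite leq_exp2l.
  have j3 : (2 ^ J.+1 <= 2 ^ T)%N by rewrite leq_exp2l.
  rewrite (@big_cat_nat _ _ _ (2 ^ J))//=; last exact: leq_trans j3.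
  rewrite [X in _ + X](@big_cat_nat _ _ _ (2 ^ J.+1))//=.
  apply: (@le_trans _ _ (\sum_(2 ^ J <= j < 2 ^ J.+1) ac s l j * V j)); last first.
    rewrite addrCA lerDl addr_ge0// big_nat sumr_ge0// => j /andP[h _]; apply: a0 => //.
    by apply: leq_trans h; rewrite expn_gt0.
  apply: (@le_trans _ _ (\sum_(2 ^ J <= j < 2 ^ J.+1) l * (c * X `^ e) * (4 ^ J.+1)%:R)).
    rewrite sumr_const_nat -[X in _ <= X]mulr_natl (_ : 2 ^ J.+1 - 2 ^ J = 2 ^ J)%N; last by rewrite expnS mul2n -addnn addnK.
    rewrite natrM [(2 ^ J)%:R]natrX -/X.
    by rewrite le_eqVlt; apply/orP; left; apply/eqP; field.
  apply: ler_sum_nat => n /andP[n0 nJ]; have n1 : (0 < n)%N by exact: leq_trans n0.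
  apply: ler_pM.
  - by rewrite !mulr_ge0 ?powR_ge0 ?(ltW l0) ?(ltW c0).
  - exact: ler0n.
  - apply: le_trans (ac_ge s l0 n1 (scale_index l0 Jl (ltnW nJ))).
    rewrite ler_wpM2l ?(ltW l0)//; apply: Hc; by rewrite n0 ltnW.
  - apply: fejer_correlation; rewrite (_ : 4 ^ J.+1 = (2 ^ J.+1) ^ 2)%N; last by rewrite -expnM mulnC expnM.
    by rewrite leq_exp2r// ltnW.
have [_] := HK l J.+1 l0 JP.
have -> : - (e' / 2) = s - 2^-1 + p^-1 - 1.
  by rewrite /e' /e; field; rewrite gt_eqF.
rewrite exprS -/X powRM ?(ltW X0)// => h.
have h' := ler_wpM2l (ltW l0) h.
rewrite -[s - 2^-1 + p^-1](subrK 1) powRS//; set L := l `^ _ in h' *.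
apply: (@le_trans _ _ ((c1 * (l * X `^ e')) `^ p)).
  apply: ler_pow; [exact: ltW | exact (mulr_ge0 (divr_ge0 (ltW c10) (ltW d0)) (mulr_ge0 (powR_ge0 _ _) (ltW l0)))|].
  rewrite -mulrA ler_wpM2l ?(ltW c10)// mulrC ler_pdivrMr// [L * l]mulrC.
  by apply: le_trans h' _; rewrite le_eqVlt; apply/orP; left; apply/eqP; ring.
rewrite le_eqVlt; apply/orP; left; apply/eqP.
have -> : (2 * 4 ^ J.+1)%:R = 8 * X ^+ 2 :> R.
  by rewrite natrM natrX exprS four_pow -/X; ring.
have hX : X `^ e' = X * X `^ e / X `^ (2 / p).
  by rewrite /e' -powRN !powRDp// powRr1 ?(ltW X0).
have h8 : (8^-1 `^ p^-1) `^ p = 8^-1 :> R by rewrite powRVK.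
have hX2 : (X `^ (2 / p)) `^ p = X ^+ 2.
  by rewrite -powRrM divfK ?gt_eqF// powR2 ?(ltW X0).
have -> : c1 * (l * X `^ e') = 8^-1 `^ p^-1 * (l * c * (X * X `^ e) / 4) / X `^ (2 / p).
  by rewrite hX /c1; field; rewrite gt_eqF// powR_gt0.
rewrite powR_div ?powR_gt0//; last by rewrite mulr_ge0 ?powR_ge0// ltW.
rewrite powRM ?powR_ge0 ?(ltW B0)// h8 hX2; field; rewrite gt_eqF//.
Qed.

End fejer_kernel_test.

(** * Even exponents by duality *)

Section even_moments.
Variable R : realType.
Implicit Types (s p l x C : R) (m n j k J T : nat) (c w : nat -> R) (A B P Q : {poly R}).

Lemma coef_mul_ge0 A B : (forall i, 0 <= A`_i) -> (forall i, 0 <= B`_i) -> forall i, 0 <= (A * B)`_i.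
Proof. by move=> A0 B0 i; rewrite coefM sumr_ge0// => j _; rewrite mulr_ge0. Qed.

Lemma coef_exp_ge0 A k : (forall i, 0 <= A`_i) -> forall i, 0 <= (A ^+ k)`_i.
Proof.
move=> A0; elim: k => [|k IHk] i; first by rewrite expr0 coef1.
by rewrite exprS coef_mul_ge0.
Qed.

Lemma coef_exp_le A B k : (forall i, 0 <= A`_i) -> (forall i, A`_i <= B`_i) ->
  forall i, (A ^+ k)`_i <= (B ^+ k)`_i.
Proof.
move=> A0 AB; elim: k => [|k IHk] i; first by rewrite !expr0.
rewrite !exprS !coefM ler_sum// => j _; apply: ler_pM => //; exact: coef_exp_ge0.
Qed.

Definition supported P lo hi := forall i, ~~ (lo <= i <= hi)%N -> P`_i = 0.

Lemma supported_mul A B a b a' b' : supported A a b -> supported B a' b' ->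
  supported (A * B) (a + a') (b + b').
Proof.
move=> sA sB i ih; rewrite coefM big1// => j _.
have [ja|ja] := boolP (a <= j <= b)%N; last by rewrite sA ?mul0r.
rewrite sB ?mulr0//; move: ih ja; have := ltn_ord j; clear; lia.
Qed.

Lemma supported_exp A a b k : supported A a b -> supported (A ^+ k) (k * a) (k * b).
Proof.
move=> sA; elim: k => [|k IHk]; last by rewrite exprS !mulSn; exact: supported_mul.
by move=> i; rewrite expr0 coef1 !mul0n leqn0; case: eqP.
Qed.

Lemma supported_sqpoly w m n : supported (sqpoly w m n) (m ^ 2) (n.-1 ^ 2).
Proof.
move=> i; apply: (@sqpoly_coef_ind _ (fun i a => ~~ (m ^ 2 <= i <= n.-1 ^ 2)%N -> a = 0)) => // k.
by move=> /andP[mk kn]; rewrite !leq_exp2r// mk/= -ltnS prednK ?kn//; apply: leq_trans kn.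
Qed.

Lemma coef_sqpoly_ge0 w m n : (forall j, (m <= j < n)%N -> 0 <= w j) -> forall i, 0 <= (sqpoly w m n)`_i.
Proof. by move=> w0 i; apply: (@sqpoly_coef_ind _ (fun _ a => 0 <= a)) => // k; exact: w0. Qed.

Lemma Lp_mul_sqpoly (h : nat -> R) w m n Q : Lp h (sqpoly w m n * Q) =
  \sum_(m <= j < n) w j * Lp (fun i => h (i + j ^ 2)%N) Q.
Proof. by rewrite mulrC LpM -(Lp_sqpoly (fun k => Lp (fun i => h (i + k)%N) Q)). Qed.

Lemma I_Mp_even P k : I (fun x => Mp P x ^+ (2 * k)) = Lp (fun i => (P ^+ k)`_i) (P ^+ k).
Proof.
rewrite -(@I_ext _ (fun x => Mp (P ^+ k) x ^+ 2)); last by move=> x; rewrite MpX -exprM mulnC.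
by rewrite sqr_Mp_parseval; apply: eq_bigr => i _; rewrite expr2.
Qed.

Lemma power_test k (X Y et : R) : 0 < et -> 0 <= X -> 0 <= Y ->
  X * Y ^+ k <= et * Y ^+ k.+1 + et^-1 ^+ k * X ^+ k.+1.
Proof.
move=> e0 X0 Y0; have [h|h] := leP X (et * Y).
  apply: (@le_trans _ _ (et * Y ^+ k.+1)).
    by rewrite exprS mulrA ler_wpM2r ?exprn_ge0.
  by rewrite lerDl mulr_ge0 ?exprn_ge0// invr_ge0 ltW.
apply: (@le_trans _ _ (et^-1 ^+ k * X ^+ k.+1)); last first.
  by rewrite lerDr mulr_ge0 ?exprn_ge0// ltW.
rewrite exprS mulrCA ler_wpM2l// -exprMn; apply: lerXn2r; rewrite ?nnegrE//.
  by rewrite mulr_ge0// invr_ge0 ltW.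
by rewrite mulrC ler_pdivlMr// mulrC ltW.
Qed.

(* Testing against [P^(k-1)] and [P^k]: only the coefficients of index at most [deg (P^k)] enter. *)
Lemma even_moment_ge c w m n a b k (et : R) : (0 < k)%N -> (m <= a)%N -> (a <= b <= n)%N -> 0 < et ->
  (forall j, (a <= j < b)%N -> 0 <= w j) ->
  (forall j, (m <= j < n)%N -> (j ^ 2 <= k * b.-1 ^ 2)%N -> 0 <= c j) ->
  (forall j, (a <= j < b)%N -> et * w j <= c j) ->
  (et / 2) ^+ (2 * k) * Lp (fun i => (sqpoly w a b ^+ k)`_i) (sqpoly w a b ^+ k) <=
    I (fun x => Emod c m n x ^+ (2 * k)).
Proof.
case: k => // k _ ma /andP[ab bn] e0 w0 c0 cw.
set P := sqpoly w a b; set S := Lp _ _.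
have P0 := coef_sqpoly_ge0 w0; rewrite -/P in P0.
(* The correlation of [P^k] and [P^(k + 1)] at lag [j^2], with [k] lowered by the case analysis. It
   vanishes past the degree of [P^(k + 1)], which discards the sines of unknown sign. *)
pose V (j : nat) : R := Lp (fun i => (P ^+ k.+1)`_(i + j ^ 2)) (P ^+ k).
have V0 j : 0 <= V j by apply: sumr_ge0 => i _; rewrite mulr_ge0// coef_exp_ge0.
have h1 : et * S <= \sum_(m <= j < n) c j * V j.
  have -> : S = \sum_(a <= j < b) w j * V j by rewrite /S {2}exprS Lp_mul_sqpoly.
  have c0' j : (m <= j < n)%N -> 0 <= c j * V j.
    move=> jmn; have [jk|jk] := leqP (j ^ 2) (k.+1 * b.-1 ^ 2).
      by rewrite mulr_ge0// c0.
    rewrite [V j]big1 ?mulr0// => i _.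
    rewrite (@supported_exp _ _ _ k.+1 (@supported_sqpoly w a b)) ?mulr0//.
    move: jk; set u := (j ^ 2)%N; set v := (k.+1 * b.-1 ^ 2)%N; clearbody u v; lia.
  rewrite [leRHS](@big_cat_nat _ _ _ a)//=; last exact: leq_trans ab bn.
  rewrite [X in _ + X](@big_cat_nat _ _ _ b)//=.
  apply: (@le_trans _ _ (\sum_(a <= j < b) c j * V j)).
    rewrite mulr_sumr; apply: ler_sum_nat => j jab.
    by rewrite mulrA ler_wpM2r// cw.
  rewrite addrCA lerDl addr_ge0// big_nat sumr_ge0// => j /andP[j1 j2]; apply: c0'.
    by rewrite j1 (leq_trans j2)// (leq_trans ab).
  by rewrite j2 andbT (leq_trans _ j1)// (leq_trans ma).
have h2 := le_trans h1 (sqpoly_duality _ _ _ _ _).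
have e20 : 0 < et / 2 by rewrite divr_gt0.
set q := (2 * k.+1)%N.
have bP : bm (fun x => Mp P x ^+ q) by apply: bmX; exact: bm_Mp.
have bE : bm (fun x => Emod c m n x ^+ q) by apply: bmX; exact: bm_Emod.
have h3 : I (fun x => Emod c m n x * (Mp (P ^+ k) x * Mp (P ^+ k.+1) x)) <=
    I (fun x => (et / 2) * Mp P x ^+ q + (et / 2)^-1 ^+ q.-1 * Emod c m n x ^+ q).
  apply: I_le.
  - by apply: bmM; [exact: bm_Emod | apply: bmM; exact: bm_Mp].
  - by apply: bmD; apply: bmZ.
  move=> x _; rewrite !MpX -exprD; have -> : q = (k + k.+1).+1 by rewrite /q; lia.
  by apply: power_test => //; [exact: Emod_ge0 | exact: Mp_ge0].
rewrite (ID (bmZ _ bP) (bmZ _ bE)) (IZ _ bP) (IZ _ bE) I_Mp_even -/P -/S in h3.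
set Y := I (fun x => Emod c m n x ^+ q) in h3 *.
have h4 : et / 2 * S <= (et / 2)^-1 ^+ q.-1 * Y.
  by move: h2 h3; set u := I _; clearbody u Y S; clear; lra.
have -> : (et / 2) ^+ q = (et / 2) ^+ q.-1 * (et / 2) by rewrite -exprSr.
rewrite -mulrA; have h5 := ler_wpM2l (exprn_ge0 q.-1 (ltW e20)) h4.
apply: le_trans h5 _; rewrite mulrA -exprMn divff ?expr1n ?mul1r//.
by rewrite gt_eqF.
Qed.

Lemma ac_ge0 s l n : 0 <= l -> n%:R ^+ 2 * l <= 1 -> 0 <= ac s l n.
Proof.
move=> l0 h; rewrite /ac mulr_ge0 ?powR_ge0// mulr_ge0//.
apply: sin_ge0_pi; rewrite -mulrA mulr_ge0 ?pi_ge0 ?mulr_ge0 ?sqr_ge0//=.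
by rewrite -[X in _ <= X]mulr1 ler_wpM2l ?pi_ge0.
Qed.

(** Cauchy-Schwarz against a constant, through [f^2 >= 2 B f - B^2] with [B = S / (n - m)]. *)
Lemma sqr_sum_window (f : nat -> R) m n (S : R) : (m < n)%N -> 0 <= S -> S <= \sum_(m <= i < n) f i ->
  S ^+ 2 / (n - m)%:R <= \sum_(m <= i < n) f i ^+ 2.
Proof.
move=> mn S0 Sf; have N0 : 0 < (n - m)%:R :> R by rewrite ltr0n subn_gt0.
set N := (n - m)%:R in N0 *; pose B := S / N; have B0 : 0 <= B by rewrite divr_ge0// ltW.
apply: (@le_trans _ _ (\sum_(m <= i < n) (2 * B * f i - B ^+ 2))); last first.
  apply: ler_sum_nat => i _; have := sqr_ge0 (f i - B); rewrite sqrrB; clear; lra.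
rewrite sumrB -mulr_sumr sumr_const_nat -[X in _ - X]mulr_natl -/N.
have h := ler_wpM2l B0 Sf.
have e1 : B * S = S ^+ 2 / N by rewrite /B; field; rewrite gt_eqF.
have e2 : N * B ^+ 2 = S ^+ 2 / N by rewrite /B; field; rewrite gt_eqF.
by rewrite e1 in h; rewrite e2; move: h; clear; lra.
Qed.

(* The windows [k 4^j <= m < k 4^(j+1)] of coefficients of [P ^+ k] are disjoint, and by
   Cauchy-Schwarz each of them contributes a constant to the [L^2] norm. *)
Lemma critical_windows k (e : R) : (0 < k)%N -> k%:R * (1 + e) = 1 -> exists2 C : R, 0 < C &
  forall J, C * J%:R <= Lp (fun i => (sqpoly (fun n => n%:R `^ e) 1 (2 ^ J) ^+ k)`_i)
                        (sqpoly (fun n => n%:R `^ e) 1 (2 ^ J) ^+ k).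
Proof.
move=> k0 ke; have [c c0 Hc] := pow_window e.
have k3 : 0 < (3 * k)%:R :> R by rewrite ltr0n muln_gt0.
exists (c ^+ k ^+ 2 / (3 * k)%:R); first by rewrite divr_gt0// !exprn_gt0.
move=> J; pose w (n : nat) : R := n%:R `^ e; rewrite -/w; set P := sqpoly w _ _; set Q := P ^+ k.
pose N := maxn (size Q) (k * 4 ^ J).
rewrite (@Lp_wide _ _ Q N) ?leq_maxl// -(big_mkord xpredT (fun i => Q`_i * Q`_i)).
rewrite (@big_cat_nat _ _ _ (k * 4 ^ J))//= ?leq_maxr//.
apply: (@le_trans _ _ (\sum_(0 <= i < k * 4 ^ J) Q`_i * Q`_i)); last first.
  by rewrite lerDl sumr_ge0// => i _; rewrite -expr2 sqr_ge0.
have w0 j : 0 <= w j by exact: powR_ge0.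
suff H j : (j <= J)%N -> c ^+ k ^+ 2 / (3 * k)%:R * j%:R <= \sum_(0 <= i < k * 4 ^ j) Q`_i * Q`_i.
  exact: H.
elim: j => [_|j IHj jJ].
  by rewrite mulr0 sumr_ge0// => i _; rewrite -expr2 sqr_ge0.
have km : (k * 4 ^ j < k * 4 ^ j.+1)%N by rewrite ltn_pmul2l// ltn_exp2l.
rewrite (@big_cat_nat _ _ _ (k * 4 ^ j))//=; last exact: ltnW.
rewrite -[j.+1%:R]natr1 mulrDr mulr1 lerD ?IHj// 1?ltnW//.
pose Pj := sqpoly w (2 ^ j) (2 ^ j.+1); pose Qj := Pj ^+ k.
have Pj0 i : 0 <= Pj`_i by apply: coef_sqpoly_ge0.
have PjP i : Pj`_i <= P`_i.
  apply: (@sqpoly_coef_ind _ (fun i a => a <= P`_i)) => [i'|n /andP[n1 n2]].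
    exact: coef_sqpoly_ge0.
  rewrite coef_sqpoly; have -> // : (1 <= n < 2 ^ J)%N.
  rewrite (leq_trans _ n1) ?expn_gt0//= (leq_trans n2)// leq_exp2l//.
have QjQ i : Qj`_i <= Q`_i by exact: coef_exp_le.
pose S : R := c ^+ k * 2 ^+ j.
have S0 : 0 <= S by rewrite mulr_ge0 ?exprn_ge0// ltW.
have kne : k%:R != 0 :> R by rewrite pnatr_eq0 -lt0n.
have QS : S <= \sum_(k * 4 ^ j <= i < k * 4 ^ j.+1) Qj`_i.
  have sQ : supported Qj (k * 4 ^ j) (k * (2 ^ j.+1).-1 ^ 2).
    rewrite [in X in supported _ X](_ : 4 ^ j = (2 ^ j) ^ 2)%N; last by rewrite -expnM mulnC expnM.
    exact: (@supported_exp _ _ _ k (@supported_sqpoly w (2 ^ j) (2 ^ j.+1))).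
  have hi : (k * (2 ^ j.+1).-1 ^ 2 < k * 4 ^ j.+1)%N.
    rewrite ltn_pmul2l// (_ : 4 ^ j.+1 = (2 ^ j.+1) ^ 2)%N; last by rewrite -expnM mulnC expnM.
    by rewrite ltn_exp2r// prednK// expn_gt0.
  have sz : (size Qj <= k * 4 ^ j.+1)%N.
    by apply/leq_sizeP => i ih; apply: sQ; rewrite negb_and -!ltnNge (leq_trans hi ih) orbT.
  (* The window contains the whole support of [Qj], so its coefficients add up to the value at [1],
     a [k]-th power. As [Pj.[1]] is at least of order [2^(j (1 + e))] and [k (1 + e) = 1], the total
     is at least of order [2^j]. *)
  have -> : \sum_(k * 4 ^ j <= i < k * 4 ^ j.+1) Qj`_i = Qj.[1].
    rewrite (horner_coef_wide _ sz) -(big_mkord xpredT (fun i => Qj`_i * 1 ^+ i)).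
    rewrite [RHS](@big_cat_nat _ _ _ (k * 4 ^ j))//=; last exact: ltnW.
    rewrite [X in _ = X + _]big_nat [X in _ = X + _]big1 ?add0r; last first.
      by move=> i /andP[_ ih]; rewrite sQ ?mul0r// negb_and -ltnNge ih.
    by apply: eq_bigr => i _; rewrite expr1n mulr1.
  rewrite /Qj horner_exp.
  have -> : Pj.[1] = \sum_(2 ^ j <= n < 2 ^ j.+1) w n.
    rewrite /Pj /sqpoly horner_sum; apply: eq_bigr => n _.
    by rewrite hornerZ hornerXn expr1n mulr1.
  have -> : S = (c * (2 ^+ j) `^ (1 + e)) ^+ k.
    rewrite exprMn /S; congr (_ * _).
    by rewrite -[RHS]powR_mulrn ?powR_ge0// -powRrM [(1 + e) * _]mulrC ke powRr1// exprn_ge0.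
  apply: lerXn2r; rewrite ?nnegrE.
  - by rewrite mulr_ge0 ?powR_ge0// ltW.
  - by rewrite sumr_ge0.
  have -> : c * (2 ^+ j) `^ (1 + e) = \sum_(2 ^ j <= n < 2 ^ j.+1) c * (2 ^+ j) `^ e.
    rewrite sumr_const_nat expnS mul2n -addnn addnK -[RHS]mulr_natl natrX.
    by rewrite powRDp ?exprn_gt0// powRr1 ?exprn_ge0// mulrCA.
  by apply: ler_sum_nat => n /andP[n1 n2]; apply: Hc; rewrite n1 ltnW.
have QS' : S <= \sum_(k * 4 ^ j <= i < k * 4 ^ j.+1) Q`_i.
  by apply: le_trans QS _; apply: ler_sum => i _; exact: QjQ.
have h := sqr_sum_window km S0 QS'.
apply: le_trans (le_trans _ h) _; last by rewrite le_eqVlt; apply/orP; left; apply/eqP; apply: eq_bigr => i _; rewrite expr2.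
rewrite -mulnBr expnS (_ : 4 * 4 ^ j - 4 ^ j = 3 * 4 ^ j)%N; last lia.
rewrite !natrM natrX four_pow /S.
rewrite le_eqVlt; apply/orP; left; apply/eqP; field; rewrite kne expf_neq0//.
Qed.

End even_moments.

(** * Counting solutions of an equation in four squares *)

Section quadruples.
Variable R : realType.
Implicit Types (a b d e g i k m n t X : nat).

Lemma sum_inv_sqr_multiples X e : (0 < e)%N ->
  \sum_(1 <= n < X.+1) (e %| n)%:R / n%:R ^+ 2 <= 2 / e%:R ^+ 2 :> R.
Proof.
move=> e0; have e0' : 0 < e%:R :> R by rewrite ltr0n.
pose f (n : nat) : R := (e %| n)%:R / n%:R ^+ 2.
have f0 n : 0 <= f n by rewrite divr_ge0// sqr_ge0.
apply: (@le_trans _ _ (\sum_(0 <= n < X.+1 * e) f n)).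
  rewrite (@big_cat_nat _ _ _ 1 0 (X.+1 * e))//=; last by rewrite muln_gt0.
  rewrite [X in _ <= _ + X](@big_cat_nat _ _ _ X.+1)//=; last by rewrite leq_pmulr.
  by rewrite addrCA lerDl addr_ge0// sumr_ge0.
rewrite sum_blocks (eq_bigr (fun k => e%:R ^- 2 / k%:R ^+ 2)); last first.
  move=> k _; rewrite big_ltn// addn0 big_nat big1 ?addr0.
    by rewrite /f dvdn_mull// natrM exprMn invfM mul1r mulrC.
  move=> r /andP[r0 re]; rewrite /f dvdn_addr ?dvdn_mull// gtnNdvd// mul0r //.
rewrite -mulr_sumr mulrC ler_wpM2r ?invr_ge0 ?sqr_ge0// big_ltn//.
rewrite expr0n/= invr0 add0r; exact: sum_inv_square.
Qed.

Lemma natr_sum_totient n : (0 < n)%N ->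
  n%:R = \sum_(1 <= e < n.+1) (if (e %| n)%N then totient e else 0)%:R :> R.
Proof.
move=> n0; rewrite -{1}(cyclic.sum_totient_dvd n) big_mkcond natr_sum/=.
rewrite -(big_mkord xpredT (fun d => (if (d %| n)%N then totient d else 0)%:R : R)).
by rewrite big_ltn// dvd0n gtn_eqF// add0r.
Qed.

(** Write [1 / n = n / n^2] and expand [n] as the sum of the totients of its divisors; after the
    exchange of sums, the multiples of [e] contribute at most [2 / e^2]. This gives the logarithm
    without any asymptotics for the totient. *)
Lemma sum_totient_ge X : \sum_(1 <= n < X.+1) n%:R^-1 / 2 <=
  \sum_(1 <= e < X.+1) (totient e)%:R / e%:R ^+ 2 :> R.
Proof.
apply: (@le_trans _ _ (\sum_(1 <= n < X.+1) \sum_(1 <= e < X.+1)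
    ((e %| n)%:R / n%:R ^+ 2) * ((totient e)%:R / 2))).
  apply: ler_sum_nat => n /andP[n0 nX].
  have n0' : 0 < n%:R :> R by rewrite ltr0n.
  have tE : n%:R <= \sum_(1 <= e < X.+1) (e %| n)%:R * (totient e)%:R :> R.
    rewrite (natr_sum_totient n0) [leRHS](@big_cat_nat _ _ _ n.+1)//=.
    rewrite -[leLHS]addr0 lerD//; last by rewrite sumr_ge0// => e _; rewrite mulr_ge0.
    by apply: ler_sum => e _; case: (_ %| _)%N; rewrite ?mul1r ?mul0r.
  under eq_bigr do rewrite mulrAC mulrA.
  rewrite -mulr_suml -mulr_suml [leRHS]mulrAC ler_wpM2r ?invr_ge0//.
  have -> : n%:R^-1 = n%:R / n%:R ^+ 2 :> R by field; rewrite gt_eqF.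
  by rewrite ler_wpM2r ?invr_ge0 ?sqr_ge0.
rewrite exchange_big_nat/=; apply: ler_sum_nat => e /andP[e0 eX].
rewrite -mulr_suml; apply: (@le_trans _ _ (2 / e%:R ^+ 2 * ((totient e)%:R / 2))).
  by rewrite ler_wpM2r ?divr_ge0//; exact: sum_inv_sqr_multiples.
have e0' : 0 < e%:R :> R by rewrite ltr0n.
by rewrite le_eqVlt; apply/orP; left; apply/eqP; field; rewrite gt_eqF.
Qed.

Lemma count_multiples e m q : (0 < e)%N -> (q <= \sum_(m <= b < m + q * e) (e %| b))%N.
Proof.
move=> e0; elim: q => [//|q IHq].
rewrite mulSn addnCA [X in (_ <= X)%N](@big_cat_nat _ _ _ (m + q * e))//=; [|by rewrite leq_addr|by lia].
rewrite -addn1 leq_add//; set m' := (m + q * e)%N.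
have -> : (e + m' = m' + e)%N by rewrite addnC.
pose x := ((m' + e.-1) %/ e * e)%N.
have x1 : (m' <= x)%N.
  have := divn_eq (m' + e.-1) e; have := ltn_pmod (m' + e.-1) e0; rewrite -/x; lia.
have x2 : (x < m' + e)%N by have := leq_trunc_div (m' + e.-1) e; rewrite -/x; lia.
rewrite (@big_cat_nat _ _ _ x)//=; last by rewrite ltnW.
by rewrite [X in (_ <= _ + X)%N]big_ltn// {1}/x dvdn_mull// addnCA leq_addr.
Qed.

Lemma count_multiples_dyadic X e : (0 < e <= X)%N ->
  X%:R / (2 * e%:R) <= \sum_(X <= b < X + X) (e %| b)%:R :> R.
Proof.
move=> /andP[e0 eX]; rewrite -natr_sum; have e0' : 0 < e%:R :> R by rewrite ltr0n.
have h := count_multiples X (X %/ e) e0.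
rewrite ler_pdivrMr ?mulr_gt0// -!natrM ler_nat.
have h2 : (\sum_(X <= b < X + X %/ e * e) (e %| b) <= \sum_(X <= b < X + X) (e %| b))%N.
  rewrite [X in (_ <= X)%N](@big_cat_nat _ _ _ (X + X %/ e * e))//= ?leq_addr//.
  by rewrite leq_add2l leq_trunc_div.
have h3 := leq_trans h h2; move: h3; set S := (\sum_(_ <= b < _) _)%N => h3.
apply: (@leq_trans (X %/ e * (2 * e))); last by rewrite leq_mul2r h3 orbT.
have := divn_eq X e; have := ltn_pmod X e0; have : (1 <= X %/ e)%N by rewrite divn_gt0.
by nia.
Qed.

(** The gcd is the sum of the totients of the common divisors, so the double sum dominates the
    totient of [e] times the square of a count of multiples, about [X / e]; the sum over [e <= X]
    then gives [X^2 log X]. *)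
Lemma sum_gcd_ge i : (2 ^ i)%:R ^+ 2 * i%:R / 16 <=
  \sum_(2 ^ i <= b < 2 ^ i + 2 ^ i) \sum_(2 ^ i <= d < 2 ^ i + 2 ^ i) (gcdn b d)%:R :> R.
Proof.
set X := (2 ^ i)%N; have X0 : (0 < X)%N by rewrite expn_gt0.
apply: (@le_trans _ _ (\sum_(X <= b < X + X) \sum_(X <= d < X + X)
   \sum_(1 <= e < X.+1) (totient e)%:R * ((e %| b)%:R * (e %| d)%:R))); last first.
  apply: ler_sum_nat => b /andP[b0 _]; apply: ler_sum_nat => d _.
  set g := gcdn b d; have g0 : (0 < g)%N by rewrite gcdn_gt0 (leq_trans X0).
  rewrite (natr_sum_totient g0).
  have E e : (totient e)%:R * ((e %| b)%:R * (e %| d)%:R) = (if (e %| g)%N then totient e else 0)%:R :> R.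
    by rewrite /g dvdn_gcd; case: (e %| b)%N; case: (e %| d)%N; rewrite /= ?mulr1 ?mulr0 ?mul0r ?mulr0.
  rewrite (eq_bigr _ (fun e _ => E e)).
  have [gX|Xg] := leqP g X.
    rewrite (@big_cat_nat _ _ _ g.+1)//= [X in _ + X]big_nat [X in _ + X]big1 ?addr0// => e /andP[ge _].
    by rewrite gtnNdvd.
  rewrite [leRHS](@big_cat_nat _ _ _ X.+1)//=; last exact: ltnW.
  by rewrite lerDl sumr_ge0.
have -> : \sum_(X <= b < X + X) \sum_(X <= d < X + X)
   \sum_(1 <= e < X.+1) (totient e)%:R * ((e %| b)%:R * (e %| d)%:R) =
   \sum_(1 <= e < X.+1) (totient e)%:R * (\sum_(X <= b < X + X) (e %| b)%:R) ^+ 2 :> R.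
  under eq_bigr do rewrite exchange_big_nat/=.
  rewrite exchange_big_nat/=; apply: eq_bigr => e _.
  rewrite expr2 mulr_suml mulr_sumr; apply: eq_bigr => b _.
  by rewrite !mulr_sumr.
apply: (@le_trans _ _ (\sum_(1 <= e < X.+1) X%:R ^+ 2 / 4 * ((totient e)%:R / e%:R ^+ 2))).
  rewrite -mulr_sumr; apply: (@le_trans _ _ (X%:R ^+ 2 / 4 * (i%:R / 2 / 2))).
    by rewrite le_eqVlt; apply/orP; left; apply/eqP; field.
  rewrite ler_wpM2l ?divr_ge0 ?sqr_ge0//; apply: le_trans (sum_totient_ge X).
  rewrite -mulr_suml ler_wpM2r ?invr_ge0//; apply: le_trans (harmonic_ge R i) _.
  by rewrite [leRHS](@big_cat_nat _ _ _ X)//= lerDl sumr_ge0// => n _; rewrite invr_ge0.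
apply: ler_sum_nat => e /andP[e0 eX]; have e0' : 0 < e%:R :> R by rewrite ltr0n.
have h : X%:R / (2 * e%:R) <= \sum_(X <= b < X + X) (e %| b)%:R :> R.
  by apply: count_multiples_dyadic; rewrite e0.
have -> : X%:R ^+ 2 / 4 * ((totient e)%:R / e%:R ^+ 2) = (totient e)%:R * (X%:R / (2 * e%:R)) ^+ 2 :> R.
  by field; rewrite gt_eqF.
by rewrite ler_wpM2l//; apply: lerXn2r => //; rewrite nnegrE ?sumr_ge0.
Qed.

Lemma Lp_coef (Q : {poly R}) m : Lp (fun i => (i == m)%:R) Q = Q`_m.
Proof.
have [mQ|Qm] := ltnP m (size Q).
  rewrite /Lp (bigD1 (Ordinal mQ))//= eqxx mulr1 big1 ?addr0// => i im.
  by rewrite [X in _ * X](_ : _ = 0) ?mulr0//; move: im; rewrite -(inj_eq val_inj)/= => /negPf->.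
rewrite nth_default// /Lp big1// => i _.
by rewrite ltn_eqF ?mulr0// (leq_trans (ltn_ord i)).
Qed.

Definition quad_energy a N : {set 'I_N * 'I_N * ('I_N * 'I_N)} :=
  [set q : 'I_N * 'I_N * ('I_N * 'I_N) | [&& (a <= q.1.1)%N && (a <= q.1.2)%N, (a <= q.2.1)%N && (a <= q.2.2)%N &
     q.2.2 ^ 2 + q.2.1 ^ 2 == q.1.2 ^ 2 + q.1.1 ^ 2]%N]%SET.

Lemma card_quad_energy a N : Lp (fun i => (sqpoly (fun=> 1 : R) a N ^+ 2)`_i) (sqpoly (fun=> 1) a N ^+ 2) =
  #|quad_energy a N|%:R.
Proof.
set P := sqpoly _ _ _.
pose E (n1 n2 n3 n4 : nat) : R := (n4 ^ 2 + n3 ^ 2 == n2 ^ 2 + n1 ^ 2)%N%:R.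
have PE m : (P ^+ 2)`_m = \sum_(a <= n3 < N) \sum_(a <= n4 < N) (n4 ^ 2 + n3 ^ 2 == m)%N%:R.
  rewrite -Lp_coef expr2 Lp_mul_sqpoly; apply: eq_bigr => n3 _.
  rewrite mul1r (Lp_sqpoly (fun i => (i + n3 ^ 2 == m)%N%:R)).
  by apply: eq_bigr => n4 _; rewrite mul1r.
transitivity (\sum_(a <= n1 < N) \sum_(a <= n2 < N) \sum_(a <= n3 < N) \sum_(a <= n4 < N) E n1 n2 n3 n4).
  rewrite {2}expr2 Lp_mul_sqpoly; apply: eq_bigr => n1 _.
  rewrite mul1r (Lp_sqpoly (fun i => (P ^+ 2)`_(i + n1 ^ 2))).
  by apply: eq_bigr => n2 _; rewrite mul1r PE.
under eq_bigr => n1 _ do under eq_bigr => n2 _ do under eq_bigr => n3 _ do rewrite big_geq_mkord/=.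
under eq_bigr => n1 _ do under eq_bigr => n2 _ do rewrite big_geq_mkord/=.
under eq_bigr => n1 _ do rewrite big_geq_mkord/=.
rewrite big_geq_mkord/=.
under eq_bigr => n1 _ do under eq_bigr => n2 _ do rewrite pair_big/=.
rewrite pair_big/= pair_big/= -sum1_card natr_sum [RHS]big_mkcond [LHS]big_mkcond/=.
apply: eq_bigr => q _; rewrite inE /E.
by case: ((a <= q.1.1) && _)%N; case: ((a <= q.2.1) && _)%N; case: ((_ + _)%N == _).
Qed.

(* [n1 = b + a, n3 = b - a, n4 = d + c, n2 = d - c] solves [n1^2 + n2^2 = n3^2 + n4^2] iff
   [a b = c d], that is [a = (d / g) t] and [c = (b / g) t] with [g = gcd(b, d)]. *)
Lemma quad_injection b d t b' d' t' : let g := gcdn b d in let g' := gcdn b' d' in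
  (0 < d)%N -> (0 < d')%N -> (4 * t <= g)%N -> (4 * t' <= g')%N ->
  (b + d %/ g * t = b' + d' %/ g' * t')%N -> (d - b %/ g * t = d' - b' %/ g' * t')%N ->
  (b - d %/ g * t = b' - d' %/ g' * t')%N -> (d + b %/ g * t = d' + b' %/ g' * t')%N ->
  (0 < b)%N -> (b < 2 * d)%N -> (d < 2 * b)%N -> (b' < 2 * d')%N -> (d' < 2 * b')%N ->
  [/\ b = b', d = d' & t = t'].
Proof.
move=> g g' d0 d0' tg tg' e1 e2 e3 e4 b0 bd db bd' db'.
have g0 : (0 < g)%N by rewrite gcdn_gt0 d0 orbT.
have g0' : (0 < g')%N by rewrite gcdn_gt0 d0' orbT.
have h1 : (4 * (d %/ g * t) <= d)%N.
  by rewrite mulnCA -{2}(divnK (dvdn_gcdr b d)) leq_mul2l tg orbT.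
have h2 : (4 * (b %/ g * t) <= b)%N.
  by rewrite mulnCA -{2}(divnK (dvdn_gcdl b d)) leq_mul2l tg orbT.
have h1' : (4 * (d' %/ g' * t') <= d')%N.
  by rewrite mulnCA -{2}(divnK (dvdn_gcdr b' d')) leq_mul2l tg' orbT.
have h2' : (4 * (b' %/ g' * t') <= b')%N.
  by rewrite mulnCA -{2}(divnK (dvdn_gcdl b' d')) leq_mul2l tg' orbT.
have bb : b = b' by move: h1 h1' e1 e3 bd db bd' db' ; clear; lia.
have dd : d = d' by move: h2 h2' e2 e4 bd db bd' db'; clear; lia.
split => //; move: e1; rewrite /g' -bb -dd -/g => /addnI/eqP.
rewrite eqn_pmul2l; first by move/eqP.
by rewrite divn_gt0// dvdn_leq// dvdn_gcdr.
Qed.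

Lemma quad_bounds b d A B X : (b < X + X)%N -> (d < X + X)%N -> (4 * A <= d)%N -> (4 * B <= b)%N ->
  [/\ b + A < 4 * X, d - B < 4 * X, b - A < 4 * X & d + B < 4 * X]%N.
Proof. by move=> *; split; lia. Qed.

(** The solutions are parametrised by triples [(b, d, t)], and for given [b], [d] there are at least
    [gcd(b, d) / 4] values of [t]: the logarithm is that of the sum of gcd's. *)
Lemma quad_energy_ge i : (2 ^ i.+1)%:R ^+ 2 * i.+1%:R / 64 <= #|quad_energy (2 ^ i) (2 ^ i.+3)|%:R :> R.
Proof.
set X := (2 ^ i.+1)%N.
have X0 : (0 < X)%N by rewrite expn_gt0.
have XE : (X = 2 * 2 ^ i)%N by rewrite /X expnS.
have NE : (2 ^ i.+3 = (4 * X).-1.+1)%N by rewrite prednK ?muln_gt0// /X !expnS; lia.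
(* The condition [4 t <= gcd(b, d)] moves [b] by at most [d / 4] and [d] by at most [b / 4], so that
   the four numbers stay between [X / 2 = 2^i] and [4 X = 2^(i + 3)], and no truncated subtraction
   reaches zero. *)
pose S := [set u : 'I_(X + X) * 'I_(X + X) * 'I_(X + X) |
  [&& (X <= u.1.1)%N && (X <= u.1.2)%N & (4 * u.2 <= gcdn u.1.1 u.1.2)%N]]%SET.
rewrite NE; set N := (4 * X).-1.
pose f (u : 'I_(X + X) * 'I_(X + X) * 'I_(X + X)) : 'I_N.+1 * 'I_N.+1 * ('I_N.+1 * 'I_N.+1) :=
  let b := val u.1.1 in let d := val u.1.2 in let g := gcdn b d in let t := val u.2 in
  ((inord (b + d %/ g * t), inord (d - b %/ g * t)), (inord (b - d %/ g * t), inord (d + b %/ g * t))).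
have hS u : u \in S -> let b := val u.1.1 in let d := val u.1.2 in let g := gcdn b d in let t := val u.2 in
    [/\ (X <= b < X + X)%N, (X <= d < X + X)%N, (4 * t <= g)%N, (4 * (d %/ g * t) <= d)%N &
        (4 * (b %/ g * t) <= b)%N].
  rewrite inE => /andP[/andP[h1 h2] h3] b d g t; rewrite h1 h2 !ltn_ord; split => //.
    by rewrite mulnCA -{2}(divnK (dvdn_gcdr b d)) leq_mul2l h3 orbT.
  by rewrite mulnCA -{2}(divnK (dvdn_gcdl b d)) leq_mul2l h3 orbT.
have fE u : u \in S -> let b := val u.1.1 in let d := val u.1.2 in let g := gcdn b d in let t := val u.2 in
    [/\ val (f u).1.1 = (b + d %/ g * t)%N, val (f u).1.2 = (d - b %/ g * t)%N,
        val (f u).2.1 = (b - d %/ g * t)%N & val (f u).2.2 = (d + b %/ g * t)%N].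
  move=> /hS/= [/andP[_ hb] /andP[_ hd] _ h1 h2]; have hN : N.+1 = (4 * X)%N by rewrite prednK// muln_gt0.
  have [q1 q2 q3 q4] := quad_bounds hb hd h1 h2.
  by split; rewrite inordK// hN.
have f_inj : {in S &, injective f}.
  move=> u v uS vS fuv; have [e1 e2 e3 e4] := fE u uS; have [e1' e2' e3' e4'] := fE v vS.
  move: e1 e2 e3 e4; rewrite fuv e1' e2' e3' e4' => e1 e2 e3 e4.
  have [/andP[b1 b2] /andP[d1 d2] ht _ _] := hS u uS.
  have [/andP[b1' b2'] /andP[d1' d2'] ht' _ _] := hS v vS.
  have [|||||||b_ d_ t_] := @quad_injection _ _ _ _ _ _ _ _ ht ht' (esym e1) (esym e2) (esym e3) (esym e4).
  - exact: leq_trans d1.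
  - exact: leq_trans d1'.
  - exact: leq_trans b1.
  - by move: b2 d1; clear; lia.
  - by move: d2 b1; clear; lia.
  - by move: b2' d1'; clear; lia.
  - by move: d2' b1'; clear; lia.
  move: u v b_ d_ t_ {uS vS fuv e1 e2 e3 e4 e1' e2' e3' e4' b1 b2 d1 d2 ht b1' b2' d1' d2' ht'} => [[u1 u2] u3] [[v1 v2] v3]/=.
  by move=> /val_inj-> /val_inj-> /val_inj->.
have f_sub : (f @: S)%SET \subset quad_energy (2 ^ i) N.+1.
  apply/fintype.subsetP => q /imsetP[u uS ->]; rewrite inE.
  have [-> -> -> ->] := fE u uS; have [hb hd _ h1 h2] := hS u uS; move: hb hd h1 h2.
  set A := (val u.1.2 %/ _ * _)%N; set B := (val u.1.1 %/ _ * _)%N => hb hd h1 h2.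
  have E : (val u.1.1 * A = val u.1.2 * B)%N.
    rewrite /A /B; set g := gcdn _ _; set b := val u.1.1; set d := val u.1.2; set t := val u.2.
    by rewrite !mulnA (muln_divA _ (dvdn_gcdr b d)) (muln_divA _ (dvdn_gcdl b d)) [(b * d)%N]mulnC.
  clearbody A B; set b := val u.1.1 in E hb h1 h2 *; set d := val u.1.2 in E hd h1 h2 *; clearbody b d.
  apply/and3P; split; [move: hb hd h1 h2 XE; clear; lia|move: hb hd h1 h2 XE; clear; lia|].
  have b4 : (B <= d)%N by move: hb hd h1 h2; clear; lia.
  have a4 : (A <= b)%N by move: hb hd h1 h2; clear; lia.
  have [d' dE] : exists d', d = (d' + B)%N by exists (d - B)%N; rewrite subnK.
  have [b' bE] : exists b', b = (b' + A)%N by exists (b - A)%N; rewrite subnK.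
  move: E; rewrite dE bE !addnK -!mulnn => E; apply/eqP.
  transitivity (d' * d' + b' * b' + 4 * ((d' + B) * B))%N; first by ring.
  by rewrite -E; ring.
have cS : (#|S| <= #|quad_energy (2 ^ i) N.+1|)%N by rewrite -(card_in_imset f_inj) subset_leq_card.
apply: (@le_trans _ _ #|S|%:R); last by rewrite ler_nat.
have -> : (#|S|%:R : R) = \sum_(X <= b < X + X) \sum_(X <= d < X + X) \sum_(0 <= t < X + X) (4 * t <= gcdn b d)%N%:R.
  under eq_bigr => b _ do under eq_bigr => d _ do rewrite big_mkord/=.
  under eq_bigr => b _ do rewrite big_geq_mkord/=.
  rewrite big_geq_mkord/= pair_big/= pair_big/= -sum1_card natr_sum [RHS]big_mkcond [LHS]big_mkcond/=.
  apply: eq_bigr => u _; rewrite inE andbT; by case: (_ && (_ <= u.1.2)%N) => //=; case: (4 * _ <= _)%N.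
have h0 : 0 <= 4^-1 :> R by rewrite invr_ge0.
have h := ler_wpM2r h0 (sum_gcd_ge i.+1); rewrite -/X in h.
apply: le_trans (le_trans _ h) _.
  by rewrite le_eqVlt; apply/orP; left; apply/eqP; field.
rewrite mulr_suml; apply: ler_sum_nat => b /andP[b1 b2]; rewrite mulr_suml.
apply: ler_sum_nat => d /andP[d1 d2]; set g := gcdn b d.
have g1 : (0 < g)%N by rewrite gcdn_gt0 (leq_trans X0).
have gb : (g <= b)%N by rewrite dvdn_leq ?dvdn_gcdl// (leq_trans X0).
have gX : ((g %/ 4).+1 <= X + X)%N by lia.
rewrite (@big_cat_nat _ _ _ (g %/ 4).+1)//=.
apply: (@le_trans _ _ (\sum_(0 <= t < (g %/ 4).+1) 1)).
  rewrite sumr_const_nat subn0 ler_pdivrMr// -natrM ler_nat; lia.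
rewrite -[leLHS]addr0 lerD ?sumr_ge0//; apply: ler_sum_nat => t /andP[_ ht].
by rewrite (_ : (4 * t <= g)%N)//; lia.
Qed.

End quadruples.

(** * Lower bounds with a logarithm *)

Section logarithmic_lower_bounds.
Variable R : realType.
Implicit Types (s p l x C : R) (m n j k i J T : nat).

Lemma scale_ge l J m : 0 < l -> l < 2^-1 / 4 ^+ m -> 4 ^+ J * l <= 2^-1 < 4 ^+ J.+1 * l -> (m <= J)%N.
Proof.
move=> l0 h /andP[_ h2]; rewrite leqNgt; apply/negP => Jm.
rewrite ltr_pdivlMr ?exprn_gt0// in h.
have : 4 ^+ J.+1 * l <= 4 ^+ m * l by rewrite ler_wpM2r ?(ltW l0)// ler_eXn2l// (ltr_nat _ 1).
by rewrite leNgt mulrC [4 ^+ J.+1 * l]mulrC; move: h h2; rewrite [4 ^+ J.+1 * l]mulrC => h h2; rewrite mulrC (lt_trans _ h2)// mulrC.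
Qed.

(* The largest frequency of [P ^+ k] stays below [2 * 4 ^ J], so the sines are nonnegative there. *)
Lemma frequency_nonneg s l J k J' n : 0 < l -> 4 ^+ J * l <= 2^-1 ->
  (k * 4 ^ J' <= 2 * 4 ^ J)%N -> (n ^ 2 <= k * (2 ^ J').-1 ^ 2)%N -> 0 <= ac s l n.
Proof.
move=> l0 Jl kJ nk; apply: ac_ge0; first exact: ltW.
have h : (n ^ 2 <= 2 * 4 ^ J)%N.
  apply: leq_trans nk (leq_trans _ kJ); rewrite leq_mul2l (_ : 4 ^ J' = (2 ^ J') ^ 2)%N.
    by rewrite leq_sqr leq_pred orbT.
  by rewrite -expnM mulnC expnM.
have h' : n%:R ^+ 2 <= 2 * 4 ^+ J :> R by rewrite -!natrX -natrM ler_nat.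
by have := ler_wpM2r (ltW l0) h'; move: Jl; clear; lra.
Qed.

Lemma I_D_even s l T k : 0 <= l <= 1 ->
  I (fun x => D s l T x `^ (2 * k)%:R) = I (fun x => Emod (ac s l) 1 (2 ^ T) x ^+ (2 * k)).
Proof. by move=> l01; rewrite I_D//; apply: I_ext => x; rewrite powR_mulrn ?Emod_ge0. Qed.

(** The weights [n^(2 - 2s)] are the coefficients of low frequency divided by [l], and
    [k (3 - 2s) = 1] is the condition for all windows of the [k]-th power to count equally. *)
Lemma LB_critical k s : (0 < k)%N -> k%:R * (3 - 2 * s) = 1 ->
  LB (2 * k)%:R s (fun l => l * logi l `^ (2 * k)%:R^-1).
Proof.
move=> k0 ks; pose e := 2 - 2 * s.
have ke : k%:R * (1 + e) = 1 by rewrite (_ : 1 + e = 3 - 2 * s)// /e; clear; lra.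
have [C C0 HC] := critical_windows k0 ke.
have [d /andP[d0 d4] Hd] := @scale_log R.
set p := (2 * k)%:R : R; have p0 : 0 < p by rewrite ltr0n muln_gt0.
have C10 : 0 < C / 12 by rewrite divr_gt0.
exists ((C / 12) `^ p^-1 / 2), (Order.min (Order.min 8^-1 d) (2^-1 / 4 ^+ (2 * k).+1)); split.
- by rewrite divr_gt0// powR_gt0.
- by rewrite lt_min divr_gt0 ?exprn_gt0// andbT lt_min d0 andbT.
move=> l /andP[l0]; rewrite !lt_min => /andP[/andP[l8 ld] lk].
have l12 : 0 < l <= 2^-1 by move: l0 l8; clear; lra.
have [J JP] := exists_scale l12; have /andP[Jl _] := JP.
have Jk := scale_ge l0 lk JP.
exists J => T JT; rewrite I_D_even; last by move: l12; clear; lra.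
have [|h1 h2] := Hd l J _ JP; first by rewrite l0.
have L0 : 0 <= logi l by move: h1 (ler0n R J.+1); clear; lra.
(* Going down by [k] scales makes room for the [k]-th power, as [k <= 4^k]; since [J > 2 k], the
   number [J'] of windows is still comparable with [J]. *)
pose J' := (J - k)%N; have j1 : (0 < 2 ^ J')%N by rewrite expn_gt0.
have h := @even_moment_ge R (ac s l) (fun n => n%:R `^ e) 1 (2 ^ T) 1 (2 ^ J') k l k0 isT _ l0 _ _ _.
apply: le_trans (h _ _ _ _); first last.
- move=> j /andP[j0 jJ]; apply: ac_ge => //; apply: (scale_index l0 Jl).
  by apply: leq_trans (ltnW jJ) _; rewrite leq_exp2l// leq_subr.
- move=> j _ jk; apply: (frequency_nonneg s l0 Jl _ jk).
  have k4 : (k <= 4 ^ k)%N by rewrite ltnW// ltn_expl.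
  apply: (@leq_trans (4 ^ k * 4 ^ J')); first by rewrite leq_mul2r k4 orbT.
  by rewrite -expnD subnKC ?leq_pmull//; move: Jk; clear; lia.
- by move=> j _; exact: powR_ge0.
- by rewrite j1 leq_exp2l//; move: JT; rewrite /J'; clear; lia.
apply: (@le_trans _ _ ((l / 2) ^+ (2 * k) * (C * J'%:R))); last first.
  by rewrite ler_wpM2l ?HC// exprn_ge0// divr_ge0// ltW.
have JJ : J.+1%:R <= 2 * J'%:R :> R by rewrite -natrM ler_nat /J'; move: Jk; clear; lia.
have -> : (C / 12) `^ p^-1 / 2 * (l * logi l `^ p^-1) =
  (l / 2) * ((C / 12) `^ p^-1 * logi l `^ p^-1) by ring.
rewrite powRM; [|by rewrite divr_ge0// ltW|by rewrite mulr_ge0 ?powR_ge0].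
rewrite powR_mulrn ?divr_ge0 ?(ltW l0)// ler_wpM2l//; first by rewrite exprn_ge0// divr_ge0// ltW.
rewrite -powRM ?(ltW C10)// powRVK//; last by rewrite mulr_ge0// ltW.
rewrite -mulrA ler_wpM2l ?(ltW C0)//.
by move: h2 JJ; clear; lra.
Qed.

(** On a few dyadic blocks at the scale the coefficients are bounded below by a constant, so the
    constant weight [1] may be used and the fourth moment becomes a count of quadruples, of order
    [X^2 log X]. *)
Lemma LB4_log s : LB 4 s (fun l => l `^ (s - 4^-1) * logi l `^ 4^-1).
Proof.
change (LB (2 * 2)%:R s (fun l => l `^ (s - 4^-1) * logi l `^ 4^-1)).
pose e := 2 - 2 * s.
have [d /andP[d0 d4] Hd] := @scale_log R.
have [K K0 HK] := scale_powR (2^-1 + e).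
(* The window is [X / 2 <= n <= 4 X], so [m X^e] bounds [n^e] from below for either sign of [e]. *)
pose m := Order.min (2^-1 `^ e) (4 `^ e) : R.
have m0 : 0 < m by rewrite lt_min !powR_gt0// invr_gt0.
(* [64] is the constant of [quad_energy_ge], and [30] comes from
   [log(1 / l) <= 6 (J + 1) <= 30 (i + 1)] with [J = i + 4]. *)
have [q q0 qE] : exists2 q : R, 0 < q & q * (64 * 30) = 1.
  exists (64 * 30)^-1; last by rewrite mulVf// mulf_neq0.
  by rewrite invr_gt0 mulr_gt0// ltr0n.
pose A := m / 2 * q `^ 4^-1.
have A0 : 0 < A by rewrite mulr_gt0 ?powR_gt0// divr_gt0.
pose B := K * 8 `^ (2^-1 + e).
have B0 : 0 < B by rewrite mulr_gt0 ?powR_gt0.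
exists (A / B), (Order.min (Order.min 8^-1 d) (2^-1 / 4 ^+ 8)); split.
- exact: divr_gt0.
- by rewrite lt_min divr_gt0 ?exprn_gt0// andbT lt_min d0 andbT.
move=> l /andP[l0]; rewrite !lt_min => /andP[/andP[l8 ld] lk].
have l12 : 0 < l <= 2^-1 by move: l0 l8; clear; lra.
have [J JP] := exists_scale l12; have /andP[Jl _] := JP.
have Jk := scale_ge l0 lk JP.
exists J => T JT; rewrite I_D_even; last by move: l12; clear; lra.
have [|h1 h2] := Hd l J _ JP; first by rewrite l0.
have L0 : 0 <= logi l by move: h1 (ler0n R J.+1); clear; lra.
have [i JE] : exists i, J = i.+4 by exists (J - 4)%N; move: Jk; clear; lia.
have i03 : (i <= i.+3)%N by clear; lia.
have i3J' : (i.+3 <= J)%N by rewrite JE.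
have i3J : (2 ^ i.+3 <= 2 ^ J)%N by rewrite leq_exp2l.
pose X := 2 ^+ i.+1 : R; have X0 : 0 < X by rewrite exprn_gt0.
have et0 : 0 < l * (m * X `^ e) by rewrite !mulr_gt0// powR_gt0.
have h := @even_moment_ge R (ac s l) (fun=> 1) 1 (2 ^ T) (2 ^ i) (2 ^ i.+3) 2 _ isT _ _ et0 _ _ _.
apply: le_trans (h _ _ _ _ _); first last.
- move=> j /andP[j0 jJ]; rewrite mulr1.
  have j0' : (0 < j)%N by rewrite (leq_trans _ j0)// expn_gt0.
  apply: le_trans (ac_ge s l0 j0' (scale_index l0 Jl _)); last first.
    exact: leq_trans (ltnW jJ) i3J.
  rewrite ler_wpM2l ?(ltW l0)// -/e.
  have XE : X = 2 * 2 ^+ i by rewrite /X exprS.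
  have j1 : 2^-1 * X <= j%:R.
    have hj : (2 ^ i)%:R <= j%:R :> R by rewrite ler_nat; exact: j0.
    by rewrite natrX in hj; rewrite XE; move: hj; clear; lra.
  have j2 : j%:R <= 4 * X.
    have hj : j%:R <= (2 ^ i.+3)%:R :> R by rewrite ler_nat; exact: ltnW jJ.
    by rewrite natrX !exprS in hj; rewrite XE; move: hj; clear; lra.
  have [e0|e0] := leP 0 e.
    apply: (@le_trans _ _ (2^-1 `^ e * X `^ e)); first by rewrite ler_wpM2r ?powR_ge0// ge_min lexx.
    by rewrite -powRM ?invr_ge0 ?(ltW X0)//; apply: ler_pow => //; rewrite mulr_ge0// ltW.
  apply: (@le_trans _ _ (4 `^ e * X `^ e)); first by rewrite ler_wpM2r ?powR_ge0// ge_min lexx orbT.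
  by rewrite -powRM ?(ltW X0)//; apply: ler_pow_neg => //; rewrite ?ltr0n// ltW.
- move=> j _ jk; apply: (frequency_nonneg s l0 Jl _ jk).
  by rewrite leq_mul2l leq_exp2l// i3J'.
- by [].
- by rewrite leq_exp2l// i03/= leq_exp2l// (leq_trans i3J').
- by rewrite expn_gt0.
rewrite card_quad_energy.
apply: (@le_trans _ _ ((l * (m * X `^ e) / 2) ^+ 4 * (X ^+ 2 * i.+1%:R / 64))); last first.
  rewrite ler_wpM2l ?exprn_ge0 ?divr_ge0 ?(ltW et0)//.
  by have := quad_energy_ge R i; rewrite natrX.
have [_] := HK l J l0 JP.
have -> : - ((2^-1 + e) / 2) = s - 4^-1 - 1 by rewrite /e; field.
have -> : 2 ^+ J = 8 * X :> R by rewrite JE /X !exprS; ring.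
rewrite powRM ?(ltW X0)// mulrA -/B => hl.
have hl' : l `^ (s - 4^-1) <= B * (l * X `^ (2^-1 + e)).
  rewrite -[s - 4^-1](subrK 1) powRS// mulrC; apply: le_trans (ler_wpM2l (ltW l0) hl) _.
  by rewrite mulrCA.
have ig : logi l <= 30 * i.+1%:R.
  apply: le_trans h2 _; rewrite -!natrM ler_nat JE; clear; lia.
set G := logi l `^ 4^-1.
have G4 : G ^+ 4 = logi l by rewrite /G -powR_mulrn ?powR_ge0// -powRrM mulVf// powRr1.
have c4 : (q `^ 4^-1) ^+ 4 = q.
  by rewrite -powR_mulrn ?powR_ge0// -powRrM mulVf// powRr1 ?(ltW q0).
have X4 : (X `^ 2^-1) ^+ 4 = X ^+ 2.
  rewrite -powR_mulrn ?powR_ge0// -powRrM (_ : 2^-1 * 4%:R = 2); last by field.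
  by rewrite powR2 ?(ltW X0).
rewrite powR_mulrn; last first.
  by rewrite mulr_ge0 ?divr_ge0 ?(ltW A0) ?(ltW B0)// mulr_ge0 ?powR_ge0.
apply: (@le_trans _ _ ((A * (l * X `^ (2^-1 + e)) * G) ^+ 4)).
  apply: lerXn2r; rewrite ?nnegrE.
  - by rewrite mulr_ge0 ?divr_ge0 ?(ltW A0) ?(ltW B0)// mulr_ge0 ?powR_ge0.
  - exact (mulr_ge0 (mulr_ge0 (ltW A0) (mulr_ge0 (ltW l0) (powR_ge0 _ _))) (powR_ge0 _ _)).
  rewrite mulrA ler_wpM2r ?powR_ge0// -mulrA ler_wpM2l ?(ltW A0)//.
  by rewrite mulrC ler_pdivrMr// [leRHS]mulrC.
rewrite powRDp//.
have -> : (A * (l * (X `^ 2^-1 * X `^ e)) * G) ^+ 4 =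
  (l * (m * X `^ e) / 2) ^+ 4 * ((q `^ 4^-1) ^+ 4 * (X `^ 2^-1) ^+ 4 * G ^+ 4).
  by rewrite /A -!exprMn; congr (_ ^+ 4); field.
rewrite c4 X4 G4 ler_wpM2l ?exprn_ge0 ?divr_ge0 ?(ltW et0)//.
have Q0 : 0 <= q * X ^+ 2 by rewrite mulr_ge0 ?sqr_ge0// ltW.
apply: le_trans (ler_wpM2l Q0 ig) _.
have -> : q * X ^+ 2 * (30 * i.+1%:R) = q * (64 * 30) * (X ^+ 2 * i.+1%:R / 64) by field.
by rewrite qE mul1r.
Qed.

End logarithmic_lower_bounds.

(** * The limit function *)

Section nonnegative_integrals.
Variable R : realType.
Implicit Types (f g : R -> R) (x l p c : R).
Local Notation mu := (@lebesgue_measure R).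
Local Notation U := (`[0%R, 1%R]%classic : set R).

(** For the limit function there is no bound at hand; nonnegativity and measurability suffice for
    extended integrals, which may be infinite. *)
Definition nnm f := measurable_fun [set: R] f /\ forall x, 0 <= f x.

Lemma nnm_EFin f : nnm f -> measurable_fun U (EFin \o f).
Proof. by move=> [mf _]; apply/measurable_EFinP; exact: measurable_funS mf. Qed.

Lemma nnmD f g : nnm f -> nnm g -> nnm (fun x => f x + g x).
Proof. by move=> [mf f0] [mg g0]; split=> [|x]; [exact: measurable_funD | rewrite addr_ge0]. Qed.

Lemma nnmZ c f : 0 <= c -> nnm f -> nnm (fun x => c * f x).
Proof. by move=> c0 [mf f0]; split=> [|x]; [exact: measurable_funM | rewrite mulr_ge0]. Qed.

Lemma intT_le f g : nnm f -> nnm g -> (forall x, f x <= g x) -> (intT f <= intT g)%E.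
Proof.
move=> mf mg fg; apply: ge0_le_integral.
- exact: measurable_U.
- by move=> x _; rewrite lee_fin; case: mf.
- exact: nnm_EFin.
- exact: nnm_EFin.
- by move=> x _; rewrite lee_fin.
Qed.

Lemma intTD f g : nnm f -> nnm g -> intT (fun x => f x + g x) = (intT f + intT g)%E.
Proof.
move=> mf mg; rewrite /intT -ge0_integralD//; last first.
- exact: nnm_EFin.
- by move=> x _; rewrite lee_fin; case: mg.
- exact: nnm_EFin.
- by move=> x _; rewrite lee_fin; case: mf.
Qed.

Lemma intTZ c f : 0 <= c -> nnm f -> intT (fun x => c * f x) = (c%:E * intT f)%E.
Proof.
move=> c0 mf; rewrite /intT -ge0_integralZl_EFin//; last first.
- exact: nnm_EFin.
- by move=> x _; rewrite lee_fin; case: mf.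
Qed.

Lemma intT_shift f l : 0 <= l <= 1 -> nnm f -> (forall x, f (x + 1) = f x) ->
  intT (fun x => f (x + l)) = intT f.
Proof.
move=> l01 [mf f0] f1; apply: (integral_periodic (f := fun x => (f x)%:E)) => //.
- exact/measurable_EFinP.
- by move=> x; rewrite f1.
Qed.

Lemma nnm_cmod f g p : measurable_fun setT f -> measurable_fun setT g ->
  nnm (fun x => cmod (f x) (g x) `^ p).
Proof.
move=> mf mg; split=> [|x]; last exact: powR_ge0.
apply: (measurableT_comp (measurable_powR _)).
apply: measurableT_comp; first by apply: continuous_measurable_fun; exact: sqrt_continuous.
by apply: measurable_funD; apply: measurable_funX.
Qed.

Lemma measurable_shift f l : measurable_fun setT f -> measurable_fun setT (fun x => f (x + l)).
Proof. by move=> mf; apply: (measurableT_comp mf); exact: (measurable_shiftr l). Qed.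

Lemma measurable_increment f l : measurable_fun setT f -> measurable_fun setT (fun x => f (x + l) - f x).
Proof. by move=> mf; apply: measurable_funB; [exact: measurable_shift | exact: mf]. Qed.

End nonnegative_integrals.

(** * From partial sums to the limit *)

Section transfer.
Variable R : realType.
Implicit Types (s p l x : R) (T : nat) (g : R -> R).

Lemma cmod_powR_add a b c d p : 0 <= p ->
  cmod (a + c) (b + d) `^ p <= 2 `^ p * (cmod a b `^ p + cmod c d `^ p) :> R.
Proof.
move=> p0; apply: le_trans (powR_addl p0 (cmod_ge0 _ _) (cmod_ge0 _ _)).
by apply: ler_pow => //; [exact: cmod_ge0 | exact: cmodD].
Qed.

(* Replacing [F] by the partial sums costs the [p]-th power of [F - S_N] at [x] and at [x + l]. *)
Lemma increment_transfer s p (Fre Fim : R -> R) : 0 < p -> is_Rs s p Fre Fim ->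
  forall l (eps : R) T0, 0 <= l <= 1 -> 0 < eps -> exists2 T, (T0 <= T)%N &
   (Ssp p Fre Fim l <= (2 `^ p)%:E * ((I (fun x => D s l T x `^ p)%R)%:E + eps%:E))%E /\
   ((I (fun x => D s l T x `^ p)%R)%:E <= (2 `^ p)%:E * (Ssp p Fre Fim l + eps%:E))%E.
Proof.
move=> p0 [pre [pim [mre [mim cvg]]]] l eps T0 l01 eps0.
have {}mre := periodic_measurable pre mre; have {}mim := periodic_measurable pim mim.
have p0' := ltW p0.
pose k : R := 2 `^ p * 2; have k0 : 0 < k by rewrite mulr_gt0 ?powR_gt0.
have [N0 HN0] : exists N0, forall N, (N0 <= N)%N ->
    (intT (fun x => cmod (Fre x - RsN_re s N x) (Fim x - RsN_im s N x) `^ p)%R <= (eps / k)%:E)%E.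
  have nb : nbhs (0 : \bar R) [set y : \bar R | (y < (eps / k)%:E)%E].
    by apply: lt_nbhsl; rewrite ?lte_fin ?divr_gt0.
  have [N0 _ H] := cvg _ nb; exists N0 => N NN; exact: ltW (H N NN).
exists (maxn T0 N0); first exact: leq_maxl.
set T := maxn _ _.
(* The partial sum of index [N] includes the term [N], so [N = 2^T - 1] matches the range
   [1 <= n < 2^T]. *)
have TN : (N0 <= (2 ^ T).-1)%N.
  by rewrite -ltnS prednK ?expn_gt0//; apply: leq_trans (ltn_expl T (ltnSn 1)); rewrite ltnS leq_maxr.
pose Hre x := Fre x - Ere (rc s) 1 (2 ^ T) x; pose Him x := Fim x - Eim (rc s) 1 (2 ^ T) x.
have e1 : (intT (fun x => cmod (Hre x) (Him x) `^ p)%R <= (eps / k)%:E)%E.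
  apply: le_trans (HN0 _ TN); rewrite le_eqVlt; apply/orP; left; apply/eqP; congr intT.
  have TS : (2 ^ T).-1.+1 = (2 ^ T)%N by rewrite prednK// expn_gt0.
  by apply/funext => x; rewrite /Hre /Him /RsN_re /RsN_im TS.
have mH1 : measurable_fun setT Hre by apply: measurable_funB => //; case: (bm_Ere (rc s) 1 (2 ^ T)).
have mH2 : measurable_fun setT Him by apply: measurable_funB => //; case: (bm_Eim (rc s) 1 (2 ^ T)).
have nH : nnm (fun x => cmod (Hre x) (Him x) `^ p) by exact: nnm_cmod.
have per c (j : nat) x : c j * cos (2 * pi * (j ^ 2)%N%:R * (x + 1)) = c j * cos (2 * pi * (j ^ 2)%N%:R * x) :> R.
  by rewrite mulrDr mulr1 (cos_2pi_int _ (j ^ 2)%N).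
have per' c (j : nat) x : c j * sin (2 * pi * (j ^ 2)%N%:R * (x + 1)) = c j * sin (2 * pi * (j ^ 2)%N%:R * x) :> R.
  by rewrite mulrDr mulr1 (sin_2pi_int _ (j ^ 2)%N).
have H1 x : cmod (Hre (x + 1)) (Him (x + 1)) `^ p = cmod (Hre x) (Him x) `^ p.
  rewrite /Hre /Him pre pim; congr (cmod (_ - _) (_ - _) `^ _).
    by apply: eq_bigr => j _.
  by apply: eq_bigr => j _.
have e2 : intT (fun x => cmod (Hre (x + l)) (Him (x + l)) `^ p) = intT (fun x => cmod (Hre x) (Him x) `^ p).
  exact: (intT_shift (f := fun x => cmod (Hre x) (Him x) `^ p)).
have nHl : nnm (fun x => cmod (Hre (x + l)) (Him (x + l)) `^ p) by exact: (nnm_cmod _ (measurable_shift l mH1) (measurable_shift l mH2)).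
have nE : nnm (fun x => cmod (Hre (x + l) - Hre x) (Him (x + l) - Him x) `^ p).
  exact: (nnm_cmod _ (measurable_increment l mH1) (measurable_increment l mH2)).
have e3 : (intT (fun x => cmod (Hre (x + l) - Hre x) (Him (x + l) - Him x) `^ p)%R <= eps%:E)%E.
  apply: (@le_trans _ _ (intT (fun x => 2 `^ p * (cmod (Hre (x + l)) (Him (x + l)) `^ p + cmod (Hre x) (Him x) `^ p)))).
    apply: (intT_le nE (nnmZ (powR_ge0 2 p) (nnmD nHl nH))) => x.
    by rewrite -(cmodN (Hre x)); exact: cmod_powR_add.
  rewrite (intTZ (powR_ge0 _ _) (nnmD nHl nH)) (intTD nHl nH) e2.
  have -> : eps%:E = ((2 `^ p)%:E * ((eps / k)%:E + (eps / k)%:E))%E.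
    by rewrite -EFinD -EFinM /k; congr EFin; field; rewrite gt_eqF ?powR_gt0.
  by apply: lee_wpmul2l; [rewrite lee_fin powR_ge0 | exact: leeD].
have nD : nnm (fun x => D s l T x `^ p) by split=> [|x]; [case: (bm_D_powR s l T p0') | exact: powR_ge0].
have nS : nnm (fun x => cmod (Fre (x + l) - Fre x) (Fim (x + l) - Fim x) `^ p).
  exact: (nnm_cmod _ (measurable_increment l mre) (measurable_increment l mim)).
have iD : intT (fun x => D s l T x `^ p) = (I (fun x => D s l T x `^ p))%:E by apply: intT_bm; exact: bm_D_powR.
rewrite -iD; split.
- apply: (@le_trans _ _ (intT (fun x => 2 `^ p * (D s l T x `^ p + cmod (Hre (x + l) - Hre x) (Him (x + l) - Him x) `^ p)))).
    apply: (intT_le nS (nnmZ (powR_ge0 2 p) (nnmD nD nE))) => x.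
    rewrite /D; apply: le_trans (cmod_powR_add _ _ _ _ p0'); rewrite le_eqVlt; apply/orP; left; apply/eqP.
    by congr (cmod _ _ `^ _); rewrite /Hre /Him; ring.
  by rewrite (intTZ (powR_ge0 _ _) (nnmD nD nE)) (intTD nD nE); apply: lee_wpmul2l; [rewrite lee_fin powR_ge0 | exact: leeD2l].
apply: (@le_trans _ _ (intT (fun x => 2 `^ p * (cmod (Fre (x + l) - Fre x) (Fim (x + l) - Fim x) `^ p +
    cmod (Hre (x + l) - Hre x) (Him (x + l) - Him x) `^ p)))).
  apply: (intT_le nD (nnmZ (powR_ge0 2 p) (nnmD nS nE))) => x.
  rewrite /D -(cmodN (Hre (x + l) - Hre x)).
  apply: le_trans (cmod_powR_add _ _ _ _ p0'); rewrite le_eqVlt; apply/orP; left; apply/eqP.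
  by congr (cmod _ _ `^ _); rewrite /Hre /Him; ring.
by rewrite (intTZ (powR_ge0 _ _) (nnmD nS nE)) (intTD nS nE); apply: lee_wpmul2l; [rewrite lee_fin powR_ge0 | exact: leeD2l].
Qed.

Lemma small_le_UB s p (Fre Fim : R -> R) g (d0 : R) : 0 < p -> is_Rs s p Fre Fim ->
  0 < d0 -> (forall l, 0 < l < d0 -> 0 < g l) -> UB p s g -> small_le (Ssp_root p Fre Fim) g.
Proof.
move=> p0 F d00 g0 [C [d [C0 dd0 H]]].
pose C1 := 2 * (2 `^ p^-1 * C); have C10 : 0 < C1 by rewrite !mulr_gt0 ?powR_gt0.
exists C1, (Order.min (Order.min d d0) 1); split => //; split; first by rewrite !lt_min dd0 d00/=.
move=> l /andP[l0]; rewrite !lt_min => /andP[/andP[ld ld0] l1].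
have l01 : 0 <= l <= 1 by rewrite !ltW.
have G0 : 0 < C * g l by rewrite mulr_gt0// g0// l0.
have [|T0 HT] := H l; first by rewrite l0.
(* The error is allowed to be as large as the main term; the total [2 * 2^p * (C g)^p] explains the
   constant [C1]. *)
have e0 : 0 < (C * g l) `^ p by rewrite powR_gt0.
have [T TT [h _]] := increment_transfer p0 F T0 l01 e0.
have {}HT := HT T TT.
have hS : (Ssp p Fre Fim l <= ((C1 * g l) `^ p)%:E)%E.
  apply: le_trans h _; rewrite -EFinD -EFinM lee_fin.
  have -> : C1 * g l = 2 * (2 `^ p^-1 * (C * g l)) by rewrite /C1; ring.
  move: HT (ltW G0); set Y := C * g l; clearbody Y => HT Y0.
  rewrite [leRHS]powRM ?mulr_ge0 ?powR_ge0// ler_wpM2l ?powR_ge0//.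
  by rewrite [leRHS]powRM ?powR_ge0// powRVK//; move: HT; clear; lra.
rewrite /Ssp_root; have C1g : 0 <= C1 * g l by rewrite mulr_ge0// ltW// g0// l0.
rewrite -(powRK p0 C1g) -poweR_EFin.
apply: gt0_ler_poweR => //; first by rewrite invr_ge0 ltW.
- rewrite in_itv/= leey andbT /Ssp; apply: integral_ge0 => x _; by rewrite lee_fin powR_ge0.
- by rewrite in_itv/= leey andbT lee_fin powR_ge0.
Qed.

Lemma small_ge_LB s p (Fre Fim : R -> R) g (d0 : R) : 0 < p -> is_Rs s p Fre Fim ->
  0 < d0 -> (forall l, 0 < l < d0 -> 0 < g l) -> LB p s g -> small_ge (Ssp_root p Fre Fim) g.
Proof.
move=> p0 F d00 g0 [C [d [C0 dd0 H]]].
pose c1 := C / (2 * 2 `^ p^-1); have q0 : 0 < 2 * 2 `^ p^-1 :> R by rewrite mulr_gt0 ?powR_gt0.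
have c10 : 0 < c1 by rewrite divr_gt0.
exists c1^-1, (Order.min (Order.min d d0) 1); split; first by rewrite invr_gt0.
split; first by rewrite !lt_min dd0 d00/=.
move=> l /andP[l0]; rewrite !lt_min => /andP[/andP[ld ld0] l1].
have l01 : 0 <= l <= 1 by rewrite !ltW.
have gl0 : 0 < g l by rewrite g0// l0.
have G0 : 0 < C * g l by rewrite mulr_gt0.
have [|T0 HT] := H l; first by rewrite l0.
(* [c1] is such that [(C g)^p = 2^p * 2 * (c1 g)^p]; an error of [(c1 g)^p] can then be subtracted
   and the same amount is left. *)
have e0 : 0 < (c1 * g l) `^ p by rewrite powR_gt0// mulr_gt0.
have [T TT [_ h]] := increment_transfer p0 F T0 l01 e0.
have {}HT := HT T TT.
have S0 : (0 <= Ssp p Fre Fim l)%E by apply: integral_ge0 => x _; rewrite lee_fin powR_ge0.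
have hS : (((c1 * g l) `^ p)%:E <= Ssp p Fre Fim l)%E.
  have E : (C * g l) `^ p = 2 `^ p * (2 * (c1 * g l) `^ p).
    have -> : C * g l = 2 * (2 `^ p^-1 * (c1 * g l)).
      by rewrite /c1; field; rewrite gt_eqF// powR_gt0.
    have cg : 0 <= c1 * g l by rewrite mulr_ge0// ltW.
    move: cg; set Y := c1 * g l; clearbody Y => Y0.
    rewrite powRM//; last exact: (mulr_ge0 (powR_ge0 _ _) Y0).
    by congr (_ * _); rewrite powRM ?powR_ge0// powRVK.
  rewrite E in HT; have h2 := le_trans (_ : ((2 `^ p * (2 * (c1 * g l) `^ p))%:E <= _)%E) h.
  have {}h2 := h2 (_ : (_ <= _)%E); rewrite lee_fin in h2; have {}h2 := h2 HT.
  move: h2; rewrite EFinM lee_pmul2l ?lte_fin ?powR_gt0//.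
  rewrite mulr2n mulrDl !mul1r EFinD leeD2rE //.
rewrite /Ssp_root -lee_pdivrMl ?invr_gt0// -EFinM invrK.
have cg : 0 <= c1 * g l by rewrite mulr_ge0// ltW.
rewrite -(powRK p0 cg) -poweR_EFin.
apply: gt0_ler_poweR => //; first by rewrite invr_ge0 ltW.
- by rewrite in_itv/= leey andbT lee_fin powR_ge0.
- by rewrite in_itv/= leey andbT.
Qed.

End transfer.

(** * Almost everywhere sum of a series of dyadic blocks *)

Section limit_function.
Variable R : realType.
Implicit Types (x p q t : R).
Local Notation mu := (@lebesgue_measure R).
Local Notation U := (`[0%R, 1%R]%classic : set R).

(** At a positive limit the power is differentiable; the limit [0] is treated by hand, since [q] may
    be below [1]. *)
Lemma cvg_powR (u : nat -> R) t q : 0 < q -> (forall n, 0 <= u n) -> u @ \oo --> t ->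
  (fun n => u n `^ q) @ \oo --> t `^ q.
Proof.
move=> q0 u0 ut; have t0 : 0 <= t.
  by rewrite -(cvg_lim (@Rhausdorff R) ut); apply: limr_ge; [exact: cvgP ut | exact: nearW].
have [t_gt0|] := ltP 0 t.
  have h := is_derive_powR q (is_derive_id t (1 : R)) t_gt0.
  have c : {for t, continuous (fun y : R => y `^ q)}.
    by apply: differentiable_continuous; apply/derivable1_diffP; case: h.
  exact: (continuous_cvg _ c ut).
move=> t_le0; have tE : t = 0 by apply/eqP; rewrite eq_le t_le0.
rewrite tE powR0 ?gt_eqF//; rewrite tE in ut.
apply/cvgrPdist_le => e e0.
have e1 : 0 < e `^ q^-1 by exact: powR_gt0.
have /cvgrPdist_le/(_ _ e1) := ut; apply: filterS => n.
rewrite !sub0r !normrN !ger0_norm ?powR_ge0// => h.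
by rewrite -[leRHS](powRVK q0 (ltW e0)); apply: ler_pow => //; exact: ltW.
Qed.

Lemma cvg_cmod (u v : nat -> R) a b : u @ \oo --> a -> v @ \oo --> b ->
  (fun n => cmod (u n) (v n)) @ \oo --> cmod a b.
Proof.
move=> ua vb; apply: (continuous_cvg _ (@sqrt_continuous R _)).
by apply: cvgD; under eq_fun do rewrite expr2; apply: cvgM.
Qed.

Lemma limn_einf_le (u : (\bar R)^nat) (B : \bar R) : (forall n, u n <= B)%E -> (limn_einf u <= B)%E.
Proof.
move=> uB; rewrite limn_einf_lim; apply: lime_le; first exact: is_cvg_einfs.
by apply: nearW => n; apply: le_trans (uB n); apply: ereal_inf_lbound; exists n => //=.
Qed.

Variables (a b : nat -> R -> R) (K u : R).
Hypotheses (ba : forall j, bm (a j)) (bb : forall j, bm (b j)).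
Hypotheses (pa : forall j x, a j (x + 1) = a j x) (pb : forall j x, b j (x + 1) = b j x).
Hypotheses (u01 : 0 < u < 1) (K0 : 0 <= K).
Hypothesis (small : forall j, I (fun x => cmod (a j x) (b j x)) <= K * u ^+ j).

Let d j x : R := cmod (a j x) (b j x).
Let phi x : \bar R := (\sum_(0 <= j <oo) (d j x)%:E)%E.
(* Outside of the null set [~` G] the blocks are absolutely summable. *)
Let G : set R := [set x | phi x \is a fin_num].

Lemma bm_block j : bm (d j). Proof. exact: bm_cmod. Qed.
Lemma block_ge0 j x : 0 <= d j x. Proof. exact: cmod_ge0. Qed.

Lemma measurable_total : measurable_fun setT phi.
Proof.
apply: (ge0_emeasurable_sum (P := xpredT)) => [k x _ _|k _]; first by rewrite lee_fin block_ge0.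
by apply/measurable_EFinP; case: (bm_block k).
Qed.

Lemma measurable_good : measurable G.
Proof. by have := emeasurable_fin_num measurableT measurable_total; rewrite setTI. Qed.

Lemma total_ge0 x : (0 <= phi x)%E.
Proof. by apply: nneseries_ge0 => n _ _; rewrite lee_fin block_ge0. Qed.

(** Monotone convergence: the [L^1] norms of the blocks are bounded by a geometric series. *)
Lemma total_integrable : (\int[mu]_(x in U) phi x < +oo)%E.
Proof.
have m1 n : measurable_fun U (fun x => (d n x)%:E).
  by apply/measurable_EFinP; case: (bm_block n) => + _; exact: measurable_funS.
have m2 n x : U x -> (0 <= (d n x)%:E)%E by move=> _; rewrite lee_fin block_ge0.
rewrite integral_nneseries; [|exact: measurable_U|exact: m1|exact: m2].
apply: (@le_lt_trans _ _ (K * (1 - u)^-1)%:E); last exact: ltry.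
apply: lime_le.
  by apply: is_cvg_nneseries => n _ _; apply: integral_ge0 => x _; rewrite lee_fin block_ge0.
apply: nearW => n.
have E j : (\int[mu]_(x in U) (d j x)%:E)%E = (I (d j))%:E by exact: (intT_bm (bm_block j)).
under eq_bigr do rewrite E; rewrite sumEFin lee_fin.
have u1 : 0 < 1 - u by case/andP: u01 => _; rewrite subr_gt0.
apply: (@le_trans _ _ (\sum_(0 <= j < n) K * u ^+ j)); first by apply: ler_sum => j _; exact: small.
rewrite -mulr_sumr ler_wpM2l// -(ler_pM2l u1) mulfV ?gt_eqF// mulrC big_mkord.
rewrite -[_ * (1 - u)]mulrC -opprB mulNr -subrX1 opprB gerBl exprn_ge0//; by case/andP: u01 => /ltW.
Qed.

Lemma good_ae : (\forall x \ae mu, U x -> G x).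
Proof.
suff : mu.-integrable U phi by move=> h; have [N [mN muN NG]] := @integrable_ae _ _ R mu U (@measurable_U R) phi h; exists N; split.
apply/integrableP; split; first exact: measurable_funS measurable_total.
apply: le_lt_trans total_integrable; rewrite le_eqVlt; apply/orP; left; apply/eqP.
by apply: eq_integral => x _; rewrite gee0_abs// total_ge0.
Qed.

Let S (c : nat -> R -> R) n x : R := \sum_(0 <= j < n) c j x.

Lemma bm_partial_sum c n : (forall j, bm (c j)) -> bm (S c n).
Proof. by move=> bc; apply: bm_sum. Qed.

Lemma cvg_on_good (c : nat -> R -> R) x : (forall j y, `|c j y| <= d j y) -> G x -> cvgn (S c ^~ x).
Proof.
move=> cd Gx; apply: (@normed_cvg R R (c ^~ x)).
apply: (@series_le_cvg _ _ (d ^~ x)) => [n|n|n|].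
- exact: normr_ge0.
- exact: block_ge0.
- exact: cd.
apply: nondecreasing_is_cvgn; first by apply: nondecreasing_series => n _ _; exact: block_ge0.
exists (fine (phi x)) => _ [n _ <-]; rewrite -lee_fin fineK// /series /= -sumEFin.
by apply: nneseries_lim_ge => m _ _; rewrite lee_fin block_ge0.
Qed.

(** Multiplying by the indicator of [G] makes the sequence converge at every point, so measurability
    passes to the limit; [G] is invariant under the period, hence so is the limit. *)
Definition Flim (c : nat -> R -> R) x : R := limn (fun n => S c n x * \1_G x).

Lemma cvg_Flim c x : (forall j y, `|c j y| <= d j y) -> (fun n => S c n x * \1_G x) @ \oo --> Flim c x.
Proof.
move=> cd; rewrite /Flim; suff : cvgn (fun n => S c n x * \1_G x) by [].
have [Gx|Gx] := pselect (G x).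
  by apply: is_cvgM; [exact: cvg_on_good | exact: is_cvg_cst].
have -> : (fun n => S c n x * \1_G x) = fun=> 0.
  by apply/funext => n; rewrite indicE memNset// mulr0.
exact: is_cvg_cst.
Qed.

Lemma measurable_Flim c : (forall j, bm (c j)) -> (forall j y, `|c j y| <= d j y) ->
  measurable_fun setT (Flim c).
Proof.
move=> bc cd; apply: (@measurable_fun_cvg _ _ _ setT (fun n x => S c n x * \1_G x)) => [n|x _].
  apply: measurable_funM; first by case: (bm_partial_sum n bc).
  by apply: measurable_indic; exact: measurable_good.
exact: cvg_Flim.
Qed.

Lemma total_periodic x : phi (x + 1) = phi x.
Proof. by rewrite /phi /d; apply: eq_eseriesr => j _; rewrite pa pb. Qed.

Lemma Flim_periodic c x : (forall j y, c j (y + 1) = c j y) -> Flim c (x + 1) = Flim c x.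
Proof.
move=> pc; rewrite /Flim; have -> // : (fun n => S c n (x + 1) * \1_G (x + 1)) = (fun n => S c n x * \1_G x).
apply/funext => n; congr (_ * _).
  by apply: eq_bigr => j _; rewrite pc.
have E : (x + 1 \in G) = (x \in G) by apply/idP/idP; rewrite !inE /G /= total_periodic.
by rewrite !indicE E.
Qed.

Lemma block_re_le j y : `|a j y| <= d j y.
Proof. by rewrite -sqrtr_sqr ler_wsqrtr// lerDl sqr_ge0. Qed.

Lemma block_im_le j y : `|b j y| <= d j y.
Proof. by rewrite -sqrtr_sqr ler_wsqrtr// lerDr sqr_ge0. Qed.

(** Fatou's lemma along the partial sums: a uniform bound of their distance to [h] is inherited by
    the limit. *)
Lemma limit_distance (h1 h2 : R -> R) q (B : R) j0 : 0 < q -> bm h1 -> bm h2 ->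
  (forall j, (j0 <= j)%N -> I (fun x => cmod (S a j x - h1 x) (S b j x - h2 x) `^ q) <= B) ->
  (intT (fun x => cmod (Flim a x - h1 x) (Flim b x - h2 x) `^ q)%R <= B%:E)%E.
Proof.
move=> q0 bh1 bh2 HB; have q0' := ltW q0.
have [mh1 _] := bh1; have [mh2 _] := bh2.
pose g n x : R := cmod (S a (n + j0) x - h1 x) (S b (n + j0) x - h2 x) `^ q.
pose g' n x : R := g n x * \1_G x.
pose k x : R := cmod (Flim a x - h1 x) (Flim b x - h2 x) `^ q.
have bg n : bm (g n) by apply: bm_powR => // [x|]; [exact: cmod_ge0 | apply: bm_cmod; apply: bmB => //; apply: bm_partial_sum].
have nk : nnm k by apply: nnm_cmod; apply: measurable_funB => //; apply: measurable_Flim => //; [exact: block_re_le | exact: block_im_le].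
have mI : measurable_fun setT (\1_G : R -> R) by apply: measurable_indic; exact: measurable_good.
have ng n : nnm (g' n).
  split=> [|x]; last by rewrite mulr_ge0 ?powR_ge0.
  by apply: measurable_funM => //; case: (bg n).
have nk' : nnm (fun x => k x * \1_G x).
  split=> [|x]; last by rewrite mulr_ge0 ?powR_ge0.
  by apply: measurable_funM => //; case: nk.
have -> : intT (fun x => k x) = intT (fun x => k x * \1_G x).
  apply: ge0_ae_eq_integral; [exact: measurable_U|exact: nnm_EFin|exact: nnm_EFin|..].
  - by move=> x _; rewrite lee_fin; case: nk.
  - by move=> x _; rewrite lee_fin; case: nk'.
  have [N [mN muN GN]] := good_ae; exists N; split => //; apply: subset_trans GN => x /= h Gx.
  by apply: h => Ux; rewrite indicE mem_set ?mulr1//; exact: Gx.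
have ck x : (fun n => g' n x) @ \oo --> k x * \1_G x.
  have [Gx|Gx] := pselect (G x); last first.
    rewrite (_ : (fun n => g' n x) = fun=> 0) ?indicE ?memNset ?mulr0//; first exact: cvg_cst.
    by apply/funext => n; rewrite /g' indicE memNset// mulr0.
  rewrite (_ : (fun n => g' n x) = fun n => g n x); last first.
    by apply/funext => n; rewrite /g' indicE mem_set// mulr1.
  rewrite indicE mem_set// mulr1; apply: cvg_powR => // [n|]; first exact: cmod_ge0.
  have cS c : (forall j y, `|c j y| <= d j y) -> (fun n => S c (n + j0) x) @ \oo --> Flim c x.
    move=> cd; have := cvg_Flim (x := x) cd; rewrite -(cvg_shiftn j0) /=.
    by rewrite indicE mem_set//; under eq_fun do rewrite mulr1.
  by apply: cvg_cmod; apply: cvgB; [apply: cS; exact: block_re_le|exact: cvg_cst|apply: cS; exact: block_im_le|exact: cvg_cst].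
have -> : intT (fun x => k x * \1_G x) = (\int[mu]_(x in U) limn_einf (fun n => (g' n x)%:E))%E.
  apply: eq_integral => x _; symmetry.
  have ce : (fun n => (g' n x)%:E) @ \oo --> (k x * \1_G x)%:E by apply: cvg_EFin; [exact: nearW | exact: ck].
  by have [-> _] := cvg_limn_einf_sup ce.
have g'0 n x : U x -> (0 <= (g' n x)%:E)%E by move=> _; rewrite lee_fin; case: (ng n).
have h := @fatou _ _ R mu U (@measurable_U R) (fun n x => (g' n x)%:E) (fun n => nnm_EFin (ng n)) g'0.
apply: le_trans h _.
apply: limn_einf_le => n.
apply: (@le_trans _ _ (intT (g n))).
  have ngn : nnm (g n) by split=> [|x]; [case: (bg n) | exact: powR_ge0].
  apply: (intT_le (ng n) ngn) => x.
  by rewrite /g' -[leRHS]mulr1 ler_wpM2l ?powR_ge0// indicE; case: (_ \in _).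
rewrite intT_bm// lee_fin; apply: HB; exact: leq_addl.
Qed.

Lemma limit_function_exists : exists F1 F2 : R -> R,
  [/\ measurable_fun setT F1, measurable_fun setT F2,
      forall x, F1 (x + 1) = F1 x, forall x, F2 (x + 1) = F2 x &
      forall (h1 h2 : R -> R) q (B : R) j0, 0 < q -> bm h1 -> bm h2 ->
      (forall j, (j0 <= j)%N -> I (fun x => cmod (\sum_(0 <= i < j) a i x - h1 x)
                                                (\sum_(0 <= i < j) b i x - h2 x) `^ q) <= B) ->
      (intT (fun x => cmod (F1 x - h1 x) (F2 x - h2 x) `^ q)%R <= B%:E)%E].
Proof.
exists (Flim a), (Flim b); split.
- exact: (measurable_Flim ba block_re_le).
- exact: (measurable_Flim bb block_im_le).
- by move=> x; exact: Flim_periodic.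
- by move=> x; exact: Flim_periodic.
by move=> h1 h2 q B j0; exact: limit_distance.
Qed.

End limit_function.

(** * Existence of the limit *)

Section existence.
Variable R : realType.
Implicit Types (s p q x C u : R) (m n j J N T : nat) (c g : nat -> R).

Lemma sum_restrict c g m n a b : \sum_(a <= j < b) (if (m <= j < n)%N then c j else 0) * g j =
  \sum_(maxn a m <= j < minn b n) c j * g j.
Proof.
rewrite [RHS](@big_nat_widen _ _ _ _ _ b) ?geq_minl// [RHS](@big_nat_widenl _ _ _ _ a) ?leq_maxl//.
rewrite [RHS]big_mkcond/= big_nat [RHS]big_nat; apply: eq_bigr => j /andP[aj jb].
rewrite leq_min geq_max jb aj/= andbC; case: ifP => //; by rewrite mul0r.
Qed.

Lemma Emod_restrict c m n a b x : Emod (fun j => if (m <= j < n)%N then c j else 0) a b x =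
  Emod c (maxn a m) (minn b n) x.
Proof. by rewrite /Emod /Ere /Eim !sum_restrict. Qed.

(** An arbitrary range is reduced to dyadic blocks by setting the coefficients outside it to zero;
    [blockb] covers the incomplete blocks. *)
Lemma tail_bound q s : 4 < q -> 1 / 2 - 1 / q < s -> exists C u : R, [/\ 0 < C, 0 < u < 1 &
  forall J m n, (2 ^ J <= m)%N -> I (fun x => Emod (rc s) m n x `^ q) <= (C * u ^+ J) `^ q].
Proof.
move=> q4 sq; have q1 : 1 <= q by move: q4; clear; lra.
have q0 : 0 <= q by exact: le_trans q1.
pose v : R := 2 `^ (1 - 2 / q); have v0 : 0 < v by exact: powR_gt0.
have [C C0 HC] := rc_block s q1 v0 (fun=> ltr01) (Wbound_gt4 q4).
set u := _ * _ in HC; have u0 : 0 < u by rewrite mulr_gt0 ?powR_gt0.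
have u1 : u < 1.
  have -> : u = 2 `^ (- (2 * s - (1 - 2 / q))) by rewrite /u /v -powRDp//; congr powR; ring.
  rewrite powRN invf_lt1 ?powR_gt0// powR2_gt1// subr_gt0.
  have -> : 2 / q = 2 * (1 / q) by rewrite mulrA mulr1.
  by move: sq; clear; lra.
have u10 : 0 < 1 - u by rewrite subr_gt0.
exists (C / (1 - u)), u; split; [exact: divr_gt0 | by rewrite u0 |].
move=> J m n Jm; have [mn|nm] := leqP m n; last first.
  by rewrite I_Emod_nil ?powR_ge0//; exact: ltnW.
pose T := (J + n)%N; have JT : (J <= T)%N by exact: leq_addr.
have nT : (n <= 2 ^ T)%N by apply: leq_trans (ltnW (ltn_expl T (ltnSn 1))); exact: leq_addl.
pose c j : R := if (m <= j < n)%N then rc s j else 0.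
rewrite (@I_ext _ _ (fun x => Emod c (2 ^ J) (2 ^ T) x `^ q)); last first.
  by move=> x; rewrite Emod_restrict (maxn_idPr Jm) (minn_idPr nT).
apply: (@le_trans _ _ ((\sum_(J <= j < T) C * u ^+ j) `^ q)).
  apply: dyadic_sum => // [j|j _]; first by rewrite mulr_gt0 ?exprn_gt0.
  rewrite (@I_ext _ _ (fun x => Emod (rc s) (maxn (2 ^ j) m) (minn (2 ^ j.+1) n) x `^ q)); last first.
    by move=> x; rewrite Emod_restrict.
  have [h|h] := leqP (maxn (2 ^ j) m) (minn (2 ^ j.+1) n); last first.
    by rewrite I_Emod_nil ?powR_ge0//; exact: ltnW.
  have := HC j (maxn (2 ^ j) m) (minn (2 ^ j.+1) n); rewrite mulr1; apply => //.
    exact: leq_maxl.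
  exact: geq_minl.
apply: ler_pow => //; first by rewrite sumr_ge0// => j _; rewrite ltW// mulr_gt0 ?exprn_gt0.
rewrite -mulr_sumr -mulrA ler_wpM2l ?(ltW C0)// mulrC ler_pdivlMr//.
rewrite -(subnKC JT); move: (T - J)%N => k.
suff -> : (\sum_(J <= j < J + k) u ^+ j) * (1 - u) = u ^+ J - u ^+ (J + k).
  by rewrite gerBl exprn_ge0// ltW.
elim: k => [|i IHi]; first by rewrite addn0 big_geq// mul0r subrr.
by rewrite addnS big_nat_recr ?leq_addr//= mulrDl IHi exprS; ring.
Qed.

Lemma I_le_of_moment (f : R -> R) q (A : R) : 1 <= q -> 0 < A -> bm f -> (forall x, 0 <= f x) ->
  I (fun x => f x `^ q) <= A `^ q -> I f <= 2 * A.
Proof.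
move=> q1 A0 bf f0 h; have q0 : 0 <= q by exact: le_trans q1.
have bfq : bm (fun x => f x `^ q) by exact: bm_powR.
pose k := A / A `^ q.
have Aq : 0 < A `^ q by exact: powR_gt0.
have h1 : I f <= I (fun x => A + k * f x `^ q).
  apply: I_le => // [|x _]; first by apply: bmD; [exact: bm_cst | exact: bmZ].
  have y0 : 0 <= f x / A by rewrite divr_ge0// ltW.
  have := powR_le1D (_ : 0 <= 1 <= q) y0; rewrite ler01 q1 => /(_ isT).
  rewrite powRr1// powR_div// => h2.
  have := ler_wpM2l (ltW A0) h2; rewrite mulrCA mulfV ?gt_eqF// mulr1 mulrDr mulr1.
  by rewrite /k mulrA [A * _ / _]mulrAC.
rewrite (ID (bm_cst _) (bmZ _ bfq)) I_cst (IZ _ bfq) in h1.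
have k0 : 0 <= k by rewrite divr_ge0// ltW.
apply: le_trans h1 _; have := ler_wpM2l k0 h; rewrite /k divfK ?gt_eqF//.
by clear; lra.
Qed.

Lemma sum_dyadic_blocks (F : nat -> R) j :
  \sum_(0 <= i < j) \sum_(2 ^ i <= n < 2 ^ i.+1) F n = \sum_(1 <= n < 2 ^ j) F n.
Proof.
elim: j => [|j IHj]; first by rewrite !big_geq.
by rewrite big_nat_recr//= IHj -big_cat_nat//= ?expn_gt0// leq_exp2l.
Qed.

Lemma cvge_to0 (e : nat -> \bar R) : (forall n, 0 <= e n)%E ->
  (forall eps : R, 0 < eps -> exists N, forall n, (N <= n)%N -> (e n <= eps%:E)%E) ->
  e @ \oo --> 0%E.
Proof.
move=> e0 H; apply/fine_cvgP; split.
  have [N HN] := H 1 ltr01; exists N => // n /= Nn.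
  by rewrite ge0_fin_numE//; apply: le_lt_trans (HN n Nn) _; rewrite ltry.
apply/cvgrPdist_le => eps eps0; have [N HN] := H eps eps0; exists N => // n /= Nn.
have h := HN n Nn; have fn : e n \is a fin_num by rewrite ge0_fin_numE//; apply: le_lt_trans h _; rewrite ltry.
by rewrite sub0r normrN ger0_norm ?fine_ge0// -lee_fin fineK.
Qed.

(** For [p <= 4] the choice [1 / q = 3/8 - t/2] gives [1/2 - 1/q = 1/8 + t/2], which is below [t]
    exactly when [t > 1/4]; capping [t] at [3/8] keeps [1 / q] positive. *)
Lemma exists_exponent s p : 0 < p -> (p <= 4 -> 1 / 4 < s) -> (4 < p -> 1 / 2 - 1 / p < s) ->
  exists q, [/\ 4 < q, p <= q & 1 / 2 - 1 / q < s].
Proof.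
move=> p0 h1 h2; have [p4|p4] := leP p 4; last by exists p; split => //; exact: h2.
have {h1} s4 := h1 p4; pose t := Order.min s (3 / 8).
have t1 : 1 / 4 < t by rewrite lt_min s4/=; clear; lra.
have t2 : t <= 3 / 8 by rewrite ge_min lexx orbT.
have ts : t <= s by rewrite ge_min lexx.
have r0 : 0 < 3 / 8 - t / 2 by move: t2; clear; lra.
have r4 : 4 < (3 / 8 - t / 2)^-1.
  by rewrite -[4]invrK ltf_pV2 ?posrE ?invr_gt0//; move: t1; clear; lra.
exists (3 / 8 - t / 2)^-1; split => //; first exact: ltW (le_lt_trans p4 r4).
by rewrite div1r [1 / _]div1r invrK; move: t1 ts; clear; lra.
Qed.

(** Convergence takes place in some [L^q] with [q > 4] and [q >= p]. This treats all [p] at once,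
    including [p < 1]; the passage from [L^q] to [L^p] is [powR_le_epsD]. *)
Theorem Rs_exists s p : 0 < p -> (p <= 4 -> 1 / 4 < s) -> (4 < p -> 1 / 2 - 1 / p < s) ->
  exists F_re F_im : R -> R, is_Rs s p F_re F_im.
Proof.
move=> p0 h1 h2; have [q [q4 pq sq]] := exists_exponent p0 h1 h2.
have q1 : 1 <= q by move: q4; clear; lra.
have q0 : 0 < q by exact: lt_le_trans q1.
have [C [u [C0 u01 HC]]] := tail_bound q4 sq; have /andP[u0 u1] := u01.
pose a j x := Ere (rc s) (2 ^ j) (2 ^ j.+1) x; pose b j x := Eim (rc s) (2 ^ j) (2 ^ j.+1) x.
have pa j x : a j (x + 1) = a j x.
  by apply: eq_bigr => n _; rewrite mulrDr mulr1 (cos_2pi_int _ (n ^ 2)%N).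
have pb j x : b j (x + 1) = b j x.
  by apply: eq_bigr => n _; rewrite mulrDr mulr1 (sin_2pi_int _ (n ^ 2)%N).
have ba j : bm (a j) by exact: bm_Ere.
have bb j : bm (b j) by exact: bm_Eim.
have K0 : 0 <= 2 * C by rewrite mulr_ge0// ltW.
have small j : I (fun x => cmod (a j x) (b j x)) <= 2 * C * u ^+ j.
  rewrite -mulrA; apply: (@I_le_of_moment _ q) => //.
  - by rewrite mulr_gt0 ?exprn_gt0.
  - exact: bm_cmod.
  - by move=> x; exact: cmod_ge0.
  - exact: (HC j (2 ^ j)%N (2 ^ j.+1)%N (leqnn _)).
have [F1 [F2 [m1 m2 p1 p2 HF]]] := limit_function_exists ba bb pa pb u01 K0 small.
have sa j x : \sum_(0 <= i < j) a i x = Ere (rc s) 1 (2 ^ j) x by exact: sum_dyadic_blocks.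
have sb j x : \sum_(0 <= i < j) b i x = Eim (rc s) 1 (2 ^ j) x by exact: sum_dyadic_blocks.
have dist J N : (2 ^ J <= N.+1)%N ->
    (intT (fun x => cmod (F1 x - RsN_re s N x) (F2 x - RsN_im s N x) `^ q)%R <= ((C * u ^+ J) `^ q)%:E)%E.
  move=> JN; apply: (HF (Ere (rc s) 1 N.+1) (Eim (rc s) 1 N.+1) q _ N.+1) => //.
  - exact: bm_Ere.
  - exact: bm_Eim.
  move=> j Nj; apply: le_trans (HC J N.+1 (2 ^ j)%N JN).
  rewrite le_eqVlt; apply/orP; left; apply/eqP; apply: I_ext => x.
  have Nj2 : (N.+1 <= 2 ^ j)%N by apply: leq_trans Nj (ltnW (ltn_expl j (ltnSn 1))).
  rewrite sa sb; congr (cmod _ _ `^ _).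
    by rewrite /Ere [X in X - _](@big_cat_nat _ _ _ N.+1)//= addrAC subrr add0r.
  by rewrite /Eim [X in X - _](@big_cat_nat _ _ _ N.+1)//= addrAC subrr add0r.
exists F1, F2; split => //; split => //; split; first exact: measurable_funS m1.
split; first exact: measurable_funS m2.
apply: cvge_to0 => [N|eps eps0].
  by apply: integral_ge0 => x _; rewrite lee_fin powR_ge0.
have e2 : 0 < eps / 2 by rewrite divr_gt0.
have [k k0 Hk] := @powR_le_epsD R p q _ (ltac:(by rewrite p0 pq)) e2.
have uq : `|u `^ q| < 1.
  by rewrite ger0_norm ?powR_ge0//; have := ltr_pow q0 (ltW u0) u1; rewrite powR1.
have e3 : 0 < eps / 2 / (k * C `^ q) by rewrite divr_gt0// mulr_gt0// powR_gt0.
have [J _ HJ] : \forall J \near \oo, (u `^ q) ^+ J <= eps / 2 / (k * C `^ q).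
  have /cvgrPdist_le/(_ _ e3) := cvg_expr uq; apply: filterS => J.
  by rewrite sub0r normrN ger0_norm// exprn_ge0// powR_ge0.
exists (2 ^ J)%N => N JN; have {}dist := dist J N (leqW JN).
have mF1 : measurable_fun setT (fun x => F1 x - RsN_re s N x).
  by apply: measurable_funB => //; case: (bm_Ere (rc s) 1 N.+1).
have mF2 : measurable_fun setT (fun x => F2 x - RsN_im s N x).
  by apply: measurable_funB => //; case: (bm_Eim (rc s) 1 N.+1).
have np := nnm_cmod p mF1 mF2; have nq := nnm_cmod q mF1 mF2.
have ne : nnm (fun=> eps / 2) by split=> [|x]; [exact: measurable_cst | exact: ltW].
apply: (@le_trans _ _ (intT (fun x => eps / 2 + k * cmod (F1 x - RsN_re s N x) (F2 x - RsN_im s N x) `^ q))).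
  apply: (intT_le np (nnmD ne (nnmZ (ltW k0) nq))) => x; exact: Hk (cmod_ge0 _ _).
rewrite (intTD ne (nnmZ (ltW k0) nq)) (intTZ (ltW k0) nq) (intT_bm (bm_cst _)) I_cst.
apply: (@le_trans _ _ ((eps / 2)%:E + k%:E * ((C * u ^+ J) `^ q)%:E)%E).
  by apply: leeD2l; apply: lee_wpmul2l => //; rewrite lee_fin ltW.
rewrite -EFinM -EFinD lee_fin [leRHS]splitr lerD2l.
rewrite powRM ?(ltW C0) ?exprn_ge0 ?(ltW u0)// powR_exprn ?(ltW u0)// mulrA mulrC.
rewrite -ler_pdivlMr ?mulr_gt0 ?powR_gt0//; apply: HJ; exact: leqnn.
Qed.

End existence.

(** * The regimes of the two parameters *)

Section asymptotics.
Variable R : realType.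
Implicit Types (s p q l x C sg : R) (m n j k i J T : nat) (g : R -> R).

Lemma UB_ext p s g g' : (forall l, g l = g' l) -> UB p s g -> UB p s g'.
Proof. by move=> gg'; have -> : g' = g by apply/funext. Qed.

Lemma LB_ext p s g g' : (forall l, g l = g' l) -> LB p s g -> LB p s g'.
Proof. by move=> gg'; have -> : g' = g by apply/funext. Qed.

Lemma pow_gt0_near e l : 0 < l < 2^-1 -> 0 < l `^ e :> R.
Proof. by case/andP => l0 _; exact: powR_gt0. Qed.

Lemma logi_gt0 l : 0 < l < 2^-1 -> 0 < logi l.
Proof.
by move=> /andP[l0 l2]; rewrite /logi ln_gt0// invf_gt1//; move: l2; clear; lra.
Qed.

Lemma log_gt0_near e l : 0 < l < 2^-1 -> 0 < l * logi l `^ e.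
Proof. by move=> ll; rewrite mulr_gt0 ?powR_gt0 ?logi_gt0//; case/andP: ll. Qed.

Lemma half_gt0 : 0 < 2^-1 :> R. Proof. by rewrite invr_gt0. Qed.

Lemma UB_gt_trivial p sg s : 1 <= p -> Wbound p (2 `^ sg) (fun=> 1) ->
  0 < 2 - 2 * s + sg -> sg < 2 * s -> UB p s (fun l => l `^ (s - sg / 2)).
Proof.
move=> p1 W h1 h2; apply: (@UB_ext _ _ (fun l => l `^ (s - sg / 2) * (fun=> 1) l)) => [l|].
  by rewrite mulr1.
apply: (UB_gt p1 (@tame1 R) W h1 h2); exists 1, 1; split => // l J _ _.
by rewrite mulr1.
Qed.

Lemma scale_log_pow e : 0 <= e -> exists C d : R, [/\ 0 < C, 0 < d & forall l J, 0 < l < d ->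
  4 ^+ J * l <= 2^-1 < 4 ^+ J.+1 * l -> J.+1%:R `^ e <= C * logi l `^ e].
Proof.
move=> e0; have [d /andP[d0 d4] H] := @scale_log R.
exists (3 `^ e), d; split; [exact: powR_gt0 | exact: d0 |].
move=> l J ld JP; have [h _] := H l J ld JP.
have L0 : 0 <= logi l by move: h (ler0n R J.+1); clear; lra.
by rewrite -powRM//; apply: ler_pow.
Qed.

Lemma UB_eq_trivial p sg s : 2 <= p -> Wbound p (2 `^ sg) (fun=> 1) ->
  2 - 2 * s + sg = 0 -> UB p s (fun l => l * logi l `^ (1 / 2)).
Proof.
move=> p2 W h; apply: (UB_eq p2 (@tame1 R) W h).
have [C [d [C0 d0 H]]] := @scale_log_pow (1 / 2) (ltac:(by rewrite divr_ge0)).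
exists C, d; split => // l J ld JP; rewrite mul1r -[X in _ `^ X <= _]div1r; exact: H.
Qed.

(** Below [4] the bounds do not depend on the exponent, so [p] is raised to one that is at least [1]
    for Minkowski's inequality and at least [2] for the energy. *)
Lemma Wbound_max3 p : p < 4 -> Wbound (Order.max p 3) (2 `^ 2^-1) (fun=> 1).
Proof.
move=> p4; apply: Wbound_lt4; rewrite gt_max p4 andbC.
by rewrite le_max (ler_nat _ 1 3) orbT andbT ltr_nat.
Qed.

Lemma max3_ge p : [/\ p <= Order.max p 3, 3 <= Order.max p 3, 2 <= Order.max p 3 & 1 <= Order.max p 3].
Proof.
by split; rewrite le_max ?lexx ?orbT// ?(ler_nat _ 1) ?(ler_nat _ 2) orbT.
Qed.

Lemma UB_subcritical p s : 0 < p -> p < 4 -> 1 / 4 < s -> s < 5 / 4 -> UB p s (fun l => l `^ (s - 1 / 4)).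
Proof.
move=> p0 p4 s1 s2; have [q1 q3 _ q4] := max3_ge p.
apply: (@UB_mono _ p (Order.max p 3) _ _ 2^-1 half_gt0) => [l||]; first exact: pow_gt0_near.
  by rewrite p0 q1.
apply: (@UB_ext _ _ (fun l => l `^ (s - 2^-1 / 2))) => [l|].
  by congr powR; clear; lra.
apply: UB_gt_trivial => //; first exact: Wbound_max3.
  by move: s2; clear; lra.
by move: s1; clear; lra.
Qed.

Lemma UB_four s : 1 / 4 < s -> s < 5 / 4 -> UB 4 s (fun l => l `^ (s - 1 / 4) * logi l `^ (1 / 4)).
Proof.
move=> s1 s2; apply: (@UB_ext _ _ (fun l => l `^ (s - 2^-1 / 2) * logi l `^ (1 / 4))) => [l|].
  by congr (powR _ _ * _); clear; lra.
apply: (UB_gt (_ : 1 <= 4) (@tame_quarter R) (@Wbound_eq4 R)).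
- by rewrite (ler_nat _ 1).
- by move: s2; clear; lra.
- by move: s1; clear; lra.
have [C [d [C0 d0 H]]] := @scale_log_pow (1 / 4) (ltac:(by rewrite divr_ge0)).
exists C, d; split => // l J ld JP; rewrite -[X in _ `^ X <= _]div1r; exact: H.
Qed.

Lemma UB_supercritical p s : 4 < p -> 1 / 2 - 1 / p < s -> s < 3 / 2 - 1 / p ->
  UB p s (fun l => l `^ (s + 1 / p - 1 / 2)).
Proof.
move=> p4 s1 s2; have p0 : 0 < p by exact: lt_trans p4.
have e2 : 2 / p = 2 * (1 / p) by rewrite mulrA mulr1.
apply: (@UB_ext _ _ (fun l => l `^ (s - (1 - 2 / p) / 2))) => [l|].
  by congr powR; rewrite e2; clear; lra.
apply: UB_gt_trivial => //.
- by move: p4; clear; lra.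
- exact: Wbound_gt4.
- by rewrite e2; move: s2; clear; lra.
- by rewrite e2; move: s1; clear; lra.
Qed.

(** With [q > 4] the blocks have exponent [2 - 2s + 1 - 2/q < 0], so the lowest frequencies dominate
    in [L^q], hence in [L^p]. *)
Lemma UB_linear p q s : 0 < p -> p <= q -> 4 < q -> 3 - 2 * s < 2 / q -> UB p s (fun l => l).
Proof.
move=> p0 pq q4 h.
apply: (@UB_mono _ p q _ _ 2^-1 half_gt0) => [l /andP[]//||]; first by rewrite p0 pq.
apply: (@UB_lt _ q (1 - 2 / q)); first by move: q4; clear; lra.
  exact: Wbound_gt4.
by move: h; clear; lra.
Qed.

Lemma UB_log p s : 0 < p -> p < 4 -> s = 5 / 4 -> UB p s (fun l => l * logi l `^ (1 / 2)).
Proof.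
move=> p0 p4 sE; have [q1 q3 q2 q4] := max3_ge p.
apply: (@UB_mono _ p (Order.max p 3) _ _ 2^-1 half_gt0) => [l||].
- exact: log_gt0_near.
- by rewrite p0 q1.
apply: (@UB_eq_trivial _ 2^-1) => //; first exact: Wbound_max3.
by rewrite sE; clear; lra.
Qed.

Lemma UB_log_four s : s = 5 / 4 -> UB 4 s (fun l => l * logi l `^ (3 / 4)).
Proof.
move=> sE; apply: (UB_eq (_ : 2 <= 4) (@tame_quarter R) (@Wbound_eq4 R)).
- by rewrite (ler_nat _ 2).
- by rewrite sE; clear; lra.
have [C [d [C0 d0 H]]] := @scale_log_pow (3 / 4) (ltac:(by rewrite divr_ge0)).
exists C, d; split => // l J ld JP; rewrite -powRDp// (_ : 4^-1 + 2^-1 = 3 / 4); last by clear; lra.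
exact: H.
Qed.

Lemma UB_log_critical p s : 4 < p -> 3 - 2 * s = 2 / p -> UB p s (fun l => l * logi l `^ (1 / 2)).
Proof.
move=> p4 h; apply: (@UB_eq_trivial _ (1 - 2 / p)).
- by move: p4; clear; lra.
- exact: Wbound_gt4.
- by move: h; clear; lra.
Qed.

(** Everything follows from [p = 2]: upwards directly, downwards by interpolation with an upper
    bound of the same order at exponent [3]. *)
Lemma LB_all p s g (d0 : R) : 0 < p -> 0 < d0 -> (forall l, 0 < l < d0 -> 0 < g l) ->
  LB 2 s g -> (p < 2 -> UB 3 s g) -> LB p s g.
Proof.
move=> p0 d00 g0 L2 U3; have [p2|p2] := ltP p 2.
  apply: (LB_le d00 g0 p0 (ltW p2) _ L2 (U3 p2)); by rewrite (ltr_nat _ 2 3).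
by apply: (LB_ge d00 g0 _ L2); rewrite p2 andbT.
Qed.

Lemma LB_subcritical p s : 0 < p -> 1 / 4 < s -> s < 5 / 4 -> LB p s (fun l => l `^ (s - 1 / 4)).
Proof.
move=> p0 s1 s2; apply: (LB_all p0 half_gt0) => [l||_]; first exact: pow_gt0_near.
  by rewrite div1r; exact: LB2_power.
by apply: UB_subcritical => //; rewrite ltr_nat.
Qed.

Lemma LB_linear p s : 0 < p -> 5 / 4 < s -> LB p s (fun l => l).
Proof.
move=> p0 s1; apply: (LB_all p0 half_gt0) => [l /andP[]//||_]; first exact: LB2_linear.
(* An exponent just above [4]: with [m] the minimum, [3 - 2s <= 1/2 - 2 m], and the product with
   [4 + m] stays below [2]. *)
pose q : R := 4 + Order.min 1 (s - 5 / 4).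
have m0 : 0 < Order.min 1 (s - 5 / 4) by rewrite lt_min ltr01 subr_gt0.
have m1 : Order.min 1 (s - 5 / 4) <= 1 by rewrite ge_min lexx.
have m2 : Order.min 1 (s - 5 / 4) <= s - 5 / 4 by rewrite ge_min lexx orbT.
apply: (@UB_linear 3 q) => //; rewrite /q; move: m0 m1 m2; set m := Order.min _ _; clearbody m => m0 m1 m2.
- by move: m0; clear; lra.
- by move: m0; clear; lra.
have q0 : 0 < 4 + m by move: m0; clear; lra.
rewrite ltr_pdivlMr//; apply: (@le_lt_trans _ _ ((2^-1 - 2 * m) * (4 + m))).
  by rewrite ler_wpM2r ?(ltW q0)//; move: m2; clear; lra.
have : 0 <= m * m by rewrite mulr_ge0 ?(ltW m0).
by move: m0; clear; nra.
Qed.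

Lemma LB_log p s : 0 < p -> s = 5 / 4 -> LB p s (fun l => l * logi l `^ (1 / 2)).
Proof.
move=> p0 sE; apply: (LB_all p0 half_gt0) => [l||_]; first exact: log_gt0_near.
  by rewrite div1r; exact: LB2_log.
by apply: UB_log => //; rewrite ltr_nat.
Qed.

Lemma LB_four s : LB 4 s (fun l => l `^ (s - 1 / 4) * logi l `^ (1 / 4)).
Proof. by rewrite div1r; exact: LB4_log. Qed.

Lemma LB_supercritical p s : 1 <= p -> LB p s (fun l => l `^ (s + 1 / p - 1 / 2)).
Proof.
move=> p1; apply: (@LB_ext _ _ (fun l => l `^ (s - 2^-1 + p^-1))) => [l|]; last exact: LB_fejer.
by congr powR; rewrite !div1r addrAC.
Qed.

Theorem increment_asymptotics s p (F_re F_im : R -> R) : 0 < p -> (p <= 4 -> 1 / 4 < s) ->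
  (4 < p -> 1 / 2 - 1 / p < s) -> is_Rs s p F_re F_im ->
  let S := Ssp_root p F_re F_im in
  (s < 5 / 4 ->
     (p < 4 -> small_sim S (fun l => l `^ (s - 1 / 4))) /\
     (p = 4 -> small_sim S (fun l => l `^ (s - 1 / 4) * logi l `^ (1 / 4))) /\
     (4 < p -> small_sim S (fun l => l `^ (s + 1 / p - 1 / 2)))) /\
  (s = 5 / 4 ->
     (p < 4 -> small_sim S (fun l => l * logi l `^ (1 / 2))) /\
     (4 < p -> small_sim S (fun l => l `^ (3 / 4 + 1 / p))) /\
     (p = 4 -> small_ge S (fun l => l * logi l `^ (1 / 2)) /\
               small_le S (fun l => l * logi l `^ (3 / 4)))) /\
  (5 / 4 < s < 3 / 2 ->
     (p < 2 / (3 - 2 * s) -> small_sim S (fun l => l)) /\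
     (2 / (3 - 2 * s) < p -> small_sim S (fun l => l `^ (s + 1 / p - 1 / 2))) /\
     (p = 2 / (3 - 2 * s) ->
        small_ge S (fun l => l) /\
        small_le S (fun l => l * logi l `^ (1 / 2)) /\
        ((exists k : nat, p = (2 * k)%:R) ->
           small_ge S (fun l => l * logi l `^ (1 / p))))) /\
  (3 / 2 <= s -> small_sim S (fun l => l)).
Proof.
move=> p0 s14 sp F S.
have le g : (forall l, 0 < l < 2^-1 -> 0 < g l) -> UB p s g -> small_le S g.
  by move=> g0; exact: small_le_UB p0 F half_gt0 g0.
have ge g : (forall l, 0 < l < 2^-1 -> 0 < g l) -> LB p s g -> small_ge S g.
  by move=> g0; exact: small_ge_LB p0 F half_gt0 g0.
have id0 l : 0 < l < 2^-1 -> 0 < l by case/andP.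
have sim g : (forall l, 0 < l < 2^-1 -> 0 < g l) -> UB p s g -> LB p s g -> small_sim S g.
  by move=> g0 U L; split; [exact: le | exact: ge].
have pq0 l e e' : 0 < l < 2^-1 -> 0 < l `^ e * logi l `^ e'.
  by move=> ll; rewrite mulr_gt0 ?powR_gt0 ?logi_gt0//; case/andP: ll.
split; [move=> s54 | split; [move=> sE | split; [move=> /andP[s54 s32] | move=> s32]]].
- split; [move=> p4 | split=> [pE|p4]].
  + have s1 := s14 (ltW p4).
    by apply: sim => [l||]; [exact: pow_gt0_near|exact: UB_subcritical|exact: LB_subcritical].
  + have s1 : 1 / 4 < s by apply: s14; rewrite pE.
    by apply: sim => [l||]; rewrite ?pE; [exact: pq0|exact: UB_four|exact: LB_four].
  + apply: sim => [l||]; [exact: pow_gt0_near| |apply: LB_supercritical].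
      apply: UB_supercritical => //; first exact: sp.
      apply: (lt_trans s54); have : 1 / p < 1 / 4 by rewrite !div1r ltf_pV2 ?posrE.
      by clear; lra.
    by move: p4; clear; lra.
- split; [move=> p4 | split=> [p4|pE]].
  + by apply: sim => [l||]; [exact: log_gt0_near|exact: UB_log|exact: LB_log].
  + have gE : (fun l : R => l `^ (3 / 4 + 1 / p)) = (fun l => l `^ (s + 1 / p - 1 / 2)).
      by apply/funext => l; congr powR; rewrite sE; clear; lra.
    rewrite gE; apply: sim => [l||]; [exact: pow_gt0_near| |apply: LB_supercritical].
      apply: UB_supercritical => //; first exact: sp.
      have : 1 / p < 1 / 4 by rewrite !div1r ltf_pV2 ?posrE.
      by rewrite sE; clear; lra.
    by move: p4; clear; lra.
  + split; [apply: ge => [l|]|apply: le => [l|]]; rewrite ?pE; try exact: log_gt0_near.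
      exact: LB_log.
    exact: UB_log_four.
- have c0 : 0 < 3 - 2 * s by move: s32; clear; lra.
  have c1 : 3 - 2 * s < 2^-1 by move: s54; clear; lra.
  have pc4 : 4 < 2 / (3 - 2 * s) by rewrite ltr_pdivlMr//; move: c1; clear; lra.
  split; [move=> pc | split=> [pc|pc]].
  + apply: sim => [l||]; [exact: id0| |exact: LB_linear].
    (* Any exponent strictly between [max p 4] and the critical one would do; the midpoint is
       taken. *)
    pose q := (Order.max p 4 + 2 / (3 - 2 * s)) / 2.
    have mq : Order.max p 4 < 2 / (3 - 2 * s) by rewrite gt_max pc pc4.
    have qp : Order.max p 4 < q by rewrite /q; move: mq; clear; lra.
    have qc : q < 2 / (3 - 2 * s) by rewrite /q; move: mq; clear; lra.
    have pm : p <= Order.max p 4 by rewrite le_max lexx.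
    have fm : 4 <= Order.max p 4 by rewrite le_max lexx orbT.
    have q4 : 4 < q by exact: le_lt_trans qp.
    apply: (@UB_linear p q) => //; first exact: ltW (le_lt_trans pm qp).
    have q0 : 0 < q by exact: lt_trans q4.
    have h : q * (3 - 2 * s) < 2 by rewrite -ltr_pdivlMr.
    by rewrite ltr_pdivlMr// mulrC.
  + have p4 : 4 < p by exact: lt_trans pc.
    apply: sim => [l||]; [exact: pow_gt0_near| |apply: LB_supercritical].
      apply: UB_supercritical => //; first exact: sp.
      move: pc; rewrite ltr_pdivrMr// mulrC -ltr_pdivrMr//.
      have -> : 2 / p = 2 * (1 / p) by rewrite mulrA mulr1.
      by clear; lra.
    by move: p4; clear; lra.
  have p4 : 4 < p by rewrite pc.
  have hc : 3 - 2 * s = 2 / p by rewrite pc invf_div mulrCA divff ?mulr1.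
  split; first by apply: ge => [l|]; [exact: id0 | exact: LB_linear].
  split; first by apply: le => [l|]; [exact: log_gt0_near | exact: UB_log_critical].
  move=> [k pk]; apply: ge => [l|]; first exact: log_gt0_near.
  have k0 : (0 < k)%N by case: k pk => // pk; move: p0; rewrite pk muln0 ltxx.
  rewrite div1r pk; apply: LB_critical => //.
  rewrite hc pk natrM; field; by rewrite pnatr_eq0 -lt0n.
(* Now [3 - 2s <= 0], so every exponent above [4] is subcritical. *)
have q5 : 4 < Order.max p 5 by rewrite lt_max (ltr_nat _ 4 5) orbT.
apply: sim => [l||]; [exact: id0| |apply: LB_linear => //].
  apply: (@UB_linear p (Order.max p 5)) => //; first by rewrite le_max lexx.
  apply: (@le_lt_trans _ _ 0); first by move: s32; clear; lra.
  by rewrite divr_gt0//; exact: lt_trans q5.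
by move: s32; clear; lra.
Qed.

End asymptotics.

Theorem theorem6p1 (R : realType) (s p : R) :
  0 < p ->
  (p <= 4 -> 1 / 4 < s) ->
  (4 < p -> 1 / 2 - 1 / p < s) ->
  (exists F_re F_im : R -> R, is_Rs s p F_re F_im) /\
  forall F_re F_im : R -> R, is_Rs s p F_re F_im ->
  let S := Ssp_root p F_re F_im in
  (s < 5 / 4 ->
     (p < 4 -> small_sim S (fun l => l `^ (s - 1 / 4))) /\
     (p = 4 -> small_sim S (fun l => l `^ (s - 1 / 4) * logi l `^ (1 / 4))) /\
     (4 < p -> small_sim S (fun l => l `^ (s + 1 / p - 1 / 2)))) /\
  (s = 5 / 4 ->
     (p < 4 -> small_sim S (fun l => l * logi l `^ (1 / 2))) /\
     (4 < p -> small_sim S (fun l => l `^ (3 / 4 + 1 / p))) /\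
     (p = 4 -> small_ge S (fun l => l * logi l `^ (1 / 2)) /\
               small_le S (fun l => l * logi l `^ (3 / 4)))) /\
  (5 / 4 < s < 3 / 2 ->
     (p < 2 / (3 - 2 * s) -> small_sim S (fun l => l)) /\
     (2 / (3 - 2 * s) < p -> small_sim S (fun l => l `^ (s + 1 / p - 1 / 2))) /\
     (p = 2 / (3 - 2 * s) ->
        small_ge S (fun l => l) /\
        small_le S (fun l => l * logi l `^ (1 / 2)) /\
        ((exists k : nat, p = (2 * k)%:R) ->
           small_ge S (fun l => l * logi l `^ (1 / p))))) /\
  (3 / 2 <= s -> small_sim S (fun l => l)).
Proof.
move=> p0 s1 s2; split; first exact: Rs_exists.
by move=> F_re F_im F; exact: increment_asymptotics.
Qed.
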